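(* Let $n\ge2$, $m\ge1$, $I=[t_0,+\infty)$, $A\in\mathbb R^{n\times n}$, let a class $\mathcal K_3(A)$ be given, $f\in\mathcal K_3^{n\times1}(A)$, and let $\varphi_0(t,c_0)$ (parameter $c_0\in\mathbb R^{n_0}$, $0\le n_0\le n$) be some particular solution of class $\mathcal K_3^{n\times1}(A)\cap C^1(I)$ of $\frac{d\varphi}{dt}=A\varphi+f(t)$. Let $a>0$, $D:=\{(t,y):t\in I,\ y\in\mathbb R^{n\times1},\ \|y-\varphi_0(t,c_0)\|\le a\}$, and consider $$\frac{dy}{dt}=Ay+f(t)+\sum_{l=1}^m\varepsilon_l(t)f_l(t,y),\qquad(t,y)\in D.\qquad( * )$$ Let ranks $\varrho_1\le\dots\le\varrho_m$ ($\varrho_l\in\mathbb R^+$) of the $\varepsilon_l$ be given, let $k\in\mathbb N$, $p_{kl}:=\max\{0,[\rho_k-\varrho_l]+1\}$, $q_{kl}:=\left[\frac{\rho_k-\varrho_l}{\varrho_1}\right]$ ($l=1,\dots,m$), and suppose: 1. $\varepsilon_l:I\to\mathbb R$, $\varepsilon_l\in C^{p_{kl}}(I)$, $\frac{d^r\varepsilon_l(t)}{dt^r}=O\bigl((\varepsilon_1(t))^{(\varrho_l+r)/\varrho_1}\bigr)$, $\varepsilon_1(t)\ge0$, $\varepsilon_1(t)=o(1)$ ($l=1,\dots,m$, $r=0,\dots,p_{kl}$, $t\to+\infty$); 2. $f_l:D\to\mathbb R^{n\times1}$, $f_l\in C^{0,\max\{2,q_{kl}+1\}}_{t,y}(D)$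 ($l=1,\dots,m$); 3. $\sup_{(t,y)\in D}\|\partial_y^\wp f_l(t,y)\|<+\infty$ for $\wp\in\mathbb N_0^n$, $0\le|\wp|\le\max\{2,q_{kl}+1\}$, $l=1,\dots,m$; 4. $\partial_y^\wp f_l(t,\varphi_0(t,c_0))\in\mathcal K_3^{n\times1}(A)$ for $\wp\in\mathbb N_0^n$, $0\le|\wp|\le q_{kl}$ and all $l$ with $\rho_k\ge\varrho_l$; 5. there is a number $\varpi\in\mathbb R^+$ such that $\varepsilon_1\in\mathcal R_\varpi(I)$; 6. $\frac{d^r\varepsilon_l(t)}{dt^r}\in\mathcal R_1(I)$ for $r=1,\dots,[\rho_k-\varrho_l]$ and all $l$ with $\rho_k-\varrho_l\ge1$; 7. for all $l$ with $\varrho_l\le\varpi\varrho_1$, with $s_l:=\left[\varpi-\frac{\varrho_l}{\varrho_1}\right]$: $f_l\in C^{0,s_l+2}_{t,y}(D)$; $\sup_{(t,y)\in D}\|\partial_y^\wp f_l(t,y)\|<+\infty$ for $\wp\in\mathbb N_0^n$, $3\le|\wp|\le s_l+2$; and $\partial_y^\wp f_l(t,\varphi_0(t,c_0))\in\mathcal K_3^{n\times1}(A)$ for $\wp\in\mathbb N_0^n$, $1\le|\wp|\le s_l+1$; 8. $0\notin\Delta(A)$; 9. for every $l$ with $\varepsilon_l\notin\mathcal R_1(I)$, $\varepsilon_l$ is (at least non-strictly) monotone on $I$ and tends to $0$ as $t\to+\infty$, and $\frac{d\varepsilon_l}{dt}\in C(I)\cap\mathcal R_1(I)$; moreover $\varepsilon_1(t)>0$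 for $t\in I$; 10. every function of the form $$\gamma_1(\varepsilon_1(t))^{-1}\frac{d\varepsilon_1(t)}{dt}+\sum_{\substack{\wp\in\mathbb N_0^m,\ 1\le|\wp|<\varpi\\ \mu_\wp\notin\mathcal R_1(I)}}\gamma_\wp\mu_\wp(t),\qquad\gamma_1,\gamma_\wp\in\mathbb R,$$ keeps its sign, at least in the non-strict sense, for all sufficiently large $t\in I$; 11. $\rho_{k+1}>\varrho_1\varpi$ and $\rho_{k+1}\ge\varrho_1(2\varpi-1)$. Then for sufficiently large $t_0$ equation $( * )$ has on $I$ at least one particular solution of the form $y=s(t)+r$, where $$s(t)=\varphi_0(t,c_0)+\sum_{s=1}^k\sum_{p=1}^{\varkappa_s}\nu_{sp}(t)\varphi_{sp}(t,c_{sp}),$$ $\varphi_0(t,c_0),\varphi_{sp}(t,c_{sp})\in\mathcal K_3^{n\times1}(A)\cap C^1(I)$ ($s=1,\dots,k$, $p=1,\dots,\varkappa_s$), and the error satisfies $$r=O\bigl((\varepsilon_1(t))^{\frac{\rho_{k+1}}{\varrho_1}-\varpi}\bigr)\qquad(t\to+\infty).$$ Moreover, $r$ depends on as many arbitrary scalar constants, sufficiently small in absolute value, as there are indices $j\in\{1,\dots,n\}$ such that $\int_Ip_{jj}(t)\,dt\ne+\infty$, where the functions $p_{jj}$ are defined in the context. (The family of solutions of the form $y=s(t)+r$ can contain no more than $n$ independent scalar parameters.)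
   Context: Notation: $\mathbb N_0=\{0\}\cup\mathbb N$; $\mathbb R^+=(0,+\infty)$; $[x]$ is the integer part (floor); $\|\cdot\|$ is the maximum modulus of the entries; $S^{n\times1}$ denotes $n$-vectors with entries in the class $S$; $\lambda_1(A),\dots,\lambda_n(A)$ are the eigenvalues of $A$, $\Lambda(A)$ its spectrum, $\Delta(A)=\{\lambda_j(A)-\lambda_l(A):j,l=1,\dots,n,\ j\ne l\}$; for a multi-index $\wp$, $|\wp|=\sum_j\wp_j$, $\wp!=\prod_j\wp_j!$, $y^\wp=\prod_jy_j^{\wp_j}$, $\partial_y^\wp$ is the corresponding partial derivative. $C^{0,q}_{t,y}(D)$: partial $y$-derivatives up to order $q$ exist and are continuous on $D$. $\mathcal R(I)$ is the set of $g:I\to\mathbb C$ for which $\int_Ig\,dt$ exists (as a convergent integral) in $\mathbb C$; $\mathcal R_p(I)=\{g:I\to\mathbb C: |g|^p\in\mathcal R(I)\}$ for $p>0$. For $\wp\in\mathbb N_0^m$, $\mu_\wp(t)=\prod_{l=1}^m(\varepsilon_l(t))^{\wp_l}$. Empty sums are $0$, empty products $1$. A parameter in $\mathbb R^0$ means no parameter. ''For sufficiently large $t_0$'' means after replacing $t_0$ by a larger number and restricting everything to the new $I=[t_0,+\infty)$. Class $\mathcal K_3(A)$: some nonempty class of functions $f:I\to\mathbb R$ such that (1) every $f$ in it is continuous and bounded on $I$; (2) if $f_1,f_2\in\mathcal K_3(A)$, $\alpha\in\mathbb R$, then $\alpha f_1,\ f_1+f_2,\ f_1f_2\in\mathcal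 K_3(A)$; (3) for each $f\in\mathcal K_3(A)$ the mean value $\operatorname M(f)=\lim_{t\to+\infty}\frac1t\int_{t_0}^tf(\tau)\,d\tau$ exists (finite) and $\sup_{t\in I}\bigl|\int_{t_0}^t(f(\tau)-\operatorname M(f))\,d\tau\bigr|<+\infty$; (4) for every $\tilde f:I\to\mathbb C$ with $\Re\tilde f,\Im\tilde f\in\mathcal K_3(A)$ and every $\lambda\in\Lambda(A)\cup\Delta(A)$, the equation $\frac{dy}{dt}=\lambda y+\tilde f(t)$ ($y:I\to\mathbb C$) has at least one particular solution $y(t,\tilde c)$ on $I$ (parameter $\tilde c\in\mathbb C^{\tilde n}$, $0\le\tilde n\le1$) with $\Re y,\Im y\in\mathcal K_3(A)\cap C^1(I)$. Ranks: $\operatorname{Rank}(\varepsilon_l)=\varrho_l$. A product $\prod_{l=1}^m\prod_{r=0}^{k_l}\bigl(\frac{d^r\varepsilon_l(t)}{dt^r}\bigr)^{\beta_{lr}}$ with $k_l,\beta_{lr}\in\mathbb N_0$, not all $\beta_{lr}$ zero, has rank $\sum_l\sum_r(\varrho_l+r)\beta_{lr}$ (products are regarded as formal monomials in the $\varepsilon_l$ and their derivatives). The set of all ranks is discrete and is enumerated increasingly as $\rho_1<\rho_2<\dots$ (so $\rho_1=\varrho_1$). For each $s$, $\nu_{s1},\dots,\nu_{s\varkappa_s}$ enumerates the products of rank $\rho_s$, with $\nu_{1p}=\varepsilon_p$ for $p=1,\dots,\varkappa_1$. Coefficients: $\varphi_{sp}(t,c_{sp})$ (parameters $c_{sp}\in\mathbb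 R^{n_{sp}}$, $0\le n_{sp}\le n$) are, recursively in $s=1,\dots,k$, particular solutions of class $\mathcal K_3^{n\times1}(A)\cap C^1(I)$ of $\frac{d\varphi_{sp}}{dt}=A\varphi_{sp}+g_{sp}$, where, with $\tilde\delta=\sum_{s\ge1}\sum_p\nu_{sp}\varphi_{sp}$, $g_{sp}$ is the coefficient of $\nu_{sp}$ in the formal expansion of $$-\sum_{s',p'}\frac{d\nu_{s'p'}}{dt}\varphi_{s'p'}+\sum_{l=1}^m\varepsilon_l\sum_{\wp\in\mathbb N_0^n}\frac1{\wp!}\partial_y^\wp f_l(t,\varphi_0(t,c_0))\tilde\delta^\wp$$ ($d\nu_{s'p'}/dt$ being expanded by the product rule as a combination of products of rank $\rho_{s'}+1$). The function $g_{sp}$ involves only $\varphi_0$ and the $\varphi_{s'p'}$ with $s'<s$, and for $s\le k$ only the derivatives $\partial_y^\wp f_l(t,\varphi_0)$ with $\rho_k\ge\varrho_l$, $|\wp|\le q_{kl}$. Functions $p_{jj}$: let $\hat A(t)=A+\sum_{l=1}^m\varepsilon_l(t)\frac{\partial f_l(t,s(t))}{\partial y}$. A real Lyapunov matrix is $Q:I\to\mathbb R^{n\times n}$, $Q\in C^1(I)$, with $Q$ and $dQ/dt$ bounded and $|\det Q(t)|\ge\mathrm{const}>0$ on $I$. Under the hypotheses, for $t_0$ large, there is (by an earlier theorem of the authors) a real Lyapunov matrix $Q$, with $\lim_{t\to+\infty}\det Q(t)$ existing and nonzero, such that $r=Q(t)x$ transforms $\frac{dr}{dt}=\hat A(t)r$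 into $\frac{dx}{dt}=\Re D(t)\,x$, $D=\operatorname{diag}(d_1,\dots,d_n)$, $$d_j(t)=\lambda_j(A)+\sum_{\substack{\wp\in\mathbb N_0^m,\ 1\le|\wp|<\varpi\\ \mu_\wp\notin\mathcal R_1(I)}}\gamma_{j\wp}\mu_\wp(t)+\varsigma_j(t),\qquad\gamma_{j\wp}\in\mathbb C,\ \ \varsigma_j:I\to\mathbb C,\ \varsigma_j\in\mathcal R(I)\cap C(I).$$ Fix such $Q,\gamma_{j\wp},\varsigma_j$ and put $$p_{jj}(t)=\Re d_j(t)+\Bigl(\varpi-\frac{\rho_{k+1}}{\varrho_1}\Bigr)(\varepsilon_1(t))^{-1}\frac{d\varepsilon_1(t)}{dt},\qquad j=1,\dots,n.$$ Standing assumption: $g(t):=-\frac{ds(t)}{dt}+As(t)+f(t)+\sum_{l=1}^m\varepsilon_l(t)f_l(t,s(t))$ is not identically zero on $I$ (otherwise $y\equiv s(t)$ is an exact solution). *)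

(* Defs.v *)
From HB Require Import structures.
From mathcomp Require Import all_boot all_order all_algebra finmap.
From mathcomp Require Import all_classical all_reals all_analysis.
From mathcomp.real_closed Require Import complex.
(* The notations of monalg clash with those of mathcomp-analysis. *)
From mathcomp.multinomials Require Import -(notations) monalg.

Set Implicit Arguments.
Unset Strict Implicit.
Unset Printing Implicit Defensive.

Import Order.TTheory GRing.Theory Num.Theory.
Import numFieldNormedType.Exports.

Local Open Scope classical_set_scope.
Local Open Scope ring_scope.

(* A function on a set S is a total function of which only the values on S
   matter: derivatives are limits taken inside S, one-sided at endpoints. *)

Section Calculus.
Context {R : realType}.
Implicit Types (t x : R) (S : set R).

Definition ray (t0 : R) : set R := `[t0, +oo[.

Definition derivable_in {V : normedModType R} S (h : R -> V) x : Prop :=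
  cvg ((y - x)^-1 *: (h y - h x) @[y --> within S x^']).

Definition derive_in {V : normedModType R} S (h : R -> V) x : V :=
  lim ((y - x)^-1 *: (h y - h x) @[y --> within S x^']).

Definition derive_in_n {V : normedModType R} S (r : nat) (h : R -> V) : R -> V :=
  iter r (derive_in S) h.

Definition Cn_in {V : normedModType R} S (p : nat) (h : R -> V) : Prop :=
  forall r : nat, (r <= p)%N ->
    {within S, continuous (derive_in_n S r h)} /\
    ((r < p)%N -> forall t, S t -> derivable_in S (derive_in_n S r h) t).

Definition solves {V : normedModType R} S (F : R -> V -> V) (y : R -> V) : Prop :=
  forall t, S t -> derivable_in S y t /\ derive_in S y t = F t (y t).

(* The class R(I), I = [t0, +oo[: convergent, possibly not absolutely
   convergent, improper integrals. *)
Definition cvg_integral (t0 : R) (g : R -> R) : Prop :=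
  (forall T, t0 <= T -> lebesgue_measure.-integrable `[t0, T] (EFin \o g)) /\
  cvg (\int[lebesgue_measure]_(x in `[t0, T]) g x @[T --> +oo]).

Definition cvg_integralC (t0 : R) (g : R -> R[i]) : Prop :=
  cvg_integral t0 (fun t => complex.Re (g t)) /\
  cvg_integral t0 (fun t => complex.Im (g t)).

Definition Rclass (p t0 : R) (g : R -> R) : Prop :=
  cvg_integral t0 (fun t => `|g t| `^ p).

Definition bigO_pinfty {V : normedModType R} (h : R -> V) (g : R -> R) : Prop :=
  exists C : R, \forall t \near +oo, `|h t| <= C * `|g t|.

Definition integral_pinfty (t0 : R) (g : R -> R) : Prop :=
  \int[lebesgue_measure]_(x in `[t0, T]) g x @[T --> +oo] --> +oo.

End Calculus.

Section MultiIndex.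
Context {d : nat}.
Implicit Types w : {ffun 'I_d -> nat}.

Definition mi_deg w : nat := (\sum_i w i)%N.
Definition mi_fact w : nat := (\prod_i (w i)`!)%N.

End MultiIndex.

Section PartialDerivatives.
Context {R : realType} {n : nat}.
Implicit Types (D : set (R * 'cV[R]_n)) (g : R -> 'cV[R]_n -> 'cV[R]_n).

(* [`| _ |] on column vectors is the maximum modulus of the entries. *)
Definition tube (t0 a : R) (phi0 : R -> 'cV[R]_n) : set (R * 'cV[R]_n) :=
  [set z | t0 <= z.1 /\ `|z.2 - phi0 z.1| <= a].

(* The section of D through (t, y) in the direction of the j-th axis. *)
Definition line_in D (j : 'I_n) (t : R) (y : 'cV[R]_n) : set R :=
  [set h | D (t, y + h *: delta_mx j 0)].

Definition pderivable_in D j g t y : Prop :=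
  derivable_in (line_in D j t y) (fun h : R => g t (y + h *: delta_mx j 0)) 0.

Definition pderive_in D j g t y : 'cV[R]_n :=
  derive_in (line_in D j t y) (fun h : R => g t (y + h *: delta_mx j 0)) 0.

Definition pderive_seq D (s : seq 'I_n) g := foldr (pderive_in D) g s.

Definition C0n_in D (q : nat) g : Prop :=
  forall s : seq 'I_n, (size s <= q)%N ->
    {within D, continuous (fun z => pderive_seq D s g z.1 z.2)} /\
    ((size s < q)%N -> forall j t y, D (t, y) ->
       pderivable_in D j (pderive_seq D s g) t y).

Definition pderive_mi D (w : {ffun 'I_n -> nat}) g :=
  pderive_seq D (flatten [seq nseq (w j) j | j <- enum 'I_n]) g.

Definition jacobian_in D g t y : 'M[R]_n :=
  \matrix_(i, j) pderive_in D j g t y i 0.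

End PartialDerivatives.

Section Spectrum.
Context {R : realType} {n : nat}.

(* lam enumerates the eigenvalues with multiplicity; hence 0 lies in the set
   of differences as soon as some eigenvalue is multiple. *)
Definition eigenvalues_of (A : 'M[R]_n) (lam : 'I_n -> R[i]) : Prop :=
  char_poly (map_mx (real_complex R) A) = \prod_(j < n) ('X - (lam j)%:P).

Definition eigen_differences (lam : 'I_n -> R[i]) : set R[i] :=
  [set z | exists j l, j != l /\ z = lam j - lam l].

End Spectrum.

Section ClassK3.
Context {R : realType}.

(* The class K_3(A) on [t0, +oo[; L stands for the union of the spectrum of A
   and of the set of eigenvalue differences. *)
Record classK3 (t0 : R) (L : set R[i]) (K : set (R -> R)) : Prop := ClassK3 {
  (* K is a set of functions on the ray *)
  K3_ext : forall f g, (forall t, ray t0 t -> f t = g t) -> K f -> K g ;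
  K3_nonempty : K !=set0 ;
  K3_continuous : forall f, K f -> {within ray t0, continuous f} ;
  K3_bounded : forall f, K f -> [bounded f t | t in ray t0] ;
  K3_scale : forall (alpha : R) f, K f -> K (fun t => alpha * f t) ;
  K3_add : forall f g, K f -> K g -> K (fun t => f t + g t) ;
  K3_mul : forall f g, K f -> K g -> K (fun t => f t * g t) ;
  K3_mean : forall f, K f -> exists M : R,
    t^-1 * \int[lebesgue_measure]_(x in `[t0, t]) f x @[t --> +oo] --> M /\
    [bounded \int[lebesgue_measure]_(x in `[t0, t]) (f x - M) | t in ray t0] ;
  K3_solve : forall (f : R -> R[i]) (lam : R[i]),
    K (fun t => complex.Re (f t)) -> K (fun t => complex.Im (f t)) -> L lam ->
    exists y : R -> R[i],
      [/\ K (fun t => complex.Re (y t)), K (fun t => complex.Im (y t)),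
          Cn_in (ray t0) 1 (fun t => complex.Re (y t)),
          Cn_in (ray t0) 1 (fun t => complex.Im (y t)) &
          forall t, ray t0 t ->
            derive_in (ray t0) (fun t => complex.Re (y t)) t
              = complex.Re (lam * y t + f t) /\
            derive_in (ray t0) (fun t => complex.Im (y t)) t
              = complex.Im (lam * y t + f t)]
}.

Definition vecK {n : nat} (K : set (R -> R)) (v : R -> 'cV[R]_n) : Prop :=
  forall i, K (fun t => v t i 0).

End ClassK3.

(* Formal monomials in the eps_l and their derivatives: the generator (l, r)
   stands for the r-th derivative of eps_l. *)
Section Monomials.
Context {R : realType} {m : nat}.

Definition mon : choiceType := cmonom ('I_m * nat)%type.

Implicit Types (b : mon) (varrho : 'I_m -> R).

Definition mon_rank varrho b : R :=
  \sum_(i <- finsupp b) (varrho i.1 + i.2%:R) *+ b i.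

Definition mon_eval (t0 : R) (eps : 'I_m -> R -> R) b (t : R) : R :=
  \prod_(i <- finsupp b) derive_in_n (ray t0) i.2 (eps i.1) t ^+ b i.

(* The time derivative of a monomial, by the product rule. *)
Definition mon_deriv b : malg mon R :=
  \sum_(i <- finsupp b)
    mkmalgU (mulcm (divcm b (ucm i)) (ucm (i.1, i.2.+1))) (b i)%:R.

(* rho_1 < rho_2 < ... are the ranks of the nontrivial monomials (the value of
   rho at 0 is irrelevant). *)
Definition ranks_enum varrho (rho : nat -> R) : Prop :=
  (forall i j : nat, (1 <= i)%N -> (i < j)%N -> rho i < rho j) /\
  forall x : R, (exists2 s, (1 <= s)%N & rho s = x) <->
                (exists2 b, b != onecm _ & mon_rank varrho b = x).

(* nu s lists nu_{s1}, ..., nu_{s kappa_s}. *)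
Definition mons_enum varrho (rho : nat -> R) (nu : nat -> seq mon) : Prop :=
  (forall s : nat, (1 <= s)%N -> uniq (nu s) /\
     forall b, b \in nu s <-> b != onecm _ /\ mon_rank varrho b = rho s) /\
  nu 1%N = [seq ucm (l, 0%N) | l <- enum 'I_m & varrho l == rho 1%N].

End Monomials.

Arguments mon m : clear implicits.

(* Formal expansion y = phi0 + \sum_b b phi_b, over monomials b, for the system
   y' = A y + f + \sum_l eps_l f_l(t, y). *)
Section Expansion.
Context {R : realType} {n m : nat}.
Variables (t0 : R) (D : set (R * 'cV[R]_n)) (A : 'M[R]_n) (f : R -> 'cV[R]_n)
  (eps : 'I_m -> R -> R) (fl : 'I_m -> R -> 'cV[R]_n -> 'cV[R]_n)
  (phi0 : R -> 'cV[R]_n) (nu : nat -> seq (mon m)) (k : nat)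
  (* coefficients are indexed by monomials: phi_{sp} is phi nu_{sp} *)
  (phi : mon m -> R -> 'cV[R]_n).

Definition rhs (t : R) (y : 'cV[R]_n) : 'cV[R]_n :=
  A *m y + f t + \sum_(l < m) eps l t *: fl l t y.

(* The formal sum delta, component j.  Terms of rank above rho_k do not
   contribute to coefficients of monomials of rank at most rho_k, the only
   ones used below. *)
Definition formal_delta (t : R) (j : 'I_n) : malg (mon m) R :=
  \sum_(1 <= s < k.+1) \sum_(b <- nu s) mkmalgU b (phi b t j 0).

(* The coefficient of b in the formal expansion of
   - \sum_b' (d b'/dt) phi_b' + \sum_l eps_l \sum_w 1/w! d^w f_l(t, phi0) delta^w.
   Since delta has no constant term, for each l only finitely many multi-indices
   w contribute. *)
Definition formal_coef (b : mon m) (t : R) : 'cV[R]_n :=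
  - (\sum_(1 <= s < k.+1) \sum_(b' <- nu s)
       mcoeff b (mon_deriv b') *: phi b' t)
  + \sum_(l < m) \sum_(w \in [set: {ffun 'I_n -> nat}])
      ((mi_fact w)%:R^-1 *
       mcoeff b (mkmalgU (ucm (l, 0%N)) 1 * \prod_j formal_delta t j ^+ w j))
      *: pderive_mi D w (fl l) t (phi0 t).

Definition expansion_coefs (K : set (R -> R)) : Prop :=
  forall s : nat, (1 <= s <= k)%N -> forall b, b \in nu s ->
    [/\ vecK K (phi b), Cn_in (ray t0) 1 (phi b) &
        solves (ray t0) (fun t v => A *m v + formal_coef b t) (phi b)].

(* The k-th partial sum s(t). *)
Definition approx_sol (t : R) : 'cV[R]_n :=
  phi0 t + \sum_(1 <= s < k.+1) \sum_(b <- nu s) mon_eval t0 eps b t *: phi b t.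

(* Its defect - s' + A s + f + \sum_l eps_l f_l(t, s). *)
Definition residual (t : R) : 'cV[R]_n :=
  - derive_in (ray t0) approx_sol t + rhs t (approx_sol t).

Definition Ahat (t : R) : 'M[R]_n :=
  A + \sum_(l < m) eps l t *: jacobian_in D (fl l) t (approx_sol t).

(* y = s + r is a solution on [T, +oo[ whose graph stays in D, and
   r = O(eps1^e). *)
Definition error_term (eps1 : R -> R) (e : R) (T : R)
    (r : R -> 'cV[R]_n) : Prop :=
  [/\ forall t, ray T t -> D (t, approx_sol t + r t),
      solves (ray T) rhs (fun t => approx_sol t + r t) &
      bigO_pinfty r (fun t => eps1 t `^ e)].

End Expansion.

(* A family of functions on [T, +oo[ satisfying P and depending on N independent
   arbitrary constants, sufficiently small in absolute value: the constants
   range over a cube around 0 and are bi-Lipschitz coordinates for the initial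
   values at T. *)
Definition independent_family {R : realType} {n : nat}
    (P : (R -> 'cV[R]_n) -> Prop) (T : R) (N : nat) : Prop :=
  exists (delta : R) (r : 'rV[R]_N -> R -> 'cV[R]_n),
    [/\ 0 < delta,
        forall c : 'rV[R]_N, (forall i, `|c 0 i| < delta) -> P (r c) &
        exists2 L : R, 0 < L & forall c c' : 'rV[R]_N,
          (forall i, `|c 0 i| < delta) -> (forall i, `|c' 0 i| < delta) ->
          `|r c T - r c' T| <= L * `|c - c'| /\
          `|c - c'| <= L * `|r c T - r c' T|].

Section Reduction.
Context {R : realType} {n m : nat}.
Variables (eps : 'I_m -> R -> R).

Definition mu (w : {ffun 'I_m -> nat}) (t : R) : R := \prod_l eps l t ^+ w l.

Definition mu_indices (t0 varpi : R) : set {ffun 'I_m -> nat} :=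
  [set w | [/\ (1 <= mi_deg w)%N, (mi_deg w)%:R < varpi & ~ Rclass 1 t0 (mu w)]].

Definition diag_coef (W : set {ffun 'I_m -> nat}) (lam : 'I_n -> R[i])
    (gam : 'I_n -> {ffun 'I_m -> nat} -> R[i]) (sig : 'I_n -> R -> R[i])
    (j : 'I_n) (t : R) : R[i] :=
  lam j + \sum_(w \in W) gam j w * real_complex R (mu w t) + sig j t.

Record lyapunov_matrix (T0 : R) (Q : R -> 'M[R]_n) : Prop := LyapunovMatrix {
  lyap_C1 : Cn_in (ray T0) 1 Q ;
  lyap_bounded : [bounded Q t | t in ray T0] ;
  lyap_deriv_bounded : [bounded derive_in (ray T0) Q t | t in ray T0] ;
  lyap_det : exists2 e : R, 0 < e & forall t, ray T0 t -> e <= `|\det (Q t)|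
}.

(* r = Q x transforms r' = B r into x' = diag(dr_1, ..., dr_n) x. *)
Definition transforms (T0 : R) (B : R -> 'M[R]_n) (dr : 'I_n -> R -> R)
    (Q : R -> 'M[R]_n) : Prop :=
  forall x : R -> 'cV[R]_n,
    solves (ray T0) (fun t v => diag_mx (\row_j dr j t) *m v) x <->
    solves (ray T0) (fun t v => B t *m v) (fun t => Q t *m x t).

Record lyapunov_reduction (T0 : R) (B : R -> 'M[R]_n)
    (W : set {ffun 'I_m -> nat}) (lam : 'I_n -> R[i]) (Q : R -> 'M[R]_n)
    (gam : 'I_n -> {ffun 'I_m -> nat} -> R[i]) (sig : 'I_n -> R -> R[i]) : Prop :=
  LyapunovReduction {
    red_lyap : lyapunov_matrix T0 Q ;
    red_det_lim : exists2 dQ : R, dQ != 0 & \det (Q t) @[t --> +oo] --> dQ ;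
    red_sig_integral : forall j, cvg_integralC T0 (sig j) ;
    red_sig_cont : forall j,
      {within ray T0, continuous (fun t => complex.Re (sig j t))} /\
      {within ray T0, continuous (fun t => complex.Im (sig j t))} ;
    red_transforms :
      transforms T0 B (fun j t => complex.Re (diag_coef W lam gam sig j t)) Q
  }.

End Reduction.

(* Main.v *)
Require Import Defs.
From HB Require Import structures.
From mathcomp Require Import all_boot all_order all_algebra finmap.
From mathcomp Require Import all_classical all_reals all_analysis.
From mathcomp.real_closed Require Import complex.
From mathcomp.multinomials Require Import -(notations) monalg.
From mathcomp Require Import ring lra.

Set Implicit Arguments.
Unset Strict Implicit.
Unset Printing Implicit Defensive.

Import Order.TTheory GRing.Theory Num.Theory.
Import numFieldNormedType.Exports.

Local Open Scope classical_set_scope.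
Local Open Scope ring_scope.

(* Put y = s(t) + r. The formal coefficients make the residual of s of order
   eps_1^(rho_{k+1}/varrho_1), so that r' = Ahat r + residual + quadratic terms.
   Let e = rho_{k+1}/varrho_1 - varpi and r = eps_1^e U v, where U is a bounded
   frame, with at least as many columns as rows, satisfying U' = Ahat U - U diag(d) - E
   with E integrable. Then v_j' = p_j v_j + (terms with integrable coefficients),
   since eps_1^varpi is integrable. Up to terms with a bounded primitive, p_j has a
   constant sign near infinity; hence the increments of its primitive are bounded
   above or below, and a contraction argument gives one solution v for every choice
   of the small values v_j(T) of the components of the first kind.

   For the existence of r, U is the real form (n x 2n) of Q^-1 Y Theta, where Q
   diagonalises A, Theta removes the imaginary parts of the d_j, and Y is obtained by
   solving away off-diagonal terms mu_w kappa of increasing degree: as mu_w' is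
   integrable, mu_w may be treated as a constant there. For the family of solutions,
   U is the given Lyapunov matrix. At most n independent parameters exist by a
   packing argument: a bi-Lipschitz image of a grid in a cube of dimension N has too
   many well-separated points for R^n when n < N. *)

(** * Calculus on a ray *)

(** Two constraints shape the argument. Dividing by eps_1^e must leave integrable terms. The
    residual leaves eps_1^varpi by the choice of e. The quadratic terms, of size eps_1 eps_1^(2e),
    leave eps_1^(1+e), which is integrable because e + 1 >= varpi; and r tends to 0 because e > 0.
    These are the two inequalities assumed of rho_{k+1}. Differentiating eps_1^e produces the term -
    e eps_1'/eps_1 of p_j. The other constraint is that the natural diagonalising frame is complex
    while solutions are real. The real and imaginary parts of its columns form 2n real columns. They
    are linearly dependent, but a right inverse is enough to lift the equation for r to one for v,
    and every solution v maps to a solution r. This lift is not injective, so it gives existence but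
    cannot count parameters. Counting needs a square invertible frame, hence the given Lyapunov
    matrix; existence, which is claimed before such a matrix is given, cannot rely on it. *)

Section DeriveIn.
Context {R : realType} {V : normedModType R}.
Implicit Types (S : set R) (h : R -> V).

(** [derivable_in] takes a limit at x, whereas [derivable] takes a limit of increments at 0; the
    substitution y = x + e relates the two. *)
Lemma growth_rate_shift h (x : R) :
  (fun y => (y - x)^-1 *: (h y - h x)) @ x^'
  = (fun e => e^-1 *: ((h \o shift x) (e *: (1 : R)) - h x)) @ 0^'.
Proof.
rewrite (_ : x^' = (fun e => e + x) @ 0^'); last first.
  apply/seteqP; split => P /=.
    move=> /nbhs_ballP[e e0 He]; apply/nbhs_ballP; exists e => // y /=.
    rewrite /ball/= sub0r normrN => ye y0; apply: He.
      by rewrite /ball/= distrC addrK.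
    by apply: contra_neq y0 => /(congr1 (fun z => z - x)); rewrite addrK subrr.
  move=> /nbhs_ballP[e e0 He]; apply/nbhs_ballP; exists e => // y /=.
  rewrite /ball/= => ye yx; rewrite -(subrK x y); apply: He => /=.
    by rewrite /ball/= sub0r opprB.
  by rewrite subr_eq0.
apply: (congr1 (fun k => k @ 0^')); apply/funext => e /=.
by rewrite addrK scaler1.
Qed.

Lemma within_dnbhs_id S (x : R) : nbhs x S -> within S x^' = x^'.
Proof.
move=> Sx; have Sx' : x^' S by exact: nbhs_dnbhs.
apply/seteqP; split => P; rewrite /within /=.
  by move=> H; apply: filterS2 Sx' H => y Sy; apply.
by move=> H; apply: filterS H => y Py.
Qed.

Lemma derivable_inE S h x : nbhs x S -> derivable_in S h x <-> derivable h x 1.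
Proof.
move=> Sx; rewrite /derivable_in /derivable within_dnbhs_id//.
by rewrite growth_rate_shift.
Qed.

Lemma derive_inE S h x : nbhs x S -> derive_in S h x = 'D_1 h x.
Proof.
by move=> Sx; rewrite /derive_in within_dnbhs_id// growth_rate_shift.
Qed.

(** The bridge to ordinary calculus. Most of the analysis takes place on rays that start strictly
    after [t0], where one-sided derivatives on [ray t0] are two-sided ones. *)
Lemma is_derive_inP S h x d : nbhs x S ->
  (derivable_in S h x /\ derive_in S h x = d) <-> is_derive x 1 h d.
Proof.
move=> Sx; split => [[/(derivable_inE _ Sx) ? <-]|[hx <-]].
  by rewrite derive_inE//; apply: DeriveDef.
by rewrite derive_inE//; split => //; apply/derivable_inE.
Qed.

Lemma nbhs_ray (t0 t : R) : t0 < t -> nbhs t (ray t0).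
Proof.
move=> tt; apply/nbhs_ballP; exists (t - t0); first by rewrite /= subr_gt0.
move=> y; rewrite /ball/= /ray /= in_itv/= andbT ltr_norml; lra.
Qed.

End DeriveIn.

Section Ray.
Context {R : realType}.
Implicit Types (T t : R) (g h G : R -> R).

Lemma rayE T t : ray T t <-> T <= t.
Proof. by rewrite /ray /= in_itv/= andbT. Qed.

(** Continuity is two-sided even at the endpoint [T], so that it combines with [is_derive] on the
    closed ray. *)
Definition cts {V : topologicalType} T (g : R -> V) :=
  forall t, T <= t -> {for t, continuous g}.

Lemma ctsW {V : topologicalType} T T' (g : R -> V) : T <= T' -> cts T g -> cts T' g.
Proof. by move=> TT' H t Tt; apply: H; apply: le_trans Tt. Qed.

Lemma cts_within {V : topologicalType} t0 T (g : R -> V) : t0 < T ->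
  {within ray t0, continuous g} -> cts T g.
Proof.
move=> t0T /subspace_continuousP H t Tt; have t0t : t0 < t by apply: lt_le_trans Tt.
move=> P /(H t ((rayE _ _).2 (ltW t0t))) HP.
change (nbhs t (fun y => ray t0 y -> P (g y))) in HP.
change (nbhs t (fun y => P (g y))).
by apply: filterS2 (nbhs_ray t0t) HP => y Hy; apply.
Qed.

Lemma within_cts {V : topologicalType} T (g : R -> V) :
  cts T g -> {within ray T, continuous g}.
Proof.
move=> H; apply/subspace_continuousP => t /rayE/H Ht.
exact: cvg_trans (cvg_app _ (@cvg_within _ _ _ _)) Ht.
Qed.

(** Freezing the function before [T] makes it continuous on the whole line, and no left
    neighbourhood of [T] needs separate treatment. *)
Lemma cts_clamp {V : topologicalType} T (g : R -> V) : {within ray T, continuous g} ->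
  continuous (fun t => g (Num.max t T)).
Proof.
move=> /subspace_continuousP H t.
have : T <= Num.max t T by rewrite le_max lexx orbT.
move=> /rayE/H Hm; move=> P {}/Hm HP.
change (nbhs (Num.max t T) (fun y => ray T y -> P (g y))) in HP.
have mc : {for t, continuous (fun y : R => Num.max y T)}.
  by apply: continuous_max; [exact: cvg_id|exact: cvg_cst].
change (nbhs t (fun y => P (g (Num.max y T)))).
have {}HP := mc _ HP.
change (nbhs t (fun y => ray T (Num.max y T) -> P (g (Num.max y T)))) in HP.
apply: filterS HP => y; apply.
by apply/rayE; rewrite le_max lexx orbT.
Qed.

Lemma antiderivative T g : {within ray T, continuous g} ->
  exists G, forall t, T <= t -> is_derive t 1 G (g t).
Proof.
move=> /cts_clamp; set g' := fun t => _ => cg.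
(* The base point lies strictly before [T], so the derivative is two-sided at [T] too. *)
exists (fun t => \int[lebesgue_measure]_(x in `[T - 1, t]) g' x)%R => t Tt.
have Tt1 : T - 1 < t by lra.
have tt1 : t < t + 1 by lra.
have int : lebesgue_measure.-integrable `[T - 1, t + 1] (EFin \o g').
  apply: continuous_compact_integrable; first exact: segment_compact.
  exact: continuous_subspaceT.
have [d1 d2] := continuous_FTC1_closed tt1 int Tt1 (cg t).
apply: DeriveDef => //; rewrite -derive1E d2 /g' max_l//.
Qed.

Lemma integral_antiderivative T G g s t : {within ray T, continuous g} ->
  (forall t, T <= t -> is_derive t 1 G (g t)) -> T <= s -> s <= t ->
  (\int[lebesgue_measure]_(x in `[s, t]) g x)%R = G t - G s.
Proof.
move=> cg dG Ts; rewrite le_eqVlt => /predU1P[<-|st].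
  by rewrite set_itv1 Rintegral_set1 subrr.
have cG x : T <= x -> {for x, continuous G}.
  by move=> /dG[dx _]; apply/differentiable_continuous/derivable1_diffP.
rewrite /Rintegral (@continuous_FTC2 _ g G)//.
- apply: continuous_subspaceW cg => x /=; rewrite /ray /= !in_itv/= andbT.
  by move=> /andP[sx _]; apply: le_trans sx.
- split.
  + by move=> x; rewrite in_itv/= => /andP[sx _]; have [] := dG x (le_trans Ts (ltW sx)).
  + exact/cvg_at_right_filter/cG.
  + by apply/cvg_at_left_filter/cG/(le_trans Ts)/ltW.
- move=> x; rewrite in_itv/= => /andP[sx _]; rewrite derive1E.
  by have [_ ] := dG x (le_trans Ts (ltW sx)).
Qed.

(** Both H + G and H - G are nondecreasing. This inequality replaces estimates of integrals
    throughout: primitives stand for integrals. *)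
Lemma derive_le T G H g h : (forall t, T <= t -> is_derive t 1 G (g t)) ->
  (forall t, T <= t -> is_derive t 1 H (h t)) ->
  forall s t, T <= s -> s <= t ->
  (forall x, s <= x <= t -> `|g x| <= h x) -> `|G t - G s| <= H t - H s.
Proof.
move=> dG dH s t Ts st gh.
have mono (F f : R -> R) : (forall t, T <= t -> is_derive t 1 F (f t)) ->
    (forall x, s <= x <= t -> 0 <= f x) -> F s <= F t.
  move=> dF f0; apply: (@ger0_derive1_ndecr R F s t _ _ _ s t) => //.
  - by move=> x; rewrite in_itv/= => /andP[sx _]; have [] := dF x (le_trans Ts (ltW sx)).
  - move=> x; rewrite in_itv/= => /andP[sx xt]; rewrite derive1E.
    by have [_ ->] := dF x (le_trans Ts (ltW sx)); rewrite f0// !ltW.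
  - apply: derivable_within_continuous => x; rewrite in_itv/= => /andP[sx _].
    by have [] := dF x (le_trans Ts sx).
rewrite ler_norml; apply/andP; split.
- have := mono (H + G) (fun x => h x + g x).
  rewrite /= => H0.
  have : H s + G s <= H t + G t.
    apply: H0 => [x Tx|x /gh]; first by have := dG x Tx; have := dH x Tx => ? ?; exact: is_deriveD.
    by rewrite ler_norml; lra.
  lra.
- have := mono (H - G) (fun x => h x - g x).
  rewrite /= => H0.
  have : H s - G s <= H t - G t.
    apply: H0 => [x Tx|x /gh]; first by have := dG x Tx; have := dH x Tx => ? ?; exact: is_deriveB.
    by rewrite ler_norml; lra.
  lra.
Qed.

End Ray.

(** * Absolutely integrable functions *)

Section Integrability.
Context {R : realType}.
Implicit Types (T t : R) (g h G : R -> R).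

Lemma nearyP (P : R -> Prop) :
  (\forall t \near +oo, P t) <-> exists T, forall t, T <= t -> P t.
Proof.
split=> [[M [_ MP]]|[T TP]].
  by exists (M + 1) => t Mt; apply: MP; rewrite (lt_le_trans _ Mt)// ltrDl.
by exists T; split => [|t /ltW/TP]//; exact: num_real.
Qed.

Lemma cts_cst {V : topologicalType} T (c : V) : cts T (fun=> c).
Proof. by move=> t _; exact: cvg_cst. Qed.

Lemma ctsD T g h : cts T g -> cts T h -> cts T (fun t => g t + h t).
Proof. by move=> cg ch t Tt; apply: cvgD; [exact: cg|exact: ch]. Qed.

Lemma ctsN T g : cts T g -> cts T (fun t => - g t).
Proof. by move=> cg t Tt; apply: cvgN; exact: cg. Qed.

Lemma ctsB T g h : cts T g -> cts T h -> cts T (fun t => g t - h t).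
Proof. by move=> cg ch; apply: ctsD => //; exact: ctsN. Qed.

Lemma ctsM T g h : cts T g -> cts T h -> cts T (fun t => g t * h t).
Proof. by move=> cg ch t Tt; apply: cvgM; [exact: cg|exact: ch]. Qed.

Lemma cts_norm T g : cts T g -> cts T (fun t => `|g t|).
Proof. by move=> cg t Tt; apply: cvg_norm; exact: cg. Qed.

Lemma cts_sum T (I : Type) (r : seq I) (P : pred I) (F : I -> R -> R) :
  (forall i, cts T (F i)) -> cts T (fun t => \sum_(i <- r | P i) F i t).
Proof.
move=> cF t Tt; apply: cvg_big => [|i _]; last exact: cF.
exact: add_continuous.
Qed.

Lemma cts_prod T (I : Type) (r : seq I) (P : pred I) (F : I -> R -> R) :
  (forall i, P i -> cts T (F i)) -> cts T (fun t => \prod_(i <- r | P i) F i t).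
Proof.
move=> cF t Tt; apply: cvg_big => [|i Pi]; last exact: cF.
exact: mul_continuous.
Qed.

Lemma ctsX T g n : cts T g -> cts T (fun t => g t ^+ n).
Proof.
move=> cg; elim: n => [|n IH]; first exact: cts_cst.
under [fun t => _]eq_fun do rewrite exprS.
exact: ctsM.
Qed.

Lemma cts_derive T g h : (forall t, T <= t -> is_derive t 1 g (h t)) -> cts T g.
Proof.
by move=> dg t /dg [dx _]; apply/differentiable_continuous/derivable1_diffP.
Qed.

Lemma antiderivative_cts T g : cts T g ->
  exists G, forall t, T <= t -> is_derive t 1 G (g t).
Proof. by move=> /within_cts/antiderivative. Qed.

(** Absolute integrability on the ray, expressed by a bounded primitive of the modulus; this keeps
    Lebesgue integrals out of the estimates. *)
Definition L1 T g := cts T g /\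
  exists2 G, forall t, T <= t -> is_derive t 1 G `|g t|
  & exists C, forall t, T <= t -> `|G t| <= C.

Lemma L1_cts T g : L1 T g -> cts T g. Proof. by case. Qed.

Lemma L1W T T' g : T <= T' -> L1 T g -> L1 T' g.
Proof.
move=> TT' [cg [G dG [C GC]]]; split; first exact: ctsW cg.
by exists G => [t Tt|]; [apply: dG|exists C => t Tt; apply: GC]; apply: le_trans Tt.
Qed.

Lemma antiderivative_nd T G g : (forall t, T <= t -> is_derive t 1 G (g t)) ->
  (forall t, T <= t -> 0 <= g t) -> forall s t, T <= s -> s <= t -> G s <= G t.
Proof.
move=> dG g0 s t Ts st.
have := @derive_le _ T (cst 0) G (cst 0) g _ dG s t Ts st.
rewrite /cst subrr normr0 subr_ge0 => h; apply: h => x /andP[sx _].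
by rewrite g0// (le_trans Ts).
Qed.

(** The domination is needed only from [T'] on: before [T'] the primitive of |g| is monotone and
    lies between its values at [T] and [T']. *)
Lemma L1_dom T T' g h (C : R) : T <= T' -> cts T g -> L1 T' h ->
  (forall t, T' <= t -> `|g t| <= C * `|h t|) -> L1 T g.
Proof.
move=> TT' cg [_ [H dH [CH HC]]] gh; split => //.
have [G dG] := antiderivative_cts (cts_norm cg).
exists G => //; exists (`|G T| + `|G T'| + `|C| * (CH + CH)) => t Tt.
have nd := antiderivative_nd dG (fun t _ => normr_ge0 _).
have CH0 : 0 <= CH by apply: le_trans (HC T' _).
have dH' : forall s, T' <= s -> is_derive s 1 (fun u => `|C| * H u) (`|C| * `|h s|).
  by move=> s Ts; have := dH s Ts => ?; exact: is_deriveZ.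
have [tT'|/ltW T't] := leP t T'.
  have h1 := nd T t (lexx T) Tt; have h2 := nd t T' Tt tT'.
  have := mulr_ge0 (normr_ge0 C) CH0.
  have := ler_norm (G T'); have := ler_norm (- G T); rewrite normrN.
  have := normr_ge0 (G T); have := normr_ge0 (G T').
  by rewrite ler_norml; nra.
have h1 := nd T T' (lexx T) TT'; have h2 := nd T' t TT' T't.
have : `|G t - G T'| <= `|C| * H t - `|C| * H T'.
  apply: (@derive_le _ T' G (fun u => `|C| * H u) (fun t => `|g t|) (fun t => `|C| * `|h t|)) => //.
    by move=> s Ts; apply: dG; apply: le_trans Ts.
  move=> x /andP[T'x _]; rewrite normr_id (le_trans (gh _ _))//.
  by rewrite ler_wpM2r// ler_norm.
rewrite -mulrBr => h3.
have : `|C| * (H t - H T') <= `|C| * (CH + CH).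
  rewrite ler_wpM2l//; have := HC t T't; have := HC T' (lexx _).
  by rewrite !ler_norml; lra.
have := ler_norm (G T'); have := ler_norm (- G T); rewrite normrN.
have := normr_ge0 (G T); have := normr_ge0 (G T').
by move: h3; rewrite !ler_norml; lra.
Qed.

Lemma L1_dom1 T g h : cts T g -> L1 T h ->
  (forall t, T <= t -> `|g t| <= `|h t|) -> L1 T g.
Proof.
by move=> cg Lh gh; apply: (@L1_dom T T g h 1) => // t Tt; rewrite mul1r gh.
Qed.

Lemma L1_norm T g : L1 T g -> L1 T (fun t => `|g t|).
Proof.
move=> Lg; apply: (L1_dom1 _ Lg) => [|t _]; first exact/cts_norm/L1_cts.
by rewrite normr_id.
Qed.

Lemma L1D T g h : L1 T g -> L1 T h -> L1 T (fun t => g t + h t).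
Proof.
move=> [cg [G dG [CG GC]]] [ch [H dH [CH HC]]].
have L : L1 T (fun t => `|g t| + `|h t|).
  split; first by apply: ctsD; exact: cts_norm.
  exists (G + H) => [t Tt|]; last first.
    exists (CG + CH) => t Tt; rewrite (le_trans (ler_normD _ _))// lerD//.
      exact: GC.
    exact: HC.
  rewrite ger0_norm ?addr_ge0//.
  by have := dG t Tt; have := dH t Tt => ? ?; exact: is_deriveD.
apply: (L1_dom1 _ L) => [|t _]; first exact: ctsD.
by rewrite (le_trans (ler_normD _ _))// ler_norm.
Qed.

Lemma L1_bndM T g h : L1 T g -> cts T h -> (exists C : R, forall t, T <= t -> `|h t| <= C) ->
  L1 T (fun t => h t * g t).
Proof.
move=> Lg ch [C hC]; apply: (@L1_dom T T _ g C) => // [|t Tt].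
  by apply: ctsM => //; exact: L1_cts.
by rewrite normrM ler_wpM2r// hC.
Qed.

Lemma L1Z T g (c : R) : L1 T g -> L1 T (fun t => c * g t).
Proof.
move=> Lg; apply: (@L1_bndM T g (fun=> c)) => //; first exact: cts_cst.
by exists `|c|.
Qed.

Lemma L1N T g : L1 T g -> L1 T (fun t => - g t).
Proof.
move=> Lg; apply: (L1_dom1 _ Lg) => [|t _]; first exact/ctsN/L1_cts.
by rewrite normrN.
Qed.

Lemma L1_0 T : L1 T (fun=> 0).
Proof.
split; first exact: cts_cst.
exists (cst 0); last by exists 0 => t _; rewrite normr0.
by move=> t _; rewrite normr0; exact: is_derive_cst.
Qed.

Lemma L1_sum T (I : Type) (r : seq I) (F : I -> R -> R) :
  (forall i, L1 T (F i)) -> L1 T (fun t => \sum_(i <- r) F i t).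
Proof.
move=> LF; elim: r => [|i r IH].
  by under [fun t => _]eq_fun do rewrite big_nil; exact: L1_0.
by under [fun t => _]eq_fun do rewrite big_cons; exact: L1D.
Qed.

Lemma nd_bounded_cauchy T G (C : R) :
  (forall s t, T <= s -> s <= t -> G s <= G t) ->
  (forall t, T <= t -> G t <= C) ->
  exists l, (forall t, T <= t -> G t <= l) /\
    forall e, 0 < e -> exists2 T', T <= T' & forall t, T' <= t -> l - e < G t.
Proof.
move=> nd GC; pose E := [set G t | t in [set t | T <= t]].
have hE : has_sup E.
  split; first by exists (G T); exists T => //=.
  by exists C => _ [t Tt <-]; exact: GC.
exists (sup E); split => [t Tt|e e0].
  by apply: ub_le_sup; [exact: hE.2|exists t].
have [_ [T' TT' <-] h] := sup_adherent e0 hE.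
by exists T' => // t T't; apply: lt_le_trans h _; exact: nd.
Qed.

(** A small tail is what turns an integrable Lipschitz weight into a contraction once the initial
    time is large. *)
Lemma L1_tail T g : L1 T g -> exists2 G,
   forall t, T <= t -> is_derive t 1 G `|g t| &
   forall e, 0 < e -> exists2 T', T <= T' & forall s t, T' <= s -> s <= t -> G t - G s <= e.
Proof.
move=> [cg [G dG [C GC]]]; exists G => // e e0.
have nd := antiderivative_nd dG (fun t _ => normr_ge0 _).
have [t Tt|l [Gl /(_ e e0) [T' TT' lG]]] := nd_bounded_cauchy (C := C) nd.
  by rewrite (le_trans (ler_norm _))// GC.
exists T' => // s t T's st; have := lG s T's; have := Gl t (le_trans TT' (le_trans T's st)); lra.
Qed.

Lemma nd_cvg T G (C : R) :
  (forall s t, T <= s -> s <= t -> G s <= G t) ->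
  (forall t, T <= t -> G t <= C) -> cvg (G t @[t --> +oo]).
Proof.
move=> nd GC; have [l [Gl H]] := nd_bounded_cauchy nd GC.
apply/cvg_ex; exists l; apply/cvgrPdist_le => e e0; apply/nearyP.
have [T' TT' lG] := H e e0; exists T' => t T't.
have := lG t T't; have := Gl t (le_trans TT' T't).
by rewrite ler_norml; lra.
Qed.

Lemma cvg_bounded_near G : cvg (G t @[t --> +oo]) ->
  exists T C, forall t, T <= t -> `|G t| <= C.
Proof.
move=> /cvg_ex[l /cvgrPdist_le /(_ _ ltr01)/nearyP[T HT]].
exists T, (`|l| + 1) => t /HT h.
have -> : G t = l - (l - G t) by ring.
by rewrite (le_trans (ler_normB _ _))// lerD2l.
Qed.

Lemma cvg_integral_antiderivative (t0 : R) G g : {within ray t0, continuous g} ->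
  (forall t, t0 <= t -> is_derive t 1 G (g t)) ->
  cvg_integral t0 g <-> cvg (G t @[t --> +oo]).
Proof.
move=> cg dG.
have eqn : \forall t \near +oo, (\int[lebesgue_measure]_(x in `[t0, t]) g x)%R = G t - G t0.
  by apply/nearyP; exists t0 => t t0t; exact: (integral_antiderivative cg dG).
rewrite /cvg_integral; split => [[_ h]|h].
  have : cvg ((G t - G t0) @[t --> +oo]).
    have /cvg_ex[l hl] := h; apply/cvg_ex; exists l; apply: cvg_trans hl.
    by apply: near_eq_cvg; apply: filterS eqn => t ->.
  move=> /cvg_ex[l hl]; apply/cvg_ex; exists (l + G t0).
  apply: cvg_trans (cvgD hl (cvg_cst (G t0))).
  by apply: near_eq_cvg; near=> t; rewrite /= subrK.
split=> [T t0T|].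
  apply: continuous_compact_integrable; first exact: segment_compact.
  apply: continuous_subspaceW cg => x /=; rewrite /ray /= !in_itv/= andbT.
  by move=> /andP[].
have /cvg_ex[l hl] := h; apply/cvg_ex; exists (l - G t0).
apply: cvg_trans (cvgB hl (cvg_cst (G t0))).
by apply: near_eq_cvg; apply: filterS eqn => t ->.
Unshelve. all: by end_near. Qed.

Lemma within_powR_cst (t0 : R) g (p : R) : {within ray t0, continuous g} -> p = 1 ->
  {within ray t0, continuous (fun t => `|g t| `^ p)}.
Proof.
move=> cg ->; under [fun t => _]eq_fun do rewrite powRr1//.
by apply/subspace_continuousP => t tt; apply: cvg_norm; move/subspace_continuousP: cg => /(_ t tt).
Qed.

Lemma Rclass_L1 (t0 T p : R) g : t0 < T -> 
  {within ray t0, continuous (fun t => `|g t| `^ p)} ->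
  Rclass p t0 g -> L1 T (fun t => `|g t| `^ p).
Proof.
move=> t0T cg Rg; have [G dG] := antiderivative cg.
have cG : cts T (fun t => `|g t| `^ p) by exact: cts_within cg.
have /cvg_bounded_near [T' [C GC]] := (cvg_integral_antiderivative cg dG).1 Rg.
split => //; exists G => [t Tt|].
  by rewrite ger0_norm ?powR_ge0//; apply: dG; rewrite (le_trans _ Tt)// ltW.
have nd := antiderivative_nd dG (fun t _ => powR_ge0 _ _).
exists (`|G t0| + `|C|) => t Tt; have t0t : t0 <= t by rewrite (le_trans _ Tt)// ltW.
have : G t0 <= G t by exact: nd.
have : G t <= G (Num.max t T') by apply: nd => //; rewrite le_max lexx.
have : `|G (Num.max t T')| <= C by apply: GC; rewrite le_max lexx orbT.
have := ler_norm (- G t0); rewrite normrN; have := normr_ge0 (G t0).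
have := ler_norm C; have := normr_ge0 C.
by rewrite !ler_norml; lra.
Qed.

Lemma Rclass1_L1 (t0 T : R) g : t0 < T -> {within ray t0, continuous g} ->
  Rclass 1 t0 g -> L1 T g.
Proof.
move=> t0T cg Rg; have := Rclass_L1 t0T (within_powR_cst cg erefl) Rg.
under [fun t => _]eq_fun do rewrite powRr1//.
move=> L; apply: (L1_dom1 _ L) => [|t _]; first exact: cts_within cg.
by rewrite normr_id.
Qed.

Lemma L1_Rclass1 (t0 T : R) g : t0 <= T -> {within ray t0, continuous g} ->
  L1 T g -> Rclass 1 t0 g.
Proof.
move=> t0T cg [cgT [H dH [C HC]]].
have cg' := within_powR_cst cg erefl.
have [G dG] := antiderivative cg'.
apply/(cvg_integral_antiderivative cg' dG).
have nd := antiderivative_nd dG (fun t _ => powR_ge0 _ _).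
apply: (@nd_cvg T _ (G T + (C + C))) => [s t Ts st|t Tt].
  by apply: nd => //; apply: le_trans Ts.
have : `|G t - G T| <= H t - H T.
  apply: (@derive_le _ T _ _ (fun t => `|g t| `^ 1) (fun t => `|g t|)) => //.
    by move=> s Ts; apply: dG; apply: le_trans Ts.
  by move=> x _; rewrite powRr1// normr_id.
by have := HC t Tt; have := HC T (lexx _); rewrite !ler_norml; lra.
Qed.

End Integrability.

(** * Systems with a dichotomy *)

Section MatrixNorm.
Context {R : realType} {m n : nat}.
Implicit Types A : 'M[R]_(m, n).

Lemma mx_norm_le A (C : R) : 0 <= C -> (forall i j, `|A i j| <= C) -> `|A| <= C.
Proof.
move=> C0 AC; rewrite /Num.norm/= mx_normrE; apply: bigmax_le => // -[i j] _ /=.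
Qed.

Lemma mx_entry_le A i j : `|A i j| <= `|A|.
Proof.
by rewrite [leRHS]/Num.norm/= mx_normrE; apply: (le_bigmax _ (fun x => `|A x.1 x.2|) (i, j)).
Qed.

End MatrixNorm.

Section Duhamel.
Context {R : realType}.
Variables (T C kappa : R) (p P w W : R -> R) (up : bool).
Hypothesis dP : forall t, T <= t -> is_derive t 1 P (p t).
Hypothesis dich : forall s t, T <= s -> s <= t ->
  if up then P t - P s <= C else - C <= P t - P s.
Hypothesis dW : forall t, T <= t -> is_derive t 1 W (w t).
Hypothesis w0 : forall t, T <= t -> 0 <= w t.
Hypothesis Wk : forall t, T <= t -> W t - W T <= kappa.

(** Variation of constants for y' = p y + h with P' = p. The integral of h e^{-P} starts at [T] when
    the increments of P are bounded above and at infinity when they are bounded below; [L] is the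
    value of the primitive [K] at that starting point. *)
Definition is_duhamel (h y : R -> R) := exists K L,
  [/\ forall t, T <= t -> is_derive t 1 K (h t * expR (- P t)),
      if up then L = K T else K t @[t --> +oo] --> L
    & forall t, y t = expR (P t) * (K t - L)].

Lemma is_derive_expRN t : T <= t -> is_derive t 1 (fun s => expR (- P s)) (- (p t) * expR (- P t)).
Proof.
move=> Tt; have h1 := dP Tt; have h2 := is_deriveN h1.
have h3 : is_derive t 1 (expR \o (- P)) (expR (- P t) * - p t).
  exact: is_derive1_comp.
by rewrite mulrC; exact: h3.
Qed.

Lemma is_duhamel_derive h y : is_duhamel h y ->
  forall t, T <= t -> is_derive t 1 y (p t * y t + h t).
Proof.
move=> [K [L [dK _ yE]]] t Tt.
have -> : y = (fun s => expR (P s) * (K s - L)) by apply/funext.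
have h1 := dP Tt; have h2 := dK t Tt.
have h3 : is_derive t 1 (expR \o P) (expR (P t) * p t) by exact: is_derive1_comp.
have h4 : is_derive t 1 (K - cst L) (h t * expR (- P t) - 0) by exact: is_deriveB.
have h5 := is_deriveM h3 h4.
apply: is_derive_eq h5 _.
have e1 : expR (P t) * expR (- P t) = 1 by rewrite expRN divff// gt_eqF// expR_gt0.
rewrite /= subr0 /GRing.scale/=.
change ((K - cst L) t) with (K t - L).
transitivity (h t * (expR (P t) * expR (- P t)) + (K t - L) * (expR (P t) * p t)); first by rewrite /=; ring.
by rewrite e1; ring.
Qed.

(** K is the difference of |B| W + K and |B| W, both monotone and bounded. *)
Lemma dominated_cvg (K g : R -> R) (B : R) : (forall t, T <= t -> is_derive t 1 K (g t)) ->
  (forall t, T <= t -> `|g t| <= B * w t) -> cvg (K t @[t --> +oo]).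
Proof.
move=> dK gB.
have B' t : T <= t -> `|g t| <= `|B| * w t.
  by move=> Tt; rewrite (le_trans (gB t Tt))// ler_wpM2r ?w0// ler_norm.
have dBW t : T <= t -> is_derive t 1 (fun u => `|B| * W u) (`|B| * w t).
  by move=> Tt; have := dW Tt => ?; exact: is_deriveZ.
have c1 : cvg ((fun u => `|B| * W u + K u) t @[t --> +oo]).
  have dd t : T <= t -> is_derive t 1 (fun u => `|B| * W u + K u) (`|B| * w t + g t).
    by move=> Tt; have := dBW t Tt; have := dK t Tt => ? ?; exact: is_deriveD.
  apply: (@nd_cvg _ T _ (`|B| * W T + K T + 2 * (`|B| * kappa))).
    apply: (antiderivative_nd dd) => t Tt; have := B' t Tt.
    by rewrite ler_norml => /andP[]; lra.
  move=> t Tt; have : `|K t - K T| <= `|B| * W t - `|B| * W T.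
    apply: (derive_le dK dBW) => // x /andP[Tx _]; exact: B'.
  rewrite -mulrBr => h; have : `|B| * (W t - W T) <= `|B| * kappa.
    by rewrite ler_wpM2l// Wk.
  by move: h; rewrite ler_norml => /andP[]; lra.
have c2 : cvg ((fun u => `|B| * W u) t @[t --> +oo]).
  apply: (@nd_cvg _ T _ (`|B| * W T + (`|B| * kappa))).
    by apply: (antiderivative_nd dBW) => t Tt; rewrite mulr_ge0// w0.
  move=> t Tt; have : `|B| * (W t - W T) <= `|B| * kappa.
    by rewrite ler_wpM2l// Wk.
  by rewrite mulrBr; lra.
move/cvg_ex: c1 => [l1 h1]; move/cvg_ex: c2 => [l2 h2].
apply/cvg_ex; exists (l1 - l2); apply: cvg_trans (cvgB h1 h2).
by apply: near_eq_cvg; near=> t; rewrite /= addrC addKr.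
Unshelve. all: by end_near. Qed.

Lemma is_duhamel_exists h (B : R) : cts T h -> (forall t, T <= t -> `|h t| <= B * w t) ->
  exists y, is_duhamel h y.
Proof.
move=> ch hB.
have cE : cts T (fun t => expR (- P t)) by apply: cts_derive => t; exact: is_derive_expRN.
have [K dK] := antiderivative_cts (ctsM ch cE).
suff [L HL] : exists L, if up then L = K T else K t @[t --> +oo] --> L.
  by exists (fun t => expR (P t) * (K t - L)), K, L.
case: up dich => [_|dw]; first by exists (K T).
(* The lower bound on the increments from [T] gives e^{-P t} <= e^{C - P T}. *)
apply/cvg_ex; apply: (@dominated_cvg K _ (B * expR (C - P T)) dK) => t Tt.
rewrite normrM (ger0_norm (expR_ge0 _)) mulrAC.
apply: (@le_trans _ _ (`|h t| * expR (C - P T))).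
  by rewrite ler_wpM2l// ler_expR; have := dw T t (lexx _) Tt; lra.
by rewrite ler_wpM2r ?expR_ge0// hB.
Qed.

(** The kernel e^{P t - P x} is at most e^C on the range of integration: x <= t in the first case
    and x >= t in the second. *)
Lemma is_duhamel_dist (h h' y y' : R -> R) (B : R) : is_duhamel h y -> is_duhamel h' y' ->
  0 <= B -> (forall t, T <= t -> `|h t - h' t| <= B * w t) ->
  forall t, T <= t -> `|y t - y' t| <= expR C * B * kappa.
Proof.
move=> [K [L [dK HL yE]]] [K' [L' [dK' HL' yE']]] B0 hB t Tt.
pose D s := K s - K' s.
have dD s : T <= s -> is_derive s 1 (fun u => expR (P t) * D u)
    (expR (P t) * ((h s - h' s) * expR (- P s))).
  move=> Ts; have h1 := dK s Ts; have h2 := dK' s Ts.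
  have h3 := is_deriveZ (expR (P t)) (is_deriveB h1 h2).
  by apply: is_derive_eq h3 _; rewrite -mulrBl.
have dV s : T <= s -> is_derive s 1 (fun u => (expR C * B) * W u) ((expR C * B) * w s).
  by move=> Ts; have := dW Ts => ?; exact: is_deriveZ.
have nW := antiderivative_nd dW w0.
have eB0 : 0 <= expR C * B by rewrite mulr_ge0// expR_ge0.
have core s1 s2 : T <= s1 -> s1 <= s2 ->
    (forall x, s1 <= x <= s2 -> P t - P x <= C) ->
    expR (P t) * `|D s2 - D s1| <= expR C * B * kappa.
  move=> Ts1 s12 PC; rewrite -[X in X * _](ger0_norm (expR_ge0 _)) -normrM mulrBr.
  apply: (@le_trans _ _ (expR C * B * W s2 - expR C * B * W s1)).
    apply: (derive_le dD dV) => // x /andP[s1x xs2].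
    have Tx : T <= x := le_trans Ts1 s1x.
    rewrite mulrCA normrM -expRD (ger0_norm (expR_ge0 _)) -mulrA mulrC.
    apply: (@le_trans _ _ (expR C * `|h x - h' x|)).
      by rewrite ler_wpM2r// ler_expR PC// s1x.
    by rewrite ler_wpM2l ?expR_ge0// hB.
  rewrite -mulrBr ler_wpM2l//.
  have := nW T s1 (lexx _) Ts1; have := Wk (le_trans Ts1 s12); lra.
rewrite yE yE' -mulrBr normrM (ger0_norm (expR_ge0 _)).
have -> : K t - L - (K' t - L') = D t - (L - L') by rewrite /D; ring.
case: up dich HL HL' => [dw -> ->|dw KL KL'].
  by apply: core => // x /andP[Tx xt]; exact: dw.
(* The value at infinity is approximated by [D s] with s large; the tolerance is divided by e^{P t}
   because that factor multiplies it at the end. *)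
have DL : D s @[s --> +oo] --> L - L' by exact: cvgB.
apply/ler_addgt0Pl => e e0.
have e1 : 0 < e / expR (P t) by rewrite divr_gt0// expR_gt0.
have /cvgrPdist_le/(_ _ e1)/nearyP[S HS] := DL.
pose s := Num.max S t.
have hs : `|L - L' - D s| <= e / expR (P t) by apply: HS; rewrite le_max lexx.
have ts : t <= s by rewrite le_max lexx orbT.
have : expR (P t) * `|D s - D t| <= expR C * B * kappa.
  apply: core => // x /andP[tx _].
  by have := dw t x Tt tx; lra.
have -> : D t - (L - L') = (D s - (L - L')) - (D s - D t) by ring.
move=> h1; apply: le_trans (ler_wpM2l (expR_ge0 _) (ler_normB _ _)) _.
rewrite mulrDr lerD//.
by rewrite distrC -ler_pdivlMl ?expR_gt0// mulrC.
Qed.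

Lemma is_duhamel0 : is_duhamel (fun=> 0) (fun=> 0).
Proof.
exists (cst 0), 0; split=> [t _||t].
- by rewrite mul0r; exact: is_derive_cst.
- by case: up => //; exact: cvg_cst.
- by rewrite /cst subrr mulr0.
Qed.

Lemma is_duhamel_init h y : is_duhamel h y -> up -> y T = 0.
Proof. by move=> [K [L [_ HL ->]]] u; move: HL; rewrite u => ->; rewrite subrr mulr0. Qed.

End Duhamel.

(** * Contraction argument for a semilinear system with a dichotomy *)

Section FixedPoint.
Context {R : realType} {M : nat}.
Variables (T C kappa : R) (p P : 'I_M -> R -> R) (w W : R -> R) (up : pred 'I_M)
  (H : R -> 'cV[R]_M -> 'cV[R]_M).
Hypothesis dP : forall j t, T <= t -> is_derive t 1 (P j) (p j t).
Hypothesis dich : forall j s t, T <= s -> s <= t ->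
  if up j then P j t - P j s <= C else - C <= P j t - P j s.
Hypothesis dW : forall t, T <= t -> is_derive t 1 W (w t).
Hypothesis w0 : forall t, T <= t -> 0 <= w t.
Hypothesis Wk : forall t, T <= t -> W t - W T <= kappa.
Hypothesis Ck : expR C * kappa <= 4^-1.

Definition ctsv (v : R -> 'cV[R]_M) := forall i, cts T (fun t => v t i 0).

Hypothesis Hc : forall v, ctsv v -> (forall t, T <= t -> `|v t| <= 1) ->
  ctsv (fun t => H t (v t)).
Hypothesis H0 : forall t, T <= t -> `|H t 0| <= w t.
Hypothesis HL : forall t v v', T <= t -> `|v| <= 1 -> `|v'| <= 1 ->
  `|H t v - H t v'| <= w t * `|v - v'|.

(** A relation and not a map: [is_duhamel] leaves the primitive arbitrary before [T]. *)
Definition picard (c : 'cV[R]_M) (v y : R -> 'cV[R]_M) : Prop :=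
  exists2 z : 'I_M -> R -> R,
    forall i, is_duhamel T (P i) (up i) (fun t => H t (v t) i 0) (z i) &
    forall t i, y t i 0 = expR (P i t - P i T) * c i 0 + z i t.

(** Components integrated from infinity have no free initial value. The bound 1/4 on the homogeneous
    part, added to 2 e^C kappa <= 1/2 for the integral, keeps the unit ball invariant. *)
Definition admissible (c : 'cV[R]_M) : Prop :=
  (forall i, ~~ up i -> c i 0 = 0) /\ expR C * `|c| <= 4^-1.

Definition small (v : R -> 'cV[R]_M) : Prop :=
  ctsv v /\ forall t, T <= t -> `|v t| <= 1.

Lemma small_bound v : small v -> forall t, T <= t -> `|H t (v t)| <= 2 * w t.
Proof.
move=> [_ v1] t Tt; have z1 : `|0 : 'cV[R]_M| <= 1 by rewrite normr0.
have := HL Tt (v1 t Tt) z1; rewrite subr0 => h.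
have -> : H t (v t) = (H t (v t) - H t 0) + H t 0 by rewrite subrK.
rewrite (le_trans (ler_normD _ _))// mulr_natl mulr2n lerD ?H0//.
by rewrite (le_trans h)// ler_piMr ?w0// v1.
Qed.

Lemma picard_exists c v : small v -> exists y, picard c v y.
Proof.
move=> sv.
have hz i : exists z, is_duhamel T (P i) (up i) (fun t => H t (v t) i 0) z.
  apply: (is_duhamel_exists (dP i) (@dich i) dW w0 Wk (B := 2)).
    by apply: Hc; case: sv.
  by move=> t Tt; rewrite (le_trans (mx_entry_le _ _ _))// small_bound.
have [z Hz] := choice hz.
exists (fun t => \col_i (expR (P i t - P i T) * c i 0 + z i t)), z => // t i.
by rewrite mxE.
Qed.

Lemma picard_derive c v y : picard c v y -> forall t i, T <= t ->
  is_derive t 1 (fun t => y t i 0) (p i t * y t i 0 + H t (v t) i 0).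
Proof.
move=> [z dz yE] t i Tt.
have -> : (fun t => y t i 0) = (fun t => expR (P i t - P i T) * c i 0 + z i t).
  by apply/funext.
have h1 := is_duhamel_derive (dP i) (dz i) Tt.
have h2 : is_derive t 1 (fun t => P i t - P i T) (p i t - 0).
  by apply: is_deriveB; exact: dP.
have h3 : is_derive t 1 (expR \o (fun t => P i t - P i T)) (expR (P i t - P i T) * (p i t - 0)).
  exact: is_derive1_comp.
have h4 := is_deriveD (is_deriveZ (c i 0) h3) h1.
have -> : (fun t => expR (P i t - P i T) * c i 0 + z i t)
  = ((fun t => c i 0 * (expR \o (fun t => P i t - P i T)) t) + z i).
  by apply/funext => s /=; rewrite mulrC.
apply: is_derive_eq h4 _.
by rewrite yE /GRing.scale/=; ring.
Qed.

Lemma picard_init c v y i : picard c v y -> up i -> y T i 0 = c i 0.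
Proof.
move=> [z dz ->] ui; rewrite subrr expR0 mul1r (is_duhamel_init (dz i) ui).
by rewrite addr0.
Qed.

Lemma hom_bound c i t : admissible c -> T <= t ->
  `|expR (P i t - P i T) * c i 0| <= expR C * `|c|.
Proof.
move=> [c0 _] Tt; have [ui|ui] := boolP (up i); last first.
  by rewrite c0// mulr0 normr0 mulr_ge0// expR_ge0.
rewrite normrM (ger0_norm (expR_ge0 _)) ler_pM ?expR_ge0 ?mx_entry_le//.
by rewrite ler_expR; have := @dich i T t (lexx _) Tt; rewrite ui.
Qed.

Lemma picard_small c v y : admissible c -> small v -> picard c v y -> small y.
Proof.
move=> ac sv py; split=> [i|t Tt].
  by apply: cts_derive => t Tt; exact: picard_derive py t i Tt.
case: py => z dz yE; apply: mx_norm_le => // i j; rewrite (ord1 j) yE.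
rewrite (le_trans (ler_normD _ _))//.
have h1 := hom_bound i ac Tt.
have h2 := is_duhamel_dist (@dich i) dW w0 Wk (dz i) (is_duhamel0 T (P i) (up i)) (ler0n _ 2).
have {}h2 : `|z i t| <= expR C * 2 * kappa.
  rewrite -[z i t]subr0; apply: h2 => // s Ts.
  by rewrite subr0 (le_trans (mx_entry_le _ _ _))// small_bound.
have := ac.2; rewrite mulrAC in h2.
by move: Ck h1 h2; lra.
Qed.

(** Varying [c] together with [v] gives the contraction (c = c') and the Lipschitz dependence on the
    parameter from one estimate. *)
Lemma picard_contract c c' v v' y y' (B : R) : admissible c -> admissible c' ->
  (forall i, ~~ up i -> c i 0 = c' i 0) ->
  small v -> small v' -> picard c v y -> picard c' v' y' -> 0 <= B ->
  (forall t, T <= t -> `|v t - v' t| <= B) ->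
  forall t, T <= t -> `|y t - y' t| <= expR C * `|c - c'| + B / 4.
Proof.
move=> ac ac' cc sv sv' [z dz yE] [z' dz' yE'] B0 vB t Tt.
have C0 : 0 <= expR C by exact: expR_ge0.
apply: mx_norm_le => [|i j]; first by rewrite addr_ge0 ?mulr_ge0// divr_ge0.
rewrite (ord1 j) !mxE yE yE'.
have -> : expR (P i t - P i T) * c i 0 + z i t - (expR (P i t - P i T) * c' i 0 + z' i t)
  = expR (P i t - P i T) * (c i 0 - c' i 0) + (z i t - z' i t) by ring.
rewrite (le_trans (ler_normD _ _))// lerD//.
  have [ui|/cc->] := boolP (up i); last by rewrite subrr mulr0 normr0 mulr_ge0.
  rewrite normrM (ger0_norm (expR_ge0 _)) ler_pM ?expR_ge0//.
    by rewrite ler_expR; have := @dich i T t (lexx _) Tt; rewrite ui.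
  by have := mx_entry_le (c - c') i 0; rewrite !mxE.
apply: (@le_trans _ _ (expR C * B * kappa)).
  apply: (is_duhamel_dist (@dich i) dW w0 Wk (dz i) (dz' i)) => // s Ts.
  have := mx_entry_le (H s (v s) - H s (v' s)) i 0; rewrite !mxE => h.
  rewrite (le_trans h)// (le_trans (HL Ts (sv.2 s Ts) (sv'.2 s Ts)))// mulrC.
  by rewrite ler_wpM2r ?w0// vB.
by rewrite mulrAC mulrC ler_wpM2l.
Qed.

Lemma small0 : small (fun=> 0).
Proof.
by split=> [i|t _]; [under [fun t => _]eq_fun do rewrite mxE; exact: cts_cst|rewrite normr0].
Qed.

Lemma picard_fixpoint c : admissible c -> exists v, small v /\ picard c v v.
Proof.
move=> ac.
have /choice[F HF] : forall v, exists y, small v -> picard c v y.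
  move=> v; have [sv|nv] := pselect (small v); last by exists v.
  by have [y py] := picard_exists c sv; exists y.
pose u k := iter k F (fun=> 0).
have su k : small (u k).
  by elim: k => [|k IH]; [exact: small0|exact: (picard_small ac IH (HF _ IH))].
have pu k : picard c (u k) (u k.+1) by exact: HF.
have hB k t : T <= t -> `|u k.+1 t - u k t| <= (4^-1) ^+ k.
  elim: k t => [t Tt|k IH t Tt]; first by rewrite expr0 subr0; exact: (su 1%N).2.
  have := picard_contract ac ac (fun i _ => erefl) (su k.+1) (su k) (pu k.+1) (pu k) _ IH Tt.
  by rewrite subrr normr0 mulr0 add0r exprSr; apply; rewrite exprn_ge0.
(* Partial sums of the geometric series; the last factor is what lets the induction on l close. *)
have hm k l t : T <= t -> `|u (k + l)%N t - u k t| <= 2 * (4^-1) ^+ k * (1 - (4^-1) ^+ l).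
  move=> Tt; elim: l => [|l IH]; first by rewrite addn0 subrr normr0 expr0 subrr mulr0.
  rewrite addnS -[X in X - _](subrK (u (k + l)%N t)) -addrA.
  rewrite (le_trans (ler_normD _ _))// (le_trans (lerD (hB _ _ Tt) IH))//.
  rewrite exprD exprSr.
  have : 0 <= (4^-1 : R) ^+ k * 4^-1 ^+ l by rewrite mulr_ge0// exprn_ge0.
  by lra.
have hm' k l t : T <= t -> (k <= l)%N -> `|u l t - u k t| <= 2 * (4^-1) ^+ k.
  move=> Tt kl; rewrite -(subnKC kl) (le_trans (hm _ _ _ Tt))//.
  by rewrite ler_piMr ?mulr_ge0 ?exprn_ge0// gerBl exprn_ge0.
have small_q e : 0 < e -> exists k, 2 * (4^-1 : R) ^+ k <= e.
  move=> e0; have q0 : (fun k => 2 * (4^-1 : R) ^+ k) k @[k --> \oo] --> (0 : R).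
    rewrite -[X in _ --> X](mulr0 2); apply: cvgM; first exact: cvg_cst.
    by apply: cvg_expr; rewrite ger0_norm//; lra.
  have /cvgrPdist_le/(_ _ e0)[k _ Hk] := q0.
  exists k; have := Hk k (leqnn k); by rewrite /= sub0r normrN ger0_norm.
have qk0 k : 0 <= 2 * (4^-1 : R) ^+ k by rewrite mulr_ge0// exprn_ge0.
(* The limit of each entry is the supremum of its lower bounds, which yields the rate of convergence
   at the same time. *)
have lim_ex (x : R * 'I_M) : exists l, T <= x.1 -> forall k,
    `|l - u k x.1 x.2 0| <= 2 * (4^-1) ^+ k.
  case: x => t i /=; have [Tt|nT] := pselect (T <= t); last by exists 0.
  pose E := range (fun k => u k t i 0 - 2 * (4^-1) ^+ k).
  have ubE k : ubound E (u k t i 0 + 2 * (4^-1) ^+ k).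
    move=> _ [l _ <-]; have [kl|/ltnW lk] := leqP k l.
      have := le_trans (mx_entry_le _ i 0) (hm' k l t Tt kl); rewrite !mxE.
      by have := qk0 l; rewrite ler_norml; lra.
    have := le_trans (mx_entry_le _ i 0) (hm' l k t Tt lk); rewrite !mxE.
    by have := qk0 k; rewrite ler_norml; lra.
  exists (sup E) => _ k.
  have E0 : E !=set0 by exists (u k t i 0 - 2 * (4^-1) ^+ k), k.
  have h1 : sup E <= u k t i 0 + 2 * (4^-1) ^+ k by apply: ge_sup.
  have h2 : u k t i 0 - 2 * (4^-1) ^+ k <= sup E.
    by apply: ub_le_sup; [exists (u k t i 0 + 2 * (4^-1) ^+ k)|exists k].
  by rewrite ler_norml; lra.
have [l Hl] := choice lim_ex.
(* The limit is frozen before [T], so that it is continuous at [T] from both sides. *)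
pose v t : 'cV[R]_M := \col_i l (Num.max t T, i).
have vu k t : T <= t -> `|v t - u k t| <= 2 * (4^-1) ^+ k.
  by move=> Tt; apply: mx_norm_le => // i j; rewrite (ord1 j) !mxE max_l//; exact: (Hl (t, i)).
have sv : small v.
  split; last first.
    move=> t Tt; apply/ler_addgt0Pl => e e0; have [k ke] := small_q _ e0.
    rewrite -[v t](subrK (u k t)) (le_trans (ler_normD _ _))// lerD//.
      exact: le_trans (vu _ _ Tt) ke.
    exact: (su k).2.
  move=> i; have maxT t : T <= Num.max t T by rewrite le_max lexx orbT.
  move=> t _; apply/cvgrPdist_le => e e0.
  have e4 : 0 < e / 4 by rewrite divr_gt0.
  have [k ke] := small_q _ e4.
  have ct : (fun s => u k (Num.max s T) i 0) @ t --> u k (Num.max t T) i 0.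
    have hh := within_cts ((su k).1 i).
    have h2 := cts_clamp hh.
    exact: (h2 t).
  move/cvgrPdist_le: ct => /(_ _ e4).
  apply: filterS => s us; rewrite !mxE.
  have h1 := Hl (Num.max t T, i) (maxT t) k; have h2 := Hl (Num.max s T, i) (maxT s) k.
  by move: us h1 h2 ke e0; rewrite /= !ler_norml; lra.
have [y py] := picard_exists c sv.
have yv t : T <= t -> y t = v t.
  move=> Tt; apply/eqP; rewrite -subr_eq0 -normr_le0; apply/ler_addgt0Pl => e e0; rewrite addr0.
  have e2 : 0 < e / 2 by rewrite divr_gt0.
  have [k ke] := small_q _ e2.
  have := picard_contract ac ac (fun i _ => erefl) sv (su k) py (pu k) (qk0 k) (vu k) Tt.
  rewrite subrr normr0 mulr0 add0r => h1; have := vu k.+1 t Tt.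
  have -> : y t - v t = (y t - u k.+1 t) - (v t - u k.+1 t) by rewrite opprB addrA subrK.
  move=> h2; rewrite (le_trans (ler_normB _ _))//.
  by move: h1 h2 ke (qk0 k); rewrite exprS; lra.
(* The image [y] is returned instead of [v]: they agree from [T] on, and the formula in [picard] is
   required at all times, also before [T]. *)
exists y; split; first exact: picard_small sv py.
case: py => z dz yE; exists z => // i; have [K [L [dK HKL zE]]] := dz i.
exists K, L; split => // t Tt; rewrite yv//; exact: dK.
Qed.

Theorem dichotomy_fixpoint : exists V : 'cV[R]_M -> R -> 'cV[R]_M,
  forall c, admissible c -> [/\ small (V c),
    forall t i, T <= t -> is_derive t 1 (fun t => V c t i 0)
      (p i t * V c t i 0 + H t (V c t) i 0),
    forall i, up i -> V c T i 0 = c i 0 &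
    forall c', admissible c' -> forall t, T <= t -> `|V c t - V c' t| <= 2 * expR C * `|c - c'|].
Proof.
have /choice[V HV] : forall c, exists v, admissible c -> small v /\ picard c v v.
  move=> c; have [ac|nc] := pselect (admissible c); last by exists (fun=> 0).
  by have [v [sv pv]] := picard_fixpoint ac; exists v.
exists V => c ac; have [sv pv] := HV c ac; split => //.
- by move=> t i Tt; exact: picard_derive pv t i Tt.
- by move=> i; exact: picard_init pv.
move=> c' ac'; have [sv' pv'] := HV c' ac'.
(* The supremum S of the distance is finite, as both solutions lie in the unit ball. Then S <= e^C
   |c - c'| + S/4 bounds S. *)
pose E := [set `|V c t - V c' t| | t in [set t | T <= t]].
have ubE2 : ubound E 2.
  move=> _ [t Tt <-]; rewrite (le_trans (ler_normB _ _))//.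
  by rewrite -[2]/(1 + 1) lerD ?(sv.2 t Tt) ?(sv'.2 t Tt).
have ubE t : T <= t -> `|V c t - V c' t| <= sup E.
  by move=> Tt; apply: ub_le_sup; [exists 2|exists t].
have B0 : 0 <= sup E by apply: le_trans (ubE T (lexx _)).
have cc i : ~~ up i -> c i 0 = c' i 0 by move=> ui; rewrite ac.1 ?ac'.1.
have := picard_contract ac ac' cc sv sv' pv pv' B0 ubE.
move=> h; have : sup E <= expR C * `|c - c'| + sup E / 4.
  apply: ge_sup; first by exists `|V c T - V c' T|, T => //=.
  by move=> _ [t Tt <-]; exact: h.
move=> h1 t Tt; have := ubE t Tt; have : 0 <= expR C * `|c - c'| by rewrite mulr_ge0// expR_ge0.
by move: h1; rewrite -mulrA; lra.
Qed.

End FixedPoint.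

Section MatrixFunctions.
Context {R : realType}.

Lemma mulmx_norm_le {m n q} (A : 'M[R]_(m, n)) (B : 'M[R]_(n, q)) :
  `|A *m B| <= n%:R * `|A| * `|B|.
Proof.
apply: mx_norm_le => [|i j]; first by rewrite !mulr_ge0.
rewrite !mxE (le_trans (ler_norm_sum _ _ _))//.
rewrite (@le_trans _ _ (\sum_(k < n) `|A| * `|B|))//.
  by apply: ler_sum => k _; rewrite normrM ler_pM// mx_entry_le.
by rewrite sumr_const card_ord -[leLHS]mulr_natl mulrA.
Qed.

Lemma mx_norm_le_sum {m n} (A : 'M[R]_(m, n)) : `|A| <= \sum_i \sum_j `|A i j|.
Proof.
apply: mx_norm_le => [|i j]; first by apply: sumr_ge0 => i _; apply: sumr_ge0.
rewrite (bigD1 i)//= (bigD1 j)//= -addrA lerDl addr_ge0//; first exact: sumr_ge0.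
by apply: sumr_ge0 => k _; apply: sumr_ge0.
Qed.

Definition ctsm {m n} (T : R) (A : R -> 'M[R]_(m, n)) : Prop :=
  forall i j, cts T (fun t => A t i j).

Lemma ctsm_mul {m n q} T (A : R -> 'M[R]_(m, n)) (B : R -> 'M[R]_(n, q)) :
  ctsm T A -> ctsm T B -> ctsm T (fun t => A t *m B t).
Proof.
move=> cA cB i j; under [fun t => _]eq_fun do rewrite mxE.
by apply: cts_sum => k; apply: ctsM; [exact: cA|exact: cB].
Qed.

Lemma ctsmD {m n} T (A B : R -> 'M[R]_(m, n)) :
  ctsm T A -> ctsm T B -> ctsm T (fun t => A t + B t).
Proof.
move=> cA cB i j; under [fun t => _]eq_fun do rewrite mxE.
by apply: ctsD; [exact: cA|exact: cB].
Qed.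

Lemma ctsmZ {m n} T (a : R -> R) (A : R -> 'M[R]_(m, n)) :
  cts T a -> ctsm T A -> ctsm T (fun t => a t *: A t).
Proof.
move=> ca cA i j; under [fun t => _]eq_fun do rewrite mxE.
by apply: ctsM; [|exact: cA].
Qed.

Lemma ctsmW {m n} T T' (A : R -> 'M[R]_(m, n)) : T <= T' -> ctsm T A -> ctsm T' A.
Proof. by move=> TT' cA i j; apply: ctsW (cA i j). Qed.

Lemma cts_inv T (a : R -> R) : cts T a -> (forall t, T <= t -> a t != 0) ->
  cts T (fun t => (a t)^-1).
Proof. by move=> ca a0 t Tt; apply: cvgV; [exact: a0|exact: ca]. Qed.

End MatrixFunctions.

(** * Conjugation r = sigma U v by a frame with a right inverse *)

Section ConjugateSystem.
Context {R : realType} {n M : nat}.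
Variables (T0 : R) (B : R -> 'M[R]_n) (U dU E : R -> 'M[R]_(n, M)) (V : R -> 'M[R]_(M, n))
  (p P : 'I_M -> R -> R) (kap sigma w1 G : R -> R) (g : R -> 'cV[R]_n -> 'cV[R]_n)
  (rho0 C CU CV : R) (up : pred 'I_M).
Hypothesis hU : forall i j t, T0 <= t -> is_derive t 1 (fun t => U t i j) (dU t i j).
Hypothesis hdU : forall t, T0 <= t ->
  dU t = B t *m U t - U t *m diag_mx (\row_j p j t) - E t.
Hypothesis hUV : forall t, T0 <= t -> U t *m V t = 1%:M.
Hypothesis hV : ctsm T0 V.
Hypothesis hE : forall i j, L1 T0 (fun t => E t i j).
Hypothesis hCU : forall t, T0 <= t -> `|U t| <= CU.
Hypothesis hCV : forall t, T0 <= t -> `|V t| <= CV.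
Hypothesis hsig : forall t, T0 <= t -> is_derive t 1 sigma (kap t * sigma t).
Hypothesis hsig_gt0 : forall t, T0 <= t -> 0 < sigma t.
Hypothesis hsig_cvg : sigma t @[t --> +oo] --> (0 : R).
Hypothesis hP : forall j t, T0 <= t -> is_derive t 1 (P j) (p j t - kap t).
Hypothesis dich : forall j s t, T0 <= s -> s <= t ->
  if up j then P j t - P j s <= C else - C <= P j t - P j s.
Hypothesis rho0_gt0 : 0 < rho0.
Hypothesis g0 : forall t, T0 <= t -> `|g t 0| <= sigma t * w1 t.
Hypothesis w1L : L1 T0 w1.
Hypothesis gL : forall t rho r r', T0 <= t -> 0 <= rho -> rho <= rho0 ->
  `|r| <= rho -> `|r'| <= rho -> `|g t r - g t r'| <= G t * rho * `|r - r'|.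
Hypothesis GL : L1 T0 (fun t => sigma t * G t).
Hypothesis gc : forall T (r : R -> 'cV[R]_n), T0 <= T -> ctsm T r ->
  (forall t, T <= t -> `|r t| <= rho0) -> ctsm T (fun t => g t (r t)).

(** With r = sigma U v, the equation r' = B r + g(t, r) becomes U (v' - (p - kap) v) = sigma^-1 g +
    E v. The right inverse [V] selects one v' that satisfies it. Only this direction is used, so M
    may exceed n. *)
Let conj_rhs t (v : 'cV[R]_M) : 'cV[R]_M :=
  V t *m ((sigma t)^-1 *: g t (sigma t *: (U t *m v)) + E t *m v).

(** An integrable weight for [conj_rhs]. [w1] bounds its value at 0. In the Lipschitz bound the
    radius and |r - r'| each contribute M CU sigma, and sigma^-1 takes one sigma back. The factors n
    and M come from the maximum norm of products. *)
Let cw t := n%:R * CV *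
  (`|w1 t| + (M%:R * CU) ^+ 2 * `|sigma t * G t| + M%:R * \sum_i \sum_j `|E t i j|).

Let CU0 : 0 <= CU. Proof. exact: le_trans (hCU (lexx T0)). Qed.
Let CV0 : 0 <= CV. Proof. exact: le_trans (hCV (lexx T0)). Qed.

Let cw_ge0 t : 0 <= cw t.
Proof.
rewrite /cw !mulr_ge0// !addr_ge0// ?mulr_ge0 ?sqr_ge0// sumr_ge0// => i _.
exact: sumr_ge0.
Qed.

Let cw_L1 : L1 T0 cw.
Proof.
apply: L1Z; apply: L1D; first apply: L1D; first exact: L1_norm.
  by apply: L1Z; exact: L1_norm.
by apply: L1Z; apply: L1_sum => i; apply: L1_sum => j; apply: L1_norm.
Qed.

Let scaled_le t (v : 'cV[R]_M) : T0 <= t -> `|v| <= 1 -> `|sigma t *: (U t *m v)| <= M%:R * CU * sigma t.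
Proof.
move=> Tt v1; rewrite normrZ gtr0_norm ?hsig_gt0// mulrC ler_pM2r ?hsig_gt0//.
rewrite (le_trans (mulmx_norm_le _ _))// -[leRHS]mulr1 ler_pM// ?mulr_ge0//.
by rewrite ler_wpM2l// hCU.
Qed.

Theorem conjugate_fixpoint : exists2 T1, T0 <= T1 & forall T, T1 <= T ->
  exists2 v : 'cV[R]_M -> R -> 'cV[R]_M,
    forall c : 'cV[R]_M, (forall i, ~~ up i -> c i 0 = 0) -> expR C * `|c| <= 4^-1 -> [/\
      forall t, T <= t -> `|v c t| <= 1,
      forall t i, T <= t -> is_derive t 1 (fun t => (sigma t *: (U t *m v c t)) i 0)
        ((B t *m (sigma t *: (U t *m v c t)) + g t (sigma t *: (U t *m v c t))) i 0),
      forall i, up i -> v c T i 0 = c i 0 &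
      forall c' : 'cV[R]_M, (forall i, ~~ up i -> c' i 0 = 0) -> expR C * `|c'| <= 4^-1 ->
        `|v c T - v c' T| <= 2 * expR C * `|c - c'|] &
    forall t, T <= t -> M%:R * CU * sigma t <= rho0.
Proof.
have [W dW Wtail] := L1_tail cw_L1.
(* From [Ta] on, the tail of [cw] is small enough for the contraction; from [Tb] on, the unit ball
   for v is sent into the ball of radius [rho0] for r. *)
have k0 : 0 < (4 * expR C)^-1 by rewrite invr_gt0 mulr_gt0// expR_gt0.
have [Ta T0a HTa] := Wtail _ k0.
have sig0 : (fun t => M%:R * CU * sigma t) t @[t --> +oo] --> (0 : R).
  rewrite -[X in _ --> X](mulr0 (M%:R * CU)).
  by apply: cvgM; [exact: cvg_cst|exact: hsig_cvg].
have /cvgrPdist_le/(_ _ rho0_gt0)/nearyP[Tb HTb] := sig0.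
exists (Num.max Ta Tb); first by rewrite le_max T0a.
move=> T; rewrite ge_max => /andP[TaT TbT].
have T0T : T0 <= T by exact: le_trans TaT.
have sr t : T <= t -> M%:R * CU * sigma t <= rho0.
  move=> Tt; have := HTb t (le_trans TbT Tt); rewrite sub0r normrN; apply: le_trans.
  exact: ler_norm.
have T0t t : T <= t -> T0 <= t by exact: le_trans.
have ctsU : ctsm T U.
  by move=> i j; apply: cts_derive => t Tt; exact: (hU i j (T0t t Tt)).
have ctss : cts T sigma by apply: cts_derive => t Tt; exact: (hsig (T0t t Tt)).
have ctsE : ctsm T E by move=> i j; apply: ctsW (L1_cts (hE i j)).
have [v Hv] : exists v : 'cV[R]_M -> R -> 'cV[R]_M,
  forall c, admissible C up c -> [/\ small T (v c),
    forall t i, T <= t -> is_derive t 1 (fun t => v c t i 0)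
      ((p i t - kap t) * v c t i 0 + conj_rhs t (v c t) i 0),
    forall i, up i -> v c T i 0 = c i 0 &
    forall c', admissible C up c' -> forall t, T <= t -> `|v c t - v c' t| <= 2 * expR C * `|c - c'|].
  apply: (@dichotomy_fixpoint R M T C (4 * expR C)^-1 (fun j t => p j t - kap t) P cw W up conj_rhs).
  - by move=> j t Tt; apply: hP; exact: T0t.
  - by move=> j s t Ts st; apply: dich => //; exact: T0t.
  - by move=> t Tt; have := dW t (T0t t Tt); rewrite ger0_norm.
  - by move=> t _; exact: cw_ge0.
  - by move=> t Tt; exact: HTa.
  - by rewrite invfM mulrCA divff ?mulr1// gt_eqF// expR_gt0.
  - move=> u cu u1 i; have cum : ctsm T u by move=> a b; rewrite (ord1 b).
    have cr : ctsm T (fun t => sigma t *: (U t *m u t)) by apply: ctsmZ => //; exact: ctsm_mul.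
    have cc : ctsm T (fun t => conj_rhs t (u t)).
      apply: ctsm_mul; first exact: ctsmW hV.
      apply: ctsmD; last exact: ctsm_mul.
      apply: ctsmZ; first by apply: cts_inv => // t Tt; rewrite gt_eqF// hsig_gt0// T0t.
      apply: gc => // t Tt; apply: le_trans (sr t Tt); exact: scaled_le (T0t t Tt) (u1 t Tt).
    exact: cc.
  - move=> t Tt; rewrite /conj_rhs !mulmx0 scaler0 addr0.
    rewrite (le_trans (mulmx_norm_le _ _))// /cw -mulrA -mulrA ler_wpM2l//.
    rewrite ler_pM// ?hCV ?T0t// normrZ ger0_norm; last by rewrite invr_ge0 ltW// hsig_gt0// T0t.
    apply: (@le_trans _ _ (w1 t)).
      by rewrite ler_pdivrMl ?hsig_gt0 ?T0t// g0// T0t.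
    rewrite (le_trans (ler_norm _))// -addrA lerDl addr_ge0// mulr_ge0// ?sqr_ge0//.
    by rewrite sumr_ge0// => i _; exact: sumr_ge0.
  - move=> t u u' Tt u1 u1'; have Tt0 := T0t t Tt.
    have s0 := hsig_gt0 Tt0.
    rewrite /conj_rhs -mulmxBr (le_trans (mulmx_norm_le _ _))//.
    rewrite /cw -!mulrA ler_wpM2l// ler_pM// ?hCV//.
    rewrite opprD addrACA -scalerBr -mulmxBr (le_trans (ler_normD _ _))//.
    rewrite -addrA mulrDl -[leLHS]add0r lerD ?mulr_ge0// mulrDl lerD//.
    + rewrite normrZ ger0_norm ?invr_ge0 ?(ltW s0)// ler_pdivrMl//.
      have := gL Tt0 (mulr_ge0 (mulr_ge0 (ler0n _ M) CU0) (ltW s0)) (sr t Tt)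
        (scaled_le Tt0 u1) (scaled_le Tt0 u1').
      move=> /le_trans; apply.
      have h1 : `|sigma t *: (U t *m u) - sigma t *: (U t *m u')| <= M%:R * CU * sigma t * `|u - u'|.
        rewrite -scalerBr -mulmxBr normrZ gtr0_norm// mulrC mulrAC ler_pM2r//.
        rewrite (le_trans (mulmx_norm_le _ _))// ler_wpM2r// ler_wpM2l// hCU//.
      have sM0 : 0 <= M%:R * CU * sigma t by rewrite !mulr_ge0// ltW.
      apply: (@le_trans _ _ (`|G t| * (M%:R * CU * sigma t)
          * `|sigma t *: (U t *m u) - sigma t *: (U t *m u')|)).
        by apply: ler_wpM2r => //; apply: ler_wpM2r => //; exact: ler_norm.
      apply: (@le_trans _ _ (`|G t| * (M%:R * CU * sigma t) * (M%:R * CU * sigma t * `|u - u'|))).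
        by apply: ler_wpM2l => //; rewrite mulr_ge0.
      rewrite normrM (gtr0_norm s0) le_eqVlt; apply/orP; left; apply/eqP; ring.
    + rewrite (le_trans (mulmx_norm_le _ _))// ler_wpM2r// ler_wpM2l//.
      exact: mx_norm_le_sum.
exists v => // c c0 cC; have [sv dv iv Lv] := Hv c (conj c0 cC); split => //.
- by case: sv.
- move=> t i Tt; have Tt0 := T0t t Tt; have s0 := hsig_gt0 Tt0.
  have -> : (fun t => (sigma t *: (U t *m v c t)) i 0)
     = sigma \* (\sum_j ((fun t => U t i j) \* (fun t => v c t j 0))).
    apply/funext => x; rewrite !mxE /=; congr (_ * _).
    by rewrite fct_sumE.
  have dUv : is_derive t 1 (\sum_j ((fun t => U t i j) \* (fun t => v c t j 0)))
    (\sum_j (U t i j *: ((p j t - kap t) * v c t j 0 + conj_rhs t (v c t) j 0)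
      + v c t j 0 *: dU t i j)).
    apply: is_derive_sum => j; apply: is_deriveM; [exact: hU|exact: dv].
  apply: is_derive_eq (is_deriveM (hsig Tt0) dUv) _.
  set S := \sum_j _.
  (* The term U diag(p) v cancels between U v' and U' v, as does E v after U V = 1 is applied. *)
  have -> : S = ((sigma t)^-1 *: g t (sigma t *: (U t *m v c t)) + B t *m (U t *m v c t)
      - kap t *: (U t *m v c t)) i 0.
    transitivity ((U t *m (diag_mx (\row_j p j t) *m v c t - kap t *: v c t + conj_rhs t (v c t))
        + dU t *m v c t) i 0).
      rewrite !mxE -big_split /=; apply: eq_bigr => j _.
      rewrite mul_diag_mx !mxE /GRing.scale/=; ring.
    congr (fun_of_matrix _ i 0).
    rewrite (hdU Tt0) !mulmxDr !mulmxA hUV// mul1mx !mulmxBl mulmxN -scalemxAr.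
    set X1 := U t *m _ *m _; set X2 := B t *m _ *m _.
    set X3 := kap t *: _; set X4 := _^-1 *: _; set X5 := E t *m _.
    move: X1 X2 X3 X4 X5 => X1 X2 X3 X4 X5.
    by apply/matrixP => a b; rewrite !mxE; ring.
  have -> : (\sum_j (fun t0 : R => U t0 i j) \* (fun t0 : R => v c t0 j 0)) t
     = (U t *m v c t) i 0 by rewrite fct_sumE mxE.
  rewrite -scalemxAr; set Gv := g t _.
  set X := U t *m v c t; set Y := B t *m X.
  move: X Y Gv => X Y Gv; rewrite !mxE /GRing.scale/=.
  by field; rewrite gt_eqF.
- by move=> c' c0' cC'; apply: Lv => //; split.
Qed.

End ConjugateSystem.

(** * Taylor expansion on the tube *)

Section Taylor1.
Context {R : realType}.

Lemma mvt_bound (r r' : R -> R) (h K : R) :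
  (forall x : R, `|x| <= `|h| -> is_derive x 1 r (r' x)) ->
  (forall x, `|x| <= `|h| -> `|r' x| <= K) -> `|r h - r 0| <= K * `|h|.
Proof.
move=> dr rK.
have cr x : `|x| <= `|h| -> derivable r x 1 by move=> /dr[].
have [h0|/ltW h0] := leP 0 h.
  have hh : `|h| = h by rewrite ger0_norm.
  have [||x] := @MVT_segment R r r' 0 h h0.
  - by move=> x; rewrite in_itv/= => xh; apply: dr; rewrite hh ler_norml; lra.
  - apply: derivable_within_continuous => x; rewrite in_itv/= => xh.
    by apply: cr; rewrite hh ler_norml; lra.
  rewrite in_itv/= => xh ->; rewrite subr0 normrM ler_wpM2r// rK// hh ler_norml; lra.
have hh : `|h| = - h by rewrite ler0_norm.
have [||x] := @MVT_segment R r r' h 0 h0.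
- by move=> x; rewrite in_itv/= => xh; apply: dr; rewrite hh ler_norml; lra.
- apply: derivable_within_continuous => x; rewrite in_itv/= => xh.
  by apply: cr; rewrite hh ler_norml; lra.
rewrite in_itv/= => xh; rewrite distrC => ->.
by rewrite sub0r normrM normrN ler_wpM2r// rK// hh ler_norml; lra.
Qed.

(** The derivative of the remainder is the remainder of lower order for f', to which induction and
    the mean value bound apply. The factorial is given up, since only the power of |h| matters. *)
Lemma taylor1 N (f : nat -> R -> R) (h M : R) :
  (forall i (x : R), (i <= N)%N -> `|x| <= `|h| -> is_derive x 1 (f i) (f i.+1 x)) ->
  (forall x, `|x| <= `|h| -> `|f N.+1 x| <= M) ->
  `|f 0%N h - \sum_(i < N.+1) h ^+ i / (i`!)%:R * f i 0| <= M * `|h| ^+ N.+1.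
Proof.
elim: N f h => [|N IH] f h df fM.
  rewrite big_ord1 expr0 fact0 divr1 mul1r expr1.
  by apply: (mvt_bound (r' := f 1%N)) => // x xh; exact: df.
pose r := fun x => f 0%N x - \sum_(i < N.+2) x ^+ i / (i`!)%:R * f i 0.
have r0 : r 0 = 0.
  rewrite /r big_ord_recl /= expr0 fact0 divr1 mul1r big1 ?addr0 ?subrr// => i _.
  by rewrite /bump /= exprS !mul0r.
pose r' := fun x => f 1%N x - \sum_(i < N.+1) x ^+ i / (i`!)%:R * f i.+1 0.
have -> : f 0%N h - \sum_(i < N.+2) h ^+ i / (i`!)%:R * f i 0 = r h - r 0.
  by rewrite r0 subr0.
rewrite exprSr mulrA; apply: (mvt_bound (r' := r')) => x xh; last first.
  have := IH (fun i => f i.+1) x _ _; rewrite -/(r' x) => h1.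
  apply: le_trans (h1 _ _) _ => [i y iN yx|y yx|].
  - by apply: df => //; apply: le_trans xh.
  - by apply: fM; apply: le_trans xh.
  have M0 : 0 <= M by apply: le_trans (fM 0 _) => //; rewrite normr0.
  by rewrite ler_wpM2l// lerXn2r// nnegrE.
pose g (i : 'I_N.+2) := (f i 0 / (i`!)%:R) \*: (fun x : R => x ^+ i).
have dg : is_derive x 1 (\sum_(i < N.+2) g i)
    (\sum_(i < N.+2) (f i 0 / (i`!)%:R) *: ((i%:R * x ^+ i.-1) : R)).
  apply: is_derive_sum => i; apply: is_deriveZ.
  have := is_deriveX i (is_derive_id x (1 : R)).
  by rewrite /GRing.scale/= mulr1 (_ : id ^+ i = (fun y : R => y ^+ i))// exprfctE.
have -> : r = f 0%N - \sum_(i < N.+2) g i.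
  apply/funext => y; rewrite /r /=.
  change (f 0%N y - \sum_(i < N.+2) y ^+ i / (i`!)%:R * f i 0 = f 0%N y - (\sum_(i < N.+2) g i) y).
  congr (_ - _); rewrite fct_sumE; apply: eq_bigr => i _.
  by rewrite /g /= /GRing.scale/=; ring.
apply: is_derive_eq (is_deriveB (df 0%N x isT xh) dg) _.
rewrite /r'; congr (_ - _); rewrite big_ord_recl /= mul0r /GRing.scale/= mulr0 add0r.
apply: eq_bigr => i _; rewrite /bump /= add1n factS natrM.
have i1 : (i.+1%:R : R) != 0 by rewrite pnatr_eq0.
have i2 : (i`!%:R : R) != 0 by rewrite pnatr_eq0 -lt0n fact_gt0.
rewrite add0n; move: (i.+1%:R : R) (i`!%:R : R) i1 i2 => u v i1 i2.
by field; rewrite i1 i2.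
Qed.

End Taylor1.

Section TaylorPolynomial.
Context {R : realType} {n : nat}.
Implicit Types (js s : seq 'I_n) (w : {ffun 'I_n -> nat}).

(** The Taylor polynomial of total degree N, built by expanding in one coordinate after another.
    [Phi] gives the partial derivatives at the centre, and [s] records those already taken. *)
Fixpoint tay (Phi : seq 'I_n -> R) (d : 'I_n -> R) js (N : nat) s : R :=
  if js is j :: js' then
    \sum_(i < N.+1) d j ^+ i / (i`!)%:R * tay Phi d js' (N - i) (nseq i j ++ s)
  else Phi s.

Definition mi_add w j i : {ffun 'I_n -> nat} := [ffun x => (w x + (x == j) * i)%N].

Fixpoint mi_list js (N : nat) : seq {ffun 'I_n -> nat} :=
  if js is j :: js' then
    [seq mi_add w j i | i <- iota 0 N.+1, w <- mi_list js' (N - i)]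
  else [:: [ffun=> 0%N]].

Definition mi_seq js w : seq 'I_n := flatten [seq nseq (w j) j | j <- js].

Lemma mi_list_cons j js N :
  mi_list (j :: js) N = [seq mi_add w j i | i <- iota 0 N.+1, w <- mi_list js (N - i)].
Proof. by []. Qed.

Lemma mi_deg_add w j i : mi_deg (mi_add w j i) = (mi_deg w + i)%N.
Proof.
rewrite /mi_deg; under eq_bigr do rewrite ffunE.
rewrite big_split /=; congr (_ + _)%N.
by rewrite (bigD1 j)//= eqxx mul1n big1 ?addn0// => k /negbTE->; rewrite mul0n.
Qed.

Lemma mi_listP js N w : uniq js -> reflect
  ((forall j, j \notin js -> w j = 0%N) /\ (mi_deg w <= N)%N) (w \in mi_list js N).
Proof.
elim: js N w => [|j js IH] N w.
  move=> _; rewrite inE; apply: (iffP eqP) => [->|[h _]].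
    by split=> [j _|]; rewrite ?ffunE// /mi_deg big1// => j _; rewrite ffunE.
  by apply/ffunP => j; rewrite ffunE h.
move=> /andP[jjs ujs]; rewrite mi_list_cons.
apply: (iffP allpairsPdep) => [[i [w' [+ /(IH _ _ ujs)[h d] ->]]]|[h d]].
  rewrite mem_iota add0n ltnS => /andP[_ iN]; split.
    move=> k; rewrite inE negb_or => /andP[/negbTE kj kjs].
    by rewrite ffunE kj mul0n addn0 h.
  by rewrite mi_deg_add -(subnK iN) leq_add2r.
pose w' : {ffun 'I_n -> nat} := [ffun x => if x == j then 0%N else w x].
have wE : w = mi_add w' j (w j).
  apply/ffunP => x; rewrite !ffunE; have [->|xj] := eqVneq x j; first by rewrite mul1n.
  by rewrite mul0n addn0.
have dE : mi_deg w = (mi_deg w' + w j)%N by rewrite {1}wE mi_deg_add.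
exists (w j), w'; split => //.
  by rewrite mem_iota add0n ltnS (leq_trans _ d)// dE leq_addl.
apply/IH => //; split=> [k kjs|]; last first.
  move: d; rewrite dE => d; have wN := leq_trans (leq_addl _ _) d.
  by rewrite -(leq_add2r (w j)) subnK.
rewrite ffunE; case: eqVneq => // kj; apply: h; by rewrite inE negb_or kj.
Qed.

Lemma mi_list_uniq js N : uniq js -> uniq (mi_list js N).
Proof.
elim: js N => [//|j js IH] N /andP[jjs ujs]; rewrite mi_list_cons.
apply: allpairs_uniq_dep => [|i _|]; [exact: iota_uniq|exact: IH|].
move=> p1 p2 /allpairsPdep[i3 [w3 [_ /(mi_listP _ _ ujs)[h3 _] ->]]].
move=> /allpairsPdep[i4 [w4 [_ /(mi_listP _ _ ujs)[h4 _] ->]]] /= E.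
have ii : i3 = i4.
  have := congr1 (fun f : {ffun 'I_n -> nat} => f j) E.
  by rewrite !ffunE eqxx !mul1n h3// h4.
rewrite ii in E *; congr existT; apply/ffunP => x.
have := congr1 (fun f : {ffun 'I_n -> nat} => f x) E.
by rewrite !ffunE => /addIn.
Qed.

(** The list is reversed because the coordinate expanded first is differentiated first and so stands
    last in the sequence of derivatives. *)
Lemma tay_mi_list (Phi : seq 'I_n -> R) (d : 'I_n -> R) js N s : uniq js ->
  tay Phi d js N s = \sum_(w <- mi_list js N)
    (mi_fact w)%:R^-1 * Phi (mi_seq (rev js) w ++ s) * \prod_j d j ^+ w j.
Proof.
elim: js N s => [|j js IH] N s.
  move=> _; rewrite /= big_seq1 /mi_fact big1; last by move=> j _; rewrite ffunE.
  rewrite invr1 mul1r big1 ?mulr1// => j _; by rewrite ffunE expr0.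
move=> /andP[jjs ujs]; rewrite mi_list_cons big_allpairs_dep /=.
rewrite -(big_mkord xpredT (fun i => d j ^+ i / (i`!)%:R * tay Phi d js (N - i) (nseq i j ++ s))).
rewrite /index_iota subn0; apply: eq_bigr => i _; rewrite IH// big_distrr /=.
apply: eq_big_seq => w /(mi_listP _ _ ujs)[h _].
have wj : w j = 0%N by exact: h.
have fE : mi_fact (mi_add w j i) = (i`! * mi_fact w)%N.
  rewrite /mi_fact (bigD1 j)//= [in RHS](bigD1 j)//= ffunE eqxx mul1n wj mul1n.
  by congr (_ * _)%N; apply: eq_bigr => k /negbTE kj; rewrite ffunE kj mul0n addn0.
have pE : \prod_k d k ^+ (mi_add w j i) k = d j ^+ i * \prod_k d k ^+ w k.
  rewrite (bigD1 j)//= [in RHS](bigD1 j)//= ffunE eqxx mul1n wj mul1r add0n.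
  by congr (_ * _); apply: eq_bigr => k /negbTE kj; rewrite ffunE kj mul0n addn0.
have sE : mi_seq (rev (j :: js)) (mi_add w j i) ++ s = mi_seq (rev js) w ++ nseq i j ++ s.
  rewrite rev_cons /mi_seq map_rcons -cats1 flatten_cat /= cats0 ffunE eqxx mul1n wj add0n.
  rewrite -catA; congr (flatten _ ++ _); apply/eq_in_map => k.
  rewrite mem_rev => kjs; rewrite ffunE; case: eqVneq => [kj|]; last by rewrite mul0n addn0.
  by move: jjs; rewrite -kj kjs.
rewrite fE pE sE natrM invfM; ring.
Qed.

End TaylorPolynomial.

(** * Families of iterated partial derivatives on an open box *)

Section PartialSystem.
Context {R : realType} {n : nat}.
Variables (y0 : 'cV[R]_n) (a : R) (q : nat) (F : seq 'I_n -> 'cV[R]_n -> R).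
Implicit Types (y z r : 'cV[R]_n) (s : seq 'I_n).

Let Om y := `|y - y0| < a.
Let e (j : 'I_n) : 'cV[R]_n := delta_mx j 0.

Hypothesis Fd : forall s j y, (size s < q)%N -> Om y ->
  is_derive (0 : R) 1 (fun h => F s (y + h *: e j)) (F (j :: s) y).
Hypothesis Fc : forall s y, (size s <= q)%N -> Om y -> {for y, continuous (F s)}.

Lemma is_derive_line s j y (x : R) : (size s < q)%N -> Om (y + x *: e j) ->
  is_derive x 1 (fun h => F s (y + h *: e j)) (F (j :: s) (y + x *: e j)).
Proof.
move=> sq Oy; have h1 := Fd j sq Oy.
have h2 : is_derive x 1 (fun h : R => h - x) 1.
  have h3 : is_derive x 1 (id - cst x) (1 - 0) by exact: is_deriveB.
  by apply: is_derive_eq h3 _; rewrite subr0.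
have h0 : is_derive (x - x) 1 (fun h => F s (y + x *: e j + h *: e j)) (F (j :: s) (y + x *: e j)).
  by rewrite subrr.
have h4 := @is_derive1_comp R (fun h => F s (y + x *: e j + h *: e j)) (fun h => h - x) x _ _ h0 h2.
rewrite mulr1 in h4; apply: near_eq_is_derive h4.
by near=> u; rewrite /= -addrA -scalerDl subrKC.
Unshelve. all: by end_near. Qed.

Lemma Om_segment y j (h x : R) : Om y -> Om (y + h *: e j) ->
  (0 <= x <= h) || (h <= x <= 0) -> Om (y + x *: e j).
Proof.
rewrite /Om => Oy Oh xh.
have a0 : 0 < a by apply: le_lt_trans Oy.
have [b [b0 yb hb ba]] : exists b, [/\ 0 <= b, `|y - y0| <= b, `|y + h *: e j - y0| <= b & b < a].
  exists (Num.max `|y - y0| `|y + h *: e j - y0|).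
  by split; rewrite ?le_max ?lexx ?normr_ge0 ?orbT// gt_max Oy.
apply: le_lt_trans ba; apply: mx_norm_le => // i k; rewrite (ord1 k).
have := le_trans (mx_entry_le _ i 0) yb; have := le_trans (mx_entry_le _ i 0) hb.
rewrite !mxE; case: (i == j) => /=; rewrite ?mulr1 ?mulr0 ?addr0//.
by move: xh; rewrite !ler_norml; lra.
Qed.

Lemma line_MVT s j y (h : R) : (size s < q)%N -> Om y -> Om (y + h *: e j) ->
  exists x : R, [/\ (0 <= x <= h) || (h <= x <= 0), Om (y + x *: e j) &
    F s (y + h *: e j) - F s y = h * F (j :: s) (y + x *: e j)].
Proof.
move=> sq Oy Oh.
pose G := fun x : R => F s (y + x *: e j).
have G0 : G 0 = F s y by rewrite /G scale0r addr0.
have dG x : (0 <= x <= h) || (h <= x <= 0) -> is_derive x 1 G (F (j :: s) (y + x *: e j)).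
  by move=> xh; apply: is_derive_line => //; exact: Om_segment xh.
have cG x : (0 <= x <= h) || (h <= x <= 0) -> derivable G x 1 by move=> /dG[].
have [h0|/ltW h0] := leP 0 h.
  have [||x] := @MVT_segment R G (fun x => F (j :: s) (y + x *: e j)) 0 h h0.
  - by move=> x; rewrite in_itv/= => /andP[x0 xh]; apply: dG; rewrite (ltW x0) (ltW xh).
  - apply: derivable_within_continuous => x; rewrite in_itv/= => xh.
    by apply: cG; rewrite xh.
  rewrite in_itv/= => xh; rewrite G0 subr0 => GE; exists x.
  by rewrite xh; split => //; [apply: Om_segment Oh _ => //; rewrite xh|rewrite [RHS]mulrC -GE].
have [||x] := @MVT_segment R G (fun x => F (j :: s) (y + x *: e j)) h 0 h0.
- by move=> x; rewrite in_itv/= => /andP[x0 xh]; apply: dG; rewrite (ltW x0) (ltW xh) orbT.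
- apply: derivable_within_continuous => x; rewrite in_itv/= => xh.
  by apply: cG; rewrite xh orbT.
rewrite in_itv/= => xh; rewrite G0 => GE; exists x.
rewrite xh orbT; split => //; first by apply: Om_segment Oh _ => //; rewrite xh orbT.
by rewrite -opprB GE sub0r mulrN opprK mulrC.
Qed.

(* Changing the coordinates from r' to r one at a time stays in the box. *)
Lemma increment_bound s y r r' (rho K : R) (c : 'I_n -> R) : (size s < q)%N ->
  `|r| <= rho -> `|r'| <= rho -> 0 <= K ->
  (forall z, `|z| <= rho -> Om (y + z)) ->
  (forall z j, `|z| <= rho -> `|F (j :: s) (y + z) - c j| <= K) ->
  `|F s (y + r) - F s (y + r') - \sum_j c j * (r j 0 - r' j 0)| <= n%:R * K * `|r - r'|.
Proof.
move=> sq rr rr' K0 Orho FK.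
have rho0 : 0 <= rho by apply: le_trans rr.
pose z k : 'cV[R]_n := \col_j if (j < k)%N then r j 0 else r' j 0.
have zr k : `|z k| <= rho.
  apply: mx_norm_le => // i j; rewrite !mxE; case: ifP => _.
    exact: le_trans (mx_entry_le _ _ _) rr.
  exact: le_trans (mx_entry_le _ _ _) rr'.
have zS (k : 'I_n) : z k.+1 = z k + (r k 0 - r' k 0) *: e k.
  apply/matrixP => i j; rewrite (ord1 j) !mxE eqxx andbT ltnS leq_eqVlt.
  have [->|/= ik] := eqVneq i k; first by rewrite eqxx ltnn /= mulr1 subrKC.
  have /negbTE-> : (i : nat) != k by [].
  by rewrite /= mulr0 addr0.
have z0 : z 0%N = r' by apply/matrixP => i j; rewrite (ord1 j) !mxE.
have zn : z n = r by apply/matrixP => i j; rewrite (ord1 j) !mxE ltn_ord.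
have -> : F s (y + r) - F s (y + r') = \sum_(k < n) (F s (y + z k.+1) - F s (y + z k)).
  rewrite -zn -z0 -(big_mkord xpredT (fun k => F s (y + z k.+1) - F s (y + z k))).
  by rewrite telescope_sumr.
rewrite -sumrB (le_trans (ler_norm_sum _ _ _))//.
rewrite -mulrA mulr_natl -[X in _ *+ X]card_ord -sumr_const ler_sum// => k _.
rewrite zS addrA.
have [x [xh Ox ->]] : exists x : R, [/\ (0 <= x <= r k 0 - r' k 0) || (r k 0 - r' k 0 <= x <= 0),
    Om (y + z k + x *: e k) &
  F s (y + z k + (r k 0 - r' k 0) *: e k) - F s (y + z k)
    = (r k 0 - r' k 0) * F (k :: s) (y + z k + x *: e k)].
  apply: line_MVT => //; first exact: Orho.
  by rewrite -addrA -zS; exact: Orho.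
rewrite mulrC -mulrBl normrM; apply: ler_pM => //; last first.
  by have := mx_entry_le (r - r') k 0; rewrite !mxE.
rewrite -addrA; apply: FK; apply: mx_norm_le => // i j; rewrite (ord1 j).
have := le_trans (mx_entry_le _ i 0) (zr k); have := le_trans (mx_entry_le _ i 0) (zr k.+1).
rewrite zS !mxE eqxx andbT; case: (i == k) => /=; rewrite ?mulr1 ?mulr0 ?addr0//.
by move: xh; rewrite !ler_norml; lra.
Qed.

(** Two applications of [increment_bound]: the second derivatives bound the oscillation of the first
    ones by n K rho, and this is the constant for the increment of [F s]. *)
Lemma quadratic_bound s y r r' (rho K : R) : ((size s).+1 < q)%N ->
  `|r| <= rho -> `|r'| <= rho -> 0 <= K ->
  (forall z, `|z| <= rho -> Om (y + z)) ->
  (forall z i j, `|z| <= rho -> `|F [:: i, j & s] (y + z)| <= K) ->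
  `|F s (y + r) - F s (y + r') - \sum_j F (j :: s) y * (r j 0 - r' j 0)|
   <= n%:R ^+ 2 * K * rho * `|r - r'|.
Proof.
move=> sq rr rr' K0 Orho FK.
have rho0 : 0 <= rho by apply: le_trans rr.
have -> : n%:R ^+ 2 * K * rho = n%:R * (n%:R * K * rho) :> R by ring.
apply: (increment_bound (ltnW sq) rr rr') => //; first by rewrite !mulr_ge0.
move=> z j zr.
have := @increment_bound (j :: s) y z 0 rho K (fun=> 0) sq zr _ K0 Orho.
rewrite normr0 => /(_ rho0); rewrite addr0 subr0 big1 ?subr0; last by move=> i _; rewrite mul0r.
move=> h; apply: le_trans (h _) _ => [u i ur|]; first by rewrite subr0 FK.
by rewrite ler_wpM2l// mulr_ge0.
Qed.

(** Schwarz's theorem by second differences. It is needed because Taylor expansion produces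
    derivatives in various orders, while the hypotheses fix one order for each multi-index. *)
Lemma mixed_partials s i j y : ((size s).+1 < q)%N -> Om y ->
  F [:: i, j & s] y = F [:: j, i & s] y.
Proof.
move=> sq Oy; have a0 : 0 < a by apply: le_lt_trans Oy.
have sq1 : (size s < q)%N by exact: ltnW.
apply/eqP; rewrite -subr_eq0 -normr_le0; apply/ler_addgt0Pl => eps eps0; rewrite addr0.
have e2 : 0 < eps / 2 by rewrite divr_gt0.
have near_y : \forall z \near y, [/\ Om z, `|F [:: i, j & s] y - F [:: i, j & s] z| <= eps / 2
    & `|F [:: j, i & s] y - F [:: j, i & s] z| <= eps / 2].
  have O1 : \forall z \near y, Om z.
    apply/nbhs_ballP; exists (a - `|y - y0|); first by rewrite /= subr_gt0.
    move=> z; rewrite -ball_normE /ball_/= => yz; rewrite /Om.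
    have -> : z - y0 = (y - y0) - (y - z) by rewrite opprB [RHS]addrC addrA subrK.
    by rewrite (le_lt_trans (ler_normB _ _))// addrC -ltrBrDr.
  have c1 : {for y, continuous (F [:: i, j & s])} by exact: Fc.
  have c2 : {for y, continuous (F [:: j, i & s])} by exact: Fc.
  move/cvgrPdist_le: c1 => /(_ _ e2) c1; move/cvgrPdist_le: c2 => /(_ _ e2) c2.
  by apply: filterS3 O1 c1 c2.
have [d /= d0 Hd] := (nbhs_ballP _ _).1 near_y.
pose h := d / 4; have h0 : 0 < h by rewrite divr_gt0.
have near_pt (u v : R) k l : 0 <= u <= h -> 0 <= v <= h -> ball y d (y + u *: e k + v *: e l).
  move=> uh vh; rewrite -ball_normE /ball_/= -addrA opprD addrA subrr sub0r normrN.
  apply: (@le_lt_trans _ _ (h + h)); last by rewrite /h; lra.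
  apply: mx_norm_le => [|x w]; first lra.
  rewrite !mxE (le_trans (ler_normD _ _))//.
  by apply: lerD; case: andP; rewrite /= ?mulr1 ?mulr0 ?normr0 ?(ltW h0)// ler_norml; lra.
(* both iterated differences of F s over the square of side h coincide *)
pose Dd k l := F s (y + h *: e k + h *: e l) - F s (y + h *: e k)
  - (F s (y + h *: e l) - F s y).
have key k l : exists z, ball y d z /\ Dd k l = h * h * F [:: l, k & s] z.
  have ballO u v k1 l1 : 0 <= u <= h -> 0 <= v <= h -> Om (y + u *: e k1 + v *: e l1).
    by move=> uh vh; have [] := Hd _ (near_pt u v k1 l1 uh vh).
  have h00 : 0 <= (0 : R) <= h by rewrite lexx ltW.
  have hh : 0 <= h <= h by rewrite lexx ltW.
  pose phi := (fun x : R => F s (y + h *: e l + x *: e k)) - (fun x => F s (y + x *: e k)).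
  have dphi x : 0 <= x <= h -> is_derive x 1 phi
      (F (k :: s) (y + h *: e l + x *: e k) - F (k :: s) (y + x *: e k)).
    move=> xh; apply: is_deriveB; apply: is_derive_line => //; first exact: ballO.
    by have := ballO x 0 k k xh h00; rewrite scale0r addr0.
  have [||x] := @MVT_segment R phi
    (fun x => F (k :: s) (y + h *: e l + x *: e k) - F (k :: s) (y + x *: e k)) 0 h (ltW h0).
  - by move=> x; rewrite in_itv/= => /andP[x0 xh]; apply: dphi; rewrite (ltW x0) (ltW xh).
  - apply: derivable_within_continuous => x; rewrite in_itv/= => xh.
    by have [] := dphi x xh.
  rewrite in_itv/= => xh.
  have -> : phi h - phi 0 = Dd k l.
    rewrite /phi /Dd; change ((F s (y + h *: e l + h *: e k) - F s (y + h *: e k))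
      - (F s (y + h *: e l + 0 *: e k) - F s (y + 0 *: e k))
      = F s (y + h *: e k + h *: e l) - F s (y + h *: e k) - (F s (y + h *: e l) - F s y)).
    by rewrite !scale0r !addr0 (addrAC y).
  rewrite subr0 => ->; rewrite (addrAC y).
  have [x2 [x2h _ ->]] : exists x2 : R, [/\ (0 <= x2 <= h) || (h <= x2 <= 0),
      Om (y + x *: e k + x2 *: e l) &
    F (k :: s) (y + x *: e k + h *: e l) - F (k :: s) (y + x *: e k)
     = h * F [:: l, k & s] (y + x *: e k + x2 *: e l)].
    apply: line_MVT => //; last exact: ballO.
    by have := ballO x 0 k k xh h00; rewrite scale0r addr0.
  exists (y + x *: e k + x2 *: e l); split; last by ring.
  apply: near_pt => //; move: x2h => /orP[//|/andP[hx x0]].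
  by move: (h0); rewrite ltNge (le_trans hx x0).
have [z1 [b1 E1]] := key j i; have [z2 [b2 E2]] := key i j.
have DE : Dd j i = Dd i j.
  by rewrite /Dd (addrAC y); ring.
have Fz : F [:: i, j & s] z1 = F [:: j, i & s] z2.
  have hh : h * h != 0 by rewrite mulf_neq0// gt_eqF.
  by apply: (mulfI hh); rewrite -E1 -E2.
have [_ p1 _] := Hd _ b1; have [_ _ p2] := Hd _ b2.
move: p1 p2; rewrite Fz !ler_norml; lra.
Qed.

Lemma partials_cons s s' j y : (size s < q)%N -> (size s' < q)%N -> Om y ->
  (forall z, Om z -> F s z = F s' z) -> F (j :: s) y = F (j :: s') y.
Proof.
move=> sq sq' Oy ss'.
have [_ <-] := Fd j sq Oy; have [_ <-] := Fd j sq' Oy.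
apply: near_eq_derive => //.
apply/nbhs_ballP; exists (a - `|y - y0|); first by rewrite /= subr_gt0.
move=> h; rewrite -ball_normE /ball_/= sub0r normrN => ha; apply: ss'; rewrite /Om addrAC.
apply: (@le_lt_trans _ _ (`|y - y0| + `|h|)); last by rewrite addrC -ltrBrDr.
rewrite (le_trans (ler_normD _ _))// lerD2l.
apply: mx_norm_le => // i k; rewrite !mxE.
by case: andP; rewrite /= ?mulr1 ?mulr0 ?normr0.
Qed.

(** Adjacent transpositions bring the head of [s] to the front of [s']; the tails then agree on the
    whole open box, so their derivatives agree. *)
Lemma partials_perm s s' y : perm_eq s s' -> (size s <= q)%N -> Om y -> F s y = F s' y.
Proof.
have swap : forall s1 (x : 'I_n) s2 z, (size (s1 ++ x :: s2) <= q)%N -> Om z ->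
    F (s1 ++ x :: s2) z = F (x :: s1 ++ s2) z.
  elim=> [//|u s1 IH] x s2 z /= sq Oz.
  have sz : size (s1 ++ x :: s2) = (size (s1 ++ s2)).+1 by rewrite !size_cat /= addnS.
  rewrite mixed_partials//; last by rewrite -sz.
  by apply: partials_cons => //= [|w Ow]; [rewrite -sz|apply: IH => //; exact: ltnW].
elim: s s' y => [|x s IH] s' y; first by rewrite perm_sym => /perm_nilP->.
move=> p sq Oy; have xs' : x \in s' by rewrite -(perm_mem p) mem_head.
move: p; case/splitPr: xs' => s1 s2 p; rewrite swap//; last by rewrite -(perm_size p).
have p2 : perm_eq s (s1 ++ s2).
  by rewrite -(perm_cons x) (perm_trans p)// perm_catC /= perm_cons perm_catC.
apply: partials_cons => //; first by rewrite -(perm_size p2).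
by move=> z Oz; apply: IH => //; exact: ltnW.
Qed.

(** The constant solves c_0 = 0, c_{j+1} = 1 + q c_j. A new coordinate adds its own one-dimensional
    remainder and at most N + 1 <= q remainders of degree N - i in the other coordinates, each
    weighted by |d|^i. *)
Lemma taylor_partials (d : 'cV[R]_n) (M : R) : `|d| < a -> 0 <= M ->
  forall js N s, uniq js -> (size s + N < q)%N ->
  (forall s' z, size s' = (size s + N).+1 -> Om z -> `|F s' z| <= M) ->
  `|F s (y0 + \col_i (if i \in js then d i 0 else 0))
    - tay (F^~ y0) (fun j => d j 0) js N s|
  <= iter (size js) (fun x => 1 + q%:R * x) 0 * M * `|d| ^+ N.+1.
Proof.
move=> da M0.
have c0 k : 0 <= iter k (fun x : R => 1 + q%:R * x) 0.
  by elim: k => //= k IH; rewrite addr_ge0// mulr_ge0.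
elim=> [|j js IH] N s.
  move=> _ sq FM /=; rewrite !mul0r (_ : \col_i 0 = 0) ?addr0 ?subrr ?normr0//.
  by apply/matrixP => i k; rewrite !mxE.
rewrite cons_uniq => /andP[jjs ujs] sq FM.
pose y := y0 + \col_i (if i \in js then d i 0 else 0).
have -> : y0 + \col_i (if i \in j :: js then d i 0 else 0) = y + d j 0 *: e j.
  rewrite /y -addrA; congr (_ + _); apply/matrixP => i k; rewrite (ord1 k) !mxE inE eqxx andbT.
  have [->|ij] := eqVneq i j; first by rewrite (negbTE jjs) add0r mulr1.
  by rewrite mulr0 addr0.
have Oy (x : R) : `|x| <= `|d j 0| -> Om (y + x *: e j).
  move=> xd; rewrite /Om; apply: le_lt_trans da; rewrite /y -(addrA y0) (addrC y0) addrK.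
  apply: mx_norm_le => // i k; rewrite (ord1 k) !mxE eqxx andbT.
  have [->|ij] := eqVneq i j; first by rewrite (negbTE jjs) add0r mulr1 (le_trans xd)// mx_entry_le.
  by rewrite mulr0 addr0; case: ifP => _; rewrite ?normr0// mx_entry_le.
pose f (i : nat) (x : R) := F (nseq i j ++ s) (y + x *: e j).
have sz i : size (nseq i j ++ s) = (i + size s)%N by rewrite size_cat size_nseq.
have h1 : `|f 0%N (d j 0) - \sum_(i < N.+1) d j 0 ^+ i / (i`!)%:R * f i 0|
    <= M * `|d j 0| ^+ N.+1.
  apply: taylor1 => [i x iN xd|x xd]; last first.
    by apply: FM; [rewrite sz addSn addnC|exact: Oy].
  apply: (is_derive_line (s := nseq i j ++ s)); last exact: Oy.
  by rewrite sz (leq_ltn_trans _ sq)// addnC leq_add2l.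
have f0 i : f i 0 = F (nseq i j ++ s) y by rewrite /f scale0r addr0.
have -> : F s (y + d j 0 *: e j) - tay (F^~ y0) (fun j => d j 0) (j :: js) N s
  = (f 0%N (d j 0) - \sum_(i < N.+1) d j 0 ^+ i / (i`!)%:R * f i 0)
  + \sum_(i < N.+1) d j 0 ^+ i / (i`!)%:R *
     (f i 0 - tay (F^~ y0) (fun j => d j 0) js (N - i) (nseq i j ++ s)).
  under [X in _ = _ + X]eq_bigr do rewrite mulrBr.
  by rewrite sumrB addrA subrK.
rewrite (le_trans (ler_normD _ _))//= mulrDl mul1r mulrDl lerD//.
  by rewrite (le_trans h1)// ler_wpM2l// lerXn2r ?nnegrE// mx_entry_le.
rewrite (le_trans (ler_norm_sum _ _ _))//.
set K := iter _ _ _.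
rewrite (@le_trans _ _ (\sum_(i < N.+1) (K * M * `|d| ^+ N.+1)))//.
  apply: ler_sum => i _; have iN : (i <= N)%N by rewrite -ltnS.
  have h2 := IH (N - i)%N (nseq i j ++ s) ujs.
  have e1 : (i + size s + (N - i) = size s + N)%N by rewrite addnAC subnKC// addnC.
  rewrite sz e1 in h2; have {}h2 := h2 sq FM; rewrite -f0 in h2.
  rewrite normrM.
  have h3 : `|d j 0 ^+ i / (i`!)%:R| <= `|d| ^+ i.
    rewrite normrM normrX normfV normr_nat -[leRHS]mulr1 ler_pM ?exprn_ge0//.
      by rewrite lerXn2r ?nnegrE// mx_entry_le.
    by rewrite invf_le1 ?ltr0n ?fact_gt0// ler1n fact_gt0.
  apply: le_trans (ler_pM _ _ h3 h2) _ => //.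
  rewrite mulrCA -exprD -subSn// subnKC//.
  exact: leqW.
rewrite sumr_const card_ord -[leLHS]mulr_natl -!mulrA.
apply: ler_wpM2r; first by rewrite !mulr_ge0 ?exprn_ge0// /K c0.
rewrite ler_nat.
by rewrite (leq_trans _ sq)// ltnS leq_addl.
Qed.

End PartialSystem.

Section MatrixContinuity.
Context {R : realType}.

Lemma cvg_mx {T : Type} {m n} (Fl : set_system T) {FF : Filter Fl} (A : T -> 'M[R]_(m, n)) (B : 'M[R]_(m, n)) :
  (forall i j, (fun x => A x i j) @ Fl --> B i j) -> A @ Fl --> B.
Proof.
move=> AB; apply/cvgrPdist_le => e e0; near=> x; apply: mx_norm_le; first exact: ltW.
move=> i j; rewrite !mxE; move: i j; near: x.
apply: filter_forall => i; apply: filter_forall => j.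
by have /cvgrPdist_le := AB i j; apply.
Unshelve. all: by end_near. Qed.

Lemma cvg_mx_entry {T : Type} {m n} (Fl : set_system T) {FF : Filter Fl} (A : T -> 'M[R]_(m, n)) (B : 'M[R]_(m, n)) i j :
  A @ Fl --> B -> (fun x => A x i j) @ Fl --> B i j.
Proof.
move=> /cvgrPdist_le AB; apply/cvgrPdist_le => e e0; have := AB e e0.
by apply: filterS => x; apply: le_trans; have := mx_entry_le (B - A x) i j; rewrite !mxE.
Qed.

Lemma is_derive_entry {m n} (A : R -> 'M[R]_(m, n)) (dA : 'M[R]_(m, n)) (t : R) :
  is_derive t 1 A dA <-> forall i j, is_derive t 1 (fun x => A x i j) (dA i j).
Proof.
split=> [[dA1 <-] i j|dA1].
  rewrite derive_mx// mxE; apply: DeriveDef => //.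
  by have /derivable_mxP := dA1; apply.
have dv : derivable A t 1 by apply/derivable_mxP => i j; have [] := dA1 i j.
apply: DeriveDef => //; rewrite derive_mx//; apply/matrixP => i j; rewrite mxE.
by have [_ ->] := dA1 i j.
Qed.

End MatrixContinuity.

Section Tube.
Context {R : realType} {n : nat}.
Variables (t0 a : R) (phi0 : R -> 'cV[R]_n).
Let D := tube t0 a phi0.
Implicit Types (g : R -> 'cV[R]_n -> 'cV[R]_n) (s : seq 'I_n) (w : {ffun 'I_n -> nat}).

Lemma nbhs_line_in j t y : t0 <= t -> `|y - phi0 t| < a -> nbhs (0 : R) (line_in D j t y).
Proof.
move=> tt ya; apply/nbhs_ballP; exists (a - `|y - phi0 t|); first by rewrite /= subr_gt0.
move=> h; rewrite -ball_normE /ball_/= sub0r normrN => ha; rewrite /line_in /D /tube /=; split => //.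
rewrite addrAC; apply: (@le_trans _ _ (`|y - phi0 t| + `|h|)); last by rewrite addrC -lerBrDr ltW.
rewrite (le_trans (ler_normD _ _))// lerD2l.
apply: mx_norm_le => // i k; rewrite !mxE.
by case: andP; rewrite /= ?mulr1 ?mulr0 ?normr0.
Qed.

Lemma pderive_seq_is_derive g q s j t y i : C0n_in D q g -> (size s < q)%N ->
  t0 <= t -> `|y - phi0 t| < a ->
  is_derive (0 : R) 1 (fun h => pderive_seq D s g t (y + h *: delta_mx j 0) i 0)
    (pderive_seq D (j :: s) g t y i 0).
Proof.
move=> gC sq tt ya; have Dty : D (t, y) by split => //=; exact: ltW.
have [_ /(_ sq j t y Dty) dg] := gC s (ltnW sq).
have /(is_derive_entry _ _ _).1 := (is_derive_inP _ _ (nbhs_line_in j tt ya)).1 (conj dg erefl).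
exact.
Qed.

(** Joint continuity is known only within [D], so the path has to stay there. The filter is
    arbitrary to cover both variation of y at fixed t and curves t -> (t, v(t)). *)
Lemma tube_cvg g q s t y (T : Type) (Fl : set_system T) {FF : Filter Fl} (u : T -> R) (v : T -> 'cV[R]_n) :
  C0n_in D q g -> (size s <= q)%N -> D (t, y) ->
  u @ Fl --> t -> v @ Fl --> y -> (\forall x \near Fl, D (u x, v x)) ->
  (fun x => pderive_seq D s g (u x) (v x)) @ Fl --> pderive_seq D s g t y.
Proof.
move=> gC sq Dty ut vy Duv; have [/subspace_continuousP cg _] := gC s sq.
move=> P /(cg (t, y) Dty) HP.
have {}HP : nbhs (t, y) (fun z => D z -> P (pderive_seq D s g z.1 z.2)) by [].
have [[A B] [/= tA yB] AB] := HP.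
have uA : Fl (fun x => A (u x)) by exact: ut.
have vB : Fl (fun x => B (v x)) by exact: vy.
change (Fl (fun x => P (pderive_seq D s g (u x) (v x)))).
change (Fl (fun x => D (u x, v x))) in Duv.
apply: filterS3 Duv uA vB => x Dx ux vx.
exact: (AB (u x, v x) (conj ux vx) Dx).
Qed.

Lemma near_tube t y : t0 <= t -> `|y - phi0 t| < a -> \forall z \near y, D (t, z).
Proof.
move=> tt ya; apply/nbhs_ballP; exists (a - `|y - phi0 t|); first by rewrite /= subr_gt0.
move=> z; rewrite -ball_normE /ball_/= => yz; split => //=.
have -> : z - phi0 t = (y - phi0 t) - (y - z) by rewrite opprB [RHS]addrC addrA subrK.
by rewrite (le_trans (ler_normB _ _))// addrC -lerBrDr ltW.
Qed.

Lemma pderive_seq_continuous g q s t y i : C0n_in D q g -> (size s <= q)%N ->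
  t0 <= t -> `|y - phi0 t| < a ->
  {for y, continuous (fun z => pderive_seq D s g t z i 0)}.
Proof.
move=> gC sq tt ya.
apply: (@cvg_mx_entry R _ _ _ (nbhs y) (nbhs_filter y) (fun z => pderive_seq D s g t z) _ i 0).
apply: (@tube_cvg g q s t y _ (nbhs y) (nbhs_filter y) (fun=> t) id gC sq).
- by split => //=; exact: ltW.
- exact: cvg_cst.
- exact: cvg_id.
- exact: near_tube.
Qed.

Lemma cts_pderive_seq g q s T (v : R -> 'cV[R]_n) : C0n_in D q g -> (size s <= q)%N ->
  t0 < T -> ctsm T phi0 -> ctsm T v -> (forall t, T <= t -> `|v t - phi0 t| < a) ->
  ctsm T (fun t => pderive_seq D s g t (v t)).
Proof.
move=> gC sq tT cphi cv va i j t Tt; rewrite (ord1 j).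
have tt : t0 < t by exact: lt_le_trans Tt.
have cv' : v @ t --> v t by apply: cvg_mx => k l; exact: cv.
have cphi' : phi0 @ t --> phi0 t by apply: cvg_mx => k l; exact: cphi.
apply: (cvg_mx_entry (A := fun t => pderive_seq D s g t (v t))).
apply: (@tube_cvg g q s t (v t) _ (nbhs t) _ id v gC sq); [|exact: cvg_id|exact: cv'|].
  by split => /=; apply: ltW => //; exact: va.
have dv : `|v x - phi0 x| @[x --> t] --> `|v t - phi0 t|.
  by apply: cvg_norm; exact: cvgB.
have H2 : \forall x \near t, `|v x - phi0 x| < a by exact: (cvgr_lt _ dv _ (va t Tt)).
change (nbhs t (fun x => D (x, v x))); change (nbhs t (fun x => `|v x - phi0 x| < a)) in H2.
apply: filterS2 (nbhs_ray tt) H2 => x /rayE tx xa.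
by split => //=; exact: ltW.
Qed.

Lemma pderive_seq_perm g q s s' t y : C0n_in D q g -> (size s <= q)%N -> perm_eq s s' ->
  t0 <= t -> `|y - phi0 t| < a -> pderive_seq D s g t y = pderive_seq D s' g t y.
Proof.
move=> gC sq ss tt ya; apply/matrixP => i j; rewrite (ord1 j).
apply: (@partials_perm R n (phi0 t) a q (fun s y => pderive_seq D s g t y i 0)) => //.
  by move=> s1 j1 y1 s1q y1a; exact: (pderive_seq_is_derive _ _ gC).
by move=> s1 y1 s1q y1a; exact: (@pderive_seq_continuous g q s1 t y1 i gC s1q tt y1a).
Qed.

Definition mi_count s : {ffun 'I_n -> nat} := [ffun j => count_mem j s].

Lemma mi_deg_count s : mi_deg (mi_count s) = size s.
Proof.
rewrite /mi_deg; under eq_bigr do rewrite ffunE.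
elim: s => [|x s IH] /=; first by rewrite big1.
rewrite big_split /= IH (bigD1 x)//= eqxx big1 ?addn0// => k.
by rewrite eq_sym => /negbTE->.
Qed.

Lemma perm_mi_seq (js : seq 'I_n) w s : uniq js -> (forall j, j \in s -> j \in js) ->
  (forall j, w j = count_mem j s) -> perm_eq s (mi_seq js w).
Proof.
move=> ujs sjs ws; apply/allP => j _ /=; apply/eqP.
rewrite /mi_seq count_flatten -map_comp.
have -> : [seq (count_mem j \o (fun j0 => nseq (w j0) j0)) i | i <- js]
   = [seq (if i == j then w j else 0)%N | i <- js].
  by apply: eq_map => i /=; rewrite count_nseq /=; case: eqVneq => [->|_]; rewrite ?mul1n ?mul0n.
rewrite sumnE big_map; have [jj|jj] := boolP (j \in js).
  rewrite (bigD1_seq j)//= eqxx big1_seq ?addn0 ?ws// => i /andP[+ _].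
  by move/negbTE->.
rewrite big1_seq; first by apply/count_memPn; apply: contra jj => /sjs.
move=> i /= ij; case: eqVneq => // iE; by rewrite iE (negbTE jj) in ij.
Qed.

(** Reduces any order of differentiation to the one built into [pderive_mi], in which bounds and
    membership in the class are assumed. The strict inequality keeps the point in the interior of
    the section, where partial derivatives commute. *)
Lemma pderive_seq_mi g q s t y : C0n_in D q g -> (size s <= q)%N ->
  t0 <= t -> `|y - phi0 t| < a -> pderive_seq D s g t y = pderive_mi D (mi_count s) g t y.
Proof.
move=> gC sq; apply: pderive_seq_perm gC sq _.
apply: (@perm_mi_seq (enum 'I_n)); first exact: enum_uniq.
  by move=> j _; rewrite mem_enum.
by move=> j; rewrite ffunE.
Qed.

Lemma pderive_seq_bounded g q N : C0n_in D q g -> (N <= q)%N ->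
  (forall w, mi_deg w = N -> [bounded pderive_mi D w g z.1 z.2 | z in D]) ->
  exists2 M, 0 <= M & forall s t y, size s = N -> t0 <= t -> `|y - phi0 t| < a ->
    `|pderive_seq D s g t y| <= M.
Proof.
move=> gC Nq gB.
have /choice[M HM] : forall s : N.-tuple 'I_n, exists M : R, forall z, D z ->
    `|pderive_mi D (mi_count s) g z.1 z.2| <= M.
  move=> s; have [|M [_ HM]] := gB (mi_count s); first by rewrite mi_deg_count size_tuple.
  exists (M + 1) => z Dz; apply: (HM (M + 1)) => //; lra.
exists (\sum_s `|M s|); first exact: sumr_ge0.
move=> s t y sN tt ya; rewrite (pderive_seq_mi gC)//; last by rewrite sN.
have sz : size s == N by apply/eqP.
have Dty : D (t, y) by split => //=; exact: ltW.
have /= h := HM (Tuple sz) (t, y) Dty.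
rewrite (le_trans h)// (bigD1 (Tuple sz))//= (le_trans (ler_norm _))// lerDl sumr_ge0//.
Qed.

Lemma tube_taylor g q s0 N : C0n_in D q g -> (size s0 + N < q)%N ->
  (forall w, mi_deg w = (size s0 + N).+1 -> [bounded pderive_mi D w g z.1 z.2 | z in D]) ->
  exists2 C, 0 <= C & forall t (d : 'cV[R]_n), t0 <= t -> `|d| < a ->
  `|pderive_seq D s0 g t (phi0 t + d) - \sum_(w <- mi_list (rev (enum 'I_n)) N)
     ((mi_fact w)%:R^-1 * \prod_j d j 0 ^+ w j) *:
      pderive_seq D (mi_seq (enum 'I_n) w ++ s0) g t (phi0 t)| <= C * `|d| ^+ N.+1.
Proof.
move=> gC sq gB; have [M M0 HM] := pderive_seq_bounded gC sq gB.
have ue : uniq (rev (enum 'I_n)) by rewrite rev_uniq enum_uniq.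
pose c := iter (size (rev (enum 'I_n))) (fun x : R => 1 + q%:R * x) 0 * M.
have c0 : 0 <= c.
  rewrite /c mulr_ge0//; elim: (size _) => //= k IH; by rewrite addr_ge0// mulr_ge0.
exists c => // t d tt da; apply: mx_norm_le; first by rewrite mulr_ge0// exprn_ge0.
move=> i j; rewrite (ord1 j) !mxE summxE.
have := @taylor_partials R n (phi0 t) a q (fun s y => pderive_seq D s g t y i 0) _ d M da M0
  (rev (enum 'I_n)) N s0 ue sq _.
rewrite tay_mi_list// revK (_ : \col_i _ = d); last first.
  by apply/matrixP => k l; rewrite (ord1 l) !mxE mem_rev mem_enum.
move=> h; apply: le_trans (h _ _).
- rewrite le_eqVlt; apply/orP; left; apply/eqP; congr (`|_ - _|); apply: eq_bigr => w _.
  by rewrite !mxE mulrAC.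
- by move=> s1 j1 y1 s1q y1a; exact: (pderive_seq_is_derive _ _ gC).
- by move=> s1 z s1N za; rewrite (le_trans (mx_entry_le _ _ _))// HM.
Qed.

Lemma tube_quadratic g q : C0n_in D q g -> (1 < q)%N ->
  (forall w, mi_deg w = 2 -> [bounded pderive_mi D w g z.1 z.2 | z in D]) ->
  exists2 C, 0 <= C & forall t (y r r' : 'cV[R]_n) (rho : R), t0 <= t ->
  `|y - phi0 t| + rho < a -> `|r| <= rho -> `|r'| <= rho ->
  `|g t (y + r) - g t (y + r') - jacobian_in D g t y *m (r - r')| <= C * rho * `|r - r'|.
Proof.
move=> gC sq gB; have [M M0 HM] := pderive_seq_bounded gC sq gB.
exists (n%:R ^+ 2 * M); first by rewrite mulr_ge0// exprn_ge0.
move=> t y r r' rho tt ya rr rr'.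
have rho0 : 0 <= rho by apply: le_trans rr.
apply: mx_norm_le => [|i j]; first by rewrite !mulr_ge0// exprn_ge0.
have Om z : `|z| <= rho -> `|y + z - phi0 t| < a.
  by move=> zr; rewrite addrAC (le_lt_trans (ler_normD _ _))// (le_lt_trans _ ya)// lerD2l.
have := @quadratic_bound R n (phi0 t) a q (fun s y => pderive_seq D s g t y i 0) _
  [::] y r r' rho M sq rr rr' M0 Om _.
rewrite (ord1 j) !mxE => h; apply: le_trans (h _ _).
- rewrite le_eqVlt; apply/orP; left; apply/eqP; congr (`|_ - _|); apply: eq_bigr => k _.
  by rewrite !mxE.
- by move=> s1 j1 y1 s1q y1a; exact: (pderive_seq_is_derive _ _ gC).
- by move=> z i1 j1 zr; rewrite (le_trans (mx_entry_le _ _ _))// HM// Om.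
Qed.

End Tube.

(** * Number of independent parameters *)

Section Dimension.
Context {R : realType}.

(* Packing: a grid of M^N points of the cube, pairwise far apart, is mapped by a
   bi-Lipschitz map into distinct cells of a grid of O(M)^n cells. *)
Lemma independent_family_dim {n : nat} (P : (R -> 'cV[R]_n) -> Prop) (T : R) N :
  independent_family P T N -> (N <= n)%N.
Proof.
move=> [d [r [d0 _ [L L0 HL]]]].
(* The images lie within L d of the base image, which is 2 L^2 M cells of side h = d / (2 L M). So K
   M cells in each direction suffice, and after a shift by K M the cell numbers are below 3 K M. *)
pose K := (Num.bound (2 * L ^+ 2)).+1.
have KL : 2 * L ^+ 2 <= K%:R.
  have h0 : 0 <= 2 * L ^+ 2 by rewrite mulr_ge0// sqr_ge0.
  by rewrite (le_trans (ltW (archi_boundP h0)))// ler_nat.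
suff H M : (0 < M)%N -> (M ^ N <= ((3 * K) * M) ^ n)%N.
  rewrite leqNgt; apply/negP => nN.
  (* If n < N, then M^(n+1) <= (3K)^n M^n, hence M <= (3K)^n. *)
  pose M := ((3 * K) ^ n).+1.
  have h1 : (M ^ n.+1 <= (3 * K) ^ n * M ^ n)%N.
    by rewrite -expnMn (leq_trans _ (H M isT))// leq_pexp2l.
  by move: h1; rewrite expnS leq_pmul2r ?expn_gt0// ltnn.
move=> M0; have M0' : 0 < M%:R :> R by rewrite ltr0n.
pose c (u : {ffun 'I_N -> 'I_M}) : 'rV[R]_N := \row_i ((u i : nat)%:R * (d / M%:R)).
have cd u i : `|c u 0 i| < d.
  rewrite mxE ger0_norm ?mulr_ge0 ?divr_ge0 ?(ltW d0)// mulrCA gtr_pMr//.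
  by rewrite ltr_pdivrMr// mul1r ltr_nat.
pose u0 : {ffun 'I_N -> 'I_M} := [ffun=> Ordinal M0].
(* Points sharing a cell have images at distance at most h, hence parameters at distance at most L
   h, which is half the grid step d / M. *)
pose h := d / (2 * L * M%:R).
have h0 : 0 < h by rewrite divr_gt0// !mulr_gt0.
pose x u j := (r (c u) T j 0 - r (c u0) T j 0) / h + (K * M)%:R.
have cc u u' : `|c u - c u'| <= d.
  apply: mx_norm_le => [|i j]; first exact: ltW.
  have M1 : d / M%:R * M%:R = d by rewrite divfK// gt_eqF.
  rewrite !mxE -mulrBl normrM (ger0_norm (divr_ge0 (ltW d0) (ltW M0'))).
  rewrite -[leRHS]M1 [leRHS]mulrC ler_wpM2r ?divr_ge0 ?(ltW d0)//.
  have a1 : ((u j)%:R : R) <= M%:R by rewrite ler_nat ltnW.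
  have a2 : ((u' j)%:R : R) <= M%:R by rewrite ler_nat ltnW.
  have a3 : 0 <= ((u j)%:R : R) by []. have a4 : 0 <= ((u' j)%:R : R) by [].
  by rewrite ler_norml; lra.
have xb u j : 0 <= x u j <= (2 * (K * M))%:R.
  have [h1 _] := HL (c u) (c u0) (cd u) (cd u0).
  have h2 : `|r (c u) T j 0 - r (c u0) T j 0| <= L * d.
    have := mx_entry_le (r (c u) T - r (c u0) T) j 0; rewrite !mxE => h3.
    by rewrite (le_trans h3)// (le_trans h1)// ler_pM2l.
  have h3 : `|(r (c u) T j 0 - r (c u0) T j 0) / h| <= (K * M)%:R.
    rewrite normrM normfV (gtr0_norm h0) ler_pdivrMr// (le_trans h2)//.
    rewrite natrM /h.
    have -> : K%:R * M%:R * (d / (2 * L * M%:R)) = K%:R * (d / (2 * L)).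
      by field; rewrite !gt_eqF.
    have -> : L * d = (2 * L ^+ 2) * (d / (2 * L)) by field; rewrite gt_eqF.
    by rewrite ler_pM2r// divr_gt0// mulr_gt0.
  by move: h3; rewrite /x (natrM _ 2) ler_norml; lra.
have x_lt u j : (Num.trunc (x u j) < (3 * K) * M)%N.
  have /andP[x0 x1] := xb u j.
  have /andP[h1 _] := truncn_itv x0.
  rewrite -(ltr_nat R) (le_lt_trans h1)// (le_lt_trans x1)// ltr_nat -mulnA ltn_mul2r.
  by rewrite muln_gt0 M0.
pose cell u : {ffun 'I_n -> 'I_((3 * K) * M)} := [ffun j => Ordinal (x_lt u j)].
suff ci : injective cell.
  by have := leq_card cell ci; rewrite !card_ffun !card_ord.
move=> u u' E; apply/eqP/negPn/negP => uu'.
have [i uui] : exists i, u i != u' i.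
  apply/existsP; rewrite -negb_forall; apply: contra uu' => /forallP e.
  by apply/eqP/ffunP => i; apply/eqP.
have far : d / M%:R <= `|c u - c u'|.
  have := mx_entry_le (c u - c u') 0 i; rewrite !mxE -mulrBl normrM.
  rewrite (ger0_norm (divr_ge0 (ltW d0) (ltW M0'))); apply: le_trans.
  rewrite ler_peMl ?divr_ge0 ?(ltW d0)//.
  wlog lt_u : u u' uui {E uu'} / (u i < u' i)%N.
    move=> W; have [lt|lt|/val_inj e] := ltngtP (u i) (u' i); first exact: W.
      by rewrite distrC; apply: W => //; rewrite eq_sym.
    by rewrite e eqxx in uui.
  rewrite distrC ger0_norm ?subr_ge0 ?ler_nat ?(ltnW lt_u)//.
  by rewrite -natrB ?(ltnW lt_u)// ler1n subn_gt0.
have near : `|r (c u) T - r (c u') T| <= h.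
  apply: mx_norm_le => [|j k]; first exact: ltW.
  rewrite (ord1 k) !mxE.
  have e : Num.trunc (x u j) = Num.trunc (x u' j).
    by have := congr1 (fun f : {ffun 'I_n -> 'I_((3 * K) * M)} => val (f j)) E; rewrite !ffunE.
  have /andP[a1 a2] := truncn_itv (andP (xb u j)).1.
  have /andP[b1 b2] := truncn_itv (andP (xb u' j)).1.
  rewrite -e in b1 b2.
  have : `|x u j - x u' j| <= 1.
    by move: a1 a2 b1 b2; rewrite -natr1 ler_norml; lra.
  have -> : x u j - x u' j = (r (c u) T j 0 - r (c u') T j 0) / h by rewrite /x; field; rewrite gt_eqF.
  by rewrite normrM normfV (gtr0_norm h0) ler_pdivrMr// mul1r.
have [_ h2] := HL (c u) (c u') (cd u) (cd u').
have := le_trans far (le_trans h2 (ler_wpM2l (ltW L0) near)).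
have -> : L * h = (d / M%:R) / 2 by rewrite /h; field; rewrite !gt_eqF.
have := divr_gt0 d0 M0'; lra.
Qed.

End Dimension.

(** * Formal monomials *)

Section MonomialMorphisms.
Context {m : nat}.
Implicit Types (b c : mon m) (i : 'I_m * nat).

Lemma mulcmE_divcm b i : i \in finsupp b -> b = mulcm (divcm b (ucm i)) (ucm i).
Proof.
move=> ib; apply/eqP/cmP => j; rewrite mulcmE divcmE ucmE.
case: eqVneq => [<-|_]; last by rewrite subn0 addn0.
by rewrite subnK// lt0n cmE_neq0.
Qed.

Context {R : realType}.
Variable varrho : 'I_m -> R.

Lemma mon_rankEw b (d : {fset ('I_m * nat)%type}) : (finsupp b `<=` d)%fset ->
  mon_rank varrho b = \sum_(i <- d) (varrho i.1 + i.2%:R) *+ b i.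
Proof.
move=> bd; rewrite /mon_rank (big_fset_incl _ bd)// => i _.
by rewrite -cmE_eq0 => /eqP->.
Qed.

Lemma mon_rankM b c : mon_rank varrho (mulcm b c) = mon_rank varrho b + mon_rank varrho c.
Proof.
have h1 : (finsupp b `<=` finsupp b `|` finsupp c)%fset by exact: fsubsetUl.
have h2 : (finsupp c `<=` finsupp b `|` finsupp c)%fset by exact: fsubsetUr.
rewrite (mon_rankEw h1) (mon_rankEw h2) -big_split /= -mdomD.
by apply: eq_bigr => i _; rewrite mulcmE mulrnDr.
Qed.

Lemma mon_rankU i : mon_rank varrho (ucm i) = varrho i.1 + i.2%:R.
Proof. by rewrite /mon_rank mdomU big_seq_fset1 ucmE eqxx. Qed.

Lemma mon_rank1 : mon_rank varrho (onecm _) = 0.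
Proof. by rewrite /mon_rank mdom1 big_seq_fset0. Qed.

Hypothesis varrho_gt0 : forall l, 0 < varrho l.

Lemma mon_rank_ge0 b : 0 <= mon_rank varrho b.
Proof. by apply: sumr_ge0 => i _; rewrite mulrn_wge0// addr_ge0// ltW. Qed.

Lemma mon_rank_ge b i : i \in finsupp b -> varrho i.1 + i.2%:R <= mon_rank varrho b.
Proof. by move=> ib; rewrite (mulcmE_divcm ib) mon_rankM mon_rankU lerDr mon_rank_ge0. Qed.

Lemma mon_supp b : b != onecm _ -> exists i, i \in finsupp b.
Proof.
move=> b1; have [E|[i ib]] := fset_0Vmem (finsupp b); last by exists i.
move: b1; case/negP; apply/cmP => i; rewrite onecmE; apply/eqP; by rewrite cmE_eq0 E in_fset0.
Qed.

Lemma mon_deriv_rank b c : mcoeff c (mon_deriv (R := R) b) != 0 ->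
  mon_rank varrho c = mon_rank varrho b + 1.
Proof.
rewrite /mon_deriv raddf_sum /= => h.
have [i ib hi] : exists2 i, i \in finsupp b & mcoeff c (mkmalgU (mulcm (divcm b (ucm i)) (ucm (i.1, i.2.+1)))
   ((b i)%:R : R)) != 0.
  apply/not_exists2P => H; move: h; rewrite big_seq big1 ?eqxx// => i ib.
  by have [//|/negP/negPn/eqP] := H i.
move: hi; rewrite mcoeffU; case: (_ =P c) => [<- _|_]; last by rewrite mulr0n eqxx.
rewrite mon_rankM mon_rankU /= [in RHS](mulcmE_divcm ib) mon_rankM mon_rankU.
by rewrite -natr1 !addrA.
Qed.

(** The filtration of formal polynomials by rank. It is multiplicative, and this decides which
    coefficients vanish without computing products. *)
Definition ranked (r : R) (g : malg (mon m) R) : Prop :=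
  forall b, mcoeff b g != 0 -> r <= mon_rank varrho b.

Lemma ranked0 r : ranked r 0.
Proof. by move=> b; rewrite mcoeff0 eqxx. Qed.

Lemma rankedD r g h : ranked r g -> ranked r h -> ranked r (g + h).
Proof.
move=> rg rh b; rewrite mcoeffD => gh; have [g0|] := eqVneq (mcoeff b g) 0; last exact: rg.
by apply: rh; move: gh; rewrite g0 add0r.
Qed.

Lemma rankedN r g : ranked r g -> ranked r (- g).
Proof. by move=> rg b; rewrite mcoeffN oppr_eq0; exact: rg. Qed.

Lemma ranked_sum r (I : eqType) (s : seq I) (F : I -> malg (mon m) R) :
  (forall x : I, x \in s -> ranked r (F x)) -> ranked r (\sum_(i <- s) F i).
Proof.
by move=> rF; rewrite big_seq; apply: (big_ind (ranked r)) => [||//]; [exact: ranked0|exact: rankedD].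
Qed.

Lemma rankedU r b x : r <= mon_rank varrho b -> ranked r (mkmalgU b x).
Proof. by move=> rb c; rewrite mcoeffU; case: (b =P c) => [<- //|_]; rewrite mulr0n eqxx. Qed.

Lemma rankedM r r' g h : ranked r g -> ranked r' h -> ranked (r + r') (g * h).
Proof.
move=> rg rh b; rewrite mcoeff_neq0 => /msuppM_le[c [c' [cg ch ->]]].
by rewrite mon_rankM lerD//; [apply: rg|apply: rh]; rewrite mcoeff_neq0.
Qed.

Lemma ranked_any g : ranked 0 g.
Proof. by move=> b _; exact: mon_rank_ge0. Qed.

Lemma ranked_exp r g k : ranked r g -> ranked (k%:R * r) (g ^+ k).
Proof.
move=> rg; elim: k => [|k IH]; first by rewrite mul0r; exact: ranked_any.
by rewrite exprS -natr1 mulrDl mul1r addrC; exact: rankedM.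
Qed.

Lemma ranked_prod_exp r {n : nat} (g : 'I_n -> malg (mon m) R) (w : {ffun 'I_n -> nat}) :
  (forall j, ranked r (g j)) -> ranked ((mi_deg w)%:R * r) (\prod_j g j ^+ w j).
Proof.
move=> rg; rewrite /mi_deg natr_sum mulr_suml.
apply: (big_ind2 (fun x y => ranked x y)) => [|x y x' y' h1 h2|j _].
- exact: ranked_any.
- exact: rankedM.
- exact: ranked_exp.
Qed.

(** A perturbation of rank at least r in the factors perturbs the product in rank at least r, by
    telescoping. This shows below that later coefficients do not influence earlier ones. *)
Lemma ranked_prod_diff r {n : nat} (g h : 'I_n -> malg (mon m) R) (w : {ffun 'I_n -> nat}) :
  (forall j, ranked r (g j - h j)) -> ranked r (\prod_j g j ^+ w j - \prod_j h j ^+ w j).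
Proof.
move=> rgh; have rexp j k : ranked r (g j ^+ k - h j ^+ k).
  by rewrite subrXX -[r]addr0; apply: rankedM => //; exact: ranked_any.
apply: (big_ind2 (fun x y => ranked r (x - y))) => [|x y x' y' h1 h2|j _].
- by rewrite subrr; exact: ranked0.
- have -> : x * x' - y * y' = (x - y) * x' + (x' - y') * y.
    by rewrite !mulrBl [x' * y]mulrC [y' * y]mulrC addrA subrK.
  by apply: rankedD; rewrite -[r]addr0; apply: rankedM => //; exact: ranked_any.
- exact: rexp.
Qed.

End MonomialMorphisms.

Section Evaluation.
Context {R : realType} {m : nat}.
Implicit Types (b c : mon m) (h : mon m -> R) (g : malg (mon m) R).

Definition lin_ext h g : R := mmap idfun h g.

Lemma lin_extD h : {morph lin_ext h : x y / x + y}.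
Proof. by move=> x y; rewrite /lin_ext mmapD. Qed.

Lemma lin_ext0 h : lin_ext h 0 = 0.
Proof. by rewrite /lin_ext mmap0. Qed.

Lemma lin_extN h : {morph lin_ext h : x / - x}.
Proof. by move=> x; rewrite /lin_ext mmapN. Qed.

Lemma lin_extU h b x : lin_ext h (mkmalgU b x) = x * h b.
Proof. by rewrite /lin_ext mmapU. Qed.

Lemma lin_ext_sum h (I : Type) (s : seq I) (P : pred I) (F : I -> malg (mon m) R) :
  lin_ext h (\sum_(i <- s | P i) F i) = \sum_(i <- s | P i) lin_ext h (F i).
Proof. exact: (big_morph _ (lin_extD h) (lin_ext0 h)). Qed.

Lemma scale_malgU x b (y : R) : x *: mkmalgU b y = mkmalgU b (x * y).
Proof. by rewrite -mul_malgC malgM_def fgmulUU mul1m. Qed.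

Lemma lin_extZ h x g : lin_ext h (x *: g) = x * lin_ext h g.
Proof.
rewrite [g]monalgE scaler_sumr !lin_ext_sum mulr_sumr; apply: eq_bigr => b _.
move: (mcoeff b g) => y.
transitivity (lin_ext h (mkmalgU b (x * y))); first by congr lin_ext; exact: scale_malgU.
transitivity (x * y * h b); first exact: lin_extU.
transitivity (x * (y * h b)); first by rewrite mulrA.
by congr (_ * _); apply/esym; exact: lin_extU.
Qed.

(** Evaluation at a fixed time is thus a ring morphism, by which formal identities become identities
    of functions. *)
Lemma lin_extM h : (forall b c, h (mulcm b c) = h b * h c) ->
  {morph lin_ext h : x y / x * y}.
Proof.
move=> hM x y; rewrite malgME lin_ext_sum.
rewrite [RHS](_ : _ = (\sum_(k <- msupp x) mcoeff k x * h k) * (\sum_(k <- msupp y) mcoeff k y * h k))//.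
rewrite big_distrl /=.
apply: eq_bigr => k1 _; rewrite lin_ext_sum big_distrr /=; apply: eq_bigr => k2 _.
rewrite lin_extU [h _]hM; ring.
Qed.

Lemma lin_ext1 h : h (onecm _) = 1 -> lin_ext h 1 = 1.
Proof. by move=> h1; rewrite -[1]mpolyC1E lin_extU h1 mulr1. Qed.

Lemma lin_extX h k g : h (onecm _) = 1 -> (forall b c, h (mulcm b c) = h b * h c) ->
  lin_ext h (g ^+ k) = lin_ext h g ^+ k.
Proof.
by move=> h1 hM; elim: k => [|k IH]; rewrite ?expr0 ?lin_ext1// !exprS lin_extM// IH.
Qed.

Variables (t0 : R) (eps : 'I_m -> R -> R).

Lemma mon_evalEw b (d : {fset ('I_m * nat)%type}) t : (finsupp b `<=` d)%fset ->
  mon_eval t0 eps b t = \prod_(i <- d) derive_in_n (ray t0) i.2 (eps i.1) t ^+ b i.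
Proof.
move=> bd; rewrite /mon_eval (big_fset_incl _ bd)// => i _.
by rewrite -cmE_eq0 => /eqP->; rewrite expr0.
Qed.

Lemma mon_evalM b c t :
  mon_eval t0 eps (mulcm b c) t = mon_eval t0 eps b t * mon_eval t0 eps c t.
Proof.
have h1 : (finsupp b `<=` finsupp b `|` finsupp c)%fset by exact: fsubsetUl.
have h2 : (finsupp c `<=` finsupp b `|` finsupp c)%fset by exact: fsubsetUr.
rewrite (mon_evalEw _ h1) (mon_evalEw _ h2) -big_split /= -mdomD.
by apply: eq_bigr => i _; rewrite mulcmE exprD.
Qed.

Lemma mon_evalU i t : mon_eval t0 eps (ucm i) t = derive_in_n (ray t0) i.2 (eps i.1) t.
Proof. by rewrite /mon_eval mdomU big_seq_fset1 ucmE eqxx expr1. Qed.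

Lemma mon_eval1 t : mon_eval t0 eps (onecm _) t = 1.
Proof. by rewrite /mon_eval mdom1 big_seq_fset0. Qed.

End Evaluation.

Section Families.
Context {R : realType} {m : nat}.
Variable t0 : R.
Implicit Types (Pc : (R -> R) -> Prop) (Pb : mon m -> Prop) (G : R -> malg (mon m) R).

(* Formal polynomials over functions of t, in an explicit monomial representation. *)
Definition fam Pc Pb G : Prop :=
  exists (I : finType) (B : I -> mon m) (c : I -> R -> R),
    [/\ forall i, Pb (B i), forall i, Pc (c i) &
    forall t, t0 <= t -> G t = \sum_i mkmalgU (B i) (c i t)].

Lemma fam0 Pc Pb : fam Pc Pb (fun=> 0).
Proof.
exists 'I_0, (fun=> onecm _), (fun _ _ => 0); split=> [[]//|[]//|t _].
by rewrite big_ord0.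
Qed.

Lemma famU Pc Pb b c : Pb b -> Pc c -> fam Pc Pb (fun t => mkmalgU b (c t)).
Proof. by move=> Pbb Pcc; exists 'I_1, (fun=> b), (fun=> c); split=> // t _; rewrite big_ord1. Qed.

Lemma fam_eq Pc Pb G G' : (forall t, t0 <= t -> G t = G' t) -> fam Pc Pb G -> fam Pc Pb G'.
Proof.
move=> GG [I [B [c [h1 h2 h3]]]]; exists I, B, c; split=> // t tt.
by rewrite -GG// h3.
Qed.

Lemma famD Pc Pb G G' : fam Pc Pb G -> fam Pc Pb G' -> fam Pc Pb (fun t => G t + G' t).
Proof.
move=> [I [B [c [h1 h2 h3]]]] [I' [B' [c' [h1' h2' h3']]]].
exists (I + I')%type, (fun x => match x with inl i => B i | inr i => B' i end),
  (fun x => match x with inl i => c i | inr i => c' i end).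
split=> [[]//|[]//|t tt].
by rewrite big_sumType h3// h3'.
Qed.

Lemma famM Pc Pc' Pc'' Pb Pb' Pb'' G G' :
  (forall f g, Pc f -> Pc' g -> Pc'' (fun t => f t * g t)) ->
  (forall b b', Pb b -> Pb' b' -> Pb'' (mulcm b b')) ->
  fam Pc Pb G -> fam Pc' Pb' G' -> fam Pc'' Pb'' (fun t => G t * G' t).
Proof.
move=> PcM PbM [I [B [c [h1 h2 h3]]]] [I' [B' [c' [h1' h2' h3']]]].
exists (I * I')%type, (fun x => mulcm (B x.1) (B' x.2)), (fun x t => c x.1 t * c' x.2 t).
split=> [i|i|t tt]; [exact: PbM|exact: PcM|].
rewrite h3// h3'// big_distrlr /= pair_big /=.
by apply: eq_bigr => i _; rewrite malgM_def fgmulUU.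
Qed.

Lemma famZ Pc Pc' Pc'' Pb c G :
  (forall f g, Pc f -> Pc' g -> Pc'' (fun t => f t * g t)) ->
  Pc c -> fam Pc' Pb G -> fam Pc'' Pb (fun t => c t *: G t).
Proof.
move=> PcM Pcc [I [B [d [h1 h2 h3]]]].
exists I, B, (fun i t => c t * d i t); split=> [//|i|t tt]; first exact: PcM.
rewrite h3// scaler_sumr; apply: eq_bigr => i _.
by rewrite scale_malgU.
Qed.

Lemma fam_sum Pc Pb (J : eqType) (s : seq J) (P : pred J) (F : J -> R -> malg (mon m) R) :
  (forall j, j \in s -> P j -> fam Pc Pb (F j)) -> fam Pc Pb (fun t => \sum_(j <- s | P j) F j t).
Proof.
elim: s => [_|j s IH hF].
  by apply: fam_eq (fam0 _ _) => t _; rewrite big_nil.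
have {}IH : fam Pc Pb (fun t => \sum_(j <- s | P j) F j t).
  by apply: IH => i si; apply: hF; rewrite inE si orbT.
have [Pj|Pj] := boolP (P j).
  by apply: fam_eq (famD (hF j (mem_head _ _) Pj) IH) => t _; rewrite big_cons Pj.
by apply: fam_eq IH => t _; rewrite big_cons (negbTE Pj).
Qed.

Lemma fam_exp Pc Pb G k : Pc (fun=> 1) -> Pb (onecm _) ->
  (forall f g, Pc f -> Pc g -> Pc (fun t => f t * g t)) ->
  (forall b b', Pb b -> Pb b' -> Pb (mulcm b b')) ->
  fam Pc Pb G -> fam Pc Pb (fun t => G t ^+ k).
Proof.
move=> P1 Pb1 PcM PbM hG; elim: k => [|k IH].
  by apply: fam_eq (famU Pb1 P1) => t _; rewrite expr0.
by apply: fam_eq (famM PcM PbM hG IH) => t _; rewrite exprS.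
Qed.

Lemma fam_prod_exp Pc Pb (n : nat) (G : 'I_n -> R -> malg (mon m) R) (w : {ffun 'I_n -> nat}) :
  Pc (fun=> 1) -> Pb (onecm _) ->
  (forall f g, Pc f -> Pc g -> Pc (fun t => f t * g t)) ->
  (forall b b', Pb b -> Pb b' -> Pb (mulcm b b')) ->
  (forall j, fam Pc Pb (G j)) -> fam Pc Pb (fun t => \prod_j G j t ^+ w j).
Proof.
move=> P1 Pb1 PcM PbM hG.
suff H (s : seq 'I_n) : fam Pc Pb (fun t => \prod_(j <- s) G j t ^+ w j) by exact: H.
elim: s => [|j s IH].
  by apply: fam_eq (famU Pb1 P1) => t _; rewrite big_nil.
have hj := fam_exp (w j) P1 Pb1 PcM PbM (hG j).
by apply: fam_eq (famM PcM PbM hj IH) => t _; rewrite big_cons.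
Qed.

Lemma fam_mcoeff Pc Pb G b : fam Pc Pb G ->
  Pc (fun=> 0) -> (forall f g, Pc f -> Pc g -> Pc (fun t => f t + g t)) ->
  (forall f g, (forall t, t0 <= t -> f t = g t) -> Pc f -> Pc g) ->
  Pc (fun t => mcoeff b (G t)).
Proof.
move=> [I [B [c [h1 h2 h3]]]] P0 PD Peq.
apply: (Peq (fun t => \sum_(i <- index_enum I) (if B i == b then c i t else 0))).
  move=> t tt; rewrite h3// raddf_sum /=; apply: eq_bigr => i _.
  by rewrite mcoeffU; case: eqP.
elim: (index_enum I) => [|i s IH].
  by apply: Peq P0 => t _; rewrite big_nil.
apply: (Peq (fun t => (if B i == b then c i t else 0) + \sum_(i <- s) (if B i == b then c i t else 0))).
  by move=> t _; rewrite big_cons.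
by apply: PD => //; case: eqP => _; [exact: h2|exact: P0].
Qed.

End Families.

(** * One-sided derivatives, closure of the class [K], and linear equations solved in it *)

Section RayDerivative.
Context {R : realType} {V : normedModType R}.
Implicit Types (h : R -> V).

Lemma ray_within_proper (t0 x : R) : t0 <= x -> ProperFilter (within (ray t0) x^').
Proof.
move=> tx; apply: Build_ProperFilter_ex => P /nbhs_ballP[e e0 He].
exists (x + e / 2); apply: He.
- by rewrite -ball_normE /ball_/= opprD addrA subrr sub0r normrN gtr0_norm ?divr_gt0// ltr_pdivrMr// ltr_pMr// ltr1n.
- by rewrite /= -subr_eq0 addrAC subrr add0r gt_eqF// divr_gt0.
- by apply/rayE; rewrite (le_trans tx)// lerDl divr_ge0// ltW.
Qed.

Definition growth_rate h (x y : R) : V := (y - x)^-1 *: (h y - h x).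

Lemma derive_in_rayP (t0 x : R) h d : t0 <= x ->
  (derivable_in (ray t0) h x /\ derive_in (ray t0) h x = d) <->
  growth_rate h x @ within (ray t0) x^' --> d.
Proof.
move=> tx; have FF := ray_within_proper tx; split=> [[dh <-]|hd]; first exact: dh.
split; first by apply/cvg_ex; exists d.
exact: cvg_lim hd.
Qed.

End RayDerivative.

Section ClosureK.
Context {R : realType}.
Variables (t0 : R) (L : set R[i]) (K : set (R -> R)).
Hypothesis hK : classK3 t0 L K.

Lemma K_ext f g : (forall t, t0 <= t -> f t = g t) -> K f -> K g.
Proof. by move=> fg; apply: (K3_ext hK) => t /rayE/fg. Qed.

Lemma K_0 : K (fun=> 0).
Proof.
have [f Kf] := K3_nonempty hK.
by apply: K_ext (K3_scale hK 0 Kf) => t _; rewrite mul0r.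
Qed.

Lemma K_sum (I : Type) (s : seq I) (F : I -> R -> R) :
  (forall i, K (F i)) -> K (fun t => \sum_(i <- s) F i t).
Proof.
move=> KF; elim: s => [|i s IH]; first by apply: K_ext K_0 => t _; rewrite big_nil.
by apply: K_ext (K3_add hK (KF i) IH) => t _; rewrite big_cons.
Qed.

Lemma K_opp f : K f -> K (fun t => - f t).
Proof. by move=> Kf; apply: K_ext (K3_scale hK (-1) Kf) => t _; rewrite mulN1r. Qed.

Lemma K_sub f g : K f -> K g -> K (fun t => f t - g t).
Proof. by move=> Kf /K_opp; exact: (K3_add hK). Qed.

(* The class K need not contain the constants. *)
Definition K1 (f : R -> R) : Prop :=
  exists (k : R -> R) (c : R), K k /\ forall t, t0 <= t -> f t = k t + c.

Lemma K1_cst c : K1 (fun=> c).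
Proof. by exists (fun=> 0), c; split=> [|t _]; [exact: K_0|rewrite add0r]. Qed.

Lemma K_K1 f : K f -> K1 f.
Proof. by move=> Kf; exists f, 0; split=> // t _; rewrite addr0. Qed.

Lemma K1_mul f g : K1 f -> K1 g -> K1 (fun t => f t * g t).
Proof.
move=> [k [c [Kk fE]]] [k' [c' [Kk' gE]]].
exists (fun t => k t * k' t + (c' * k t + c * k' t)), (c * c'); split.
  apply: (K3_add hK); first exact: (K3_mul hK).
  by apply: (K3_add hK); exact: (K3_scale hK).
by move=> t tt; rewrite fE// gE//; ring.
Qed.

Lemma K_mulK1 f g : K f -> K1 g -> K (fun t => f t * g t).
Proof.
move=> Kf [k [c [Kk gE]]]; apply: (@K_ext (fun t => f t * k t + c * f t)).
  by move=> t tt; rewrite gE//; ring.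
by apply: (K3_add hK); [exact: (K3_mul hK)|exact: (K3_scale hK)].
Qed.

Lemma K_bounded f : K f -> exists C : R, forall t, t0 <= t -> `|f t| <= C.
Proof.
move=> /(K3_bounded hK)[M [_ HM]]; exists (M + 1) => t /rayE tt.
by apply: (HM (M + 1)) => //; lra.
Qed.

Lemma K_cts f T : t0 < T -> K f -> cts T f.
Proof. by move=> tT /(K3_continuous hK); exact: cts_within. Qed.

(* Condition (3) on the class. *)
Lemma K_mean f : K f -> exists M : R, forall T, t0 <= T ->
  forall G, (forall t, T <= t -> is_derive t 1 G (f t - M)) ->
  exists C : R, forall t, T <= t -> `|G t| <= C.
Proof.
move=> Kf; have [M [_ [B [_ HB]]]] := K3_mean hK Kf.
exists M => T tT G dG.
have cf : {within ray t0, continuous (fun t => f t - M)}.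
  apply/subspace_continuousP => t tt; apply: cvgB; last exact: cvg_cst.
  by have /subspace_continuousP := K3_continuous hK Kf; apply.
have [H dH] := antiderivative cf.
have Hb t : t0 <= t -> `|H t - H t0| <= B + 1.
  move=> tt; rewrite -(integral_antiderivative cf dH (lexx t0) tt).
  by apply: (HB (B + 1)); [lra|exact/rayE].
exists (`|G T| + ((B + 1) + (B + 1))) => t Tt.
have dH' s : T <= s -> is_derive s 1 H (f s - M) by move=> Ts; apply: dH; apply: le_trans Ts.
have dGH s : T <= s -> is_derive s 1 (G - H) 0.
  by move=> Ts; apply: is_derive_eq (is_deriveB (dG s Ts) (dH' s Ts)) _; rewrite subrr.
have d0 s : T <= s -> is_derive s 1 (cst 0 : R -> R) 0 by move=> _; exact: is_derive_cst.
have h := derive_le dGH d0 (lexx T) Tt _.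
have {}h : `|(G - H) t - (G - H) T| <= 0.
  have -> : 0 = (cst 0 : R -> R) t - (cst 0 : R -> R) T by rewrite subrr.
  by apply: h => x _; rewrite normr0.
have e : (G - H) t - (G - H) T = 0 by apply/eqP; rewrite -normr_le0.
have : G t = G T + (H t - H T).
  by move: e; change ((G - H) t) with (G t - H t); change ((G - H) T) with (G T - H T); lra.
have := Hb t (le_trans tT Tt); have := Hb T tT.
have := ler_norm (G T); have := ler_norm (- G T); rewrite normrN.
by rewrite !ler_norml; lra.
Qed.

End ClosureK.

Section Diagonalization.
Context {F : fieldType} {n : nat}.

Lemma simple_spectrum_diagonalizable (A : 'M[F]_n) (lam : 'I_n -> F) :
  char_poly A = \prod_(j < n) ('X - (lam j)%:P) -> injective lam ->
  exists2 Q : 'M[F]_n, Q \in unitmx & Q *m A = diag_mx (\row_j lam j) *m Q.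
Proof.
move=> cA inj.
have /choice[v Hv] : forall j, exists v : 'rV[F]_n, v *m A = lam j *: v /\ v != 0.
  move=> j; have : eigenvalue A (lam j).
    rewrite eigenvalue_root_char cA; apply/rootP; rewrite horner_prod (bigD1 j)//=.
    by rewrite hornerXsubC subrr mul0r.
  by move=> /eigenvalueP[v vA v0]; exists v.
pose Q := \matrix_j v j.
exists Q; last first.
  apply/row_matrixP => j; rewrite row_mul rowK (Hv j).1 mul_diag_mx.
  by apply/rowP => l; rewrite !mxE.
rewrite -row_free_unit -kermx_eq0; apply/eqP/row_matrixP => i0; rewrite row0.
set c := row i0 (kermx Q).
have cQ : c *m Q = 0 by rewrite -row_mul mulmx_ker row0.
have pow k : \sum_j (c 0 j * lam j ^+ k) *: v j = 0.
  elim: k => [|k IH].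
    rewrite -[RHS]cQ mulmx_sum_row; apply: eq_bigr => j _.
    by rewrite expr0 mulr1 rowK.
  have := congr1 (mulmx^~ A) IH; rewrite mul0mx mulmx_suml => E; rewrite -[RHS]E.
  by apply: eq_bigr => j _; rewrite -scalemxAl (Hv j).1 scalerA exprSr mulrA.
pose W := \matrix_(j, l) (c 0 j * v j 0 l).
have VW : Vandermonde n (\row_j lam j) *m W = 0.
  apply/matrixP => k l; rewrite !mxE.
  have E := congr1 (fun M : 'rV[F]_n => M 0 l) (pow k).
  rewrite summxE !mxE in E; rewrite -[RHS]E.
  by apply: eq_bigr => j _; rewrite !mxE; ring.
have Vu : Vandermonde n (\row_j lam j) \in unitmx.
  rewrite unitmxE det_Vandermonde unitfE; apply/prodf_neq0 => i _; apply/prodf_neq0 => j ij.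
  by rewrite !mxE subr_eq0; apply/eqP => /inj ji; rewrite ji ltnn in ij.
have W0 : W = 0 by rewrite -(mulKmx Vu W) VW mulmx0.
apply/rowP => j; rewrite [RHS]mxE; apply/eqP; case: (rV0Pn _ (Hv j).2) => l vl.
have := congr1 (fun M : 'M[F]_n => M j l) W0; rewrite !mxE => /eqP.
by rewrite mulf_eq0 (negbTE vl) orbF.
Qed.

End Diagonalization.

Section ComplexParts.
Context {R : realType}.
Implicit Types x y : R[i].
Local Notation Re := complex.Re.
Local Notation Im := complex.Im.

Lemma ReD x y : Re (x + y) = Re x + Re y. Proof. by case: x; case: y. Qed.
Lemma ImD x y : Im (x + y) = Im x + Im y. Proof. by case: x; case: y. Qed.
Lemma ReM x y : Re (x * y) = Re x * Re y - Im x * Im y. Proof. by case: x; case: y. Qed.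
Lemma ImM x y : Im (x * y) = Re x * Im y + Im x * Re y. Proof. by case: x; case: y. Qed.
Lemma Re_sum (I : Type) (s : seq I) (P : pred I) (F : I -> R[i]) :
  Re (\sum_(i <- s | P i) F i) = \sum_(i <- s | P i) Re (F i).
Proof. exact: (big_morph _ ReD erefl). Qed.
Lemma Im_sum (I : Type) (s : seq I) (P : pred I) (F : I -> R[i]) :
  Im (\sum_(i <- s | P i) F i) = \sum_(i <- s | P i) Im (F i).
Proof. exact: (big_morph _ ImD erefl). Qed.
Lemma complex_eq x y : Re x = Re y -> Im x = Im y -> x = y.
Proof. by case: x => a b; case: y => c d /= -> ->. Qed.
Lemma Re_real (a : R) : Re (real_complex R a) = a. Proof. by []. Qed.
Lemma Im_real (a : R) : Im (real_complex R a) = 0. Proof. by []. Qed.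

End ComplexParts.

Section ComplexK.
Context {R : realType}.
Variables (t0 : R) (L : set R[i]) (K : set (R -> R)).
Hypothesis hK : classK3 t0 L K.
Implicit Types f g : R -> R[i].

Definition KC f : Prop := K (fun t => complex.Re (f t)) /\ K (fun t => complex.Im (f t)).

Lemma KC_ext f g : (forall t, t0 <= t -> f t = g t) -> KC f -> KC g.
Proof.
by move=> fg [h1 h2]; split; [apply: (K_ext hK) h1|apply: (K_ext hK) h2] => t /fg->.
Qed.

Lemma KC_0 : KC (fun=> 0).
Proof. by split; exact: (K_0 hK). Qed.

Lemma KC_add f g : KC f -> KC g -> KC (fun t => f t + g t).
Proof.
move=> [f1 f2] [g1 g2]; split.
  by apply: (K_ext hK) (K3_add hK f1 g1) => t _; rewrite ReD.
by apply: (K_ext hK) (K3_add hK f2 g2) => t _; rewrite ImD.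
Qed.

Lemma KC_mul f g : KC f -> KC g -> KC (fun t => f t * g t).
Proof.
move=> [f1 f2] [g1 g2]; split.
  apply: (K_ext hK) (K_sub hK (K3_mul hK f1 g1) (K3_mul hK f2 g2)) => t _.
  by rewrite ReM.
apply: (K_ext hK) (K3_add hK (K3_mul hK f1 g2) (K3_mul hK f2 g1)) => t _.
by rewrite ImM.
Qed.

Lemma KC_scale (c : R[i]) f : KC f -> KC (fun t => c * f t).
Proof.
move=> [f1 f2]; split.
  apply: (K_ext hK) (K_sub hK (K3_scale hK (complex.Re c) f1) (K3_scale hK (complex.Im c) f2)) => t _.
  by rewrite ReM.
apply: (K_ext hK) (K3_add hK (K3_scale hK (complex.Re c) f2) (K3_scale hK (complex.Im c) f1)) => t _.
by rewrite ImM.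
Qed.

Lemma KC_sum (I : Type) (s : seq I) (F : I -> R -> R[i]) :
  (forall i, KC (F i)) -> KC (fun t => \sum_(i <- s) F i t).
Proof.
move=> KF; elim: s => [|i s IH]; first by apply: KC_ext KC_0 => t _; rewrite big_nil.
by apply: KC_ext (KC_add (KF i) IH) => t _; rewrite big_cons.
Qed.

Lemma KC_real (f : R -> R) : K f -> KC (fun t => real_complex R (f t)).
Proof. by move=> Kf; split=> //; exact: (K_0 hK). Qed.

End ComplexK.

Section LinearSolve.
Context {R : realType} {n : nat}.
Variables (t0 : R) (A : 'M[R]_n) (lam : 'I_n -> R[i]) (K : set (R -> R)).
Hypothesis hlam : eigenvalues_of A lam.
Hypothesis hK : classK3 t0 (range lam `|` eigen_differences lam) K.
Hypothesis hdiff : ~ eigen_differences lam 0.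

Lemma eigenvalues_inj : injective lam.
Proof.
move=> j l E; apply: contra_notP hdiff => jl; exists j, l.
by split; [apply/eqP|rewrite E subrr].
Qed.

(** Diagonalisation reduces to n scalar complex equations, solvable in the class by its condition on
    eigenvalues. The real part of the vector obtained is again a solution because A and g are
    real. *)
Lemma K_linear_solve (g : R -> 'cV[R]_n) : vecK K g -> exists phi : R -> 'cV[R]_n,
  [/\ vecK K phi, Cn_in (ray t0) 1 phi & solves (ray t0) (fun t v => A *m v + g t) phi].
Proof.
move=> Kg; have [Q Qu QA] := simple_spectrum_diagonalizable hlam eigenvalues_inj.
have /choice[y Hy] : forall j, exists y : R -> R[i],
    [/\ K (fun t => complex.Re (y t)), K (fun t => complex.Im (y t)),
      Cn_in (ray t0) 1 (fun t => complex.Re (y t)),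
      Cn_in (ray t0) 1 (fun t => complex.Im (y t)) &
      forall t, ray t0 t ->
        derive_in (ray t0) (fun t => complex.Re (y t)) t
          = complex.Re (lam j * y t + \sum_i Q j i * real_complex R (g t i 0)) /\
        derive_in (ray t0) (fun t => complex.Im (y t)) t
          = complex.Im (lam j * y t + \sum_i Q j i * real_complex R (g t i 0))].
  move=> j.
  have [h1 h2] : KC K (fun t => \sum_i Q j i * real_complex R (g t i 0)).
    by apply: (KC_sum hK) => i; apply: (KC_scale hK); apply: (KC_real hK); exact: Kg.
  by apply: (K3_solve hK h1 h2); left; exists j.
pose P := invmx Q.
pose phi t : 'cV[R]_n := \col_i complex.Re (\sum_j P i j * y j t).
have phiE t i : phi t i 0 = \sum_j (complex.Re (P i j) * complex.Re (y j t) - complex.Im (P i j) * complex.Im (y j t)).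
  by rewrite mxE Re_sum; apply: eq_bigr => j _; rewrite ReM.
have Kphi : vecK K phi.
  move=> i; apply: (K_ext hK) (K_sum hK _ _) => [t _|j]; first by rewrite phiE.
  by have [y1 y2 _ _ _] := Hy j; apply: (K_sub hK); exact: (K3_scale hK).
have AP : map_mx (real_complex R) A *m P = P *m diag_mx (\row_j lam j).
  by rewrite -[LHS]mul1mx -(mulVmx Qu) -/P -[LHS]mulmxA; congr (_ *m _); rewrite mulmxA QA mulmxK.
have growth t : t0 <= t -> growth_rate phi t @ within (ray t0) t^' --> A *m phi t + g t.
  move=> tt; have FF := ray_within_proper tt; apply: cvg_mx => i j; rewrite (ord1 j) {j}.
  have -> : (fun x => growth_rate phi t x i 0) = (fun x => \sum_j
      (complex.Re (P i j) * growth_rate (fun s => complex.Re (y j s)  ) t x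
      - complex.Im (P i j) * growth_rate (fun s => complex.Im (y j s)  ) t x)).
    have mE (B C : 'cV[R]_n) (c : R) : (c *: (B - C)) i 0 = c * (B i 0 - C i 0) by rewrite !mxE.
    apply/funext => x; rewrite /growth_rate mE !phiE -sumrB mulr_sumr.
    by apply: eq_bigr => j _; rewrite /GRing.scale/=; ring.
  have -> : (A *m phi t + g t) i 0 = \sum_j
    (complex.Re (P i j) * complex.Re (lam j * y j t + \sum_i Q j i * real_complex R (g t i 0))
     - complex.Im (P i j) * complex.Im (lam j * y j t + \sum_i Q j i * real_complex R (g t i 0))).
    pose Y : 'cV[R[i]]_n := \col_j y j t.
    pose gC : 'cV[R[i]]_n := \col_i real_complex R (g t i 0).
    have e1 : (A *m phi t + g t) i 0 = complex.Re ((map_mx (real_complex R) A *m (P *m Y) + P *m (Q *m gC)) i 0).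
      rewrite /P mulKmx// !mxE ReD; congr (_ + _); rewrite Re_sum; apply: eq_bigr => k _.
      rewrite [map_mx _ _ _ _]mxE ReM Re_real Im_real mul0r subr0 /phi !mxE.
      by congr (_ * complex.Re _); apply: eq_bigr => j _; rewrite !mxE.
    rewrite e1 mulmxA AP -mulmxA -mulmxDr mxE Re_sum; apply: eq_bigr => j _.
    have -> : (diag_mx (\row_j lam j) *m Y + Q *m gC) j 0
        = lam j * y j t + \sum_i Q j i * real_complex R (g t i 0).
      by rewrite mul_diag_mx !mxE; congr (_ + _); apply: eq_bigr => k _; rewrite !mxE.
    by rewrite ReM.
  apply: cvg_big => [|j _]; first exact: add_continuous.
  have [_ _ c1 c2 /(_ t ((rayE _ _).2 tt))[d1 d2]] := Hy j.
  have [_ /(_ isT t ((rayE _ _).2 tt)) D1] := c1 0%N isT.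
  have [_ /(_ isT t ((rayE _ _).2 tt)) D2] := c2 0%N isT.
  apply: cvgB; apply: cvgM; (try exact: cvg_cst).
    exact: ((derive_in_rayP _ _ tt).1 (conj D1 d1)).
  exact: ((derive_in_rayP _ _ tt).1 (conj D2 d2)).
have sol : solves (ray t0) (fun t v => A *m v + g t) phi.
  by move=> t /rayE tt; apply/derive_in_rayP => //; exact: growth.
have cphi : {within ray t0, continuous phi}.
  apply/subspace_continuousP => t tt; apply: cvg_mx => i j; rewrite (ord1 j).
  by have /subspace_continuousP := K3_continuous hK (Kphi i); apply.
exists phi; split=> // r; rewrite leq_eqVlt ltnS leqn0 => /orP[/eqP->|/eqP->]; split=> //.
- apply: (@subspace_eq_continuous _ _ _ (fun t => A *m phi t + g t)).
    by move=> t; rewrite inE => /sol[_ <-].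
  apply/subspace_continuousP => t tt; apply: cvg_mx => i j; rewrite (ord1 j).
  have Ki : K (fun t => (A *m phi t + g t) i 0).
    apply: (K_ext hK) (K3_add hK (K_sum hK (index_enum 'I_n) (fun k => K3_scale hK (A i k) (Kphi k))) (Kg i)) => u _.
    by rewrite [RHS]mxE [in RHS]mxE.
  by have /subspace_continuousP := K3_continuous hK Ki; apply.
- by move=> _ t /sol[].
Qed.

End LinearSolve.

(** * The formal expansion *)

Section FormalExpansion.
Context {R : realType} {n m : nat}.
Variables (t0 : R) (A : 'M[R]_n) (lam : 'I_n -> R[i]) (K : set (R -> R)).
Hypothesis hlam : eigenvalues_of A lam.
Hypothesis hK : classK3 t0 (range lam `|` eigen_differences lam) K.
Hypothesis hdiff : ~ eigen_differences lam 0.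
Variables (D : set (R * 'cV[R]_n)) (fl : 'I_m.+1 -> R -> 'cV[R]_n -> 'cV[R]_n)
  (phi0 : R -> 'cV[R]_n) (varrho : 'I_m.+1 -> R) (rho : nat -> R)
  (nu : nat -> seq (mon m.+1)) (k : nat) (pk : 'I_m.+1 -> nat) (qk : 'I_m.+1 -> int).
Hypothesis hvarrho0 : forall l, 0 < varrho l.
Hypothesis hvarrho : forall l l' : 'I_m.+1, (l <= l')%N -> varrho l <= varrho l'.
Hypothesis hrho : ranks_enum varrho rho.
Hypothesis hnu : mons_enum varrho rho nu.
Hypothesis hpk : forall l, (pk l)%:Z = Num.max 0 (Num.floor (rho k - varrho l) + 1).
Hypothesis hqk : forall l, qk l = Num.floor ((rho k - varrho l) / varrho ord0).
Hypothesis hflK : forall l (w : {ffun 'I_n -> nat}), varrho l <= rho k ->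
  (mi_deg w)%:Z <= qk l -> vecK K (fun t => pderive_mi D w (fl l) t (phi0 t)).
Implicit Types (phi : mon m.+1 -> R -> 'cV[R]_n) (b : mon m.+1).

Lemma rank_ge_min b : b != onecm _ -> varrho ord0 <= mon_rank varrho b.
Proof.
move=> /mon_supp[i ib]; apply: le_trans (mon_rank_ge hvarrho0 ib).
by rewrite (@le_trans _ _ (varrho i.1)) ?lerDl// hvarrho.
Qed.

Lemma mem_nu s b : (1 <= s)%N -> b \in nu s <-> b != onecm _ /\ mon_rank varrho b = rho s.
Proof. by move=> s1; have [+ _] := hnu; move=> /(_ s s1)[_]; apply. Qed.

Lemma rank_nu b : b != onecm _ -> exists2 s, (1 <= s)%N & b \in nu s.
Proof.
move=> b1; have [_ /(_ (mon_rank varrho b))[_]] := hrho.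
case=> [|s s1 sb]; first by exists b.
by exists s => //; apply/mem_nu.
Qed.

Lemma rho_lt i j : (1 <= i)%N -> (1 <= j)%N -> (rho i < rho j) = (i < j)%N.
Proof.
move=> i1 j1; have [mono _] := hrho; have [ij|ij|->] := ltngtP i j; last by rewrite ltxx.
  by rewrite mono.
by apply/negbTE; rewrite -leNgt ltW// mono.
Qed.

Lemma rho_le i j : (1 <= i)%N -> (1 <= j)%N -> (rho i <= rho j) = (i <= j)%N.
Proof. by move=> i1 j1; rewrite leNgt rho_lt// -leqNgt. Qed.

(** Every nontrivial monomial has one of the enumerated ranks. The trivial monomial has rank 0 and
    is excluded by rho_s >= 0. *)
Lemma rank_gap b s : (1 <= s)%N -> rho s < mon_rank varrho b -> rho s.+1 <= mon_rank varrho b.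
Proof.
move=> s1 sb; have b1 : b != onecm _.
  apply: contraTneq sb => ->; rewrite mon_rank1 -leNgt.
  have [_ /(_ (rho s))[+ _]] := hrho; case; first by exists s.
  by move=> c _ <-; exact: mon_rank_ge0.
have [s' s'1 /(mem_nu _ s'1)[_ E]] := rank_nu b1.
by move: sb; rewrite E rho_lt// rho_le.
Qed.

Definition taylor_deg l := `|qk l|%N.

(** Taylor terms of higher degree have rank above rho_k, as [formal_delta] has rank at least
    varrho_1. The absolute value in [taylor_deg] is harmless because qk l >= 0 here. *)
Lemma taylor_degP l : varrho l <= rho k -> (taylor_deg l)%:Z = qk l /\
  rho k < varrho l + (taylor_deg l).+1%:R * varrho ord0.
Proof.
move=> lk; have q0 : 0 <= qk l by rewrite hqk floor_ge0 divr_ge0 ?subr_ge0// ltW.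
have E : (taylor_deg l)%:Z = qk l by rewrite /taylor_deg gez0_abs.
split=> //; rewrite -ltrBlDl -ltr_pdivrMr//.
have := lt_succ_floor ((rho k - varrho l) / varrho ord0).
by rewrite -hqk -E -natr1 intrD.
Qed.

Lemma delta_ranked phi t j r : (forall s b, (1 <= s <= k)%N -> b \in nu s -> phi b t j 0 = 0 \/ r <= rho s) ->
  ranked varrho r (formal_delta nu k phi t j).
Proof.
move=> H; apply: ranked_sum => s; rewrite mem_index_iota => sk.
apply: ranked_sum => b bs; have [->|rs] := H s b sk bs.
  by rewrite monalgU0; exact: ranked0.
by apply: rankedU; have /andP[s1 _] := sk; have [_ ->] := (mem_nu b s1).1 bs.
Qed.

Lemma rho_ge_min s : (1 <= s)%N -> varrho ord0 <= rho s.
Proof.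
move=> s1; have [_ /(_ (rho s))[+ _]] := hrho; case; first by exists s.
by move=> c c1 <-; exact: rank_ge_min.
Qed.

Lemma delta_ranked_min phi t j : ranked varrho (varrho ord0) (formal_delta nu k phi t j).
Proof. by apply: delta_ranked => s b /andP[s1 _] _; right; exact: rho_ge_min. Qed.

(** The product has rank at least varrho_l + |w| varrho_1 > rho_k. Hence the sum over all
    multi-indices in [formal_coef] is finite; if varrho_l > rho_k, it is empty. *)
Lemma mcoeff_high phi t l (w : {ffun 'I_n -> nat}) b : mon_rank varrho b <= rho k ->
  (varrho l <= rho k -> (taylor_deg l < mi_deg w)%N) ->
  mcoeff b (mkmalgU (ucm (l, 0%N)) 1 * \prod_j formal_delta nu k phi t j ^+ w j) = 0.
Proof.
move=> bk H; apply/eqP/negPn/negP => h.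
have : varrho l + (mi_deg w)%:R * varrho ord0 <= mon_rank varrho b.
  apply: rankedM h; first by apply: rankedU; rewrite mon_rankU addr0.
  by apply: ranked_prod_exp => // j; exact: delta_ranked_min.
move=> /le_trans/(_ bk) h1.
have lk : varrho l <= rho k.
  by apply: le_trans h1; rewrite lerDl mulr_ge0// ltW.
have [_ h2] := taylor_degP lk.
have := le_lt_trans h1 h2; rewrite ltrD2l ltr_pM2r// ltr_nat ltnS leqNgt.
by rewrite H.
Qed.

Lemma fsum_list (V : nmodType) (T : choiceType) (s : seq T) (F : T -> V) : uniq s ->
  (forall w, w \notin s -> F w = 0) -> \sum_(w \in [set: T]) F w = \sum_(w <- s) F w.
Proof.
move=> us F0; rewrite (fsbigE s _ us)//; last by move=> w _; exact: F0.
by apply: eq_bigl => w; rewrite in_setT.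
Qed.

Definition mis (N : nat) : seq {ffun 'I_n -> nat} := mi_list (rev (enum 'I_n)) N.

Lemma mem_mis N w : (w \in mis N) = (mi_deg w <= N)%N.
Proof.
have ue : uniq (rev (enum 'I_n)) by rewrite rev_uniq enum_uniq.
apply/(mi_listP N w ue)/idP => [[]//|d]; split=> // j.
by rewrite mem_rev mem_enum.
Qed.

Lemma mis_uniq N : uniq (mis N).
Proof. by apply: mi_list_uniq; rewrite rev_uniq enum_uniq. Qed.

(** One polynomial whose coefficients of rank at most rho_k are the [formal_coef]. Evaluating it as
    a whole gives the residual up to Taylor remainders. *)
Definition formal_red phi t (i : 'I_n) : malg (mon m.+1) R :=
  - (\sum_(1 <= s < k.+1) \sum_(b <- nu s) phi b t i 0 *: mon_deriv b)
  + \sum_(l < m.+1 | varrho l <= rho k) mkmalgU (ucm (l, 0%N)) 1 *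
     \sum_(w <- mis (taylor_deg l))
       ((mi_fact w)%:R^-1 * pderive_mi D w (fl l) t (phi0 t) i 0) *:
         \prod_j formal_delta nu k phi t j ^+ w j.

Lemma formal_coefE phi b t i : mon_rank varrho b <= rho k ->
  formal_coef D fl phi0 nu k phi b t i 0 = mcoeff b (formal_red phi t i).
Proof.
move=> bk; rewrite /formal_coef /formal_red [LHS]mxE [in LHS]mxE mcoeffD mcoeffN.
congr (- _ + _).
  rewrite summxE raddf_sum /=; apply: eq_bigr => s _; rewrite summxE raddf_sum /=.
  by apply: eq_bigr => c _; rewrite mxE mcoeffZ mulrC.
rewrite summxE raddf_sum /= (bigID (fun l : 'I_m.+1 => varrho l <= rho k)) /= [X in _ + X]big1 ?addr0.
  apply: eq_bigr => l lk; rewrite (fsum_list (mis_uniq (taylor_deg l))); last first.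
    by move=> w; rewrite mem_mis -ltnNge => dw; rewrite mcoeff_high// mulr0 scale0r.
  rewrite summxE mulr_sumr raddf_sum /=; apply: eq_bigr => w _.
  by rewrite mxE -scalerAr mcoeffZ; ring.
move=> l lk; rewrite (fsum_list (s := [::]))// ?big_nil ?mxE// => w _.
by rewrite mcoeff_high ?mulr0 ?scale0r// => /(elimN idP lk).
Qed.

Lemma formal_coef_dep phi phi' s b t : (1 <= s <= k)%N -> b \in nu s ->
  (forall s' b', (1 <= s')%N -> (s' < s)%N -> b' \in nu s' -> phi b' = phi' b') ->
  formal_coef D fl phi0 nu k phi b t = formal_coef D fl phi0 nu k phi' b t.
Proof.
move=> /andP[s1 sk] bs E; have [b1 rb] := (mem_nu b s1).1 bs.
have bk : mon_rank varrho b <= rho k by rewrite rb rho_le// (leq_trans s1).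
apply/matrixP => i j; rewrite (ord1 j).
apply: etrans (formal_coefE phi t i bk) _.
apply: etrans _ (esym (formal_coefE phi' t i bk)).
apply/eqP; rewrite -subr_eq0 -mcoeffB; apply/negPn/negP.
(* Time differentiation raises the rank by 1 and a factor eps_l by at least varrho_1, so a change of
   coefficients from rank rho_s on is visible only from rank rho_s + e on. *)
pose e := Num.min 1 (varrho ord0).
have e0 : 0 < e by rewrite lt_min ltr01 hvarrho0.
suff : ranked varrho (rho s + e) (formal_red phi t i - formal_red phi' t i).
  by move=> /(_ b) h /h; rewrite rb leNgt ltrDl e0.
have cases s' b' : (1 <= s')%N -> b' \in nu s' -> phi b' t = phi' b' t \/ rho s <= rho s'.
  move=> s'1 b's; have [lt|ge] := ltnP s' s; first by left; rewrite (E s' b').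
  by right; rewrite rho_le.
have -> : formal_red phi t i - formal_red phi' t i =
  - (\sum_(1 <= s < k.+1) \sum_(b <- nu s) (phi b t i 0 - phi' b t i 0) *: mon_deriv b)
  + \sum_(l < m.+1 | varrho l <= rho k) mkmalgU (ucm (l, 0%N)) 1 *
     \sum_(w <- mis (taylor_deg l))
       ((mi_fact w)%:R^-1 * pderive_mi D w (fl l) t (phi0 t) i 0) *:
         (\prod_j formal_delta nu k phi t j ^+ w j - \prod_j formal_delta nu k phi' t j ^+ w j).
  rewrite /formal_red opprD addrACA; congr (_ + _).
    rewrite -opprD; congr (- _); rewrite -sumrB; apply: eq_bigr => s' _.
    by rewrite -sumrB; apply: eq_bigr => c _; rewrite scalerBl.
  rewrite -sumrB; apply: eq_bigr => l _; rewrite -mulrBr -sumrB; congr (_ * _).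
  by apply: eq_bigr => w _; rewrite scalerBr.
have rZ r x g : ranked varrho r g -> ranked varrho r (x *: g).
  by move=> rg c; rewrite mcoeffZ mulf_eq0 negb_or => /andP[_]; exact: rg.
apply: rankedD.
  apply: rankedN; apply: ranked_sum => s'; rewrite mem_index_iota => /andP[s'1 _].
  apply: ranked_sum => b' b's; have [->|le] := cases s' b' s'1 b's.
    by rewrite subrr scale0r; exact: ranked0.
  apply: rZ => c /(mon_deriv_rank varrho) ->.
  have [_ ->] := (mem_nu b' s'1).1 b's.
  by rewrite lerD// ge_min lexx.
rewrite -big_filter; apply: ranked_sum => l _; rewrite addrC; apply: rankedM.
  by apply: rankedU; rewrite mon_rankU addr0 ge_min hvarrho ?orbT.
apply: ranked_sum => w _; apply: rZ; apply: ranked_prod_diff => // j'.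
have -> : formal_delta nu k phi t j' - formal_delta nu k phi' t j'
   = formal_delta nu k (fun b t => phi b t - phi' b t) t j'.
  rewrite /formal_delta -sumrB; apply: eq_bigr => s' _; rewrite -sumrB.
  by apply: eq_bigr => c _; rewrite -monalgUB !mxE.
apply: delta_ranked => s' b' /andP[s'1 _] b's; have [->|] := cases s' b' s'1 b's; last by right.
by left; rewrite subrr mxE.
Qed.

Definition admissible_mon b : Prop := forall i, i \in finsupp b -> (i.2 <= pk i.1)%N.

Lemma admissible_monM b c : admissible_mon b -> admissible_mon c -> admissible_mon (mulcm b c).
Proof. by move=> hb hc i; rewrite mdomD in_fsetU => /orP[/hb|/hc]. Qed.

Lemma admissible_monU i : (i.2 <= pk i.1)%N -> admissible_mon (ucm i).
Proof. by move=> ik j; rewrite mdomU inE => /eqP->. Qed.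

Lemma admissible_mon1 : admissible_mon (onecm _).
Proof. by move=> i; rewrite mdom1 in_fset0. Qed.

(** The strict inequality leaves room for one more derivative, so that monomials of the approximate
    solution can be differentiated in time. *)
Lemma low_rank_order b i : mon_rank varrho b <= rho k -> i \in finsupp b -> (i.2 < pk i.1)%N.
Proof.
move=> bk ib; have h := le_trans (mon_rank_ge hvarrho0 ib) bk.
have h2 : (i.2 : int) <= Num.floor (rho k - varrho i.1).
  by rewrite floor_ge_int lerBrDl.
have : (i.2 : int) + 1 <= (pk i.1 : int) by rewrite hpk le_max lerD2r h2 orbT.
by rewrite -PoszD lez_nat addn1.
Qed.

Lemma low_rank_admissible b : mon_rank varrho b <= rho k -> admissible_mon b.
Proof. by move=> bk i ib; exact: ltnW (low_rank_order bk ib). Qed.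

Lemma nu_low s b : (1 <= s <= k)%N -> b \in nu s -> mon_rank varrho b <= rho k.
Proof.
move=> /andP[s1 sk] bs; have [_ ->] := (mem_nu b s1).1 bs.
by rewrite rho_le// (leq_trans s1).
Qed.

Definition nontrivial_mon b : Prop := admissible_mon b /\ b != onecm _.

Lemma mulcm_neq1 b c : b != onecm _ -> mulcm b c != onecm ('I_m.+1 * nat)%type.
Proof. by apply: contra => /eqP/mulcm_eq0[-> _]. Qed.

Let KK : forall f g, K f -> K1 t0 K g -> K (fun t => f t * g t).
Proof. exact: (K_mulK1 hK). Qed.

Lemma fam_formal_delta phi j :
  (forall s b, (1 <= s <= k)%N -> b \in nu s -> vecK K (phi b)) ->
  fam t0 (K1 t0 K) admissible_mon (fun t => formal_delta nu k phi t j).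
Proof.
move=> Kphi; apply: fam_sum => s; rewrite mem_index_iota => sk _.
apply: fam_sum => b bs _; apply: famU; first exact: low_rank_admissible (nu_low sk bs).
exact: K_K1 (Kphi s b sk bs j).
Qed.

(** The coefficients lie in [K] itself and not only in [K1], although products of powers of
    [formal_delta] may be empty: every term carries a factor phi_b or a partial derivative of f_l
    along phi0, which lies in [K]. *)
Lemma fam_formal_red phi i :
  (forall s b, (1 <= s <= k)%N -> b \in nu s -> vecK K (phi b)) ->
  fam t0 K nontrivial_mon (fun t => formal_red phi t i).
Proof.
move=> Kphi; apply: famD.
  have h : fam t0 K nontrivial_mon (fun t => \sum_(1 <= s < k.+1) \sum_(b <- nu s)
      (- phi b t i 0) *: mon_deriv b).
    apply: fam_sum => s; rewrite mem_index_iota => sk _; apply: fam_sum => b bs _.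
    apply: (famZ (Pc := K) (Pc' := K1 t0 K) KK); first by apply: (K_opp hK); exact: Kphi bs i.
    apply: fam_sum => j jb _; apply: famU; last exact: (K1_cst hK).
    have bk := nu_low sk bs; split; last by rewrite mulcmC mulcm_neq1// cm1_eq1.
    apply: admissible_monM; last by apply: admissible_monU; exact: low_rank_order bk jb.
    move=> l; rewrite -cmE_neq0 divcmE => lb; apply: (low_rank_admissible bk).
    by rewrite -cmE_neq0; apply: contraNneq lb => ->.
  apply: fam_eq h => t _; rewrite -sumrN; apply: eq_bigr => s _.
  by rewrite -sumrN; apply: eq_bigr => b _; rewrite scaleNr.
apply: fam_sum => l _ lk.
apply: (famM (Pc := K1 t0 K) (Pc' := K) (Pb := nontrivial_mon) (Pb' := admissible_mon)).
- by move=> f g K1f Kg; apply: (K_ext hK) (KK Kg K1f) => t _; rewrite mulrC.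
- by move=> b c [hb b1] hc; split; [exact: admissible_monM|exact: mulcm_neq1].
- apply: famU; last exact: (K1_cst hK).
  by split; [exact: admissible_monU|rewrite cm1_eq1].
apply: fam_sum => w; rewrite mem_mis => dw _.
apply: (famZ (Pc := K) (Pc' := K1 t0 K) KK).
  apply: (K3_scale hK); apply: hflK => //.
  by have [<- _] := taylor_degP lk; rewrite lez_nat.
apply: fam_prod_exp.
- exact: (K1_cst hK).
- exact: admissible_mon1.
- exact: (K1_mul hK).
- exact: admissible_monM.
- by move=> j; exact: fam_formal_delta.
Qed.

Lemma solves_forcing (g h : R -> 'cV[R]_n) y : (forall t, g t = h t) ->
  solves (ray t0) (fun t v => A *m v + h t) y -> solves (ray t0) (fun t v => A *m v + g t) y.
Proof. by move=> gh hy t tt; have [d1 d2] := hy t tt; split=> //; rewrite d2 gh. Qed.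

Lemma expansion_exists : exists phi, expansion_coefs t0 D A fl phi0 nu k phi K.
Proof.
suff [phi H] : exists phi, forall s, (1 <= s <= k)%N -> (s <= k)%N -> forall b, b \in nu s ->
    [/\ vecK K (phi b), Cn_in (ray t0) 1 (phi b) &
        solves (ray t0) (fun t v => A *m v + formal_coef D fl phi0 nu k phi b t) (phi b)].
  by exists phi => s sk b bs; apply: (H s) => //; case/andP: sk.
suff H r : (r <= k)%N -> exists phi, forall s, (1 <= s <= k)%N -> (s <= r)%N ->
    forall b, b \in nu s ->
    [/\ vecK K (phi b), Cn_in (ray t0) 1 (phi b) &
        solves (ray t0) (fun t v => A *m v + formal_coef D fl phi0 nu k phi b t) (phi b)].
  exact: H.
elim: r => [_|r IH rk].
  by exists (fun _ _ => 0) => s /andP[s1 _]; rewrite leqNgt s1.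
have [phi Hphi] := IH (ltnW rk).
(* Coefficients of rank above rho_r are still arbitrary and need not lie in [K]. They are replaced
   by 0, which does not affect the forcing terms of rank rho_{r+1}. *)
pose low b := has (fun s => b \in nu s) (iota 1 r).
pose phit b t := if low b then phi b t else 0.
have phitK s b : (1 <= s <= k)%N -> b \in nu s -> vecK K (phit b).
  move=> _ _ i; rewrite /phit; case: (boolP (low b)) => [|_].
    move=> /hasP[s']; rewrite mem_iota add1n ltnS => /andP[s1 sr] bs.
    have s'k : (1 <= s' <= k)%N by rewrite s1 (leq_trans sr)// ltnW.
    by have [+ _ _] := Hphi s' s'k sr b bs; apply.
  by apply: (K_ext hK) (K_0 hK) => t _; rewrite mxE.
have r1k : (1 <= r.+1 <= k)%N by rewrite rk.
have phit_low s b : (1 <= s)%N -> (s < r.+1)%N -> b \in nu s -> phi b = phit b.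
  move=> s1 sr bs; rewrite /phit (_ : low b = true)//.
  by apply/hasP; exists s => //; rewrite mem_iota s1 add1n.
have /choice[psi Hpsi] : forall b, exists psi : R -> 'cV[R]_n, b \in nu r.+1 ->
    [/\ vecK K psi, Cn_in (ray t0) 1 psi &
      solves (ray t0) (fun t v => A *m v + formal_coef D fl phi0 nu k phi b t) psi].
  move=> b; have [bs|nb] := boolP (b \in nu r.+1); last by exists (fun=> 0).
  have Kc : vecK K (fun t => formal_coef D fl phi0 nu k phi b t).
    move=> i; apply: (K_ext hK) (fam_mcoeff b (fam_formal_red i phitK) (K_0 hK) (K3_add hK) (K_ext hK)) => t _.
    apply: etrans (esym (formal_coefE phit t i (nu_low r1k bs))) _.
    have E : formal_coef D fl phi0 nu k phi b t = formal_coef D fl phi0 nu k phit b t.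
      by apply: (formal_coef_dep t r1k bs) => s b'; exact: phit_low.
    exact: (congr1 (fun M : 'cV[R]_n => M i 0) (esym E)).
  by have [y Hy] := K_linear_solve hlam hK hdiff Kc; exists y.
pose phi' b := if b \in nu r.+1 then psi b else phi b.
have agree s b : (1 <= s)%N -> (s < r.+1)%N -> b \in nu s -> phi' b = phi b.
  move=> s1 sr bs; rewrite /phi'; case: (boolP (b \in nu r.+1)) => // br.
  have := rho_lt s1 (isT : (1 <= r.+1)%N); rewrite sr.
  by have [_ <-] := (mem_nu b s1).1 bs; have [_ <-] := (mem_nu b (ltn0Sn r)).1 br; rewrite ltxx.
have transfer b (y : R -> 'cV[R]_n) ph : phi' b = y ->
    (forall t, formal_coef D fl phi0 nu k phi' b t = formal_coef D fl phi0 nu k ph b t) ->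
    [/\ vecK K y, Cn_in (ray t0) 1 y &
      solves (ray t0) (fun t v => A *m v + formal_coef D fl phi0 nu k ph b t) y] ->
    [/\ vecK K (phi' b), Cn_in (ray t0) 1 (phi' b) &
      solves (ray t0) (fun t v => A *m v + formal_coef D fl phi0 nu k phi' b t) (phi' b)].
  move=> -> E [h1 h2 h3]; apply: And3 h1 h2 _; exact: solves_forcing E h3.
exists phi' => s sk; rewrite leq_eqVlt => /orP[/eqP sE|sr] b bs.
  rewrite sE in bs; have Eb : phi' b = psi b by rewrite /phi' bs.
  apply: (transfer b _ phi Eb) (Hpsi b bs) => t.
  by apply: (formal_coef_dep t r1k bs) => s' b' s1 s'r; exact: agree.
have s1 : (1 <= s)%N by case/andP: sk.
apply: (transfer b _ phi (agree s b s1 sr bs)) (Hphi s sk sr b bs) => t.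
apply: (formal_coef_dep t sk bs) => s' b' s'1 s's; apply: agree => //.
exact: ltn_trans s's sr.
Qed.

End FormalExpansion.

(** * Orders of magnitude and the residual *)

Section OrderOfMagnitude.
Context {R : realType}.
Variable e1 : R -> R.
Hypothesis e1_gt0 : \forall t \near +oo, 0 < e1 t.
Hypothesis e1_cvg0 : e1 t @[t --> +oo] --> (0 : R).
Implicit Types g h : R -> R.

Definition ordO (x : R) g := bigO_pinfty g (fun t => e1 t `^ x).

Lemma ordOP x g : ordO x g <-> exists2 C : R, 0 <= C & \forall t \near +oo, `|g t| <= C * e1 t `^ x.
Proof.
split=> [[C HC]|[C _ HC]]; last first.
  by exists C; apply: filterS HC => t; rewrite (ger0_norm (powR_ge0 _ _)).
exists `|C|; first exact: normr_ge0.
apply: filterS HC => t; rewrite (ger0_norm (powR_ge0 _ _)) => /le_trans; apply.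
by rewrite ler_wpM2r ?powR_ge0 ?ler_norm.
Qed.

Lemma ordO_ext x g h : (\forall t \near +oo, g t = h t) -> ordO x g -> ordO x h.
Proof. by move=> gh [C HC]; exists C; apply: filterS2 gh HC => t <-. Qed.

Lemma ordOW x y g : y <= x -> ordO x g -> ordO y g.
Proof.
move=> yx /ordOP[C C0 HC]; apply/ordOP; exists C => //.
have H1 : \forall t \near +oo, `|e1 t| < 1.
  by have /cvgr0Pnorm_lt := e1_cvg0; apply.
apply: filterS3 HC H1 e1_gt0 => t ht h1 h0; apply: le_trans ht _.
by rewrite ler_wpM2l// ger_powR// h0/= ltW// -[e1 t]gtr0_norm.
Qed.

Lemma ordOD x g h : ordO x g -> ordO x h -> ordO x (fun t => g t + h t).
Proof.
move=> /ordOP[C C0 HC] /ordOP[C' C'0 HC']; apply/ordOP; exists (C + C'); first exact: addr_ge0.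
by apply: filterS2 HC HC' => t h1 h2; rewrite mulrDl (le_trans (ler_normD _ _))// lerD.
Qed.

Lemma ordO0 x : ordO x (fun=> 0).
Proof. by apply/ordOP; exists 0 => //; near=> t; rewrite normr0 mul0r.
Unshelve. all: by end_near. Qed.

Lemma ordO_sum x (I : eqType) (s : seq I) (P : pred I) (F : I -> R -> R) :
  (forall i, i \in s -> P i -> ordO x (F i)) -> ordO x (fun t => \sum_(i <- s | P i) F i t).
Proof.
elim: s => [_|i s IH hF].
  by apply: ordO_ext (ordO0 x); near=> t; rewrite big_nil.
have {}IH : ordO x (fun t => \sum_(i <- s | P i) F i t).
  by apply: IH => j js; apply: hF; rewrite inE js orbT.
have [Pi|Pi] := boolP (P i).
  by apply: ordO_ext (ordOD (hF i (mem_head _ _) Pi) IH); near=> t; rewrite big_cons Pi.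
by apply: ordO_ext IH; near=> t; rewrite big_cons (negbTE Pi).
Unshelve. all: by end_near. Qed.

Lemma ordOM x y g h : ordO x g -> ordO y h -> ordO (x + y) (fun t => g t * h t).
Proof.
move=> /ordOP[C C0 HC] /ordOP[C' C'0 HC']; apply/ordOP; exists (C * C'); first exact: mulr_ge0.
apply: filterS3 HC HC' e1_gt0 => t h1 h2 h0.
have -> : e1 t `^ (x + y) = e1 t `^ x * e1 t `^ y by rewrite powRD//; apply/implyP => _; rewrite gt_eqF.
by rewrite normrM mulrACA ler_pM.
Qed.

Lemma ordO_bounded g : (exists C : R, \forall t \near +oo, `|g t| <= C) -> ordO 0 g.
Proof. by move=> [C HC]; exists C; apply: filterS HC => t; rewrite powRr0 normr1 mulr1. Qed.

Lemma ordO1 : ordO 0 (fun=> 1).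
Proof. by apply: ordO_bounded; exists 1; near=> t; rewrite normr1.
Unshelve. all: by end_near. Qed.

Lemma ordOX x g n : ordO x g -> ordO (n%:R * x) (fun t => g t ^+ n).
Proof.
move=> hg; elim: n => [|n IH].
  by rewrite mul0r; apply: ordO_ext ordO1; near=> t; rewrite expr0.
rewrite -natr1 mulrDl mul1r addrC; apply: ordO_ext (ordOM hg IH).
by near=> t; rewrite exprS.
Unshelve. all: by end_near. Qed.

Lemma ordO_prod (I : eqType) (s : seq I) (x : I -> R) (F : I -> R -> R) :
  (forall i, i \in s -> ordO (x i) (F i)) ->
  ordO (\sum_(i <- s) x i) (fun t => \prod_(i <- s) F i t).
Proof.
elim: s => [_|i s IH hF].
  by rewrite big_nil; apply: ordO_ext ordO1; near=> t; rewrite big_nil.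
rewrite big_cons; have := ordOM (hF i (mem_head _ _)) (IH (fun j js => hF j (mem_behead (s := i :: s) js))).
by apply: ordO_ext; near=> t; rewrite big_cons.
Unshelve. all: by end_near. Qed.

End OrderOfMagnitude.

Lemma is_derive_prod_seq {R : realType} (I : eqType) (s : seq I) (F dF : I -> R -> R) (t : R) :
  uniq s -> (forall i, i \in s -> is_derive t 1 (F i) (dF i t)) ->
  is_derive t 1 (fun x => \prod_(i <- s) F i x)
    (\sum_(i <- s) dF i t * \prod_(j <- s | j != i) F j t).
Proof.
elim: s => [_ _|i s IH /= /andP[nis us] hF].
  rewrite big_nil (_ : (fun x => _) = cst 1); first exact: is_derive_cst.
  by apply/funext => x; rewrite big_nil.
have h1 := hF i (mem_head _ _).
have h2 := IH us (fun j js => hF j (mem_behead (s := i :: s) js)).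
rewrite (_ : (fun x => _) = F i * (fun x => \prod_(j <- s) F j x)); last first.
  by apply/funext => x; rewrite big_cons.
apply: (is_derive_eq (is_deriveM h1 h2)); rewrite /= !big_cons eqxx /= /GRing.scale /=.
rewrite addrC mulrC; congr (_ * _ + _).
  rewrite [RHS]big_seq_cond [LHS]big_seq; apply: eq_bigl => j.
  by case: (boolP (j \in s)) => //= js; case: eqVneq => // ji; rewrite -ji js in nis.
rewrite big_distrr /= !big_seq; apply: eq_bigr => j js.
rewrite big_cons; case: eqVneq => [ij|_]; first by rewrite ij js in nis.
by rewrite mulrCA.
Qed.

Section MonomialCalculus.
Context {R : realType} {m : nat}.
Variables (t0 : R) (eps : 'I_m.+1 -> R -> R) (pk : 'I_m.+1 -> nat) (varrho : 'I_m.+1 -> R).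
Hypothesis hepsC : forall l, Cn_in (ray t0) (pk l) (eps l).
Hypothesis hepsO : forall l r, (r <= pk l)%N ->
  bigO_pinfty (derive_in_n (ray t0) r (eps l))
    (fun t => eps ord0 t `^ ((varrho l + r%:R) / varrho ord0)).
Hypothesis heps_o1 : eps ord0 t @[t --> +oo] --> (0 : R).
Hypothesis heps_gt0 : forall t, ray t0 t -> 0 < eps ord0 t.
Implicit Types (b : mon m.+1) (i : 'I_m.+1 * nat).

Lemma is_derive_eps l r t : (r < pk l)%N -> t0 < t ->
  is_derive t 1 (derive_in_n (ray t0) r (eps l)) (derive_in_n (ray t0) r.+1 (eps l) t).
Proof.
move=> rp tt; have [_ /(_ rp t) d] := hepsC (ltnW rp).
by apply: (is_derive_inP _ _ (nbhs_ray tt)).1; split=> //; apply: d; apply/rayE/ltW.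
Qed.

Lemma cts_eps T l r : t0 < T -> (r <= pk l)%N -> cts T (derive_in_n (ray t0) r (eps l)).
Proof. by move=> tT /(hepsC (l := l))[+ _]; exact: cts_within. Qed.

Lemma cts_mon_eval T b : t0 < T -> admissible_mon pk b -> cts T (mon_eval t0 eps b).
Proof.
move=> tT bp; rewrite /mon_eval.
rewrite (_ : (fun t => _) = (fun t => \prod_(i <- finsupp b | i \in finsupp b)
  derive_in_n (ray t0) i.2 (eps i.1) t ^+ b i)); last by apply/funext => t; rewrite -big_seq.
by apply: cts_prod => i ib; apply: ctsX; apply: cts_eps => //; exact: bp.
Qed.

(** Evaluation intertwines the formal product rule with differentiation; dividing by a generator
    matches the exponent lowered by one. *)
Lemma is_derive_mon_eval b t : (forall i, i \in finsupp b -> (i.2 < pk i.1)%N) -> t0 < t ->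
  is_derive t 1 (mon_eval t0 eps b) (lin_ext (mon_eval t0 eps ^~ t) (mon_deriv b)).
Proof.
move=> bp tt; pose F i x := derive_in_n (ray t0) i.2 (eps i.1) x ^+ b i.
pose dF i x := (b i)%:R * derive_in_n (ray t0) i.2 (eps i.1) x ^+ (b i).-1 *
   derive_in_n (ray t0) i.2.+1 (eps i.1) x.
have h : is_derive t 1 (fun x => \prod_(i <- finsupp b) F i x)
    (\sum_(i <- finsupp b) dF i t * \prod_(j <- finsupp b | j != i) F j t).
  apply: is_derive_prod_seq; first exact: fset_uniq.
  move=> i ib; have := is_derive_eps (bp i ib) tt => di.
  rewrite /F; have E : (0 < b i)%N by rewrite lt0n cmE_neq0.
  have -> : (fun x => derive_in_n (ray t0) i.2 (eps i.1) x ^+ b i) =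
    derive_in_n (ray t0) i.2 (eps i.1) ^+ (b i).-1.+1.
    by rewrite prednK//; apply/funext => x; rewrite fctE.
  apply: is_derive_eq; rewrite /dF /GRing.scale /= prednK//; ring.
apply: (is_derive_eq h); rewrite /mon_deriv lin_ext_sum !big_seq; apply: eq_bigr => i ib.
rewrite lin_extU mon_evalM mon_evalU /dF -!mulrA; congr (_ * _).
rewrite [RHS]mulrC mulrCA; congr (_ * _).
rewrite (mon_evalEw _ _ _ (d := finsupp b)); last first.
  by apply/fsubsetP => j; rewrite -!cmE_neq0 divcmE; apply: contraNneq => ->.
rewrite (bigD1_seq i ib)/=; last exact: fset_uniq.
rewrite divcmE ucmE eqxx subn1; congr (_ * _); apply: eq_bigr => j ji.
by rewrite /F divcmE ucmE eq_sym (negbTE ji) subn0.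
Qed.

Lemma heps_near : \forall t \near +oo, 0 < eps ord0 t.
Proof. by apply/nearyP; exists t0 => t /rayE; exact: heps_gt0. Qed.

Lemma ordO_mon_eval b : admissible_mon pk b ->
  ordO (eps ord0) (mon_rank varrho b / varrho ord0) (mon_eval t0 eps b).
Proof.
move=> bp; rewrite /mon_rank mulr_suml.
apply: (ordO_prod heps_near (x := fun i => (varrho i.1 + i.2%:R) *+ b i / varrho ord0)
  (F := fun i t => derive_in_n (ray t0) i.2 (eps i.1) t ^+ b i)).
move=> i ib; rewrite -[_ *+ b i]mulr_natl -mulrA; apply: ordOX; first exact: heps_near.
by apply: hepsO; exact: bp.
Qed.

End MonomialCalculus.

Lemma is_derive_sum_seq {R : realType} (I : eqType) (s : seq I) (F : I -> R -> R) (dF : I -> R) (t : R) :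
  (forall i, i \in s -> is_derive t 1 (F i) (dF i)) ->
  is_derive t 1 (fun x => \sum_(i <- s) F i x) (\sum_(i <- s) dF i).
Proof.
elim: s => [_|i s IH hF].
  rewrite big_nil (_ : (fun x => _) = cst 0); first exact: is_derive_cst.
  by apply/funext => x; rewrite big_nil.
have h1 := hF i (mem_head _ _).
have h2 := IH (fun j js => hF j (mem_behead (s := i :: s) js)).
rewrite big_cons (_ : (fun x => _) = F i + (fun x => \sum_(j <- s) F j x)).
  exact: is_deriveD.
by apply/funext => x; rewrite big_cons.
Qed.

Section Residual.
Context {R : realType} {n m : nat}.
Variables (t0 : R) (A : 'M[R]_n) (lam : 'I_n -> R[i]) (K : set (R -> R)).
Hypothesis hK : classK3 t0 (range lam `|` eigen_differences lam) K.
Variables (f : R -> 'cV[R]_n) (a : R)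
  (eps : 'I_m.+1 -> R -> R) (fl : 'I_m.+1 -> R -> 'cV[R]_n -> 'cV[R]_n)
  (phi0 : R -> 'cV[R]_n) (varrho : 'I_m.+1 -> R) (rho : nat -> R)
  (nu : nat -> seq (mon m.+1)) (k : nat) (pk : 'I_m.+1 -> nat) (qk : 'I_m.+1 -> int).
Let D := tube t0 a phi0.
Hypothesis ha : 0 < a.
Hypothesis hphi0 : solves (ray t0) (fun t v => A *m v + f t) phi0.
Hypothesis hvarrho0 : forall l, 0 < varrho l.
Hypothesis hvarrho : forall l l' : 'I_m.+1, (l <= l')%N -> varrho l <= varrho l'.
Hypothesis hrho : ranks_enum varrho rho.
Hypothesis hnu : mons_enum varrho rho nu.
Hypothesis hk : (1 <= k)%N.
Hypothesis hpk : forall l, (pk l)%:Z = Num.max 0 (Num.floor (rho k - varrho l) + 1).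
Hypothesis hqk : forall l, qk l = Num.floor ((rho k - varrho l) / varrho ord0).
Hypothesis hepsC : forall l, Cn_in (ray t0) (pk l) (eps l).
Hypothesis hepsO : forall l r, (r <= pk l)%N ->
  bigO_pinfty (derive_in_n (ray t0) r (eps l))
    (fun t => eps ord0 t `^ ((varrho l + r%:R) / varrho ord0)).
Hypothesis heps_o1 : eps ord0 t @[t --> +oo] --> (0 : R).
Hypothesis hflC : forall l (q : nat), q%:Z = Num.max 2 (qk l + 1) -> C0n_in D q (fl l).
Hypothesis hflB : forall l (w : {ffun 'I_n -> nat}),
  (mi_deg w)%:Z <= Num.max 2 (qk l + 1) -> [bounded pderive_mi D w (fl l) z.1 z.2 | z in D].
Hypothesis hflK : forall l (w : {ffun 'I_n -> nat}), varrho l <= rho k ->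
  (mi_deg w)%:Z <= qk l -> vecK K (fun t => pderive_mi D w (fl l) t (phi0 t)).
Hypothesis heps_gt0 : forall t, ray t0 t -> 0 < eps ord0 t.
Variable phi : mon m.+1 -> R -> 'cV[R]_n.
Hypothesis hphi : expansion_coefs t0 D A fl phi0 nu k phi K.

Let ev t b := mon_eval t0 eps b t.
Let e1 := eps ord0.
Let s := approx_sol t0 eps phi0 nu k phi.
Let ord := ordO e1.

Let e1_gt0 : \forall t \near +oo, 0 < e1 t.
Proof. exact: heps_near heps_gt0. Qed.

Definition correction t : 'cV[R]_n :=
  \sum_(1 <= s < k.+1) \sum_(b <- nu s) mon_eval t0 eps b t *: phi b t.

Lemma correctionE t j : correction t j 0 =
  \sum_(1 <= s < k.+1) \sum_(b <- nu s) mon_eval t0 eps b t * phi b t j 0.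
Proof.
rewrite /correction summxE; apply: eq_bigr => r _; rewrite summxE.
by apply: eq_bigr => b _; rewrite mxE.
Qed.

Lemma lin_ext_delta t j : lin_ext (ev t) (formal_delta nu k phi t j) = correction t j 0.
Proof.
rewrite /formal_delta lin_ext_sum correctionE; apply: eq_bigr => r _.
rewrite lin_ext_sum; apply: eq_bigr => b _.
by apply: etrans (lin_extU _ _ _) _; rewrite mulrC.
Qed.

Let evM t b c : ev t (mulcm b c) = ev t b * ev t c. Proof. exact: mon_evalM. Qed.
Let ev1 t : ev t (onecm _) = 1. Proof. exact: mon_eval1. Qed.

Lemma lin_ext_red t i : lin_ext (ev t) (formal_red D fl phi0 varrho rho nu k qk phi t i) =
  - (\sum_(1 <= s < k.+1) \sum_(b <- nu s) phi b t i 0 * lin_ext (ev t) (mon_deriv b))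
  + \sum_(l < m.+1 | varrho l <= rho k) eps l t *
     \sum_(w <- mis (n := n) (taylor_deg qk l))
       ((mi_fact w)%:R^-1 * pderive_mi D w (fl l) t (phi0 t) i 0) *
         \prod_j correction t j 0 ^+ w j.
Proof.
rewrite /formal_red lin_extD lin_extN; congr (- _ + _).
  rewrite lin_ext_sum; apply: eq_bigr => r _; rewrite lin_ext_sum; apply: eq_bigr => b _.
  exact: lin_extZ.
rewrite lin_ext_sum; apply: eq_bigr => l _.
apply: etrans (lin_extM (evM t) _ _) _.
congr (_ * _); first by apply: etrans (lin_extU _ _ _) _; rewrite mul1r /ev mon_evalU.
rewrite lin_ext_sum; apply: eq_bigr => w _.
apply: etrans (lin_extZ _ _ _) _; congr (_ * _).
rewrite (big_morph _ (lin_extM (evM t)) (lin_ext1 (ev1 t))); apply: eq_bigr => j _.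
by rewrite (lin_extX _ _ (ev1 t) (evM t)) lin_ext_delta.
Qed.

Let phiK r b : (1 <= r <= k)%N -> b \in nu r -> vecK K (phi b).
Proof. by move=> rk br; have [] := hphi rk br. Qed.

Let low r b : (1 <= r <= k)%N -> b \in nu r -> mon_rank varrho b <= rho k.
Proof. exact: nu_low. Qed.

(** Each nontrivial monomial occurs once in exactly one list [nu s], and s <= k means rank at most
    rho_k. So the double sum picks out at most one term. *)
Lemma low_sum (g c : mon m.+1 -> R) b : b != onecm _ ->
  \sum_(1 <= s < k.+1) \sum_(b' <- nu s) g b' * (c b *+ (b == b')) =
  if mon_rank varrho b <= rho k then g b * c b else 0.
Proof.
move=> b1; have inner r : (1 <= r)%N -> \sum_(b' <- nu r) g b' * (c b *+ (b == b')) =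
    if b \in nu r then g b * c b else 0.
  move=> r1; have [/(_ r r1)[ur _] _] := hnu.
  have [br|br] := boolP (b \in nu r); last first.
    rewrite big_seq big1// => b' b'r; case: eqP => [E|_]; last by rewrite mulr0n mulr0.
    by rewrite E b'r in br.
  rewrite (bigD1_seq b)//= eqxx mulr1n big1 ?addr0// => b' bb'.
  by rewrite eq_sym (negbTE bb') mulr0n mulr0.
have [r0 r01 br0] := rank_nu hrho hnu b1; have [_ rb] := (mem_nu hnu b r01).1 br0.
rewrite rb (rho_le hrho)// big_nat_cond.
have [r0k|r0k] := leqP r0 k.
  rewrite -big_nat_cond (bigD1_seq r0) ?iota_uniq ?mem_index_iota ?r01//=.
  rewrite inner// br0 big1_seq ?addr0// => r; rewrite mem_index_iota => /andP[rr0 /andP[r1 _]].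
  rewrite inner//; case: (boolP (b \in nu r)) => // /(mem_nu hnu b r1).1[_ E].
  have := rho_le hrho r01 r1; have := rho_le hrho r1 r01; rewrite -E rb lexx => h1 h2.
  by case/eqP: rr0; apply/eqP; rewrite eqn_leq -h1 -h2.
rewrite big1// => r /andP[/andP[r1 rk] _]; rewrite inner//.
case: (boolP (b \in nu r)) => // /(mem_nu hnu b r1).1[_ E].
have := rho_le hrho r01 r1; rewrite -E rb lexx => /esym; rewrite leqNgt.
by rewrite (leq_ltn_trans _ r0k).
Qed.

(* The formal coefficients cancel all the monomials of rank at most rho_k. *)
Lemma lin_ext_red_low i : exists (I : finType) (B : I -> mon m.+1) (c : I -> R -> R),
  [/\ forall x, admissible_mon pk (B x), forall x, B x != onecm _, forall x, K (c x) &
   forall t, t0 <= t ->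
   lin_ext (ev t) (formal_red D fl phi0 varrho rho nu k qk phi t i) -
   \sum_(1 <= s < k.+1) \sum_(b <- nu s) ev t b * formal_coef D fl phi0 nu k phi b t i 0 =
   \sum_(x | rho k < mon_rank varrho (B x)) c x t * ev t (B x)].
Proof.
have [I [B [c [B1 cK E]]]] := fam_formal_red hK hvarrho0 hrho hnu hpk hqk hflK i phiK.
exists I, B, c; split=> // [x|x|t tt]; [by have [] := B1 x|by have [] := B1 x|].
have -> : \sum_(1 <= s < k.+1) \sum_(b <- nu s) ev t b * formal_coef D fl phi0 nu k phi b t i 0 =
    \sum_x if mon_rank varrho (B x) <= rho k then ev t (B x) * c x t else 0.
  transitivity (\sum_(1 <= s < k.+1) \sum_(b <- nu s) \sum_x ev t b * (c x t *+ (B x == b))).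
    rewrite !big_nat; apply: eq_bigr => r rk; rewrite !big_seq; apply: eq_bigr => b br.
    have bk := low rk br.
    have -> := formal_coefE D fl phi0 hvarrho0 hvarrho hrho hnu hqk phi t i bk.
    rewrite E// raddf_sum mulr_sumr; apply: eq_bigr => x _; congr (_ * _).
    exact: mcoeffU.
  under eq_bigr do rewrite exchange_big; rewrite exchange_big; apply: eq_bigr => x _.
  rewrite -(low_sum (ev t) (fun=> c x t)) //; by have [] := B1 x.
rewrite E// lin_ext_sum -sumrB [RHS]big_mkcond; apply: eq_bigr => x _.
have -> : lin_ext (ev t) (mkmalgU (B x) (c x t)) = c x t * ev t (B x) by exact: lin_extU.
by rewrite ltNge; case: ifP => _; rewrite ?subr0// mulrC subrr.
Qed.

Lemma ord_bounded_K g : K g -> ord 0 g.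
Proof.
move=> /(K_bounded hK)[C HC]; apply: ordO_bounded; exists C.
by apply/nearyP; exists t0.
Qed.

Lemma ord_mon b : admissible_mon pk b -> ord (mon_rank varrho b / varrho ord0) (ev ^~ b).
Proof. exact: (ordO_mon_eval hepsO). Qed.

Lemma ord_correction j : ord 1 (fun t => correction t j 0).
Proof.
have : ord 1 (fun t => \sum_(1 <= s < k.+1) \sum_(b <- nu s) ev t b * phi b t j 0).
  apply: ordO_sum => r; rewrite mem_index_iota => rk _; apply: ordO_sum => b br _.
  rewrite -[1]addr0; apply: ordOM => //; last exact: ord_bounded_K (phiK rk br j).
  have bk := low rk br; have /andP[r1 _] := rk; have [b1 _] := (mem_nu hnu b r1).1 br.
  apply: ordOW (ord_mon (low_rank_admissible hvarrho0 hpk bk)) => //.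
  by rewrite ler_pdivlMr// mul1r (rank_ge_min hvarrho0 hvarrho).
by apply: ordO_ext; near=> t; rewrite correctionE.
Unshelve. all: by end_near. Qed.

Lemma correction_bound : exists2 C, 0 <= C & \forall t \near +oo, `|correction t| <= C * e1 t.
Proof.
have /choice[C HC] : forall j, exists C, 0 <= C /\ \forall t \near +oo, `|correction t j 0| <= C * e1 t.
  move=> j; have /ordOP[C C0 HC] := ord_correction j; exists C; split=> //.
  by apply: filterS2 HC e1_gt0 => t h /ltW h0; rewrite powRr1 in h.
exists (\sum_j C j); first by apply: sumr_ge0 => j _; case: (HC j).
near=> t; have e0 : 0 < e1 t by near: t.
apply: mx_norm_le; first by rewrite mulr_ge0 ?sumr_ge0// ?ltW// => j _; case: (HC j).
move=> i j; rewrite (ord1 j).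
have -> : `|correction t i 0| <= (\sum_j C j) * e1 t = true; last by [].
apply: (@le_trans _ _ (C i * e1 t)); last first.
  rewrite ler_wpM2r ?(ltW e0)// (bigD1 i)//= lerDl sumr_ge0// => j' _; by case: (HC j').
move: i; near: t; apply: filter_forall => i; by case: (HC i).
Unshelve. all: by end_near. Qed.

Lemma correction_cvg0 : correction t @[t --> +oo] --> (0 : 'cV[R]_n).
Proof.
have [C C0 HC] := correction_bound; apply/cvgr0Pnorm_lt => e e0.
have h : C * e1 t @[t --> +oo] --> (0 : R).
  by rewrite -[0](mulr0 C); apply: cvgM => //; exact: cvg_cst.
by apply: filterS2 HC (cvgr_lt _ h _ e0) => t; exact: le_lt_trans.
Qed.

Lemma approx_solE t : s t = phi0 t + correction t.
Proof. by []. Qed.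

Lemma is_derive_approx t : t0 < t -> exists2 d, is_derive t 1 s d &
  forall i, d i 0 = (A *m s t + f t) i 0 +
    \sum_(1 <= s < k.+1) \sum_(b <- nu s) (phi b t i 0 * lin_ext (ev t) (mon_deriv b) +
       ev t b * formal_coef D fl phi0 nu k phi b t i 0).
Proof.
move=> tt; have tt' : ray t0 t by apply/rayE/ltW.
pose F r b i x := mon_eval t0 eps b x * phi b x i 0.
have d0 : is_derive t 1 phi0 (A *m phi0 t + f t).
  exact: (is_derive_inP _ _ (nbhs_ray tt)).1 (hphi0 tt').
have db r b : (1 <= r <= k)%N -> b \in nu r -> is_derive t 1 (phi b)
    (A *m phi b t + formal_coef D fl phi0 nu k phi b t).
  move=> rk br; have [_ _ /(_ t tt')] := hphi rk br.
  exact: (is_derive_inP _ _ (nbhs_ray tt)).1.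
pose d : 'cV[R]_n := \col_i ((A *m phi0 t + f t) i 0 +
  \sum_(1 <= s < k.+1) \sum_(b <- nu s) (phi b t i 0 * lin_ext (ev t) (mon_deriv b) +
       ev t b * (A *m phi b t + formal_coef D fl phi0 nu k phi b t) i 0)).
exists d.
  apply/is_derive_entry => i j; rewrite (ord1 j) mxE.
  have -> : (fun x => s x i 0) = (fun x => phi0 x i 0) +
     (fun x => \sum_(1 <= r < k.+1) \sum_(b <- nu r) mon_eval t0 eps b x * phi b x i 0).
    by apply/funext => x; rewrite approx_solE mxE correctionE.
  apply: is_deriveD; first exact: (is_derive_entry _ _ _).1 d0 i 0.
  apply: is_derive_sum_seq => r; rewrite mem_index_iota => rk.
  apply: is_derive_sum_seq => b br.
  have h1 := is_derive_mon_eval hepsC (fun i => low_rank_order hvarrho0 hpk (low rk br)) tt.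
  have h2 := (is_derive_entry _ _ _).1 (db r b rk br) i 0.
  by apply: (is_derive_eq (is_deriveM h1 h2)); rewrite /GRing.scale /= addrC mulrC.
move=> i; rewrite mxE.
have -> : (A *m s t + f t) i 0 = (A *m phi0 t + f t) i 0 +
    \sum_(1 <= r < k.+1) \sum_(b <- nu r) ev t b * (A *m phi b t) i 0.
  rewrite approx_solE mulmxDr addrAC mxE; congr (_ + _).
  rewrite /correction mulmx_sumr summxE; apply: eq_bigr => r _.
  rewrite mulmx_sumr summxE; apply: eq_bigr => b _.
  by rewrite -scalemxAr mxE.
rewrite -addrA; congr (_ + _); rewrite -big_split; apply: eq_bigr => r _ /=.
rewrite -big_split; apply: eq_bigr => b _ /=.
have -> : (A *m phi b t + formal_coef D fl phi0 nu k phi b t) i 0 =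
  (A *m phi b t) i 0 + formal_coef D fl phi0 nu k phi b t i 0 by rewrite mxE.
by rewrite mulrDr addrCA.
Qed.

Lemma derive_in_approx t : t0 < t -> is_derive t 1 s (derive_in (ray t0) s t).
Proof.
move=> tt; have [d ds _] := is_derive_approx tt.
by have [_ ->] := (is_derive_inP s d (nbhs_ray tt)).2 ds.
Qed.

(** The defect splits into what the formal cancellation leaves over, of rank above rho_k, and the
    Taylor remainders of the f_l. The linear part cancels through the equations for phi0 and the
    phi_b. *)
Lemma residualE t i : t0 < t -> residual t0 A f eps fl phi0 nu k phi t i 0 =
  (lin_ext (ev t) (formal_red D fl phi0 varrho rho nu k qk phi t i) -
   \sum_(1 <= s < k.+1) \sum_(b <- nu s) ev t b * formal_coef D fl phi0 nu k phi b t i 0)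
  + \sum_(l < m.+1) eps l t * (fl l t (s t) i 0 -
      if varrho l <= rho k then
        \sum_(w <- mis (n := n) (taylor_deg qk l))
         ((mi_fact w)%:R^-1 * pderive_mi D w (fl l) t (phi0 t) i 0) *
         \prod_j correction t j 0 ^+ w j
      else 0).
Proof.
move=> tt; have [d ds dE] := is_derive_approx tt.
have [_ E] := (is_derive_inP s d (nbhs_ray tt)).2 ds.
rewrite /residual /rhs -/s.
have -> : (- derive_in (ray t0) s t + (A *m s t + f t + \sum_(l < m.+1) eps l t *: fl l t (s t))) i 0
   = - d i 0 + (A *m s t + f t) i 0 + \sum_(l < m.+1) eps l t * fl l t (s t) i 0.
  rewrite E !mxE summxE addrA; congr (_ + _); apply: eq_bigr => l _; by rewrite mxE.
rewrite lin_ext_red dE.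
set U := (A *m s t + f t) i 0.
set SL := \sum_(l < m.+1 | varrho l <= rho k) _.
have -> : \sum_(1 <= s0 < k.+1) \sum_(b <- nu s0) (phi b t i 0 * lin_ext (ev t) (mon_deriv b) +
    ev t b * formal_coef D fl phi0 nu k phi b t i 0) =
  \sum_(1 <= s0 < k.+1) \sum_(b <- nu s0) phi b t i 0 * lin_ext (ev t) (mon_deriv b) +
  \sum_(1 <= s0 < k.+1) \sum_(b <- nu s0) ev t b * formal_coef D fl phi0 nu k phi b t i 0.
  by rewrite -big_split; apply: eq_bigr => r _; rewrite -big_split.
set S1 := \sum_(1 <= s0 < k.+1) _; set S2 := \sum_(1 <= s0 < k.+1) _.
have -> : \sum_(l < m.+1) eps l t * (fl l t (s t) i 0 -
   if varrho l <= rho k then \sum_(w <- mis (taylor_deg qk l))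
      ((mi_fact w)%:R^-1 * pderive_mi D w (fl l) t (phi0 t) i 0) *
       \prod_j correction t j 0 ^+ w j else 0) =
   \sum_(l < m.+1) eps l t * fl l t (s t) i 0 - SL.
  rewrite /SL [X in _ - X]big_mkcond -sumrB; apply: eq_bigr => l _.
  by rewrite mulrBr; case: ifP => _; rewrite ?mulr0.
by ring.
Qed.

(** Realising the orders of Taylor remainders as ranks lets [rank_gap] improve an exponent above
    rho_k to at least rho_{k+1}. *)
Lemma mon_of_rank l N : exists2 b : mon m.+1, mon_rank varrho b = varrho l + N%:R * varrho ord0 &
  b != onecm _.
Proof.
elim: N => [|N [b bE b1]].
  by exists (ucm (l, 0%N)); rewrite ?mon_rankU ?mul0r// cm1_eq1.
exists (mulcm b (ucm (ord0, 0%N))); last exact: mulcm_neq1.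
by rewrite mon_rankM mon_rankU bE -natr1 /= addr0; ring.
Qed.

Let order : R := rho k.+1 / varrho ord0.

Lemma residual_entry_order i : ord order (fun t => residual t0 A f eps fl phi0 nu k phi t i 0).
Proof.
have [I [B [c [Badm B1 cK HE]]]] := lin_ext_red_low i.
suff h : ord order (fun t => \sum_(x <- index_enum I | rho k < mon_rank varrho (B x)) c x t * ev t (B x)
  + \sum_(l <- index_enum 'I_m.+1) eps l t * (fl l t (s t) i 0 -
      if varrho l <= rho k then
        \sum_(w <- mis (n := n) (taylor_deg qk l))
         ((mi_fact w)%:R^-1 * pderive_mi D w (fl l) t (phi0 t) i 0) *
         \prod_j correction t j 0 ^+ w j
      else 0)).
  apply: ordO_ext h; apply/nearyP; exists (t0 + 1) => t tt.
  have t0t : t0 < t by apply: lt_le_trans tt; rewrite ltrDl.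
  by rewrite residualE// HE// ltW.
have high b : rho k < mon_rank varrho b -> order <= mon_rank varrho b / varrho ord0.
  by move=> h; rewrite /order ler_pM2r ?invr_gt0// (rank_gap hvarrho0 hrho hnu).
apply: ordOD.
  apply: ordO_sum => x _ xk; rewrite -[order]add0r; apply: ordOM => //; first exact: ord_bounded_K.
  by apply: ordOW (ord_mon (Badm x)) => //; exact: high.
apply: ordO_sum => l _ _.
have epsl : ord (varrho l / varrho ord0) (eps l).
  by have := hepsO (leq0n (pk l)); rewrite addr0.
have [q hq] : exists q : nat, q%:Z = Num.max 2 (qk l + 1).
  by exists (absz (Num.max 2 (qk l + 1))); rewrite gez0_abs// le_max.
have gC := hflC hq.
have small : \forall t \near +oo, `|correction t| < a.
  by have /cvgr0Pnorm_lt := correction_cvg0; apply.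
(* For varrho_l > rho_k nothing is subtracted, and boundedness of f_l suffices. Otherwise the
   remainder contributes the power [taylor_deg] + 1 of the correction. *)
have [lk|lk] := leP (varrho l) (rho k); last first.
  have [b bE b1] := mon_of_rank l 0.
  apply: (@ordOW _ _ e1_gt0 heps_o1 (varrho l / varrho ord0)).
    have -> : varrho l = mon_rank varrho b by rewrite bE mul0r addr0.
    by apply: high; rewrite bE mul0r addr0.
  rewrite -[X in ordO _ X]addr0; apply: ordOM => //; apply: ordO_bounded.
  have [|M M0 HM] := @pderive_seq_bounded R n t0 a phi0 (fl l) q 0 gC (leq0n _).
    by move=> w w0; apply: hflB; rewrite w0 le_max.
  exists M; apply/nearyP; have /nearyP[T HT] := small.
  exists (Num.max t0 T) => t; rewrite ge_max => /andP[tt Tt].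
  rewrite subr0; apply: le_trans (mx_entry_le _ i 0) _.
  apply: (HM [::]) => //.
  rewrite approx_solE addrC addKr; exact: HT.
have [qE rem] := taylor_degP hvarrho0 hqk lk.
have Nq : (size (Nil 'I_n) + taylor_deg qk l < q)%N.
  by rewrite -ltz_nat hq lt_max qE ltrDl ltr01 orbT.
have [|C C0 HC] := tube_taylor gC Nq.
  move=> w wN; apply: hflB; rewrite wN /= add0n le_max -addn1 PoszD qE lexx orbT//.
have [b bE b1] := mon_of_rank l (taylor_deg qk l).+1.
apply: (@ordOW _ _ e1_gt0 heps_o1 (varrho l / varrho ord0 + (taylor_deg qk l).+1%:R)).
  have -> : varrho l / varrho ord0 + (taylor_deg qk l).+1%:R = mon_rank varrho b / varrho ord0.
    by rewrite bE mulrDl mulfK// gt_eqF.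
  by apply: high; rewrite bE.
apply: ordOM => //; have [C' C'0 HC'] := correction_bound.
apply/ordOP; exists (C * C' ^+ (taylor_deg qk l).+1).
  by rewrite mulr_ge0// exprn_ge0.
have /nearyP[T HT] := small; have /nearyP[T' HT'] := HC'; have /nearyP[T'' HT''] := e1_gt0.
apply/nearyP; exists (Num.max t0 (Num.max T (Num.max T' T''))) => t.
rewrite !ge_max => /andP[tt /andP[Tt /andP[T't T''t]]].
have e0 := HT'' t T''t.
rewrite (powR_mulrn _ (ltW e0)) -mulrA -exprMn.
apply: (@le_trans _ _ (C * `|correction t| ^+ (taylor_deg qk l).+1)); last first.
  by rewrite ler_wpM2l// lerXn2r ?nnegrE ?HT'// mulr_ge0// ltW.
have := HC t (correction t) tt (HT t Tt); apply: le_trans.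
apply: le_trans (mx_entry_le _ i 0).
rewrite le_eqVlt; apply/orP; left; apply/eqP; congr (`|_|).
rewrite [RHS]mxE [in RHS]mxE summxE; congr (_ - _); apply: eq_bigr => w _.
by rewrite mxE cats0 mulrAC.
Qed.

Lemma residual_bound : exists2 C, 0 <= C & \forall t \near +oo,
  `|residual t0 A f eps fl phi0 nu k phi t| <= C * e1 t `^ order.
Proof.
have /choice[C HC] : forall i, exists C, 0 <= C /\ \forall t \near +oo,
    `|residual t0 A f eps fl phi0 nu k phi t i 0| <= C * e1 t `^ order.
  by move=> i; have /ordOP[C C0 HC] := residual_entry_order i; exists C.
exists (\sum_j C j); first by apply: sumr_ge0 => j _; case: (HC j).
near=> t.
apply: mx_norm_le; first by rewrite mulr_ge0 ?powR_ge0 ?sumr_ge0// => j _; case: (HC j).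
move=> i j; rewrite (ord1 j).
apply: (@le_trans _ _ (C i * e1 t `^ order)); last first.
  rewrite ler_wpM2r ?powR_ge0// (bigD1 i)//= lerDl sumr_ge0// => j' _; by case: (HC j').
move: i; near: t; apply: filter_forall => i; by case: (HC i).
Unshelve. all: by end_near. Qed.

End Residual.

(** * Slowly varying coefficients and the normal form *)

Section BoundedContinuous.
Context {R : realType}.
Variable T : R.
Implicit Types (g h : R -> R).

Definition bcts g := cts T g /\ exists C : R, forall t, T <= t -> `|g t| <= C.

Lemma bcts_near g : cts T g -> (exists C : R, \forall t \near +oo, `|g t| <= C) -> bcts g.
Proof.
move=> cg; split=> //; have [C /nearyP[T' HT']] := H; pose T2 := Num.max T T'.
have TT2 : T <= T2 by rewrite le_max lexx.
have cw : {within `[T, T2], continuous (fun t => `|g t|)}.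
  apply: continuous_in_subspaceT => t; rewrite inE /= in_itv /= => /andP[Tt _].
  exact: (cts_norm cg Tt).
have [c _ Hc] := EVT_max TT2 cw.
exists (Num.max `|g c| C) => t Tt; rewrite le_max.
have [tT2|/ltW T2t] := leP t T2; first by rewrite Hc// in_itv/= Tt.
by rewrite HT' ?orbT// (le_trans _ T2t)// le_max lexx orbT.
Qed.

Lemma bcts_cst c : bcts (fun=> c).
Proof. by split; [exact: cts_cst|exists `|c|]. Qed.

Lemma bctsD g h : bcts g -> bcts h -> bcts (fun t => g t + h t).
Proof.
move=> [cg [C HC]] [ch [C' HC']]; split; first exact: ctsD.
by exists (C + C') => t Tt; rewrite (le_trans (ler_normD _ _))// lerD ?HC ?HC'.
Qed.

Lemma bctsN g : bcts g -> bcts (fun t => - g t).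
Proof. by move=> [cg [C HC]]; split; [exact: ctsN|exists C => t; rewrite normrN; exact: HC]. Qed.

Lemma bctsB g h : bcts g -> bcts h -> bcts (fun t => g t - h t).
Proof. by move=> bg bh; apply: bctsD => //; exact: bctsN. Qed.

Lemma bctsM g h : bcts g -> bcts h -> bcts (fun t => g t * h t).
Proof.
move=> [cg [C HC]] [ch [C' HC']]; split; first exact: ctsM.
by exists (C * C') => t Tt; rewrite normrM ler_pM ?HC ?HC'.
Qed.

Lemma bcts_sum (I : Type) (s : seq I) (F : I -> R -> R) : (forall i, bcts (F i)) ->
  bcts (fun t => \sum_(i <- s) F i t).
Proof.
move=> hF; elim: s => [|i s IH].
  by rewrite (_ : (fun t => _) = (fun=> 0)); [exact: bcts_cst|apply/funext => t; rewrite big_nil].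
rewrite (_ : (fun t => _) = (fun t => F i t + \sum_(j <- s) F j t)); first exact: bctsD.
by apply/funext => t; rewrite big_cons.
Qed.

Lemma bcts_prod (I : eqType) (s : seq I) (F : I -> R -> R) : (forall i, i \in s -> bcts (F i)) ->
  bcts (fun t => \prod_(i <- s) F i t).
Proof.
elim: s => [|i s IH] hF.
  by rewrite (_ : (fun t => _) = (fun=> 1)); [exact: bcts_cst|apply/funext => t; rewrite big_nil].
rewrite (_ : (fun t => _) = (fun t => F i t * \prod_(j <- s) F j t)).
  by apply: bctsM; [exact: hF (mem_head _ _)|apply: IH => j js; apply: hF; rewrite inE js orbT].
by apply/funext => t; rewrite big_cons.
Qed.

Lemma bctsX g N : bcts g -> bcts (fun t => g t ^+ N).
Proof.
move=> bg; elim: N => [|N IH]; first exact: bcts_cst.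
rewrite (_ : (fun t => _) = (fun t => g t * g t ^+ N)); first exact: bctsM.
by apply/funext => t; rewrite exprS.
Qed.

Lemma bcts_L1 g h : bcts g -> L1 T h -> L1 T (fun t => g t * h t).
Proof. by move=> [cg bg] Lh; exact: L1_bndM. Qed.

Lemma L1_bounded_primitive g : L1 T g -> exists2 G, (forall t, T <= t -> is_derive t 1 G (g t)) &
  exists C : R, forall t, T <= t -> `|G t| <= C.
Proof.
move=> [cg [H dH [C HC]]]; have [G dG] := antiderivative_cts cg; exists G => //.
exists (`|G T| + (C + C)) => t Tt.
have h : `|G t - G T| <= H t - H T.
  by apply: (derive_le dG dH (lexx T) Tt).
have := HC t Tt; have := HC T (lexx T); have := ler_norm (G T); have := ler_norm (- G T).
by rewrite normrN; move: h; rewrite !ler_norml; lra.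
Qed.

End BoundedContinuous.

Section ComplexClasses.
Context {R : realType}.
Local Notation Re := complex.Re.
Local Notation Im := complex.Im.
Variable T : R.
Implicit Types (g h : R -> R[i]).

Definition bctsC g := bcts T (fun t => Re (g t)) /\ bcts T (fun t => Im (g t)).
Definition L1C g := L1 T (fun t => Re (g t)) /\ L1 T (fun t => Im (g t)).
Definition ctsC g := cts T (fun t => Re (g t)) /\ cts T (fun t => Im (g t)).

Lemma bctsC_ctsC g : bctsC g -> ctsC g. Proof. by move=> [[? _] [? _]]. Qed.

Let reD g h : (fun t => Re (g t + h t)) = (fun t => Re (g t) + Re (h t)).
Proof. by apply/funext => t; rewrite ReD. Qed.
Let imD g h : (fun t => Im (g t + h t)) = (fun t => Im (g t) + Im (h t)).
Proof. by apply/funext => t; rewrite ImD. Qed.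
Let reM g h : (fun t => Re (g t * h t)) = (fun t => Re (g t) * Re (h t) - Im (g t) * Im (h t)).
Proof. by apply/funext => t; rewrite ReM. Qed.
Let imM g h : (fun t => Im (g t * h t)) = (fun t => Re (g t) * Im (h t) + Im (g t) * Re (h t)).
Proof. by apply/funext => t; rewrite ImM. Qed.

Lemma bctsCD g h : bctsC g -> bctsC h -> bctsC (fun t => g t + h t).
Proof. by move=> [g1 g2] [h1 h2]; split; rewrite ?reD ?imD; exact: bctsD. Qed.

Lemma bctsCM g h : bctsC g -> bctsC h -> bctsC (fun t => g t * h t).
Proof.
by move=> [g1 g2] [h1 h2]; split; rewrite ?reM ?imM;
  [apply: bctsB; exact: bctsM|apply: bctsD; exact: bctsM].
Qed.

Lemma bctsC_cst c : bctsC (fun=> c). Proof. by split; exact: bcts_cst. Qed.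

Lemma bctsC_real (g : R -> R) : bcts T g -> bctsC (fun t => real_complex R (g t)).
Proof. by move=> bg; split=> //; exact: bcts_cst. Qed.

Lemma ctsCD g h : ctsC g -> ctsC h -> ctsC (fun t => g t + h t).
Proof. by move=> [g1 g2] [h1 h2]; split; rewrite ?reD ?imD; exact: ctsD. Qed.

Lemma ctsCM g h : ctsC g -> ctsC h -> ctsC (fun t => g t * h t).
Proof.
by move=> [g1 g2] [h1 h2]; split; rewrite ?reM ?imM;
  [apply: ctsB; exact: ctsM|apply: ctsD; exact: ctsM].
Qed.

Lemma L1C_ctsC g : L1C g -> ctsC g. Proof. by move=> [/L1_cts ? /L1_cts ?]. Qed.

Lemma L1C0 : L1C (fun=> 0). Proof. by split; exact: L1_0. Qed.

Lemma L1CD g h : L1C g -> L1C h -> L1C (fun t => g t + h t).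
Proof. by move=> [g1 g2] [h1 h2]; split; rewrite ?reD ?imD; exact: L1D. Qed.

Lemma L1C_bctsM g h : bctsC g -> L1C h -> L1C (fun t => g t * h t).
Proof.
move=> [g1 g2] [h1 h2]; split; rewrite ?reM ?imM.
  by apply: L1D; [|apply: L1N]; exact: bcts_L1.
by apply: L1D; exact: bcts_L1.
Qed.

Lemma L1CZ c g : L1C g -> L1C (fun t => c * g t).
Proof. exact: L1C_bctsM (bctsC_cst c). Qed.

End ComplexClasses.

(* Powers of the slowly varying small parameters, abstractly: products remain in
   the family or become integrable. *)
Section ParameterClass.
Context {R : realType}.
Local Notation Re := complex.Re.
Local Notation Im := complex.Im.
Variables (t0 T : R) (L : set R[i]) (K : set (R -> R)).
Hypothesis hK : classK3 t0 L K.
Hypothesis tT : t0 < T.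
Variables (I : Type) (W : I -> Prop) (deg : I -> nat) (mu dmu : I -> R -> R).
Hypothesis mu_bcts : forall w, W w -> bcts T (mu w).
Hypothesis mu_cvg0 : forall w, W w -> mu w t @[t --> +oo] --> (0 : R).
Hypothesis mu_derive : forall w t, W w -> T <= t -> is_derive t 1 (mu w) (dmu w t).
Hypothesis dmu_L1 : forall w, W w -> L1 T (dmu w).
Hypothesis muM : forall w w', W w -> W w' -> L1 T (fun t => mu w t * mu w' t) \/
  exists w'', [/\ W w'', deg w'' = (deg w + deg w')%N & forall t, mu w'' t = mu w t * mu w' t].
Implicit Types (g h : R -> R[i]) (w : I).

Inductive pcls (N : nat) : (R -> R[i]) -> Prop :=
| pcls_L1 g : L1C T g -> pcls N g
| pcls_mu w g : W w -> (N <= deg w)%N -> KC K g -> pcls N (fun t => real_complex R (mu w t) * g t)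
| pcls_add g h : pcls N g -> pcls N h -> pcls N (fun t => g t + h t).

Lemma K_bcts (f : R -> R) : K f -> bcts T f.
Proof.
move=> Kf; split; first exact: (K_cts hK tT).
by have [C HC] := K_bounded hK Kf; exists C => t Tt; apply: HC; rewrite (le_trans _ Tt)// ltW.
Qed.

Lemma KC_bctsC g : KC K g -> bctsC T g.
Proof. by move=> [g1 g2]; split; exact: K_bcts. Qed.

Lemma mu_bctsC w : W w -> bctsC T (fun t => real_complex R (mu w t)).
Proof. by move=> Ww; apply: bctsC_real; exact: mu_bcts. Qed.

Lemma pclsW N N' g : (N' <= N)%N -> pcls N g -> pcls N' g.
Proof.
move=> NN; elim=> [{}g Lg|w {}g Ww Nw Kg|{}g h _ IHg _ IHh]; first exact: pcls_L1.
  by apply: pcls_mu => //; exact: leq_trans Nw.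
exact: pcls_add.
Qed.

Lemma pclsZ N c g : pcls N g -> pcls N (fun t => c * g t).
Proof.
elim=> [{}g Lg|w {}g Ww Nw Kg|{}g h _ IHg _ IHh]; first by apply: pcls_L1; exact: L1CZ.
  rewrite (_ : (fun t => _) = (fun t => real_complex R (mu w t) * (c * g t))).
    by apply: pcls_mu => //; exact: (KC_scale hK).
  by apply/funext => t; rewrite mulrCA.
rewrite (_ : (fun t => _) = (fun t => c * g t + c * h t)); first exact: pcls_add.
by apply/funext => t; rewrite mulrDr.
Qed.

Lemma pcls0 N : pcls N (fun=> 0).
Proof. by apply: pcls_L1; exact: L1C0. Qed.

Lemma pcls_sum N (J : Type) (s : seq J) (F : J -> R -> R[i]) : (forall j, pcls N (F j)) ->
  pcls N (fun t => \sum_(j <- s) F j t).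
Proof.
move=> hF; elim: s => [|i s IH].
  by rewrite (_ : (fun t => _) = (fun=> 0)); [exact: pcls0|apply/funext => t; rewrite big_nil].
rewrite (_ : (fun t => _) = (fun t => F i t + \sum_(j <- s) F j t)); first exact: pcls_add.
by apply/funext => t; rewrite big_cons.
Qed.

(** Boundedness of one factor is required because a product of two merely integrable functions need
    not be integrable. *)
Lemma pclsM N N' g h : pcls N g -> pcls N' h -> bctsC T h -> pcls (N + N') (fun t => g t * h t).
Proof.
move=> + clh bh; elim=> [{}g Lg|w {}g Ww Nw Kg|{}g g' _ IHg _ IHg'].
- apply: pcls_L1; rewrite (_ : (fun t => _) = (fun t => h t * g t)); first exact: L1C_bctsM.
  by apply/funext => t; rewrite mulrC.
- have bg : bctsC T (fun t => real_complex R (mu w t) * g t).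
    by apply: bctsCM; [exact: mu_bctsC|exact: KC_bctsC].
  elim: clh {bh} => [{}h Lh|w' {}h Ww' Nw' Kh|{}h h' _ IHh _ IHh'].
  + by apply: pcls_L1; exact: L1C_bctsM.
  + have E : (fun t => real_complex R (mu w t) * g t * (real_complex R (mu w' t) * h t)) =
      (fun t => real_complex R (mu w t * mu w' t) * (g t * h t)).
      by apply/funext => t; rewrite rmorphM mulrACA.
    rewrite E; have [Lw|[w'' [Ww'' dw'' wE]]] := muM Ww Ww'.
      apply: pcls_L1; rewrite (_ : (fun t => _) =
        (fun t => (g t * h t) * real_complex R (mu w t * mu w' t))); last first.
        by apply/funext => t; rewrite mulrC.
      apply: L1C_bctsM; first by apply: bctsCM; exact: KC_bctsC.
      by split=> //; exact: L1_0.
    rewrite (_ : (fun t => _) = (fun t => real_complex R (mu w'' t) * (g t * h t))).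
      by apply: pcls_mu => //; [rewrite dw'' leq_add|exact: (KC_mul hK)].
    by apply/funext => t; rewrite wE.
  + rewrite (_ : (fun t => _) = (fun t => real_complex R (mu w t) * g t * h t +
      real_complex R (mu w t) * g t * h' t)); first exact: pcls_add.
    by apply/funext => t; rewrite mulrDr.
- rewrite (_ : (fun t => _) = (fun t => g t * h t + g' t * h t)); first exact: pcls_add.
  by apply/funext => t; rewrite mulrDl.
Qed.

(** Degrees in [W] are bounded in the application, so raising the degree finitely often leaves only
    integrable terms. *)
Lemma pcls_high N g : (forall w, W w -> (deg w < N)%N) -> pcls N g -> L1C T g.
Proof.
move=> WN; elim=> [//|w {}g Ww Nw Kg|{}g h _ IHg _ IHh]; last exact: L1CD.
by have := leq_trans (WN w Ww) Nw; rewrite ltnn.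
Qed.

(* Drops the integrable part, which need not be bounded. *)
Lemma pcls_strip N g : pcls N g -> exists2 h, pcls N h /\ bctsC T h & L1C T (fun t => g t - h t).
Proof.
elim=> [{}g Lg|w {}g Ww Nw Kg|{}g g' _ [h [ph bh] Lh] _ [h' [ph' bh'] Lh']].
- exists (fun=> 0); first by split; [exact: pcls0|exact: bctsC_cst].
  by rewrite (_ : (fun t => _) = g)//; apply/funext => t; rewrite subr0.
- exists (fun t => real_complex R (mu w t) * g t).
    split; first exact: pcls_mu.
    by apply: bctsCM; [exact: mu_bctsC|exact: KC_bctsC].
  rewrite (_ : (fun t => _) = (fun=> 0)); first exact: L1C0.
  by apply/funext => t; rewrite subrr.
- exists (fun t => h t + h' t); first by split; [exact: pcls_add|exact: bctsCD].
  rewrite (_ : (fun t => _) = (fun t => (g t - h t) + (g' t - h' t))); first exact: L1CD.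
  by apply/funext => t; rewrite opprD addrACA.
Qed.

Definition is_deriveC (t : R) g (d : R[i]) := is_derive t 1 (fun x => Re (g x)) (Re d) /\
  is_derive t 1 (fun x => Im (g x)) (Im d).

Lemma is_deriveCD t g h d e : is_deriveC t g d -> is_deriveC t h e ->
  is_deriveC t (fun t => g t + h t) (d + e).
Proof.
move=> [g1 g2] [h1 h2]; split; rewrite ?ReD ?ImD.
  rewrite (_ : (fun t => _) = (fun x => Re (g x)) + (fun x => Re (h x))); first exact: is_deriveD.
  by apply/funext => x; rewrite ReD.
rewrite (_ : (fun t => _) = (fun x => Im (g x)) + (fun x => Im (h x))); first exact: is_deriveD.
by apply/funext => x; rewrite ImD.
Qed.

(* The coefficients mu_w kappa are integrated against e^{delta t} as if mu_w were constant. *)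
Lemma pcls_solve N delta g : L delta -> pcls N g -> exists v dv,
  [/\ pcls N v, bctsC T v, ctsC T dv,
      Re (v t) @[t --> +oo] --> (0 : R) /\ Im (v t) @[t --> +oo] --> (0 : R) &
      (forall t, T <= t -> is_deriveC t v (dv t)) /\
      L1C T (fun t => dv t - delta * v t - g t)].
Proof.
move=> Ld; elim=> [{}g Lg|w {}g Ww Nw Kg|{}g g' _ [v [dv [pv bv cdv [v1 v2] [dvP Lv]]]]
   _ [v' [dv' [pv' bv' cdv' [v1' v2'] [dvP' Lv']]]]].
- exists (fun=> 0), (fun=> 0); split.
  + exact: pcls0.
  + exact: bctsC_cst.
  + by apply: bctsC_ctsC; exact: bctsC_cst.
  + by split; exact: cvg_cst.
  + split; first by move=> t _; split; exact: is_derive_cst.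
    rewrite (_ : (fun t => _) = (fun t => -1 * g t)); first exact: L1CZ.
    by apply/funext => t; rewrite mulr0 subrr sub0r mulN1r.
- have [y [y1 y2 c1 c2 Hy]] := K3_solve hK (Kg.1) (Kg.2) Ld.
  have Ky : KC K y by [].
  have dy t : T <= t -> is_deriveC t y (delta * y t + g t).
    move=> Tt; have t0t : t0 < t by exact: lt_le_trans Tt.
    have tt : ray t0 t by apply/rayE/ltW.
    have [e1 e2] := Hy t tt.
    have [_ /(_ isT t tt) D1] := c1 0%N isT.
    have [_ /(_ isT t tt) D2] := c2 0%N isT.
    by split; apply: (is_derive_inP _ _ (nbhs_ray t0t)).1; split.
  exists (fun t => real_complex R (mu w t) * y t),
    (fun t => real_complex R (dmu w t) * y t + real_complex R (mu w t) * (delta * y t + g t)).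
  have bw := mu_bcts Ww; have bwC := mu_bctsC Ww.
  have Ldw : L1C T (fun t => real_complex R (dmu w t)).
    by split; [exact: dmu_L1|exact: L1_0].
  have by' := KC_bctsC Ky; have bg := KC_bctsC Kg.
  split.
  + exact: pcls_mu.
  + exact: bctsCM.
  + apply: ctsCD; first by apply: ctsCM; [exact: L1C_ctsC|exact: bctsC_ctsC].
    apply: bctsC_ctsC; apply: bctsCM => //; apply: bctsCD => //.
    by apply: bctsCM => //; exact: bctsC_cst.
  + have cvg0 (f : R -> R) : bcts T f -> mu w t * f t @[t --> +oo] --> (0 : R).
      move=> [_ [C HC]]; apply/cvgr0Pnorm_lt => e e0.
      have C1 : 0 < `|C| + 1 by rewrite ltr_wpDl.
      have /cvgr0Pnorm_lt/(_ (e / (`|C| + 1))) := mu_cvg0 Ww.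
      rewrite divr_gt0// => /(_ isT) H.
      have HT : \forall t \near +oo, T <= t by apply/nearyP; exists T.
      apply: filterS2 H HT => t H Tt; rewrite ltr_pdivlMr// in H.
      apply: le_lt_trans H; rewrite normrM; apply: ler_wpM2l => //.
      by have := HC t Tt; have := ler_norm C; lra.
    split.
      rewrite (_ : (fun t => _) = (fun t => mu w t * Re (y t))); first by apply: cvg0; exact: by'.1.
      by apply/funext => t; rewrite ReM Re_real Im_real mul0r subr0.
    rewrite (_ : (fun t => _) = (fun t => mu w t * Im (y t))); first by apply: cvg0; exact: by'.2.
    by apply/funext => t; rewrite ImM Re_real Im_real mul0r addr0.
  + split=> [t Tt|].
      have dm := mu_derive Ww Tt; have [d1 d2] := dy t Tt; split.
        rewrite (_ : (fun x => _) = mu w * (fun x => Re (y x))); last first.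
          by apply/funext => x; rewrite ReM Re_real Im_real mul0r subr0.
        apply: (is_derive_eq (is_deriveM dm d1)).
        by move: (delta * y t + g t) => Z; rewrite ReD !ReM /GRing.scale /=; ring.
      rewrite (_ : (fun x => _) = mu w * (fun x => Im (y x))); last first.
        by apply/funext => x; rewrite ImM Re_real Im_real mul0r addr0.
      apply: (is_derive_eq (is_deriveM dm d2)).
      by move: (delta * y t + g t) => Z; rewrite ImD !ImM /GRing.scale /=; ring.
    rewrite (_ : (fun t => _) = (fun t => y t * real_complex R (dmu w t))); first exact: L1C_bctsM.
    by apply/funext => t; ring.
- exists (fun t => v t + v' t), (fun t => dv t + dv' t); split.
  + exact: pcls_add.
  + exact: bctsCD.
  + exact: ctsCD.
  + split; rewrite -[0]addr0.
      by rewrite (_ : (fun t => _) = (fun t => Re (v t) + Re (v' t))); [exact: cvgD|apply/funext => t; rewrite ReD].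
    by rewrite (_ : (fun t => _) = (fun t => Im (v t) + Im (v' t))); [exact: cvgD|apply/funext => t; rewrite ImD].
  + split=> [t Tt|]; first by apply: is_deriveCD; [exact: dvP|exact: dvP'].
    rewrite (_ : (fun t => _) = (fun t => (dv t - delta * v t - g t) + (dv' t - delta * v' t - g' t))).
      exact: L1CD.
    by apply/funext => t; ring.
Qed.

(* Splitting the coefficients into mean value and oscillation. *)
Lemma pcls_mean N g : pcls N g -> exists (r : seq (I * R)) (sig : R -> R),
  [/\ forall x, List.In x r -> W x.1, cts T sig,
      exists2 G, (forall t, T <= t -> is_derive t 1 G (sig t)) &
        exists C : R, forall t, T <= t -> `|G t| <= C &
      forall t, Re (g t) = \sum_(x <- r) x.2 * mu x.1 t + sig t].
Proof.
elim=> [{}g [Lg _]|w {}g Ww Nw [Kg _]|{}g g' _ [r [sg [Wr cs [G dG [C HC]] E]]]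
    _ [r' [sg' [Wr' cs' [G' dG' [C' HC']] E']]]].
- exists [::], (fun t => Re (g t)); split=> //; first exact: L1_cts.
    exact: L1_bounded_primitive.
  by move=> t; rewrite big_nil add0r.
- have [M HM] := K_mean hK Kg.
  have ck : cts T (fun t => Re (g t) - M) by apply: ctsB; [exact: (K_cts hK)|exact: cts_cst].
  have [G dG] := antiderivative_cts ck.
  have bG := HM T (ltW tT) G dG.
  have cG := cts_derive dG.
  (* Integration by parts: with H' = mu' G integrable, mu G - H is a bounded primitive of mu (Re g -
     M). *)
  have [H dH bH] : exists2 H, (forall t, T <= t -> is_derive t 1 H (G t * dmu w t)) &
     exists C : R, forall t, T <= t -> `|H t| <= C.
    by apply: L1_bounded_primitive; apply: bcts_L1 => //; exact: dmu_L1.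
  exists [:: (w, M)], (fun t => mu w t * (Re (g t) - M)); split.
  + by move=> x [<-|].
  + by apply: ctsM => //; have [] := mu_bcts Ww.
  + exists (fun t => mu w t * G t - H t).
      move=> t Tt; have d1 := is_deriveM (mu_derive Ww Tt) (dG t Tt).
      apply: (is_derive_eq (is_deriveB d1 (dH t Tt))).
      by rewrite /GRing.scale /=; ring.
    have [_ ?] : bcts T (fun t => mu w t * G t - H t); last by [].
    apply: bctsB; first by apply: bctsM; [exact: mu_bcts|split].
    by split=> //; exact: cts_derive dH.
  + by move=> t; rewrite big_seq1 /= ReM Re_real Im_real mul0r subr0 mulrBr; ring.
- exists (r ++ r'), (fun t => sg t + sg' t); split.
  + by move=> x /(List.in_app_or r r' x)[/Wr|/Wr'].
  + exact: ctsD.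
  + exists (G + G'); first by move=> t Tt; exact: is_deriveD (dG t Tt) (dG' t Tt).
    exists (C + C') => t Tt; rewrite (le_trans (ler_normD _ _))// lerD ?HC ?HC'//.
  + by move=> t; rewrite ReD E E' big_cat /=; ring.
Qed.

End ParameterClass.

(** * Successive diagonalisation up to integrable terms *)

Section NormalForm.
Context {R : realType}.
Local Notation Re := complex.Re.
Local Notation Im := complex.Im.
Variables (t0 T : R) (L : set R[i]) (K : set (R -> R)).
Hypothesis hK : classK3 t0 L K.
Hypothesis tT : t0 < T.
Variables (I : Type) (W : I -> Prop) (deg : I -> nat) (mu dmu : I -> R -> R).
Hypothesis mu_bcts : forall w, W w -> bcts T (mu w).
Hypothesis mu_cvg0 : forall w, W w -> mu w t @[t --> +oo] --> (0 : R).
Hypothesis mu_derive : forall w t, W w -> T <= t -> is_derive t 1 (mu w) (dmu w t).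
Hypothesis dmu_L1 : forall w, W w -> L1 T (dmu w).
Hypothesis muM : forall w w', W w -> W w' -> L1 T (fun t => mu w t * mu w' t) \/
  exists w'', [/\ W w'', deg w'' = (deg w + deg w')%N & forall t, mu w'' t = mu w t * mu w' t].
Local Notation pcls := (pcls T K W deg mu).
Let pM := pclsM hK tT mu_bcts muM.
Let pZ := pclsZ hK (T := T) (W := W) (deg := deg) (mu := mu).

Variables (n : nat) (lam : 'I_n -> R[i]).
Hypothesis Ldiff : forall i j, i != j -> L (lam i - lam j).
Variable C : 'I_n -> 'I_n -> R -> R[i].
Hypothesis C1 : forall i j, pcls 1 (C i j).

(** The entries of (Lam + C)(1 + X) - (1 + X)(Lam + diag d) - X' with Lam = diag lam: the error of 1
    + X as a frame diagonalising Lam + C. *)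
Definition normal_defect (X dX : 'I_n -> 'I_n -> R -> R[i]) (d : 'I_n -> R -> R[i]) i j t :=
  C i j t + \sum_k C i k t * X k j t + (lam i - lam j) * X i j t
  - (i == j)%:R * d j t - X i j t * d j t - dX i j t.

Definition vanishing (g : R -> R[i]) :=
  Re (g t) @[t --> +oo] --> (0 : R) /\ Im (g t) @[t --> +oo] --> (0 : R).

Lemma vanishingD g h : vanishing g -> vanishing h -> vanishing (fun t => g t + h t).
Proof.
move=> [g1 g2] [h1 h2]; split; rewrite -[0]addr0.
  by rewrite (_ : (fun t => _) = (fun t => Re (g t) + Re (h t))); [exact: cvgD|apply/funext => t; rewrite ReD].
by rewrite (_ : (fun t => _) = (fun t => Im (g t) + Im (h t))); [exact: cvgD|apply/funext => t; rewrite ImD].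
Qed.

Lemma normal_form_step N : exists (X dX : 'I_n -> 'I_n -> R -> R[i]) (d : 'I_n -> R -> R[i]),
  [/\ forall i j, [/\ pcls 1 (X i j), bctsC T (X i j), vanishing (X i j),
        ctsC T (dX i j) & forall t, T <= t -> is_deriveC t (X i j) (dX i j t)],
      forall j, pcls 1 (d j) /\ bctsC T (d j) &
      forall i j, pcls N.+1 (normal_defect X dX d i j)].
Proof.
elim: N => [|N [X [dX [d [HX Hd HE]]]]].
  exists (fun _ _ _ => 0), (fun _ _ _ => 0), (fun _ _ => 0); split.
  - move=> i j; split.
    + exact: pcls0.
    + exact: bctsC_cst.
    + by split; exact: cvg_cst.
    + by apply: bctsC_ctsC; exact: bctsC_cst.
    + by move=> t _; split; exact: is_derive_cst.
  - by move=> j; split; [exact: pcls0|exact: bctsC_cst].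
  - move=> i j; rewrite (_ : normal_defect _ _ _ i j = C i j)//; apply/funext => t.
    by rewrite /normal_defect !mulr0 !subr0 big1 ?addr0// => k _; rewrite mulr0.
(* Diagonal entries cannot be solved away, as the difference lam_j - lam_j is 0; they are moved into
   [d]. Their integrable part is left in the defect, which keeps [d] bounded and hence usable as a
   factor. *)
have /choice[g Hg] : forall j, exists g, [/\ pcls N.+1 g, bctsC T g &
    L1C T (fun t => normal_defect X dX d j j t - g t)].
  by move=> j; have [g [h1 h2] h3] := pcls_strip hK tT mu_bcts (HE j j); exists g.
have solve i j : exists v dv, [/\ pcls N.+1 v, bctsC T v /\ vanishing v, ctsC T dv,
    forall t, T <= t -> is_deriveC t v (dv t) &
    L1C T (fun t => dv t - (lam i - lam j) * v t -
      (normal_defect X dX d i j t - (i == j)%:R * g j t))].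
  have [->|ij] := eqVneq i j.
    have [h1 h2 h3] := Hg j; exists (fun=> 0), (fun=> 0); split.
    + exact: pcls0.
    + by split; [exact: bctsC_cst|split; exact: cvg_cst].
    + by apply: bctsC_ctsC; exact: bctsC_cst.
    + by move=> t _; split; exact: is_derive_cst.
    + rewrite (_ : (fun t => _) = (fun t => -1 * (normal_defect X dX d j j t - g j t))); first exact: L1CZ.
      by apply/funext => t; rewrite mulr0 subrr mul1r sub0r mulN1r.
  have [v [dv [h1 h2 h3 h4 [h5 h6]]]] := pcls_solve hK tT mu_bcts mu_cvg0 mu_derive dmu_L1 (Ldiff ij) (HE i j).
  exists v, dv; split=> //.
  rewrite (_ : (fun t => _) = (fun t => dv t - (lam i - lam j) * v t - normal_defect X dX d i j t))//.
  by apply/funext => t; rewrite mul0r subr0.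
have /choice[v1 Hv1] : forall ij, exists v dv, [/\ pcls N.+1 v, bctsC T v /\ vanishing v, ctsC T dv,
    forall t, T <= t -> is_deriveC t v (dv t) &
    L1C T (fun t => dv t - (lam ij.1 - lam ij.2) * v t -
      (normal_defect X dX d ij.1 ij.2 t - (ij.1 == ij.2)%:R * g ij.2 t))].
  by move=> [i j]; exact: solve.
have /choice[dv1 Hdv1] := Hv1.
pose v i j := v1 (i, j); pose dv i j := dv1 (i, j).
have Hv i j : [/\ pcls N.+1 (v i j), bctsC T (v i j) /\ vanishing (v i j), ctsC T (dv i j),
    forall t, T <= t -> is_deriveC t (v i j) (dv i j t) &
    L1C T (fun t => dv i j t - (lam i - lam j) * v i j t -
      (normal_defect X dX d i j t - (i == j)%:R * g j t))] by exact: (Hdv1 (i, j)).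
exists (fun i j t => X i j t + v i j t), (fun i j t => dX i j t + dv i j t), (fun j t => d j t + g j t).
split.
- move=> i j; have [x1 x2 x3 x4 x5] := HX i j; have [w1 [w2 w3] w4 w5 _] := Hv i j; split.
  + by apply: pcls_add => //; apply: pclsW w1.
  + exact: bctsCD.
  + exact: vanishingD.
  + exact: ctsCD.
  + by move=> t Tt; apply: is_deriveCD; [exact: x5|exact: w5].
- move=> j; have [d1 d2] := Hd j; have [g1 g2 _] := Hg j; split; last exact: bctsCD.
  by apply: pcls_add => //; apply: pclsW g1.
move=> i j; have [x1 x2 x3 x4 x5] := HX i j; have [w1 [w2 w3] w4 w5 w6] := Hv i j.
have [d1 d2] := Hd j; have [g1 g2 _] := Hg j.
(* The old defect cancels up to integrable terms. The products that remain combine a factor of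
   degree at least N + 1, namely v or g, with another of degree at least 1. *)
rewrite (_ : normal_defect _ _ _ i j = (fun t =>
   -1 * (dv i j t - (lam i - lam j) * v i j t - (normal_defect X dX d i j t - (i == j)%:R * g j t))
   + (\sum_k C i k t * v k j t + ((-1) * (X i j t * g j t) +
      ((-1) * (v i j t * d j t) + (-1) * (v i j t * g j t)))))); last first.
  apply/funext => t; rewrite /normal_defect.
  under eq_bigr do rewrite mulrDr.
  by rewrite big_split /=; ring.
apply: pcls_add; first by apply: pcls_L1; exact: L1CZ.
apply: pcls_add.
  apply: pcls_sum => k; rewrite -add1n; have [? [? _] _ _ _] := Hv k j; exact: pM.
apply: pcls_add; first by apply: pZ; rewrite -add1n; exact: pM.
apply: pcls_add; first by apply: pZ; rewrite -addn1; exact: pM.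
by apply: pZ; apply: (pclsW (N := N.+1 + N.+1)); [rewrite addnS ltnS leq_addr|exact: pM].
Qed.

Lemma normal_form N : (forall w, W w -> (deg w <= N)%N) ->
  exists (X dX : 'I_n -> 'I_n -> R -> R[i]) (d : 'I_n -> R -> R[i]),
  [/\ forall i j, [/\ bctsC T (X i j), vanishing (X i j) &
        forall t, T <= t -> is_deriveC t (X i j) (dX i j t)],
      forall j, pcls 1 (d j) /\ bctsC T (d j) &
      forall i j, L1C T (normal_defect X dX d i j)].
Proof.
move=> WN; have [X [dX [d [HX Hd HE]]]] := normal_form_step N.
exists X, dX, d; split=> // i j; first by have [] := HX i j.
by apply: (pcls_high (N := N.+1)) (HE i j) => w /WN; rewrite ltnS.
Qed.

End NormalForm.

Lemma bctsW {R : realType} (T T' : R) g : T <= T' -> bcts T g -> bcts T' g.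
Proof.
move=> TT' [cg [C HC]]; split; first exact: ctsW cg.
by exists C => t T't; apply: HC; exact: le_trans T't.
Qed.

Section BoundedInverse.
Context {R : realType}.
Implicit Types T : R.

Lemma bcts_det T m (A : R -> 'M[R]_m) : (forall i j, bcts T (fun t => A t i j)) ->
  bcts T (fun t => \det (A t)).
Proof.
move=> bA; rewrite /determinant; apply: bcts_sum => s.
apply: bctsM; first exact: bcts_cst.
by apply: bcts_prod => i _; exact: bA.
Qed.

(** Cramer's rule: the adjugate is polynomial in the entries, and the determinant stays away from
    0. *)
Lemma bcts_invmx T m (A : R -> 'M[R]_m) (e : R) : (forall i j, bcts T (fun t => A t i j)) ->
  0 < e -> (forall t, T <= t -> e <= `|\det (A t)|) ->
  forall i j, bcts T (fun t => invmx (A t) i j).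
Proof.
move=> bA e0 dA i j; have [cd _] := bcts_det bA.
have d0 t : T <= t -> \det (A t) != 0.
  by move=> Tt; rewrite -normr_gt0 (lt_le_trans e0)// dA.
have binv : bcts T (fun t => (\det (A t))^-1).
  split; first exact: cts_inv.
  by exists e^-1 => t Tt; rewrite normfV lef_pV2 ?dA// posrE normr_gt0 d0.
have badj : bcts T (fun t => \adj (A t) i j).
  rewrite (_ : (fun t => _) = (fun t => (-1) ^+ (j + i) * \det (row' j (col' i (A t))))); last first.
    by apply/funext => t; rewrite mxE.
  apply: bctsM; first exact: bcts_cst.
  apply: bcts_det => k l; rewrite (_ : (fun t => _) = (fun t => A t (lift j k) (lift i l)))//.
  by apply/funext => t; rewrite !mxE.
have [c1 [M HM]] := bctsM binv badj.
have E t : \det (A t) != 0 -> (\det (A t))^-1 * \adj (A t) i j = invmx (A t) i j.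
  by move=> dt; rewrite /invmx unitmxE unitfE dt [RHS]mxE.
split; last by exists M => t Tt; rewrite -E ?HM// d0.
(* A neighbourhood of t = T reaches to the left of [T], where no bound on the determinant is given,
   and [invmx] is not the adjugate formula at singular matrices. Continuity of the determinant
   settles this. *)
move=> t Tt; have nz : \forall x \near t, \det (A x) != 0.
  by apply: (cvgr_neq0 _ (cd t Tt)); exact: d0.
change ((fun x => invmx (A x) i j) @ t --> invmx (A t) i j).
rewrite -(E t (d0 t Tt)); apply: cvg_trans (c1 t Tt).
by apply: near_eq_cvg; apply: filterS nz => x dx; rewrite E.
Qed.

Lemma cvg_det {T : Type} (Fl : set_system T) {FF : Filter Fl} m (A : T -> 'M[R]_m) (B : 'M[R]_m) :
  (forall i j, (fun x => A x i j) @ Fl --> B i j) -> (fun x => \det (A x)) @ Fl --> \det B.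
Proof.
move=> AB; rewrite /determinant; apply: cvg_big => [|s _]; first exact: add_continuous.
apply: cvgM; first exact: cvg_cst.
by apply: cvg_big => [|i _]; [exact: mul_continuous|exact: AB].
Qed.

End BoundedInverse.

Lemma mxB2 {V : zmodType} p q (M1 M2 M3 : 'M[V]_(p, q)) i j :
  (M1 - M2 - M3) i j = M1 i j - M2 i j - M3 i j.
Proof. by rewrite !mxE. Qed.

Section ComplexSums.
Context {R : realType} {J : Type}.
Variable T : R.
Implicit Types (s : seq J) (F : J -> R -> R[i]).

Lemma bctsC_sum s F : (forall j, bctsC T (F j)) -> bctsC T (fun t => \sum_(j <- s) F j t).
Proof.
move=> hF; elim: s => [|i s IH].
  by rewrite (_ : (fun t => _) = (fun=> 0)); [exact: bctsC_cst|apply/funext => t; rewrite big_nil].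
rewrite (_ : (fun t => _) = (fun t => F i t + \sum_(j <- s) F j t)); first exact: bctsCD.
by apply/funext => t; rewrite big_cons.
Qed.

Lemma L1C_sum s F : (forall j, L1C T (F j)) -> L1C T (fun t => \sum_(j <- s) F j t).
Proof.
move=> hF; elim: s => [|i s IH].
  by rewrite (_ : (fun t => _) = (fun=> 0)); [exact: L1C0|apply/funext => t; rewrite big_nil].
rewrite (_ : (fun t => _) = (fun t => F i t + \sum_(j <- s) F j t)); first exact: L1CD.
by apply/funext => t; rewrite big_cons.
Qed.

Lemma vanishing_sum s F : (forall j, vanishing (F j)) -> vanishing (fun t => \sum_(j <- s) F j t).
Proof.
move=> hF; elim: s => [|i s IH].
  rewrite (_ : (fun t => _) = (fun=> 0)); first by split; exact: cvg_cst.
  by apply/funext => t; rewrite big_nil.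
rewrite (_ : (fun t => _) = (fun t => F i t + \sum_(j <- s) F j t)); first exact: vanishingD.
by apply/funext => t; rewrite big_cons.
Qed.

Lemma vanishingZ (c : R[i]) (g : R -> R[i]) : vanishing g -> vanishing (fun t => c * g t).
Proof.
move=> [g1 g2]; split.
  rewrite (_ : (fun t => _) = (fun t => complex.Re c * complex.Re (g t) - complex.Im c * complex.Im (g t))).
    have -> : (0 : R) = complex.Re c * 0 - complex.Im c * 0 by rewrite !mulr0 subrr.
    by apply: cvgB; apply: cvgM => //; exact: cvg_cst.
  by apply/funext => t; rewrite ReM.
rewrite (_ : (fun t => _) = (fun t => complex.Re c * complex.Im (g t) + complex.Im c * complex.Re (g t))).
  have -> : (0 : R) = complex.Re c * 0 + complex.Im c * 0 by rewrite !mulr0 addr0.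
  by apply: cvgD; apply: cvgM => //; exact: cvg_cst.
by apply/funext => t; rewrite ImM.
Qed.

End ComplexSums.

Lemma is_deriveC_lin {R : realType} n (t : R) (c : 'I_n -> R[i]) (X : 'I_n -> R -> R[i]) (dX : 'I_n -> R[i]) :
  (forall k, is_deriveC t (X k) (dX k)) ->
  is_deriveC t (fun x => \sum_k c k * X k x) (\sum_k c k * dX k).
Proof.
move=> H; split; rewrite ?Re_sum ?Im_sum.
  rewrite (_ : (fun x => _) = (fun x => \sum_k complex.Re (c k * X k x))); last first.
    by apply/funext => x; rewrite Re_sum.
  apply: is_derive_sum_seq => k _; have [h1 h2] := H k.
  rewrite (_ : (fun x => _) = (complex.Re (c k) \*: (fun x => complex.Re (X k x))) -
     (complex.Im (c k) \*: (fun x => complex.Im (X k x)))); last first.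
    by apply/funext => x; rewrite ReM.
  by rewrite ReM; exact: is_deriveB.
rewrite (_ : (fun x => _) = (fun x => \sum_k complex.Im (c k * X k x))); last first.
  by apply/funext => x; rewrite Im_sum.
apply: is_derive_sum_seq => k _; have [h1 h2] := H k.
rewrite (_ : (fun x => _) = (complex.Re (c k) \*: (fun x => complex.Im (X k x))) +
   (complex.Im (c k) \*: (fun x => complex.Re (X k x)))); last first.
  by apply/funext => x; rewrite ImM.
by rewrite ImM; exact: is_deriveD.
Qed.

(** A complex column gives two real columns with the same growth rate. *)
Definition doubled {R : realType} {n : nat} (p : 'I_n -> R -> R) (j : 'I_(n + n)) (t : R) : R :=
  match fintype.split j with inl j => p j t | inr j => p j t end.

Lemma row_mx_defect {R : realType} {n : nat} (t : R) (p : 'I_n -> R -> R) (B : 'M[R]_n)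
  (a b da db fa fb : 'I_n -> 'I_n -> R) :
  (forall i j, da i j = \sum_k B i k * a k j - a i j * p j t - fa i j) ->
  (forall i j, db i j = \sum_k B i k * b k j - b i j * p j t - fb i j) ->
  row_mx (\matrix_(i, j) da i j) (\matrix_(i, j) db i j) =
  B *m row_mx (\matrix_(i, j) a i j) (\matrix_(i, j) b i j)
  - row_mx (\matrix_(i, j) a i j) (\matrix_(i, j) b i j) *m diag_mx (\row_j doubled p j t)
  - row_mx (\matrix_(i, j) fa i j) (\matrix_(i, j) fb i j).
Proof.
move=> Ha Hb; apply/matrixP => i j.
rewrite mxB2 mul_mx_diag [X in _ - X - _]mxE [(\row__ _) _ _]mxE mul_mx_row /doubled.
rewrite -(splitK j); case: (fintype.split j) => j' /=.
  rewrite !row_mxEl (unsplitK (inl j')) mxE Ha mxE.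
  rewrite [(B *m _) i j']mxE [X in _ = _ - X]mxE; congr (_ - _ - _).
  by apply: eq_bigr => k _; rewrite mxE.
rewrite !row_mxEr (unsplitK (inr j')) mxE Hb mxE.
rewrite [(B *m _) i j']mxE [X in _ = _ - X]mxE; congr (_ - _ - _).
by apply: eq_bigr => k _; rewrite mxE.
Qed.

(** * The real n x 2n frame obtained from the complex normal form *)

Section RealNormalForm.
Context {R : realType}.
Local Notation Re := complex.Re.
Local Notation Im := complex.Im.
Local Notation C_ := (real_complex R).
Variables (T : R) (n : nat) (A : 'M[R]_n) (lam : 'I_n -> R[i]) (B : R -> 'M[R]_n)
  (Q : 'M[R[i]]_n).
Hypothesis Qu : Q \in unitmx.
Hypothesis QA : Q *m map_mx C_ A = diag_mx (\row_j lam j) *m Q.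
Let P := invmx Q.

Definition conjugated_perturbation i j t : R[i] :=
  (Q *m map_mx C_ (B t - A) *m P) i j.

Variables (X dX : 'I_n -> 'I_n -> R -> R[i]) (d : 'I_n -> R -> R[i]).
Hypothesis bX : forall i j, bctsC T (X i j).
Hypothesis X0 : forall i j, vanishing (X i j).
Hypothesis dXP : forall i j t, T <= t -> is_deriveC t (X i j) (dX i j t).
Hypothesis bd : forall j, bctsC T (d j).
Hypothesis LE : forall i j, L1C T (normal_defect lam conjugated_perturbation X dX d i j).

Let Xm t : 'M[R[i]]_n := \matrix_(i, j) X i j t.
Let dXm t : 'M[R[i]]_n := \matrix_(i, j) dX i j t.
Let Em t : 'M[R[i]]_n := \matrix_(i, j) normal_defect lam conjugated_perturbation X dX d i j t.
Let Dm t : 'M[R[i]]_n := diag_mx (\row_j (lam j + d j t)).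
Let S t : 'M[R[i]]_n := P *m (1%:M + Xm t).
Let dS t : 'M[R[i]]_n := P *m dXm t.
Let F t : 'M[R[i]]_n := P *m Em t.

(** Since B P = P (Lam + C), the defect of the frame S = P (1 + X) for B is P times the normal-form
    defect. *)
Lemma complex_defect t : F t = map_mx C_ (B t) *m S t - S t *m Dm t - dS t.
Proof.
pose Lm : 'M[R[i]]_n := diag_mx (\row_j lam j).
pose Cm := Q *m map_mx C_ (B t - A) *m P.
have PQ : P *m Q = 1%:M by exact: mulVmx.
have BP : map_mx C_ (B t) *m P = P *m (Lm + Cm).
  have -> : B t = A + (B t - A) by rewrite addrC subrK.
  rewrite map_mxD mulmxDl mulmxDr; congr (_ + _).
    by rewrite -[LHS]mul1mx -PQ -[LHS]mulmxA; congr (_ *m _); rewrite mulmxA QA mulmxK.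
  by rewrite /Cm -[Q *m _ *m P]mulmxA [RHS]mulmxA PQ mul1mx.
rewrite /F; have -> : Em t = (Lm + Cm) *m (1%:M + Xm t) - (1%:M + Xm t) *m Dm t - dXm t.
  apply/matrixP => i j.
  have e1 : ((Lm + Cm) *m (1%:M + Xm t)) i j = (i == j)%:R * lam j + lam i * X i j t +
     (conjugated_perturbation i j t + \sum_k conjugated_perturbation i k t * X k j t).
    rewrite mulmxDl mulmxDr mulmxDr !mulmx1 mxE; congr (_ + _).
      by rewrite mxE /Lm mul_diag_mx !mxE mulr_natl; congr (_ + _); case: eqVneq => [->|].
    rewrite mxE /conjugated_perturbation; congr (_ + _); rewrite mxE; apply: eq_bigr => k _.
    by rewrite [Xm t k j]mxE.
  have e2 : ((1%:M + Xm t) *m Dm t) i j = (i == j)%:R * (lam j + d j t) + X i j t * (lam j + d j t).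
    rewrite mulmxDl mul1mx mxE /Dm mul_mx_diag !mxE; congr (_ + _).
    by case: eqVneq => [->|_]; rewrite ?mul1r ?mulr1n ?mul0r ?mulr0n.
  rewrite mxB2 e1 e2 [Em t i j]mxE [dXm t i j]mxE /normal_defect.
  ring.
by rewrite /S /dS !mulmxBr /= [P *m (_ *m _)]mulmxA -BP -!mulmxA.
Qed.

Variable th : 'I_n -> R -> R.
Hypothesis dth : forall j t, T <= t -> is_derive t 1 (th j) (Im (lam j + d j t)).

(* Real and imaginary part of z e^{i theta}. *)
Let rot_re (z : R[i]) (x : R) : R := Re z * cos x - Im z * sin x.
Let rot_im (z : R[i]) (x : R) : R := Re z * sin x + Im z * cos x.

Definition real_frame t : 'M[R]_(n, n + n) :=
  row_mx (\matrix_(i, j) rot_re (S t i j) (th j t)) (\matrix_(i, j) rot_im (S t i j) (th j t)).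

Definition real_frame_deriv t : 'M[R]_(n, n + n) :=
  row_mx (\matrix_(i, j) (rot_re (dS t i j) (th j t) - Im (lam j + d j t) * rot_im (S t i j) (th j t)))
         (\matrix_(i, j) (rot_im (dS t i j) (th j t) + Im (lam j + d j t) * rot_re (S t i j) (th j t))).

Definition real_frame_defect t : 'M[R]_(n, n + n) :=
  row_mx (\matrix_(i, j) rot_re (F t i j) (th j t)) (\matrix_(i, j) rot_im (F t i j) (th j t)).

(** Multiplying column j by e^{i theta_j} with theta_j' = Im(lam_j + d_j) cancels the imaginary part
    of the rate. As B is real, real and imaginary parts of the columns then satisfy the same
    equation separately. *)
Lemma real_frame_eq t : real_frame_deriv t = B t *m real_frame t -
  real_frame t *m diag_mx (\row_j doubled (fun j t => Re (lam j + d j t)) j t) - real_frame_defect t.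
Proof.
have Fij i j : dS t i j = (\sum_k C_ (B t i k) * S t k j) - S t i j * (lam j + d j t) - F t i j.
  rewrite complex_defect mxB2; set BS := map_mx _ _ *m _; set SD := S t *m Dm t.
  have -> : BS i j = \sum_k C_ (B t i k) * S t k j by rewrite mxE; apply: eq_bigr => k _; rewrite mxE.
  have -> : SD i j = S t i j * (lam j + d j t) by rewrite /SD /Dm mul_mx_diag mxE [(\row__ _) _ _]mxE.
  by ring.
have re_sum (c : 'I_n -> R) (z : 'I_n -> R[i]) : Re (\sum_k C_ (c k) * z k) = \sum_k c k * Re (z k).
  by rewrite Re_sum; apply: eq_bigr => k _; rewrite ReM /=; ring.
have im_sum (c : 'I_n -> R) (z : 'I_n -> R[i]) : Im (\sum_k C_ (c k) * z k) = \sum_k c k * Im (z k).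
  by rewrite Im_sum; apply: eq_bigr => k _; rewrite ImM /=; ring.
have reB (x y z : R[i]) : Re (x - y - z) = Re x - Re y - Re z by case: x; case: y; case: z.
have imB (x y z : R[i]) : Im (x - y - z) = Im x - Im y - Im z by case: x; case: y; case: z.
apply: row_mx_defect => i j; rewrite Fij; move: (S t) (F t) (lam j + d j t) => s F' z;
  rewrite /rot_re /rot_im reB imB !re_sum !im_sum ReM ImM.
  under [in RHS]eq_bigr do rewrite mulrBr 2!mulrA.
  by rewrite sumrB -!mulr_suml; ring.
under [in RHS]eq_bigr do rewrite mulrDr 2!mulrA.
by rewrite big_split -!mulr_suml /=; ring.
Qed.

Lemma is_derive_real_frame i j t : T <= t ->
  is_derive t 1 (fun t => real_frame t i j) (real_frame_deriv t i j).
Proof.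
move=> Tt.
have dcos j' : is_derive t 1 (fun x => cos (th j' x)) (- Im (lam j' + d j' t) * sin (th j' t)).
  have h := @is_derive1_comp R cos (th j') t _ _ (is_derive_cos _) (dth j' Tt).
  by apply: (is_derive_eq h); rewrite /GRing.scale /=; ring.
have dsin j' : is_derive t 1 (fun x => sin (th j' x)) (Im (lam j' + d j' t) * cos (th j' t)).
  have h := @is_derive1_comp R sin (th j') t _ _ (is_derive_sin _) (dth j' Tt).
  by apply: (is_derive_eq h); rewrite /GRing.scale /=; ring.
have dS' i' j' : is_deriveC t (fun x => S x i' j') (dS t i' j').
  have E x : S x i' j' = P i' j' + \sum_k P i' k * X k j' x.
    rewrite /S mulmxDr mulmx1 [LHS]mxE [(_ *m _) i' j']mxE; congr (_ + _).
    by apply: eq_bigr => k _; rewrite mxE.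
  rewrite (_ : (fun x => S x i' j') = (fun x => P i' j' + \sum_k P i' k * X k j' x)); last exact/funext.
  rewrite [dS t i' j'](_ : _ = 0 + \sum_k P i' k * dX k j' t); last first.
    by rewrite add0r mxE; apply: eq_bigr => k _; rewrite mxE.
  apply: is_deriveCD; first by split; exact: is_derive_cst.
  by apply: is_deriveC_lin => k; exact: dXP.
rewrite /real_frame /real_frame_deriv.
rewrite -(splitK j); case: (fintype.split j) => j' /=.
  rewrite row_mxEl mxE.
  have -> : (fun x => row_mx (\matrix_(i, j) rot_re (S x i j) (th j x))
      (\matrix_(i, j) rot_im (S x i j) (th j x)) i (lshift n j')) =
    (fun x => Re (S x i j')) * (fun x => cos (th j' x)) - (fun x => Im (S x i j')) * (fun x => sin (th j' x)).
    by apply/funext => x; rewrite row_mxEl mxE.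
  have [s1 s2] := dS' i j'.
  apply: (is_derive_eq (is_deriveB (is_deriveM s1 (dcos j')) (is_deriveM s2 (dsin j')))).
  by move: (S t) (dS t) (lam j' + d j' t) => s ds z; rewrite /rot_re /rot_im /GRing.scale /=; ring.
rewrite row_mxEr mxE.
have -> : (fun x => row_mx (\matrix_(i, j) rot_re (S x i j) (th j x))
    (\matrix_(i, j) rot_im (S x i j) (th j x)) i (rshift n j')) =
  (fun x => Re (S x i j')) * (fun x => sin (th j' x)) + (fun x => Im (S x i j')) * (fun x => cos (th j' x)).
  by apply/funext => x; rewrite row_mxEr mxE.
have [s1 s2] := dS' i j'.
apply: (is_derive_eq (is_deriveD (is_deriveM s1 (dsin j')) (is_deriveM s2 (dcos j')))).
by move: (S t) (dS t) (lam j' + d j' t) => s ds z; rewrite /rot_re /rot_im /GRing.scale /=; ring.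
Qed.

Lemma bctsC_frame i j : bctsC T (fun t => S t i j).
Proof.
have E x : S x i j = P i j + \sum_k P i k * X k j x.
  rewrite /S mulmxDr mulmx1 [LHS]mxE [(_ *m _) i j]mxE; congr (_ + _).
  by apply: eq_bigr => k _; rewrite mxE.
rewrite (_ : (fun x => S x i j) = (fun x => P i j + \sum_k P i k * X k j x)); last exact/funext.
apply: bctsCD; first exact: bctsC_cst.
by apply: bctsC_sum => k; apply: bctsCM; [exact: bctsC_cst|exact: bX].
Qed.

Let cts_th j : cts T (th j). Proof. exact: cts_derive (dth j). Qed.

Lemma bcts_trig j : bcts T (fun t => cos (th j t)) /\ bcts T (fun t => sin (th j t)).
Proof.
split; split.
- by move=> t Tt; apply: (@continuous_comp _ _ _ (th j) cos); [exact: cts_th|exact: continuous_cos].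
- by exists 1 => t _; rewrite ler_norml cos_geN1 cos_le1.
- by move=> t Tt; apply: (@continuous_comp _ _ _ (th j) sin); [exact: cts_th|exact: continuous_sin].
- by exists 1 => t _; rewrite ler_norml sin_geN1 sin_le1.
Qed.

Lemma bcts_real_frame i j : bcts T (fun t => real_frame t i j).
Proof.
rewrite -(splitK j); case: (fintype.split j) => j' /=; have [b1 b2] := bctsC_frame i j';
  have [c1 c2] := bcts_trig j'.
  rewrite (_ : (fun x => _) = (fun x => Re (S x i j') * cos (th j' x) - Im (S x i j') * sin (th j' x))).
    by apply: bctsB; exact: bctsM.
  by apply/funext => x; rewrite row_mxEl mxE.
rewrite (_ : (fun x => _) = (fun x => Re (S x i j') * sin (th j' x) + Im (S x i j') * cos (th j' x))).
  by apply: bctsD; exact: bctsM.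
by apply/funext => x; rewrite row_mxEr mxE.
Qed.

Lemma L1_real_frame_defect i j : L1 T (fun t => real_frame_defect t i j).
Proof.
have LF i' j' : L1C T (fun t => F t i' j').
  rewrite (_ : (fun t => _) = (fun t => \sum_k P i' k * normal_defect lam conjugated_perturbation X dX d k j' t)).
    by apply: L1C_sum => k; exact: L1CZ.
  by apply/funext => t; rewrite mxE; apply: eq_bigr => k _; rewrite mxE.
rewrite -(splitK j); case: (fintype.split j) => j' /=; have [b1 b2] := LF i j';
  have [c1 c2] := bcts_trig j'.
  rewrite (_ : (fun x => _) = (fun x => cos (th j' x) * Re (F x i j') + - (sin (th j' x) * Im (F x i j')))).
    by apply: L1D; [exact: bcts_L1|apply: L1N; exact: bcts_L1].
  by apply/funext => x; rewrite row_mxEl mxE /rot_re mulrC [sin _ * _]mulrC.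
rewrite (_ : (fun x => _) = (fun x => sin (th j' x) * Re (F x i j') + cos (th j' x) * Im (F x i j'))).
  by apply: L1D; exact: bcts_L1.
by apply/funext => x; rewrite row_mxEr mxE /rot_im mulrC [cos _ * _]mulrC.
Qed.

(** This is the real part of P P^*. The rotations do not appear because cos^2 + sin^2 = 1, and X
    tends to 0. If a real v annihilates it, then v Re P = v Im P = 0, so v P = 0 and v = 0. *)
Definition frame_limit : 'M[R]_n :=
  map_mx (fun z : R[i] => Re z) P *m (map_mx (fun z : R[i] => Re z) P)^T + map_mx (fun z : R[i] => Im z) P *m (map_mx (fun z : R[i] => Im z) P)^T.

Lemma det_frame_limit : \det frame_limit != 0.
Proof.
apply/det0P => -[v v0 vG].
pose x := v *m map_mx (fun z : R[i] => Re z) P; pose y := v *m map_mx (fun z : R[i] => Im z) P.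
have sq0 : x *m x^T + y *m y^T = 0.
  rewrite /x /y !trmx_mul !mulmxA -mulmxDl -[_ *m (map_mx (fun z : R[i] => Re z) P)^T]mulmxA -[_ *m (map_mx (fun z : R[i] => Im z) P)^T]mulmxA.
  by rewrite -mulmxDr -/frame_limit vG mul0mx.
have sum0 : \sum_j (x 0 j ^+ 2 + y 0 j ^+ 2) = 0.
  have := congr1 (fun M : 'M[R]_1 => M 0 0) sq0; rewrite [LHS]mxE [RHS]mxE [(x *m _) 0 0]mxE [(y *m _) 0 0]mxE => E0.
  apply: etrans E0.
  have tr_e (z : 'rV[R]_n) j : z^T j 0 = z 0 j by rewrite mxE.
  by rewrite big_split; congr (_ + _); apply: eq_bigr => j _; rewrite tr_e expr2.
have xy0 j : x 0 j = 0 /\ y 0 j = 0.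
  have nn j' : true -> 0 <= x 0 j' ^+ 2 + y 0 j' ^+ 2 by move=> _; rewrite addr_ge0// sqr_ge0.
  have /eqP : x 0 j ^+ 2 + y 0 j ^+ 2 = 0 by apply: (psumr_eq0P nn sum0).
  by rewrite paddr_eq0 ?sqr_ge0// !sqrf_eq0 => /andP[/eqP ? /eqP ?].
have vP : map_mx C_ v *m P = 0.
  apply/matrixP => i j; rewrite (ord1 i) [RHS]mxE [LHS]mxE.
  have -> : \sum_k map_mx C_ v 0 k * P k j = \sum_k C_ (v 0 k) * P k j.
    by apply: eq_bigr => k _; rewrite [map_mx _ _ _ _]mxE.
  have [+ +] := xy0 j; rewrite /x /y !mxE => h1 h2; apply: complex_eq.
    rewrite Re_sum -[RHS]h1; apply: eq_bigr => k _; rewrite [map_mx _ _ _ _]mxE ReM /=; ring.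
  rewrite Im_sum -[RHS]h2; apply: eq_bigr => k _; rewrite [map_mx _ _ _ _]mxE ImM /=; ring.
have : map_mx C_ v = 0 by rewrite -[LHS]mulmx1 -(mulVmx Qu) mulmxA -/P vP mul0mx.
move=> /matrixP v00; case/eqP: v0; apply/matrixP => i j; have := v00 i j.
by rewrite !mxE => -[].
Qed.

Lemma frame_gram_cvg i k :
  (real_frame t *m (real_frame t)^T) i k @[t --> +oo] --> frame_limit i k.
Proof.
have S0 i' j' : Re (S t i' j') @[t --> +oo] --> Re (P i' j') /\ Im (S t i' j') @[t --> +oo] --> Im (P i' j').
  have E x : S x i' j' = P i' j' + \sum_k P i' k * X k j' x.
    rewrite /S mulmxDr mulmx1 [LHS]mxE [(_ *m _) i' j']mxE; congr (_ + _).
    by apply: eq_bigr => l _; rewrite mxE.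
  have [v1 v2] : vanishing (fun x => \sum_k P i' k * X k j' x).
    by apply: vanishing_sum => l; exact: vanishingZ.
  split.
    rewrite (_ : (fun t => _) = (fun t => Re (P i' j') + Re (\sum_k P i' k * X k j' t))); last first.
      by apply/funext => t; rewrite E ReD.
    by rewrite -[X in _ --> X]addr0; apply: cvgD => //; exact: cvg_cst.
  rewrite (_ : (fun t => _) = (fun t => Im (P i' j') + Im (\sum_k P i' k * X k j' t))); last first.
    by apply/funext => t; rewrite E ImD.
  by rewrite -[X in _ --> X]addr0; apply: cvgD => //; exact: cvg_cst.
have -> : (fun t => (real_frame t *m (real_frame t)^T) i k) =
   (fun t => \sum_j (Re (S t i j) * Re (S t k j) + Im (S t i j) * Im (S t k j))).
  apply/funext => t; rewrite /real_frame tr_row_mx mul_row_col [LHS]mxE.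
  rewrite [(_ *m _) i k in X in X + _]mxE [(_ *m _) i k in X in _ + X]mxE -big_split.
  apply: eq_bigr => j _ /=; have := cos2Dsin2 (th j t); move: (S t) => s cs; rewrite !mxE /rot_re /rot_im.
  rewrite -[RHS]mulr1 -cs.
  by ring.
have -> : frame_limit i k = \sum_j (Re (P i j) * Re (P k j) + Im (P i j) * Im (P k j)).
  rewrite /frame_limit mxE [(_ *m _) i k in X in X + _]mxE [(_ *m _) i k in X in _ + X]mxE -big_split.
  by apply: eq_bigr => j _; rewrite !mxE.
apply: cvg_big => [|j _]; first exact: add_continuous.
by have [a1 a2] := S0 i j; have [b1 b2] := S0 k j; apply: cvgD; exact: cvgM.
Qed.

(* A right inverse of the n x 2n frame: the limit of the Gram matrix is nonsingular. *)
Definition real_coframe t : 'M[R]_(n + n, n) :=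
  (real_frame t)^T *m invmx (real_frame t *m (real_frame t)^T).

Lemma real_coframe_bcts : exists2 T', T <= T' &
  (forall t, T' <= t -> real_frame t *m real_coframe t = 1%:M) /\
  forall i j, bcts T' (fun t => real_coframe t i j).
Proof.
have dl : \det (real_frame t *m (real_frame t)^T) @[t --> +oo] --> \det frame_limit.
  by apply: cvg_det; exact: frame_gram_cvg.
pose e := `|\det frame_limit| / 2.
have e0 : 0 < e by rewrite divr_gt0// normr_gt0 det_frame_limit.
have /nearyP[T1 HT1] : \forall t \near +oo, e < `|\det (real_frame t *m (real_frame t)^T)|.
  have lt : e < `|\det frame_limit|.
    by rewrite /e ltr_pdivrMr// ltr_pMr ?normr_gt0 ?det_frame_limit// ltr1n.
  exact: (cvgr_gt _ (cvg_norm dl) _ lt).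
pose T' := Num.max T T1; have TT' : T <= T' by rewrite le_max lexx.
exists T' => //.
have det_ge t : T' <= t -> e <= `|\det (real_frame t *m (real_frame t)^T)|.
  by move=> T't; apply/ltW/HT1; rewrite (le_trans _ T't)// le_max lexx orbT.
have bU i j : bcts T' (fun t => real_frame t i j) := bctsW TT' (bcts_real_frame i j).
have bG i j : bcts T' (fun t => (real_frame t *m (real_frame t)^T) i j).
  rewrite (_ : (fun t => _) = (fun t => \sum_k real_frame t i k * real_frame t j k)).
    by apply: bcts_sum => k; exact: bctsM.
  by apply/funext => t; rewrite mxE; apply: eq_bigr => k _; rewrite [_^T k j]mxE.
split=> [t T't|i j].
  rewrite /real_coframe mulmxA mulmxV// unitmxE unitfE -normr_gt0.
  exact: lt_le_trans e0 (det_ge t T't).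
rewrite (_ : (fun t => _) = (fun t => \sum_k real_frame t k i * invmx (real_frame t *m (real_frame t)^T) k j)).
  by apply: bcts_sum => k; apply: bctsM => //; exact: (bcts_invmx bG e0 det_ge).
by apply/funext => t; rewrite mxE; apply: eq_bigr => k _; rewrite [_^T i k]mxE.
Qed.

End RealNormalForm.

(** * Products [mu] of the small parameters *)

Section SmallParameters.
Context {R : realType} {m : nat}.
Variables (t0 : R) (L : set R[i]) (K : set (R -> R)).
Hypothesis hK : classK3 t0 L K.
Variables (eps : 'I_m.+1 -> R -> R) (pk : 'I_m.+1 -> nat) (varrho : 'I_m.+1 -> R) (varpi : R).
Hypothesis hvarrho0 : forall l, 0 < varrho l.
Hypothesis hvarrho : forall l l' : 'I_m.+1, (l <= l')%N -> varrho l <= varrho l'.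
Hypothesis hepsC : forall l, Cn_in (ray t0) (pk l) (eps l).
Hypothesis hepsO : forall l r, (r <= pk l)%N ->
  bigO_pinfty (derive_in_n (ray t0) r (eps l))
    (fun t => eps ord0 t `^ ((varrho l + r%:R) / varrho ord0)).
Hypothesis heps_o1 : eps ord0 t @[t --> +oo] --> (0 : R).
Hypothesis heps_gt0 : forall t, ray t0 t -> 0 < eps ord0 t.
Hypothesis hvarpi : Rclass varpi t0 (eps ord0).
Hypothesis hmono : forall l, ~ Rclass 1 t0 (eps l) ->
   [/\ {in ray t0 &, {homo eps l : x y / x <= y}} \/
       {in ray t0 &, {homo eps l : x y /~ x <= y}},
       eps l t @[t --> +oo] --> (0 : R),
       Cn_in (ray t0) 1 (eps l) &
       Rclass 1 t0 (derive_in (ray t0) (eps l))].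
Implicit Types (w : {ffun 'I_m.+1 -> nat}) (T : R) (g : R -> R).
Let e1 := eps ord0.
Let ord := ordO e1.

Let e1_gt0 : \forall t \near +oo, 0 < e1 t.
Proof. exact: heps_near heps_gt0. Qed.

Lemma ordO_cvg0 x g : 0 < x -> ord x g -> g t @[t --> +oo] --> (0 : R).
Proof.
move=> x0 /ordOP[C C0 HC]; apply/cvgr0Pnorm_lt => e epos.
have C1 : 0 < C + 1 by rewrite ltr_wpDl.
pose h := (e / (C + 1)) `^ x^-1.
have h0 : 0 < h by rewrite powR_gt0// divr_gt0.
have e1h : \forall t \near +oo, `|e1 t| < h by have /cvgr0Pnorm_lt := heps_o1; apply.
apply: filterS3 HC e1h e1_gt0 => t ht et e0; apply: le_lt_trans ht _.
rewrite gtr0_norm// in et.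
have : e1 t `^ x < h `^ x by rewrite gt0_ltr_powR// nnegrE ltW.
rewrite /h -powRrM mulVf ?gt_eqF// powRr1 ?divr_ge0 ?ltW// ltr_pdivlMr// => H.
by apply: le_lt_trans H; rewrite mulrC ler_wpM2l ?powR_ge0// lerDl ler01.
Qed.

Lemma ordO_bcts T x g : 0 <= x -> cts T g -> ord x g -> bcts T g.
Proof.
move=> x0 cg og; apply: bcts_near => //.
have /ordOP[C C0 HC] := ordOW e1_gt0 heps_o1 x0 og; exists C.
by apply: filterS HC => t; rewrite powRr0 mulr1.
Qed.

Lemma eps_within l : {within ray t0, continuous (eps l)}.
Proof. by have [+ _] := hepsC (leq0n (pk l)). Qed.

Lemma ord_eps l : ord (varrho l / varrho ord0) (eps l).
Proof. by have := hepsO (leq0n (pk l)); rewrite addr0. Qed.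

Lemma eps_bcts T l : t0 < T -> bcts T (eps l).
Proof.
move=> tT; apply: (@ordO_bcts _ (varrho l / varrho ord0)); last exact: ord_eps.
  by rewrite divr_ge0// ltW.
exact: (cts_within tT (@eps_within l)).
Qed.

Lemma powR_within x : {within ray t0, continuous (fun t => `|e1 t| `^ x)}.
Proof.
apply/subspace_continuousP => t tt; have e0 := heps_gt0 tt.
have ce : e1 x @[x --> within (ray t0) (nbhs t)] --> e1 t.
  by have /subspace_continuousP := @eps_within ord0; apply.
have cn : `|e1 x| @[x --> within (ray t0) (nbhs t)] --> `|e1 t| by exact: cvg_norm.
have cp : {for `|e1 t|, continuous (@powR R ^~ x)}.
  apply: differentiable_continuous; apply/derivable1_diffP.
  have n0 : 0 < `|e1 t| by rewrite normr_gt0 gt_eqF.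
  by have [] := is_derive1_powR x n0.
exact: (cvg_comp _ _ cn cp).
Qed.

Lemma L1_varpi T : t0 < T -> L1 T (fun t => e1 t `^ varpi).
Proof.
move=> tT; have H := Rclass_L1 tT (@powR_within varpi) hvarpi.
have E t : t0 <= t -> `|e1 t| `^ varpi = e1 t `^ varpi.
  by move=> tt; rewrite gtr0_norm// heps_gt0//; exact/rayE.
apply: (L1_dom1 _ H); last first.
  by move=> t Tt; rewrite E// (le_trans _ Tt)// ltW.
apply: (cts_within tT); apply: (@subspace_eq_continuous _ _ _ (fun t => `|e1 t| `^ varpi)).
  by move=> t; rewrite inE => /rayE; exact: E.
exact: powR_within.
Qed.

Lemma ordO_L1 T g : t0 < T -> cts T g -> ord varpi g -> L1 T g.
Proof.
move=> tT cg /ordOP[C C0 /nearyP[T1 HT1]]; pose T' := Num.max T T1.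
have TT' : T <= T' by rewrite le_max lexx.
apply: (@L1_dom _ T T' g (fun t => e1 t `^ varpi) C) => //.
  by apply: L1_varpi; exact: lt_le_trans TT'.
move=> t T't; rewrite (ger0_norm (powR_ge0 _ _)); apply: HT1.
by rewrite (le_trans _ T't)// le_max lexx orbT.
Qed.

Lemma mu_within w : {within ray t0, continuous (mu eps w)}.
Proof.
apply/subspace_continuousP => t tt.
apply: cvg_big => [|l _]; first exact: mul_continuous.
have c : eps l x @[x --> within (ray t0) (nbhs t)] --> eps l t.
  by have /subspace_continuousP := @eps_within l; apply.
elim: (w l) => [|q IH].
  rewrite (_ : (fun x => _) = (fun=> 1)); first exact: cvg_cst.
  by apply/funext => x; rewrite expr0.
under [fun x => _]eq_fun do rewrite exprS.
by rewrite exprS; exact: cvgM.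
Qed.

Lemma mu_bounded_cts T w : t0 < T -> bcts T (mu eps w).
Proof. by move=> tT; apply: bcts_prod => l _; apply: bctsX; exact: eps_bcts. Qed.

Lemma ord_mu w : ord (mi_deg w)%:R (mu eps w).
Proof.
have h : ord (\sum_(l <- index_enum 'I_m.+1) (w l)%:R * (varrho l / varrho ord0)) (mu eps w).
  by apply: ordO_prod => // l _; apply: ordOX => //; exact: ord_eps.
apply: ordOW h => //; rewrite /mi_deg natr_sum ler_sum// => l _.
by rewrite -[leLHS]mulr1 ler_wpM2l// ler_pdivlMr// mul1r hvarrho.
Qed.

(** Below degree varpi, being excluded from [mu_indices] means integrability. From degree varpi on,
    mu_w = O(eps_1^varpi). *)
Lemma mu_L1 T w : t0 < T -> (1 <= mi_deg w)%N -> ~ mu_indices eps t0 varpi w -> L1 T (mu eps w).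
Proof.
move=> tT w1 nW; have [dw|dw] := ltP (mi_deg w)%:R varpi.
  apply: (Rclass1_L1 tT (@mu_within w)); by apply: contrapT => nR; apply: nW; split.
apply: ordO_L1 => //; first by have [] := @mu_bounded_cts T w tT.
exact: (ordOW _ _ dw (@ord_mu w)).
Qed.

(** An integrable factor eps_l would make the product integrable, the remaining factors being
    bounded. Hence the condition that eps_l' is integrable is available for every eps_l occurring in
    mu_w, and mu_w' is integrable. *)
Lemma slow_parameter w l : mu_indices eps t0 varpi w -> (0 < w l)%N -> ~ Rclass 1 t0 (eps l).
Proof.
move=> [_ _ nR] wl Rl; apply: nR; have tT : t0 < t0 + 1 by rewrite ltrDl.
apply: (L1_Rclass1 (ltW tT) (@mu_within w)).
have Ll := Rclass1_L1 tT (@eps_within l) Rl.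
rewrite (_ : mu eps w = (fun t => (eps l t ^+ (w l).-1 * \prod_(j | j != l) eps j t ^+ w j) * eps l t)).
  apply: bcts_L1 => //; apply: bctsM; first by apply: bctsX; exact: eps_bcts.
  rewrite (_ : (fun t => _) = (fun t => \prod_(j <- [seq j <- index_enum 'I_m.+1 | j != l]) eps j t ^+ w j)).
    by apply: bcts_prod => j _; apply: bctsX; exact: eps_bcts.
  by apply/funext => t; rewrite big_filter.
apply/funext => t; rewrite /mu (bigD1 l)//= -{1}(prednK wl) exprS; ring.
Qed.

Lemma slow_derive T l : t0 < T -> ~ Rclass 1 t0 (eps l) ->
  L1 T (derive_in (ray t0) (eps l)) /\
  forall t, T <= t -> is_derive t 1 (eps l) (derive_in (ray t0) (eps l) t).
Proof.
move=> tT /hmono[_ _ c1 Rd]; split.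
  by apply: Rclass1_L1 Rd => //; have [+ _] := c1 1%N isT.
move=> t Tt; have t0t : t0 < t by exact: lt_le_trans Tt.
apply: (is_derive_inP _ _ (nbhs_ray t0t)).1; split=> //.
by have [_ /(_ isT t)] := c1 0%N isT; apply; apply/rayE/ltW.
Qed.

Definition mu_deriv w t : R := \sum_l ((w l)%:R * eps l t ^+ (w l).-1 * derive_in (ray t0) (eps l) t)
  * \prod_(j | j != l) eps j t ^+ w j.

Lemma is_derive_mu T w t : t0 < T -> mu_indices eps t0 varpi w -> T <= t ->
  is_derive t 1 (mu eps w) (mu_deriv w t).
Proof.
move=> tT Ww Tt; apply: (is_derive_prod_seq (s := index_enum 'I_m.+1) (F := fun l x => eps l x ^+ w l)
   (dF := fun l t => (w l)%:R * eps l t ^+ (w l).-1 * derive_in (ray t0) (eps l) t)).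
  exact: index_enum_uniq.
move=> l _; case E : (w l) => [|q].
  rewrite (_ : (fun x => _) = cst 1); first by rewrite mul0r mul0r; exact: is_derive_cst.
  by apply/funext => x; rewrite expr0.
have wl : (0 < w l)%N by rewrite E.
have [_ /(_ t Tt) d] := slow_derive tT (slow_parameter Ww wl).
rewrite (_ : (fun x => _) = eps l ^+ q.+1); last by apply/funext => x; rewrite fctE.
by apply: is_derive_eq; rewrite /GRing.scale /=; ring.
Qed.

Lemma mu_deriv_L1 T w : t0 < T -> mu_indices eps t0 varpi w -> L1 T (mu_deriv w).
Proof.
move=> tT Ww; apply: L1_sum => l; have [w0|wl] := posnP (w l).
  rewrite (_ : (fun t => _) = (fun=> 0)); first exact: L1_0.
  by apply/funext => t; rewrite w0 !mul0r.
have [Ld _] := slow_derive tT (slow_parameter Ww wl).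
rewrite (_ : (fun t => _) = (fun t => ((w l)%:R * eps l t ^+ (w l).-1 *
   \prod_(j <- [seq j <- index_enum 'I_m.+1 | j != l]) eps j t ^+ w j) * derive_in (ray t0) (eps l) t)).
  apply: bcts_L1 => //; apply: bctsM.
    by apply: bctsM; [exact: bcts_cst|apply: bctsX; exact: eps_bcts].
  by apply: bcts_prod => j _; apply: bctsX; exact: eps_bcts.
by apply/funext => t; rewrite big_filter; ring.
Qed.

Lemma mu_cvg0 w : (1 <= mi_deg w)%N -> mu eps w t @[t --> +oo] --> (0 : R).
Proof. by move=> w1; apply: ordO_cvg0 (@ord_mu w); rewrite ltr0n. Qed.

Lemma mu_mul T w w' : t0 < T -> mu_indices eps t0 varpi w -> mu_indices eps t0 varpi w' ->
  L1 T (fun t => mu eps w t * mu eps w' t) \/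
  exists w'', [/\ mu_indices eps t0 varpi w'', mi_deg w'' = (mi_deg w + mi_deg w')%N &
    forall t, mu eps w'' t = mu eps w t * mu eps w' t].
Proof.
move=> tT [w1 _ _] _; pose w2 := [ffun l => (w l + w' l)%N].
have muE t : mu eps w2 t = mu eps w t * mu eps w' t.
  by rewrite /mu -big_split; apply: eq_bigr => l _; rewrite ffunE exprD.
have degE : mi_deg w2 = (mi_deg w + mi_deg w')%N.
  by rewrite /mi_deg -big_split; apply: eq_bigr => l _; rewrite ffunE.
have [W2|nW2] := pselect (mu_indices eps t0 varpi w2); first by right; exists w2.
left; rewrite (_ : (fun t => _) = mu eps w2); last by apply/funext => t; rewrite muE.
by apply: mu_L1 => //; rewrite degE (leq_trans w1)// leq_addr.
Qed.

Lemma mu_pcls T w N (g : R -> R[i]) : t0 < T -> (1 <= mi_deg w)%N -> (N <= mi_deg w)%N -> KC K g ->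
  pcls T K (mu_indices eps t0 varpi) mi_deg (mu eps) N (fun t => real_complex R (mu eps w t) * g t).
Proof.
move=> tT w1 Nw Kg; have [Ww|nW] := pselect (mu_indices eps t0 varpi w); first exact: pcls_mu.
apply: pcls_L1; rewrite (_ : (fun t => _) = (fun t => g t * real_complex R (mu eps w t))).
  apply: L1C_bctsM; first exact: (KC_bctsC hK).
  by split; [exact: mu_L1|exact: L1_0].
by apply/funext => t; rewrite mulrC.
Qed.

End SmallParameters.

Lemma mu_unit {R : realType} {m : nat} (eps : 'I_m.+1 -> R -> R) l :
  exists2 w : {ffun 'I_m.+1 -> nat}, mi_deg w = 1%N & mu eps w = eps l.
Proof.
exists [ffun l' => (l' == l) : nat].
  rewrite /mi_deg (bigD1 l)//= ffunE eqxx big1// => l' /negbTE ll.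
  by rewrite ffunE ll.
apply/funext => t; rewrite /mu (bigD1 l)//= ffunE eqxx expr1 big1 ?mulr1// => l' /negbTE ll.
by rewrite ffunE ll expr0.
Qed.

(** * The linearisation along the partial sum belongs to the class of the normal form *)

Section Perturbation.
Context {R : realType} {n m : nat}.
Variables (t0 : R) (A : 'M[R]_n) (lam : 'I_n -> R[i]) (K : set (R -> R)).
Hypothesis hK : classK3 t0 (range lam `|` eigen_differences lam) K.
Variables (f : R -> 'cV[R]_n) (a : R)
  (eps : 'I_m.+1 -> R -> R) (fl : 'I_m.+1 -> R -> 'cV[R]_n -> 'cV[R]_n)
  (phi0 : R -> 'cV[R]_n) (varrho : 'I_m.+1 -> R) (rho : nat -> R)
  (nu : nat -> seq (mon m.+1)) (k : nat) (pk : 'I_m.+1 -> nat) (qk : 'I_m.+1 -> int).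
Local Notation D := (tube t0 a phi0).
Hypothesis hphi0K : vecK K phi0.
Hypothesis hphi0 : solves (ray t0) (fun t v => A *m v + f t) phi0.
Hypothesis hvarrho0 : forall l, 0 < varrho l.
Hypothesis hvarrho : forall l l' : 'I_m.+1, (l <= l')%N -> varrho l <= varrho l'.
Hypothesis hrho : ranks_enum varrho rho.
Hypothesis hnu : mons_enum varrho rho nu.
Hypothesis hpk : forall l, (pk l)%:Z = Num.max 0 (Num.floor (rho k - varrho l) + 1).
Hypothesis hepsC : forall l, Cn_in (ray t0) (pk l) (eps l).
Hypothesis hepsO : forall l r, (r <= pk l)%N ->
  bigO_pinfty (derive_in_n (ray t0) r (eps l))
    (fun t => eps ord0 t `^ ((varrho l + r%:R) / varrho ord0)).
Hypothesis heps_o1 : eps ord0 t @[t --> +oo] --> (0 : R).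
Hypothesis hflC : forall l (q : nat), q%:Z = Num.max 2 (qk l + 1) -> C0n_in D q (fl l).
Hypothesis hflB : forall l (w : {ffun 'I_n -> nat}),
  (mi_deg w)%:Z <= Num.max 2 (qk l + 1) -> [bounded pderive_mi D w (fl l) z.1 z.2 | z in D].
Hypothesis heps_gt0 : forall t, ray t0 t -> 0 < eps ord0 t.
Variable varpi : R.
Hypothesis hvarpi : Rclass varpi t0 (eps ord0).
Hypothesis hepsR : forall l (r : nat), 1 <= rho k - varrho l -> (1 <= r)%N ->
  r%:Z <= Num.floor (rho k - varrho l) -> Rclass 1 t0 (derive_in_n (ray t0) r (eps l)).
Hypothesis hfl7 : forall l (sl : nat), varrho l <= varpi * varrho ord0 ->
  sl%:Z = Num.floor (varpi - varrho l / varrho ord0) ->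
  [/\ C0n_in D (sl + 2) (fl l),
      forall w : {ffun 'I_n -> nat}, (3 <= mi_deg w <= sl + 2)%N ->
        [bounded pderive_mi D w (fl l) z.1 z.2 | z in D] &
      forall w : {ffun 'I_n -> nat}, (1 <= mi_deg w <= sl + 1)%N ->
        vecK K (fun t => pderive_mi D w (fl l) t (phi0 t))].
Variable phi : mon m.+1 -> R -> 'cV[R]_n.
Hypothesis hphi : expansion_coefs t0 D A fl phi0 nu k phi K.
Variable T : R.
Hypothesis tT : t0 < T.
Hypothesis corr_lt : forall t, T <= t -> `|correction t0 eps nu k phi t| < a.

Let e1 := eps ord0.
Let ord := ordO e1.
Let delta := correction t0 eps nu k phi.
Local Notation pc := (pcls T K (mu_indices eps t0 varpi) mi_deg (mu eps)).
Local Notation C_ := (real_complex R).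

Let e1_gt0 : \forall t \near +oo, 0 < e1 t.
Proof. exact: heps_near heps_gt0. Qed.

Lemma parameter_bcts l : bcts T (eps l).
Proof. exact: (eps_bcts hvarrho0 hepsC hepsO). Qed.

Lemma mu_system_bcts w : mu_indices eps t0 varpi w -> bcts T (mu eps w).
Proof. by move=> _; exact: (mu_bounded_cts hvarrho0 hepsC hepsO). Qed.

Lemma mu_system_mul w w' : mu_indices eps t0 varpi w -> mu_indices eps t0 varpi w' ->
  L1 T (fun t => mu eps w t * mu eps w' t) \/
  exists w'', [/\ mu_indices eps t0 varpi w'', mi_deg w'' = (mi_deg w + mi_deg w')%N &
    forall t, mu eps w'' t = mu eps w t * mu eps w' t].
Proof. exact: (mu_mul hvarrho0 hvarrho hepsC hepsO heps_o1 heps_gt0 hvarpi tT). Qed.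

Let muP w N (g : R -> R[i]) := @mu_pcls R m t0 _ K hK eps pk varrho varpi hvarrho0 hvarrho hepsC hepsO
  heps_o1 heps_gt0 hvarpi T w N g tT.
Let pM := pclsM hK tT mu_system_bcts mu_system_mul.

Lemma cts_correction i : cts T (fun t => delta t i 0).
Proof.
pose s := approx_sol t0 eps phi0 nu k phi.
rewrite (_ : (fun t => _) = (fun t => s t i 0 - phi0 t i 0)); last first.
  by apply/funext => t; rewrite /s approx_solE mxE addrAC subrr add0r.
apply: ctsB; last exact: (K_cts hK).
have ds t : T <= t -> is_derive t 1 (fun x => s x i 0) (derive_in (ray t0) s t i 0).
  move=> Tt; have t0t : t0 < t by exact: lt_le_trans Tt.
  exact: (is_derive_entry _ _ _).1 (derive_in_approx hphi0 hvarrho0 hrho hnu hpk hepsC hphi t0t) i 0.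
exact: cts_derive ds.
Qed.

Lemma ord_delta j : ord 1 (fun t => delta t j 0).
Proof. exact: (ord_correction hK hvarrho0 hvarrho hrho hnu hpk hepsO heps_o1 heps_gt0 hphi). Qed.

Lemma bcts_correction j : bcts T (fun t => delta t j 0).
Proof.
apply: (ordO_bcts heps_o1 heps_gt0 (x := 1)); [exact: ler01|exact: cts_correction|exact: ord_delta].
Qed.

Lemma underived_mon_eval (b : mon m.+1) : (forall i, i \in finsupp b -> i.2 = 0%N) ->
  mon_eval t0 eps b = mu eps [ffun l => b (l, 0%N)].
Proof.
move=> b0; apply/funext => t; rewrite /mon_eval /mu.
rewrite (partition_big (fun i => i.1) predT)//=; apply: eq_bigr => l _; rewrite ffunE.
rewrite big_seq_cond; have [lb|lb] := boolP ((l, 0%N) \in finsupp b); last first.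
  rewrite big1 => [|[l' r] /= /andP[ib /eqP E]].
    by move: lb; rewrite -cmE_eq0 => /eqP ->; rewrite expr0.
  have r0 : r = 0%N := b0 _ ib; subst r.
  by case/negP: lb; rewrite -E.
rewrite (eq_bigl (fun i => (i \in finsupp b) && (i == (l, 0%N)))); last first.
  move=> [l' r] /=; rewrite xpair_eqE; case: (boolP (_ \in _)) => //= ib.
  by have /= -> := b0 _ ib; rewrite eqxx andbT.
rewrite -big_seq_cond -big_filter filter_pred1_uniq ?fset_uniq// big_seq1 //.
Qed.

(** A monomial containing a derivative of some eps_l is integrable, since that derivative is and the
    other factors are bounded. Any other monomial is some mu_w. *)
Lemma mon_pcls s b g : (1 <= s <= k)%N -> b \in nu s -> K g ->
  pc 1 (fun t => C_ (mon_eval t0 eps b t * g t)).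
Proof.
move=> sk bs Kg; have bk := nu_low hrho hnu sk bs.
have badm := low_rank_admissible hvarrho0 hpk bk.
have /andP[s1 _] := sk; have [b1 _] := (mem_nu hnu b s1).1 bs.
have bg : bcts T g by exact: (K_bcts hK).
have [[i [ib i2]]|H] := pselect (exists i, i \in finsupp b /\ (0 < i.2)%N).
  apply: pcls_L1; split; last exact: L1_0.
  have bE := mulcmE_divcm ib.
  have di : i.2%:R <= rho k - varrho i.1.
    by rewrite lerBrDl; apply: le_trans bk; exact: mon_rank_ge.
  have Li : L1 T (derive_in_n (ray t0) i.2 (eps i.1)).
    apply: (Rclass1_L1 tT); first by have [+ _] := hepsC (badm i ib).
    apply: hepsR => //; last by rewrite floor_ge_int.
    by apply: le_trans di; rewrite ler1n.
  have dadm : admissible_mon pk (divcm b (ucm i)).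
    by move=> j; rewrite -cmE_neq0 divcmE => jb; apply: badm; rewrite -cmE_neq0; apply: contraNneq jb => ->.
  have bd : bcts T (mon_eval t0 eps (divcm b (ucm i))).
    have r0 : 0 <= mon_rank varrho (divcm b (ucm i)) / varrho ord0.
      by rewrite divr_ge0 ?mon_rank_ge0// ltW.
    apply: (ordO_bcts heps_o1 heps_gt0 r0); first exact: cts_mon_eval hepsC _ _ tT dadm.
    exact: (ordO_mon_eval hepsO).
  rewrite (_ : (fun t => _) = (fun t => (mon_eval t0 eps (divcm b (ucm i)) t * g t) *
     derive_in_n (ray t0) i.2 (eps i.1) t)).
    by apply: bcts_L1 => //; exact: bctsM.
  by apply/funext => t /=; rewrite [in LHS]bE mon_evalM mon_evalU mulrAC.
have b0 i : i \in finsupp b -> i.2 = 0%N.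
  by move=> ib; apply/eqP; rewrite -leqn0 leqNgt; apply/negP => i2; apply: H; exists i.
rewrite underived_mon_eval//.
rewrite (_ : (fun t => _) = (fun t => C_ (mu eps [ffun l => b (l, 0%N)] t) * C_ (g t))); last first.
  by apply/funext => t; rewrite rmorphM.
have w1 : (1 <= mi_deg [ffun l => b (l, 0%N)])%N.
  have [[l r] ib] := mon_supp b1; have r0 : r = 0%N := b0 _ ib; subst r.
  rewrite /mi_deg (bigD1 l)//= ffunE; apply: leq_trans (leq_addr _ _).
  by rewrite lt0n cmE_neq0.
by apply: muP => //; exact: (KC_real hK Kg).
Qed.

Lemma pcls_sum_seq N (J : eqType) (s : seq J) (F : J -> R -> R[i]) : (forall j, j \in s -> pc N (F j)) ->
  pc N (fun t => \sum_(j <- s) F j t).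
Proof.
elim: s => [|i s IH] hF.
  by rewrite (_ : (fun t => _) = (fun=> 0)); [exact: pcls0|apply/funext => t; rewrite big_nil].
rewrite (_ : (fun t => _) = (fun t => F i t + \sum_(j <- s) F j t)).
  by apply: pcls_add; [exact: hF (mem_head _ _)|apply: IH => j js; apply: hF; rewrite inE js orbT].
by apply/funext => t; rewrite big_cons.
Qed.

Lemma correction_pcls j : pc 1 (fun t => C_ (delta t j 0)).
Proof.
rewrite (_ : (fun t => _) = (fun t => \sum_(1 <= s < k.+1) \sum_(b <- nu s)
   C_ (mon_eval t0 eps b t * phi b t j 0))); last first.
  apply/funext => t; rewrite /delta correctionE rmorph_sum; apply: eq_bigr => s _.
  by rewrite rmorph_sum.
apply: pcls_sum_seq => s; rewrite mem_index_iota => sk; apply: pcls_sum_seq => b bs.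
by have [/(_ j) Kb _ _] := hphi sk bs; exact: mon_pcls sk bs Kb.
Qed.

Lemma pcls_mul_prod g (s : seq 'I_n) (w : {ffun 'I_n -> nat}) : pc 1 g ->
  pc 1 (fun t => g t * C_ (\prod_(j <- s) delta t j 0 ^+ w j)).
Proof.
move=> pg; elim: s => [|j s IH].
  by rewrite (_ : (fun t => _) = g)//; apply/funext => t; rewrite big_nil mulr1.
suff H q : pc 1 (fun t => g t * C_ (\prod_(j <- s) delta t j 0 ^+ w j) * C_ (delta t j 0 ^+ q)).
  rewrite (_ : (fun t => _) = (fun t => g t * C_ (\prod_(j <- s) delta t j 0 ^+ w j) *
    C_ (delta t j 0 ^+ w j))) //.
  by apply/funext => t; rewrite big_cons rmorphM mulrA mulrAC.
elim: q => [|q IHq].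
  by rewrite (_ : (fun t => _) = (fun t => g t * C_ (\prod_(j <- s) delta t j 0 ^+ w j)))//;
    apply/funext => t; rewrite expr0 mulr1.
rewrite (_ : (fun t => _) = (fun t => g t * C_ (\prod_(j <- s) delta t j 0 ^+ w j) *
    C_ (delta t j 0 ^+ q) * C_ (delta t j 0))); last first.
  by apply/funext => t; rewrite exprSr rmorphM mulrA.
apply: (pclsW (N := 1 + 1)) => //; apply: pM => //; first exact: correction_pcls.
by apply: bctsC_real; exact: bcts_correction.
Qed.

Let s t := phi0 t + delta t.

Lemma jacobian_bcts l i j : bcts T (fun t => pderive_seq D [:: j] (fl l) t (s t) i 0).
Proof.
have [q hq] : exists q : nat, q%:Z = Num.max 2 (qk l + 1).
  by exists (absz (Num.max 2 (qk l + 1))); rewrite gez0_abs// le_max.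
have gC := hflC hq; have q1 : (1 <= q)%N by rewrite -lez_nat hq le_max.
have cphi : ctsm T phi0 by move=> i' j'; rewrite (ord1 j'); exact: (K_cts hK).
have cs : ctsm T s.
  move=> i' j'; rewrite (ord1 j').
  rewrite (_ : (fun t => _) = (fun t => phi0 t i' 0 + delta t i' 0)); last first.
    by apply/funext => t; rewrite mxE.
  by apply: ctsD; [exact: (K_cts hK)|exact: cts_correction].
have small t : T <= t -> `|s t - phi0 t| < a.
  by move=> Tt; rewrite /s addrC addKr corr_lt.
split; first exact: (cts_pderive_seq gC _ tT cphi cs small).
have [|M M0 HM] := pderive_seq_bounded gC q1.
  by move=> w w1; apply: hflB; rewrite w1 le_max.
exists M => t Tt; apply: le_trans (mx_entry_le _ i 0) _; apply: HM => //; last exact: small.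
by rewrite (le_trans _ Tt)// ltW.
Qed.

Lemma size_mi_seq (w : {ffun 'I_n -> nat}) : size (mi_seq (enum 'I_n) w) = mi_deg w.
Proof.
rewrite /mi_seq size_flatten /shape -map_comp sumnE big_map big_enum /mi_deg.
by apply: eq_bigr => j _ /=; rewrite size_nseq.
Qed.

(** If eps_l is integrable, boundedness of the Jacobian suffices. Otherwise the derivative is
    expanded about phi0 to degree [sl]: its Taylor coefficients lie in [K], and eps_l times the
    remainder has order varrho_l/varrho_1 + sl + 1 >= varpi, so it is integrable. *)
Lemma jacobian_pcls l i j : pc 1 (fun t => C_ (eps l t * pderive_seq D [:: j] (fl l) t (s t) i 0)).
Proof.
have [Rl|nRl] := pselect (Rclass 1 t0 (eps l)).
  apply: pcls_L1; split; last exact: L1_0.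
  have Ll := Rclass1_L1 tT (eps_within hepsC (l := l)) Rl.
  rewrite (_ : (fun t => _) = (fun t => pderive_seq D [:: j] (fl l) t (s t) i 0 * eps l t)).
    by apply: bcts_L1 => //; exact: jacobian_bcts.
  by apply/funext => t /=; rewrite mulrC.
(* Otherwise eps_l = O(eps_1^varpi) would be integrable. *)
have lw : varrho l <= varpi * varrho ord0.
  rewrite leNgt; apply/negP => h; apply: nRl.
  apply: (L1_Rclass1 (ltW tT) (eps_within hepsC (l := l))).
  apply: (ordO_L1 hepsC heps_gt0 hvarpi tT); first by have [] := parameter_bcts l.
  apply: (ordOW e1_gt0 heps_o1 _ (ord_eps hepsO l)).
  by rewrite ler_pdivlMr// ltW.
have sl0 : 0 <= Num.floor (varpi - varrho l / varrho ord0).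
  by rewrite floor_ge0 subr_ge0 ler_pdivrMr.
pose sl := absz (Num.floor (varpi - varrho l / varrho ord0)).
have slE : sl%:Z = Num.floor (varpi - varrho l / varrho ord0) by rewrite /sl gez0_abs.
have [gC gB gK] := hfl7 lw slE.
have sq : (size [:: j] + sl < sl + 2)%N by rewrite /= add1n addn2 ltnS.
have [|C C0 HC] := tube_taylor gC sq.
  (* The remainder involves derivatives of order sl + 2: order 2 is bounded by the general
     hypothesis, orders from 3 on by the extra smoothness for slow parameters. *)
  move=> w; rewrite /= add1n => w2; have [sl1|/eqP] := posnP sl.
    by apply: hflB; rewrite w2 sl1 le_max.
  by move=> sl1; apply: gB; rewrite w2 addn2 leqnn andbT !ltnS lt0n; apply/eqP => E; rewrite E in sl1.
have [kap kapE] : exists kap : {ffun 'I_n -> nat} -> R -> R, forall w t,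
    kap w t = pderive_seq D (mi_seq (enum 'I_n) w ++ [:: j]) (fl l) t (phi0 t) i 0.
  by eexists => w t; reflexivity.
have a0 : 0 < a by apply: le_lt_trans (corr_lt (lexx T)).
have Kkap w : (mi_deg w <= sl)%N -> K (kap w).
  move=> wsl; have sz : size (mi_seq (enum 'I_n) w ++ [:: j]) = (mi_deg w).+1.
    by rewrite size_cat size_mi_seq addn1.
  have H : (1 <= mi_deg (mi_count (mi_seq (enum 'I_n) w ++ [:: j])) <= sl + 1)%N.
    by rewrite mi_deg_count sz addn1 /= ltnS.
  have := gK _ H i; apply: (K_ext hK) => t tt.
  have szl : (size (mi_seq (enum 'I_n) w ++ [:: j]) <= sl + 2)%N.
    by rewrite sz addn2 ltnS (leq_trans wsl).
  have pa : `|phi0 t - phi0 t| < a by rewrite subrr normr0.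
  exact: etrans (congr1 (fun v : 'cV[R]_n => v i 0) (esym (pderive_seq_mi gC szl tt pa))) (esym (kapE w t)).
have [tayl taylE] : exists tayl : R -> R, forall t, tayl t =
    \sum_(w <- mis (n := n) sl) ((mi_fact w)%:R^-1 * \prod_(j <- index_enum 'I_n) delta t j 0 ^+ w j) * kap w t.
  by eexists => t; reflexivity.
rewrite (_ : (fun t => _) = (fun t =>
   C_ (eps l t * (pderive_seq D [:: j] (fl l) t (s t) i 0 - tayl t)) +
   \sum_(w <- mis sl) C_ (eps l t * ((mi_fact w)%:R^-1 * kap w t)) * C_ (\prod_(j <- index_enum 'I_n) delta t j 0 ^+ w j))); last first.
  apply/funext => t.
  have E : eps l t * pderive_seq D [:: j] (fl l) t (s t) i 0 =
    eps l t * (pderive_seq D [:: j] (fl l) t (s t) i 0 - tayl t) +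
    \sum_(w <- mis sl) (eps l t * ((mi_fact w)%:R^-1 * kap w t)) * \prod_(j <- index_enum 'I_n) delta t j 0 ^+ w j.
    rewrite mulrBr taylE mulr_sumr -addrA -[LHS]addr0; congr (_ + _).
    rewrite addrC; apply/esym/eqP; rewrite subr_eq0; apply/eqP; apply: eq_bigr => w _.
    by rewrite -!mulrA; congr (_ * (_ * _)); rewrite mulrC.
  by rewrite [in LHS]E rmorphD rmorph_sum; congr (_ + _); apply: eq_bigr => w _; rewrite rmorphM.
have bprod w : bcts T (fun t => \prod_(j <- index_enum 'I_n) delta t j 0 ^+ w j).
  by apply: bcts_prod => j' _; apply: bctsX; exact: bcts_correction.
have btayl : cts T tayl.
  have E : tayl = (fun t => \sum_(w <- mis sl) (if (mi_deg w <= sl)%N then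
       ((mi_fact w)%:R^-1 * \prod_(j <- index_enum 'I_n) delta t j 0 ^+ w j) * kap w t else 0)).
    by apply/funext => t; rewrite taylE; apply: eq_big_seq => w; rewrite mem_mis => ->.
  suff [] : bcts T tayl by [].
  rewrite E; apply: bcts_sum => w; case: (boolP (mi_deg w <= sl)%N) => [wsl|_]; last exact: bcts_cst.
  exact: (bctsM (bctsM (bcts_cst T _) (bprod w)) (K_bcts hK tT (Kkap w wsl))).
apply: pcls_add.
  apply: pcls_L1; split; last exact: L1_0.
  have [cJ _] := jacobian_bcts l i j; have [ce _] := parameter_bcts l.
  apply: (ordO_L1 hepsC heps_gt0 hvarpi tT); first exact: (ctsM ce (ctsB cJ btayl)).
  have hx : varpi <= varrho l / varrho ord0 + sl.+1%:R.
    have := lt_succ_floor (varpi - varrho l / varrho ord0); rewrite -slE.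
    by rewrite ltrBlDl intrD -pmulrn natr1 => /ltW.
  apply: (ordOW e1_gt0 heps_o1 hx); apply: (ordOM e1_gt0 (ord_eps hepsO l)).
  have [C' C'0 HC'] := correction_bound hK hvarrho0 hvarrho hrho hnu hpk hepsO heps_o1 heps_gt0 hphi.
  apply: (ordOP e1 _ _).2; exists (C * C' ^+ sl.+1); first exact: (mulr_ge0 C0 (exprn_ge0 _ C'0)).
  have HT : \forall t \near +oo, T <= t by apply/nearyP; exists T.
  apply: filterS3 HC' e1_gt0 HT => t h1 e0 Tt.
  rewrite (powR_mulrn _ (ltW e0)) -mulrA -exprMn.
  apply: (@le_trans _ _ (C * `|delta t| ^+ sl.+1)); last first.
    apply: (ler_wpM2l C0); apply: (lerXn2r _ _ _ h1); rewrite nnegrE; first exact: normr_ge0.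
    exact: (mulr_ge0 C'0 (ltW e0)).
  have tt : t0 <= t := le_trans (ltW tT) Tt.
  have := HC t (delta t) tt (corr_lt Tt); apply: le_trans.
  apply: le_trans (mx_entry_le _ i 0).
  rewrite le_eqVlt; apply/orP; left; apply/eqP; congr (`|_|).
  rewrite [RHS]mxE [in RHS]mxE summxE taylE; congr (_ - _); apply: eq_bigr => w _.
  by rewrite mxE kapE.
apply: pcls_sum_seq => w; rewrite mem_mis => wsl.
apply: pcls_mul_prod.
have [w1 d1 muE] := mu_unit eps l.
rewrite (_ : (fun t => _) = (fun t => C_ (mu eps w1 t) * C_ ((mi_fact w)%:R^-1 * kap w t))); last first.
  by apply/funext => t; rewrite rmorphM muE.
have w11 : (0 < mi_deg w1)%N by rewrite d1.
exact: (muP w11 w11 (KC_real hK (K3_scale hK _ (Kkap w wsl)))).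
Qed.

Lemma Ahat_entry t i j : (Ahat t0 D A eps fl phi0 nu k phi t - A) i j =
  \sum_(l < m.+1) eps l t * pderive_seq D [:: j] (fl l) t (s t) i 0.
Proof.
rewrite /Ahat addrAC subrr add0r summxE; apply: eq_bigr => l _.
by rewrite mxE [jacobian_in _ _ _ _ _ _]mxE.
Qed.

Lemma Ahat_pcls i j : pc 1 (fun t => C_ ((Ahat t0 D A eps fl phi0 nu k phi t - A) i j)) /\
  bcts T (fun t => (Ahat t0 D A eps fl phi0 nu k phi t - A) i j).
Proof.
split.
  rewrite (_ : (fun t => _) = (fun t => \sum_(l <- index_enum 'I_m.+1)
      C_ (eps l t * pderive_seq D [:: j] (fl l) t (s t) i 0))); last first.
    by apply/funext => t; rewrite Ahat_entry rmorph_sum.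
  by apply: pcls_sum_seq => l _; exact: jacobian_pcls.
rewrite (_ : (fun t => _) = (fun t => \sum_(l <- index_enum 'I_m.+1)
   eps l t * pderive_seq D [:: j] (fl l) t (s t) i 0)); last first.
  by apply/funext => t; rewrite Ahat_entry.
by apply: bcts_sum => l; apply: bctsM; [exact: parameter_bcts|exact: jacobian_bcts].
Qed.

End Perturbation.

(** * Solutions near the partial sum *)

Section OneSidedDerivative.
Context {R : realType}.

Lemma is_derive_ray {V : normedModType R} (T t : R) (h : R -> V) d : T <= t ->
  is_derive t 1 h d -> derivable_in (ray T) h t /\ derive_in (ray T) h t = d.
Proof.
move=> Tt dh; apply/derive_in_rayP => //.
have [dv <-] := (is_derive_inP h d (filterT : nbhs t setT)).2 dh.
have H : growth_rate h t @ t^' --> derive_in setT h t.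
  by rewrite -(within_dnbhs_id (filterT : nbhs t setT)); exact: dv.
by apply: cvg_trans H; apply: cvg_app; exact: cvg_within.
Qed.

Lemma cts_ext (t0 T : R) (g h : R -> R) : t0 < T -> (forall t, t0 < t -> g t = h t) -> cts T g -> cts T h.
Proof.
move=> tT gh cg t Tt; have t0t : t0 < t by exact: lt_le_trans Tt.
change (h @ t --> h t); rewrite -(gh t t0t); apply: cvg_trans (cg t Tt).
apply: near_eq_cvg; apply: filterS (lt_nbhsr t0t) => x xt; rewrite gh//.
Qed.

End OneSidedDerivative.

Section Dichotomy.
Context {R : realType}.

(** For l <> 0 the sign of l + q is eventually that of l; for l = 0 it is the assumed sign of q. So
    P - G is eventually monotone with G bounded. A nondecreasing P - G with P bounded above also has
    increments bounded above; hence the second alternative can include unboundedness, which matches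
    a divergent integral of p_jj. *)
Lemma increments_dichotomy (T l : R) (q sig P G : R -> R) (CG : R) :
  q t @[t --> +oo] --> (0 : R) ->
  (\forall t \near +oo, 0 <= q t) \/ (\forall t \near +oo, q t <= 0) ->
  (forall t, T <= t -> is_derive t 1 P (l + q t + sig t)) ->
  (forall t, T <= t -> is_derive t 1 G (sig t)) ->
  (forall t, T <= t -> `|G t| <= CG) ->
  exists T1 C : R, T <= T1 /\
    ((forall s t, T1 <= s -> s <= t -> P t - P s <= C) \/
     ((forall s t, T1 <= s -> s <= t -> - C <= P t - P s) /\
      ~ exists B : R, forall t, T1 <= t -> P t <= B)).
Proof.
move=> q0 sgn dP dG bG.
have near_q (x : R) : 0 < x -> \forall t \near +oo, `|q t| < x.
  by move: q0 => /cvgr0Pnorm_lt; apply.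
have : (\forall t \near +oo, 0 <= l + q t) \/ (\forall t \near +oo, l + q t <= 0).
  have [l0|l0|->] := ltgtP l 0.
  - right; have nl : 0 < - l by rewrite oppr_gt0.
    by apply: filterS (near_q _ nl) => t; rewrite ltr_norml; lra.
  - by left; apply: filterS (near_q _ l0) => t; rewrite ltr_norml; lra.
  - by case: sgn => h; [left|right]; apply: filterS h => t; rewrite add0r.
have dH t : T <= t -> is_derive t 1 (P - G) (l + q t).
  by move=> Tt; apply: (is_derive_eq (is_deriveB (dP t Tt) (dG t Tt))); ring.
have incr s t : P t - P s = ((P - G) t - (P - G) s) + (G t - G s).
  by rewrite -[(P - G) t]/(P t - G t) -[(P - G) s]/(P s - G s); ring.
have Gts s t : T <= s -> s <= t -> - (CG + CG) <= G t - G s <= CG + CG.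
  move=> Ts st; have := bG s Ts; have := bG t (le_trans Ts st).
  by rewrite !ler_norml; lra.
case=> /nearyP[T' HT']; pose T1 := Num.max T T'.
  have TT1 : T <= T1 by rewrite le_max lexx.
  have T'1 t : T1 <= t -> T' <= t by move=> T1t; rewrite (le_trans _ T1t)// le_max lexx orbT.
  have nd : forall s t, T1 <= s -> s <= t -> (P - G) s <= (P - G) t.
    have d1 t : T1 <= t -> is_derive t 1 (P - G) (l + q t) by move=> h; exact: dH (le_trans TT1 h).
    by apply: (antiderivative_nd d1) => t T1t; exact: HT' (T'1 t T1t).
  have [[B HB]|nB] := pselect (exists B : R, forall t, T1 <= t -> P t <= B).
    exists T1, (B + CG - (P - G) T1 + (CG + CG)); split=> //; left=> s t T1s st.
    rewrite incr; have := nd T1 s (lexx _) T1s; have := HB t (le_trans T1s st).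
    have := Gts s t (le_trans TT1 T1s) st.
    have := bG t (le_trans TT1 (le_trans T1s st)); rewrite ler_norml.
    rewrite -[(P - G) t]/(P t - G t); lra.
  exists T1, (CG + CG); split=> //; right; split=> // s t T1s st.
  rewrite incr; have := nd s t T1s st; have := Gts s t (le_trans TT1 T1s) st; lra.
have TT1 : T <= T1 by rewrite le_max lexx.
have T'1 t : T1 <= t -> T' <= t by move=> T1t; rewrite (le_trans _ T1t)// le_max lexx orbT.
have nd : forall s t, T1 <= s -> s <= t -> (- (P - G)) s <= (- (P - G)) t.
  have d1 t : T1 <= t -> is_derive t 1 (- (P - G)) (- (l + q t)).
    by move=> h; have := dH t (le_trans TT1 h) => ?; exact: is_deriveN.
  by apply: (antiderivative_nd d1) => t T1t; rewrite oppr_ge0; exact: HT' (T'1 t T1t).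
exists T1, (CG + CG); split=> //; left=> s t T1s st.
rewrite incr; have := nd s t T1s st; have := Gts s t (le_trans TT1 T1s) st.
by rewrite -[(- (P - G)) s]/(- (P - G) s) -[(- (P - G)) t]/(- (P - G) t); lra.
Qed.

End Dichotomy.

Section ParameterSums.
Context {R : realType} {I : choiceType}.

(** The list coming from [pcls_mean] may repeat an index; coefficients of equal indices are added to
    obtain the form used in the sign condition. *)
Lemma fsum_of_list (W : set I) (r : seq (I * R)) (mu : I -> R -> R) :
  (forall x, List.In x r -> W x.1) ->
  exists g : I -> R, forall t, \sum_(w \in W) g w * mu w t = \sum_(x <- r) x.2 * mu x.1 t.
Proof.
move=> rW; pose g w := \sum_(x <- r | x.1 == w) x.2; exists g => t.
pose s := undup [seq x.1 | x <- r].
have sW : {subset s <= W}.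
  move=> w; rewrite mem_undup => /mapP[x xr ->]; rewrite inE; apply: rW.
  by elim: r xr {g s} => //= y r IH; rewrite inE => /orP[/eqP->|/IH]; [left|right].
rewrite (fsbigE s); first last.
- move=> w _ ws; rewrite /g big_seq_cond big1 ?mul0r// => x /andP[xr /eqP xw].
  by move: ws; rewrite mem_undup -xw map_f.
- by move=> w /= /sW; rewrite inE.
- exact: undup_uniq.
rewrite big_seq_cond (eq_bigl (fun w => w \in s)); last first.
  by move=> w; case: (boolP (w \in s)) => //= /sW; rewrite inE => h; rewrite mem_set.
under eq_bigr do rewrite /g mulr_suml.
rewrite -big_seq (exchange_big_dep predT)//= big_seq [RHS]big_seq; apply: eq_bigr => x xr.
have xs : x.1 \in s by rewrite mem_undup map_f.
rewrite -big_filter (_ : [seq i <- s | x.1 == i] = [:: x.1]) ?big_seq1//.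
rewrite -(filter_pred1_uniq (undup_uniq _) xs); apply: eq_filter => w /=; exact: eq_sym.
Qed.

End ParameterSums.

(** * The equation for r and its solution by means of a given frame *)

Section Solutions.
Context {R : realType} {n m : nat}.
Variables (t0 : R) (A : 'M[R]_n) (lam : 'I_n -> R[i]) (K : set (R -> R)).
Hypothesis hK : classK3 t0 (range lam `|` eigen_differences lam) K.
Variables (f : R -> 'cV[R]_n) (a : R)
  (eps : 'I_m.+1 -> R -> R) (fl : 'I_m.+1 -> R -> 'cV[R]_n -> 'cV[R]_n)
  (phi0 : R -> 'cV[R]_n) (varrho : 'I_m.+1 -> R) (rho : nat -> R)
  (nu : nat -> seq (mon m.+1)) (k : nat) (pk : 'I_m.+1 -> nat) (qk : 'I_m.+1 -> int).
Local Notation D := (tube t0 a phi0).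
Hypothesis ha : 0 < a.
Hypothesis hphi0K : vecK K phi0.
Hypothesis hphi0 : solves (ray t0) (fun t v => A *m v + f t) phi0.
Hypothesis hvarrho0 : forall l, 0 < varrho l.
Hypothesis hvarrho : forall l l' : 'I_m.+1, (l <= l')%N -> varrho l <= varrho l'.
Hypothesis hrho : ranks_enum varrho rho.
Hypothesis hnu : mons_enum varrho rho nu.
Hypothesis hk : (1 <= k)%N.
Hypothesis hpk : forall l, (pk l)%:Z = Num.max 0 (Num.floor (rho k - varrho l) + 1).
Hypothesis hqk : forall l, qk l = Num.floor ((rho k - varrho l) / varrho ord0).
Hypothesis hepsC : forall l, Cn_in (ray t0) (pk l) (eps l).
Hypothesis hepsO : forall l r, (r <= pk l)%N ->
  bigO_pinfty (derive_in_n (ray t0) r (eps l))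
    (fun t => eps ord0 t `^ ((varrho l + r%:R) / varrho ord0)).
Hypothesis heps_o1 : eps ord0 t @[t --> +oo] --> (0 : R).
Hypothesis hflC : forall l (q : nat), q%:Z = Num.max 2 (qk l + 1) -> C0n_in D q (fl l).
Hypothesis hflB : forall l (w : {ffun 'I_n -> nat}),
  (mi_deg w)%:Z <= Num.max 2 (qk l + 1) -> [bounded pderive_mi D w (fl l) z.1 z.2 | z in D].
Hypothesis hflK : forall l (w : {ffun 'I_n -> nat}), varrho l <= rho k ->
  (mi_deg w)%:Z <= qk l -> vecK K (fun t => pderive_mi D w (fl l) t (phi0 t)).
Variable varpi : R.
Hypothesis hvarpi : Rclass varpi t0 (eps ord0).
Hypothesis heps_gt0 : forall t, ray t0 t -> 0 < eps ord0 t.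
Hypothesis hrho1 : varrho ord0 * varpi < rho k.+1.
Hypothesis hrho2 : varrho ord0 * (2 * varpi - 1) <= rho k.+1.
Variable phi : mon m.+1 -> R -> 'cV[R]_n.
Hypothesis hphi : expansion_coefs t0 D A fl phi0 nu k phi K.

Let e1 := eps ord0.
Let e1' := derive_in (ray t0) e1.
Let ord := ordO e1.
Let s := approx_sol t0 eps phi0 nu k phi.
Let delta := correction t0 eps nu k phi.
Let res := residual t0 A f eps fl phi0 nu k phi.
Let B := Ahat t0 D A eps fl phi0 nu k phi.
Let e : R := rho k.+1 / varrho ord0 - varpi.
Let sigma t := e1 t `^ e.
Let kap t := e * ((e1 t)^-1 * e1' t).

Let e1_gt0 : \forall t \near +oo, 0 < e1 t.
Proof. exact: heps_near heps_gt0. Qed.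

Lemma exponent_gt0 : 0 < e.
Proof. by rewrite subr_gt0 ltr_pdivlMr// mulrC. Qed.

Lemma exponent_ge : varpi <= e + 1.
Proof.
rewrite /e; have : 2 * varpi - 1 <= rho k.+1 / varrho ord0 by rewrite ler_pdivlMr// mulrC.
by lra.
Qed.

Lemma first_order : (1 <= pk ord0)%N.
Proof.
rewrite -lez_nat hpk le_max lerDr floor_ge0 subr_ge0 (rho_ge_min hvarrho0 hvarrho hrho) ?orbT//.
Qed.

Lemma is_derive_e1 t : t0 < t -> is_derive t 1 e1 (e1' t).
Proof. by move=> tt; have := is_derive_eps hepsC (r := 0) first_order tt. Qed.

Lemma is_derive_sigma t : t0 < t -> is_derive t 1 sigma (kap t * sigma t).
Proof.
move=> tt; have e0 : 0 < e1 t by apply: heps_gt0; apply/rayE/ltW.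
have d1 := is_derive_e1 tt.
have h := @is_derive1_comp R (@powR R ^~ e) e1 t _ _ (is_derive1_powR e e0) d1.
apply: (is_derive_eq h); rewrite /kap /sigma.
have -> : e1 t `^ (e - 1) = e1 t `^ e * (e1 t)^-1.
  rewrite powRB; last by apply/implyP => _; rewrite gt_eqF.
  by rewrite powRr1// ltW.
by rewrite /GRing.scale /=; ring.
Qed.

Lemma sigma_gt0 t : t0 <= t -> 0 < sigma t.
Proof. by move=> tt; apply: powR_gt0; apply: heps_gt0; exact/rayE. Qed.

Lemma ord_powR x : ord x (fun t => e1 t `^ x).
Proof. by exists 1; near=> t; rewrite mul1r.
Unshelve. all: by end_near. Qed.

Lemma sigma_cvg0 : sigma t @[t --> +oo] --> (0 : R).
Proof. exact: (ordO_cvg0 heps_o1 heps_gt0 exponent_gt0 (ord_powR e)). Qed.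

(** The order condition for r = 1 gives eps_1'/eps_1 = O(eps_1^(1/varrho_1)); it applies because pk
    ord0 >= 1. *)
Lemma kap_cvg0 : kap t @[t --> +oo] --> (0 : R).
Proof.
have v0 : 0 < (varrho ord0)^-1 by rewrite invr_gt0.
apply: (ordO_cvg0 heps_o1 heps_gt0 v0).
have -> : (varrho ord0)^-1 = 0 + (-1 + (varrho ord0 + 1%:R) / varrho ord0).
  by rewrite mulrDl divff ?gt_eqF// add0r addKr mul1r.
apply: ordOM => //; first by apply: ordO_bounded; exists `|e|; near=> t.
apply: ordOM => //; last exact: hepsO first_order.
apply/ordOP; exists 1 => //; apply: filterS e1_gt0 => t et.
by rewrite mul1r (powR_inv1 (ltW et)) gtr0_norm ?invr_gt0.
Unshelve. all: by end_near. Qed.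

Lemma cts_kap T : t0 < T -> cts T kap.
Proof.
move=> tT; apply: ctsM; first exact: cts_cst.
have c1 : cts T e1 := cts_eps hepsC tT (leq0n _) (l := ord0).
have c2 : cts T e1' := cts_eps hepsC tT first_order.
apply: ctsM => //; apply: cts_inv => // t Tt.
by rewrite gt_eqF// heps_gt0//; apply/rayE; rewrite (le_trans _ Tt)// ltW.
Qed.

Lemma smoothness_degree l : exists2 q : nat, q%:Z = Num.max 2 (qk l + 1) & (1 < q)%N.
Proof.
have q0 : 0 <= Num.max 2 (qk l + 1) by rewrite le_max.
exists (absz (Num.max 2 (qk l + 1))); first by rewrite gez0_abs.
by rewrite -ltz_nat gez0_abs// lt_max.
Qed.

Lemma cts_fl T (v : R -> 'cV[R]_n) l : t0 < T -> ctsm T v ->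
  (forall t, T <= t -> `|v t - phi0 t| < a) -> ctsm T (fun t => fl l t (v t)).
Proof.
move=> tT cv va; have [q hq _] := smoothness_degree l.
apply: (cts_pderive_seq (s := [::]) (hflC hq) _ tT) => //.
by move=> i j; rewrite (ord1 j); exact: (K_cts hK).
Qed.

Lemma cts_approx T : t0 < T -> ctsm T s.
Proof.
move=> tT i j; rewrite (ord1 j).
have ds t : T <= t -> is_derive t 1 (fun x => s x i 0) (derive_in (ray t0) s t i 0).
  move=> Tt; have t0t : t0 < t by exact: lt_le_trans Tt.
  exact: (is_derive_entry _ _ _).1 (derive_in_approx hphi0 hvarrho0 hrho hnu hpk hepsC hphi t0t) i 0.
exact: cts_derive ds.
Qed.

Lemma approxB t : s t - phi0 t = delta t.
Proof. by rewrite /s approx_solE addrC addKr. Qed.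

(** The definition contains the derivative of s, which is awkward to treat directly. The
    decomposition [residualE] expresses the residual by monomials with coefficients in [K] and
    Taylor remainders, all continuous. *)
Lemma cts_residual T i : t0 < T -> (forall t, T <= t -> `|delta t| < a) -> cts T (fun t => res t i 0).
Proof.
move=> tT da.
have [I [P [c [Padm _ cK HE]]]] := lin_ext_red_low hK eps hvarrho0 hvarrho hrho hnu hk hpk hqk hflK hphi i.
apply: (cts_ext tT (g := fun t => \sum_(x | rho k < mon_rank varrho (P x)) c x t * mon_eval t0 eps (P x) t +
  \sum_(l < m.+1) eps l t * (fl l t (s t) i 0 -
    (if varrho l <= rho k then \sum_(w <- mis (n := n) (taylor_deg qk l))
         (mi_fact w)%:R^-1 * pderive_mi D w (fl l) t (phi0 t) i 0 *
         \prod_(j <- index_enum 'I_n) delta t j 0 ^+ w j else 0)))).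
  move=> t tt; rewrite /res (residualE qk hphi0 hvarrho0 hrho hnu hpk hepsC hphi i tt).
  by congr (_ + _); rewrite HE// ltW.
apply: ctsD.
  apply: cts_sum => x; apply: ctsM; first exact: (K_cts hK).
  exact: (cts_mon_eval hepsC tT (Padm x)).
apply: cts_sum => l; apply: ctsM; first exact: (cts_eps hepsC tT (leq0n _)).
apply: ctsB.
  have cf : ctsm T (fun t => fl l t (s t)).
    apply: cts_fl => //; first exact: cts_approx.
    by move=> t Tt; rewrite approxB da.
  exact: (cf i 0).
have [lk|_] := leP (varrho l) (rho k); last exact: cts_cst.
have [qE _] := taylor_degP hvarrho0 hqk lk.
pose F w t := (mi_fact w)%:R^-1 * pderive_mi D w (fl l) t (phi0 t) i 0 *
  \prod_(j <- index_enum 'I_n) delta t j 0 ^+ w j.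
have E : (fun t => \sum_(w <- mis (n := n) (taylor_deg qk l)) F w t) = (fun t =>
    \sum_(w <- mis (n := n) (taylor_deg qk l) | (mi_deg w <= taylor_deg qk l)%N) F w t).
  by apply/funext => t; rewrite big_seq [RHS]big_seq_cond; apply: eq_bigl => w; rewrite mem_mis andbb.
change (cts T (fun t => \sum_(w <- mis (n := n) (taylor_deg qk l)) F w t)); rewrite E.
have ctsF w : (mi_deg w <= taylor_deg qk l)%N -> cts T (F w).
  move=> wl; apply: ctsM.
    apply: ctsM; first exact: cts_cst.
    by apply: (K_cts hK tT); apply: hflK => //; rewrite -qE lez_nat.
  apply: cts_prod => j _; apply: ctsX.
  exact: (cts_correction hK hphi0K hphi0 hvarrho0 hrho hnu hpk hepsC hphi tT).
move=> t Tt; apply: cvg_big => [|w wl]; first exact: add_continuous.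
exact: ctsF.
Qed.

Definition nonlinear_part t (r : 'cV[R]_n) : 'cV[R]_n := res t +
  \sum_(l < m.+1) eps l t *: (fl l t (s t + r) - fl l t (s t) - jacobian_in D (fl l) t (s t) *m r).

Lemma cts_nonlinear_part T (r : R -> 'cV[R]_n) : t0 < T ->
  (forall t, T <= t -> `|delta t| < a) -> ctsm T r ->
  (forall t, T <= t -> `|delta t| + `|r t| < a) -> ctsm T (fun t => nonlinear_part t (r t)).
Proof.
move=> tT da cr ra i j; rewrite (ord1 j).
have cs := cts_approx tT.
have cf l : ctsm T (fun t => fl l t (s t)) by apply: cts_fl => // t Tt; rewrite approxB da.
have cfr l : ctsm T (fun t => fl l t (s t + r t)).
  apply: cts_fl => //; first exact: ctsmD.
  by move=> t Tt; rewrite addrAC approxB (le_lt_trans (ler_normD _ _))// ra.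
have cJ l : ctsm T (fun t => jacobian_in D (fl l) t (s t)).
  move=> i' j'; have [c _] := jacobian_bcts hK hphi0K hphi0 hvarrho0 hrho hnu hpk hepsC hflC hflB hphi tT da l i' j'.
  by rewrite (_ : (fun t => _) = (fun t => pderive_seq D [:: j'] (fl l) t (s t) i' 0)); [exact: c|apply/funext => t; rewrite mxE].
rewrite (_ : (fun t => _) = (fun t => res t i 0 + \sum_(l < m.+1) eps l t *
  (fl l t (s t + r t) i 0 - fl l t (s t) i 0 - (jacobian_in D (fl l) t (s t) *m r t) i 0))); last first.
  apply/funext => t; rewrite /nonlinear_part mxE summxE; congr (_ + _).
  by apply: eq_bigr => l _; rewrite mxE mxB2.
apply: ctsD; first exact: cts_residual.
apply: cts_sum => l; apply: ctsM; first exact: (cts_eps hepsC tT (leq0n _)).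
apply: ctsB; first by apply: ctsB; [exact: cfr|exact: cf].
by have := ctsm_mul (cJ l) cr; apply.
Qed.

Lemma nonlinear_part0 t : nonlinear_part t 0 = res t.
Proof.
rewrite /nonlinear_part big1 ?addr0// => l _.
by rewrite subrr mulmx0 subrr scaler0.
Qed.

Lemma perturbed_equation t (r : 'cV[R]_n) :
  B t *m r + nonlinear_part t r = rhs A f eps fl t (s t + r) - derive_in (ray t0) s t.
Proof.
rewrite /nonlinear_part /B /Ahat /res /residual /rhs mulmxDl mulmx_suml -/s.
have -> : \sum_(l < m.+1) eps l t *: (fl l t (s t + r) - fl l t (s t) - jacobian_in D (fl l) t (s t) *m r) =
  \sum_(l < m.+1) eps l t *: fl l t (s t + r) - \sum_(l < m.+1) eps l t *: fl l t (s t)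
  - \sum_(l < m.+1) (eps l t *: jacobian_in D (fl l) t (s t)) *m r.
  rewrite -!sumrB; apply: eq_bigr => l _.
  by rewrite !scalerBr -scalemxAl.
rewrite [A *m (s t + r)]mulmxDr.
move: (\sum_(l < m.+1) eps l t *: fl l t (s t + r)) (\sum_(l < m.+1) eps l t *: fl l t (s t))
  (\sum_(l < m.+1) (eps l t *: jacobian_in D (fl l) t (s t)) *m r) (A *m r) (A *m s t) (derive_in (ray t0) s t) (f t).
move=> x1 x2 x3 x4 x5 x6 x7; apply/matrixP => i j; rewrite !mxE; ring.
Qed.


(** The radius a is shared equally between the correction and r, so that s + r stays in the tube.
    [G] is a combination of the |eps_l| = O(eps_1), so sigma G = O(eps_1^(e+1)) is integrable by
    [exponent_ge]. *)
Lemma nonlinear_bounds : exists T0 (C : R) (G : R -> R), [/\ t0 < T0,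
    forall t, T0 <= t -> `|delta t| < a / 2,
    forall t, T0 <= t -> `|nonlinear_part t 0| <= sigma t * (C * e1 t `^ varpi),
    forall t rad r r', T0 <= t -> 0 <= rad -> rad <= a / 2 -> `|r| <= rad -> `|r'| <= rad ->
      `|nonlinear_part t r - nonlinear_part t r'| <= G t * rad * `|r - r'| &
    forall T, T0 <= T -> L1 T (fun t => sigma t * G t)].
Proof.
have [C C0 /nearyP[T1 HT1]] := residual_bound hK ha hphi0 hvarrho0 hvarrho hrho hnu hk hpk hqk hepsC hepsO
  heps_o1 hflC hflB hflK heps_gt0 hphi.
have a20 : 0 < a / 2 by rewrite divr_gt0.
have /nearyP[T2 HT2] : \forall t \near +oo, `|delta t| < a / 2.
  have /cvgr0Pnorm_lt := correction_cvg0 hK hvarrho0 hvarrho hrho hnu hpk hepsO heps_o1 heps_gt0 hphi.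
  by apply.
have /choice[CQ HCQ] : forall l, exists C, 0 <= C /\ forall t (y r r' : 'cV[R]_n) (rad : R), t0 <= t ->
    `|y - phi0 t| + rad < a -> `|r| <= rad -> `|r'| <= rad ->
    `|fl l t (y + r) - fl l t (y + r') - jacobian_in D (fl l) t y *m (r - r')| <= C * rad * `|r - r'|.
  move=> l; have [q hq q1] := smoothness_degree l.
  have [|CQ CQ0 HQ] := tube_quadratic (hflC hq) q1.
    by move=> w w2; apply: hflB; rewrite w2 le_max.
  by exists CQ.
pose T0 := Num.max (t0 + 1) (Num.max T1 T2).
have T0E t : T0 <= t -> [/\ t0 < t, T1 <= t & T2 <= t].
  by rewrite /T0 !ge_max => /andP[h /andP[h1 h2]]; split=> //; rewrite (lt_le_trans _ h)// ltrDl.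
have [tT0 _ _] := T0E T0 (lexx _).
pose G t := \sum_l CQ l * `|eps l t|.
exists T0, C, G; split=> //.
- by move=> t /T0E[_ _]; exact: HT2.
- move=> t /T0E[tt T1t _]; rewrite nonlinear_part0.
  have := HT1 t T1t; rewrite (_ : rho k.+1 / varrho ord0 = e + varpi); last by rewrite /e subrK.
  have -> : eps ord0 t `^ (e + varpi) = sigma t * e1 t `^ varpi.
    rewrite powRD//; apply/implyP => _; rewrite gt_eqF// heps_gt0//; exact/rayE/ltW.
  by rewrite mulrCA.
- move=> t rad r r' T0t rad0 rada rr rr'; have [tt _ T2t] := T0E t T0t.
  have -> : nonlinear_part t r - nonlinear_part t r' = \sum_(l < m.+1) eps l t *:
     (fl l t (s t + r) - fl l t (s t + r') - jacobian_in D (fl l) t (s t) *m (r - r')).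
    rewrite /nonlinear_part opprD addrACA subrr add0r -sumrB; apply: eq_bigr => l _.
    rewrite -scalerBr; congr (_ *: _); rewrite mulmxBr.
    move: (fl l t (s t + r)) (fl l t (s t + r')) (fl l t (s t)) (_ *m r) (_ *m r') => x1 x2 x3 x4 x5.
    by apply/matrixP => i j; rewrite !mxE; ring.
  apply: le_trans (ler_norm_sum _ _ _) _; rewrite /G -mulrA mulr_suml; apply: ler_sum => l _.
  rewrite normrZ -mulrA mulrCA ler_wpM2l// mulrA; have [_ HQ] := HCQ l; apply: HQ => //; first exact: ltW.
  by rewrite approxB; apply: lt_le_trans (ltr_leD (HT2 t T2t) rada) _; rewrite -splitr.
- move=> T T0T; have [tT _ _] := T0E T T0T.
  have cs : cts T sigma.
    have ds t : T <= t -> is_derive t 1 sigma (kap t * sigma t).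
      by move=> Tt; apply: is_derive_sigma; exact: lt_le_trans Tt.
    exact: cts_derive ds.
  have cG : cts T G.
    apply: cts_sum => l; apply: ctsM; first exact: cts_cst.
    by apply: cts_norm; exact: (cts_eps hepsC tT (leq0n _)).
  apply: (ordO_L1 hepsC heps_gt0 hvarpi tT); first exact: ctsM.
  apply: (ordOW e1_gt0 heps_o1 exponent_ge); apply: ordOM => //; first exact: ord_powR.
  apply: ordO_sum => l _ _; rewrite -[1]add0r; apply: ordOM => //.
    by apply: ordO_bounded; exists `|CQ l|; near=> t.
  have [_ lE] : true /\ 1 <= varrho l / varrho ord0 by rewrite ler_pdivlMr// mul1r hvarrho.
  have /ordOP[Ce Ce0 He] := ordOW e1_gt0 heps_o1 lE (ord_eps hepsO l).
  by apply/ordOP; exists Ce => //; apply: filterS He => t; rewrite normr_id.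
Unshelve. all: by end_near. Qed.


Section FrameSolutions.
Variables (M : nat) (Tf : R) (U dU E : R -> 'M[R]_(n, M)) (V : R -> 'M[R]_(M, n))
  (p P : 'I_M -> R -> R) (CU CV C : R) (up : pred 'I_M).
Hypothesis hU : forall i j t, Tf <= t -> is_derive t 1 (fun t => U t i j) (dU t i j).
Hypothesis hdU : forall t, Tf <= t -> dU t = B t *m U t - U t *m diag_mx (\row_j p j t) - E t.
Hypothesis hUV : forall t, Tf <= t -> U t *m V t = 1%:M.
Hypothesis hV : ctsm Tf V.
Hypothesis hE : forall i j, L1 Tf (fun t => E t i j).
Hypothesis hCU : forall t, Tf <= t -> `|U t| <= CU.
Hypothesis hCV : forall t, Tf <= t -> `|V t| <= CV.
Hypothesis hP : forall j t, Tf <= t -> is_derive t 1 (P j) (p j t - kap t).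
Hypothesis dich : forall j s t, Tf <= s -> s <= t ->
  if up j then P j t - P j s <= C else - C <= P j t - P j s.

Lemma frame_solutions : exists T1, forall T, T1 <= T ->
  exists v : 'cV[R]_M -> R -> 'cV[R]_M,
    forall c : 'cV[R]_M, (forall i, ~~ up i -> c i 0 = 0) -> expR C * `|c| <= 4^-1 -> [/\
      error_term t0 D A f eps fl phi0 nu k phi e1 e T (fun t => sigma t *: (U t *m v c t)),
      forall i, up i -> v c T i 0 = c i 0 &
      forall c' : 'cV[R]_M, (forall i, ~~ up i -> c' i 0 = 0) -> expR C * `|c'| <= 4^-1 ->
        `|v c T - v c' T| <= 2 * expR C * `|c - c'|].
Proof.
have [T0 [Cr [G [tT0 small g0 gL GL]]]] := nonlinear_bounds.
have a20 : 0 < a / 2 by rewrite divr_gt0.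
have a2a : a / 2 < a by rewrite ltr_pdivrMr// ltr_pMr// ltr1n.
pose T2 := Num.max T0 Tf.
have T02 : T0 <= T2 by rewrite le_max lexx.
have Tf2 : Tf <= T2 by rewrite le_max lexx orbT.
have T0t t : T2 <= t -> T0 <= t by exact: le_trans.
have Tft t : T2 <= t -> Tf <= t by exact: le_trans.
have tt t : T2 <= t -> t0 < t by move=> h; apply: lt_le_trans tT0 (T0t t h).
have tT2 := tt T2 (lexx _).
have := @conjugate_fixpoint R n M T2 B U dU E V p P kap sigma (fun t => Cr * e1 t `^ varpi) G
  nonlinear_part (a / 2) C CU CV up.
case.
- by move=> i j t /Tft; exact: hU.
- by move=> t /Tft; exact: hdU.
- by move=> t /Tft; exact: hUV.
- exact: ctsmW hV.
- by move=> i j; exact: L1W (hE i j).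
- by move=> t /Tft; exact: hCU.
- by move=> t /Tft; exact: hCV.
- by move=> t /tt; exact: is_derive_sigma.
- by move=> t /tt/ltW; exact: sigma_gt0.
- exact: sigma_cvg0.
- by move=> j t /Tft; exact: hP.
- by move=> j s' t Ts; apply: dich; exact: Tft.
- exact: a20.
- by move=> t /T0t; exact: g0.
- by apply: L1Z; exact: (L1_varpi hepsC heps_gt0 hvarpi).
- by move=> t rad r r' /T0t h; exact: gL.
- exact: GL.
- move=> T r T2T cr ra; apply: cts_nonlinear_part => //.
  + exact: tt.
  + by move=> t Tt; apply: lt_trans (small t (T0t t (le_trans T2T Tt))) a2a.
  + move=> t Tt; apply: lt_le_trans (ltr_leD (small t (T0t t (le_trans T2T Tt))) (ra t Tt)) _.
    by rewrite -splitr.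
move=> T1 T21 HT1; exists T1 => T T1T.
have [v Hv rad] := HT1 T T1T; exists v => c c0 cC.
have [v1 dv vT vL] := Hv c c0 cC; split=> //.
have T2T : T2 <= T by exact: le_trans T1T.
have CU0 : 0 <= CU := le_trans (normr_ge0 _) (hCU (lexx Tf)).
have r_le t : T <= t -> `|sigma t *: (U t *m v c t)| <= M%:R * CU * sigma t.
  move=> Tt; have T2t := le_trans T2T Tt.
  have sg : 0 < sigma t by apply: sigma_gt0; exact/ltW/tt.
  rewrite normrZ (gtr0_norm sg) mulrC; apply: (ler_wpM2r (ltW sg)).
  apply: le_trans (mulmx_norm_le _ _) _; rewrite -[leRHS]mulr1.
  rewrite ler_pM ?mulr_ge0//; last exact: v1.
  by rewrite ler_wpM2l// hCU// Tft.
split.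
- move=> t /rayE Tt; have T2t := le_trans T2T Tt; split=> /=; first exact/ltW/tt.
  rewrite addrAC approxB; apply: le_trans (ler_normD _ _) _; rewrite [leRHS]splitr.
  by rewrite lerD// ?(ltW (small t (T0t t T2t)))// (le_trans (r_le t Tt))// rad.
- move=> t /rayE Tt; have T2t := le_trans T2T Tt; apply: is_derive_ray => //.
  have ds : is_derive t 1 s (derive_in (ray t0) s t).
    exact: (derive_in_approx hphi0 hvarrho0 hrho hnu hpk hepsC hphi (tt t T2t)).
  have dr : is_derive t 1 (fun t => sigma t *: (U t *m v c t))
      (B t *m (sigma t *: (U t *m v c t)) + nonlinear_part t (sigma t *: (U t *m v c t))).
    apply/is_derive_entry => i j; rewrite (ord1 j).
    exact: (dv t i Tt).
  have h := is_deriveD ds dr; apply: (is_derive_eq h).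
  by rewrite perturbed_equation addrC subrK.
- exists (M%:R * CU); apply/nearyP; exists T => t Tt.
  by rewrite (ger0_norm (powR_ge0 _ _)); exact: r_le.
Qed.

End FrameSolutions.

End Solutions.

Lemma bcts_mx_bound {R : realType} {p q : nat} (T : R) (A : R -> 'M[R]_(p, q)) :
  (forall i j, bcts T (fun t => A t i j)) -> exists C : R, forall t, T <= t -> `|A t| <= C.
Proof.
move=> bA.
have /choice[C HC] : forall ij : 'I_p * 'I_q, exists C : R, forall t, T <= t -> `|A t ij.1 ij.2| <= C.
  by move=> [i j]; have [_] := bA i j.
exists (\sum_ij `|C ij|) => t Tt; apply: mx_norm_le => [|i j]; first exact: sumr_ge0.
apply: le_trans (HC (i, j) t Tt) _; rewrite (bigD1 (i, j))//= (le_trans (ler_norm _))//.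
by rewrite lerDl sumr_ge0.
Qed.

Lemma fin_upper_bound {R : realType} {I : finType} (F : I -> R) : exists M, forall i, F i <= M.
Proof.
exists (\sum_i `|F i|) => i; rewrite (bigD1 i)//= (le_trans (ler_norm _))//.
by rewrite lerDl sumr_ge0.
Qed.

(** * Existence of r through the real normal form *)

Section Existence.
Context {R : realType} {n m : nat}.
Variables (t0 : R) (A : 'M[R]_n) (lam : 'I_n -> R[i]) (K : set (R -> R)).
Hypothesis hlam : eigenvalues_of A lam.
Hypothesis hK : classK3 t0 (range lam `|` eigen_differences lam) K.
Variables (f : R -> 'cV[R]_n) (a : R)
  (eps : 'I_m.+1 -> R -> R) (fl : 'I_m.+1 -> R -> 'cV[R]_n -> 'cV[R]_n)
  (phi0 : R -> 'cV[R]_n) (varrho : 'I_m.+1 -> R) (rho : nat -> R)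
  (nu : nat -> seq (mon m.+1)) (k : nat) (pk : 'I_m.+1 -> nat) (qk : 'I_m.+1 -> int).
Local Notation D := (tube t0 a phi0).
Hypothesis ha : 0 < a.
Hypothesis hphi0K : vecK K phi0.
Hypothesis hphi0 : solves (ray t0) (fun t v => A *m v + f t) phi0.
Hypothesis hvarrho0 : forall l, 0 < varrho l.
Hypothesis hvarrho : forall l l' : 'I_m.+1, (l <= l')%N -> varrho l <= varrho l'.
Hypothesis hrho : ranks_enum varrho rho.
Hypothesis hnu : mons_enum varrho rho nu.
Hypothesis hk : (1 <= k)%N.
Hypothesis hpk : forall l, (pk l)%:Z = Num.max 0 (Num.floor (rho k - varrho l) + 1).
Hypothesis hqk : forall l, qk l = Num.floor ((rho k - varrho l) / varrho ord0).
Hypothesis hepsC : forall l, Cn_in (ray t0) (pk l) (eps l).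
Hypothesis hepsO : forall l r, (r <= pk l)%N ->
  bigO_pinfty (derive_in_n (ray t0) r (eps l))
    (fun t => eps ord0 t `^ ((varrho l + r%:R) / varrho ord0)).
Hypothesis heps_o1 : eps ord0 t @[t --> +oo] --> (0 : R).
Hypothesis hflC : forall l (q : nat), q%:Z = Num.max 2 (qk l + 1) -> C0n_in D q (fl l).
Hypothesis hflB : forall l (w : {ffun 'I_n -> nat}),
  (mi_deg w)%:Z <= Num.max 2 (qk l + 1) -> [bounded pderive_mi D w (fl l) z.1 z.2 | z in D].
Hypothesis hflK : forall l (w : {ffun 'I_n -> nat}), varrho l <= rho k ->
  (mi_deg w)%:Z <= qk l -> vecK K (fun t => pderive_mi D w (fl l) t (phi0 t)).
Variable varpi : R.
Hypothesis hvarpi0 : 0 < varpi.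
Hypothesis hvarpi : Rclass varpi t0 (eps ord0).
Hypothesis heps_gt0 : forall t, ray t0 t -> 0 < eps ord0 t.
Hypothesis hrho1 : varrho ord0 * varpi < rho k.+1.
Hypothesis hrho2 : varrho ord0 * (2 * varpi - 1) <= rho k.+1.
Variable phi : mon m.+1 -> R -> 'cV[R]_n.
Hypothesis hphi : expansion_coefs t0 D A fl phi0 nu k phi K.

Hypothesis hepsR : forall l (r : nat), 1 <= rho k - varrho l -> (1 <= r)%N ->
  r%:Z <= Num.floor (rho k - varrho l) -> Rclass 1 t0 (derive_in_n (ray t0) r (eps l)).
Hypothesis hfl7 : forall l (sl : nat), varrho l <= varpi * varrho ord0 ->
  sl%:Z = Num.floor (varpi - varrho l / varrho ord0) ->
  [/\ C0n_in D (sl + 2) (fl l),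
      forall w : {ffun 'I_n -> nat}, (3 <= mi_deg w <= sl + 2)%N ->
        [bounded pderive_mi D w (fl l) z.1 z.2 | z in D] &
      forall w : {ffun 'I_n -> nat}, (1 <= mi_deg w <= sl + 1)%N ->
        vecK K (fun t => pderive_mi D w (fl l) t (phi0 t))].
Hypothesis hdiff : ~ eigen_differences lam 0.
Hypothesis hmono : forall l, ~ Rclass 1 t0 (eps l) ->
   [/\ {in ray t0 &, {homo eps l : x y / x <= y}} \/
       {in ray t0 &, {homo eps l : x y /~ x <= y}},
       eps l t @[t --> +oo] --> (0 : R),
       Cn_in (ray t0) 1 (eps l) &
       Rclass 1 t0 (derive_in (ray t0) (eps l))].
Hypothesis hsign : forall (g1 : R) (g : {ffun 'I_m.+1 -> nat} -> R),
   let F t := g1 * (eps ord0 t)^-1 * derive_in (ray t0) (eps ord0) t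
     + \sum_(w \in mu_indices eps t0 varpi) g w * mu eps w t in
   (\forall t \near +oo, 0 <= F t) \/ (\forall t \near +oo, F t <= 0).

Let e1 := eps ord0.
Let s := approx_sol t0 eps phi0 nu k phi.
Let delta := correction t0 eps nu k phi.
Let B := Ahat t0 D A eps fl phi0 nu k phi.
Let e : R := rho k.+1 / varrho ord0 - varpi.
Let kap t := e * ((e1 t)^-1 * derive_in (ray t0) e1 t).

(** The sign condition is applied with gamma_1 = - e; the term [kap] is thereby absorbed into the
    vanishing part q. *)
Lemma mean_dichotomy T (l : R) (g : {ffun 'I_m.+1 -> nat} -> R) (sig P G : R -> R) (CG : R) : t0 < T ->
  \sum_(w \in mu_indices eps t0 varpi) g w * mu eps w t @[t --> +oo] --> (0 : R) ->
  (forall t, T <= t -> is_derive t 1 P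
     (l + \sum_(w \in mu_indices eps t0 varpi) g w * mu eps w t + sig t - kap t)) ->
  (forall t, T <= t -> is_derive t 1 G (sig t)) ->
  (forall t, T <= t -> `|G t| <= CG) ->
  exists T1 C : R, T <= T1 /\
    ((forall s t, T1 <= s -> s <= t -> P t - P s <= C) \/
     ((forall s t, T1 <= s -> s <= t -> - C <= P t - P s) /\
      ~ exists B : R, forall t, T1 <= t -> P t <= B)).
Proof.
move=> tT g0 dP dG bG.
pose q t := \sum_(w \in mu_indices eps t0 varpi) g w * mu eps w t - kap t.
apply: (@increments_dichotomy R T l q sig P G CG) => //.
- rewrite -[0](subrr 0); apply: cvgB => //.
  exact: (kap_cvg0 hvarrho0 hvarrho hrho hk hpk hepsO heps_o1 varpi heps_gt0).
- have E t : (- e) * (eps ord0 t)^-1 * derive_in (ray t0) (eps ord0) t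
     + \sum_(w \in mu_indices eps t0 varpi) g w * mu eps w t = q t.
    by rewrite /q /kap /e1; ring.
  by have [h|h] := hsign (- e) g; [left|right]; apply: filterS h => t; rewrite E.
- by move=> t Tt; apply: is_derive_eq (dP t Tt) _; rewrite /q; ring.
Qed.

Lemma conjugated_pcls T Q : t0 < T -> (forall t, T <= t -> `|delta t| < a) -> forall i j,
  pcls T K (mu_indices eps t0 varpi) mi_deg (mu eps) 1 (conjugated_perturbation A B Q i j).
Proof.
move=> tT da i j.
rewrite (_ : conjugated_perturbation A B Q i j = (fun t => \sum_b invmx Q b j *
   (\sum_a Q i a * real_complex R ((B t - A) a b)))); last first.
  apply/funext => t; rewrite /conjugated_perturbation mxE; apply: eq_bigr => b _.
  rewrite mulrC mxE; congr (_ * _); apply: eq_bigr => c _.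
  by rewrite [map_mx _ _ _ _]mxE.
apply: pcls_sum => b; apply: (pclsZ hK); apply: pcls_sum => c; apply: (pclsZ hK).
by have [] := Ahat_pcls hK hphi0K hphi0 hvarrho0 hvarrho hrho hnu hpk hepsC hepsO heps_o1 hflC hflB
  heps_gt0 hvarpi hepsR hfl7 hphi tT da c b.
Qed.

Lemma error_exists : \forall T \near +oo, exists r,
  error_term t0 D A f eps fl phi0 nu k phi (eps ord0) e T r.
Proof.
have [T0 [tT0 da]] : exists T, t0 < T /\ forall t, T <= t -> `|delta t| < a.
  have /nearyP[T HT] : \forall t \near +oo, `|delta t| < a.
    have /cvgr0Pnorm_lt := correction_cvg0 hK hvarrho0 hvarrho hrho hnu hpk hepsO heps_o1 heps_gt0 hphi.
    by apply.
  exists (Num.max (t0 + 1) T); split; first by rewrite lt_max ltrDl ltr01.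
  by move=> t; rewrite ge_max => /andP[_]; exact: HT.
have [Q Qu QA] := simple_spectrum_diagonalizable hlam (eigenvalues_inj hdiff).
have Ldiff i j : i != j -> (range lam `|` eigen_differences lam) (lam i - lam j).
  by move=> ij; right; exists i, j.
have WN w : mu_indices eps t0 varpi w -> (mi_deg w <= Num.bound varpi)%N.
  move=> [_ dw _]; rewrite -(ler_nat R); apply/ltW/(lt_trans dw).
  exact: (archi_boundP (ltW hvarpi0)).
pose dm := mu_deriv t0 eps.
have mb := mu_system_bcts hvarrho0 hepsC hepsO heps_o1 heps_gt0 (varpi := varpi) tT0.
have mc w : mu_indices eps t0 varpi w -> mu eps w t @[t --> +oo] --> (0 : R).
  by move=> [w1 _ _]; exact: (mu_cvg0 hvarrho0 hvarrho hepsO heps_o1 heps_gt0 w1).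
have md w t : mu_indices eps t0 varpi w -> T0 <= t -> is_derive t 1 (mu eps w) (dm w t).
  exact: (is_derive_mu hvarrho0 hepsC hepsO heps_o1 heps_gt0 hmono tT0).
have ml w : mu_indices eps t0 varpi w -> L1 T0 (dm w).
  exact: (mu_deriv_L1 hvarrho0 hepsC hepsO heps_o1 heps_gt0 hmono tT0).
have mm w w' := mu_mul hvarrho0 hvarrho hepsC hepsO heps_o1 heps_gt0 hvarpi (w := w) (w' := w') tT0.
have [X [dX [d [HX Hd HE]]]] := normal_form hK tT0 mb mc md ml mm Ldiff (conjugated_pcls Q tT0 da) WN.
have bX i j : bctsC T0 (X i j) by have [] := HX i j.
have X0 i j : vanishing (X i j) by have [] := HX i j.
have dXP i j t : T0 <= t -> is_deriveC t (X i j) (dX i j t) by have [_ _] := HX i j; apply.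
have bd j : bctsC T0 (fun t => lam j + d j t).
  by apply: bctsCD; [exact: bctsC_cst|have [] := Hd j].
have /choice[th dth] : forall j, exists th : R -> R, forall t, T0 <= t ->
    is_derive t 1 th (complex.Im (lam j + d j t)).
  by move=> j; apply: antiderivative_cts; have [_ []] := bd j.
have dth' j t : T0 <= t -> is_derive t 1 (th j) (complex.Im (lam j + d j t)) by exact: dth.
have [T' TT' [UV bV]] := real_coframe_bcts Qu bX X0 dth'.
have bU := bcts_real_frame Q bX dth'.
have [CU HCU] := bcts_mx_bound bU.
have [CV HCV] := bcts_mx_bound bV.
have /choice[P dP] : forall j, exists P : R -> R, forall t, T0 <= t ->
    is_derive t 1 P (complex.Re (lam j + d j t) - kap t).
  move=> j; apply: antiderivative_cts; apply: ctsB; first by have [[]] := bd j.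
  exact: (cts_kap hvarrho0 hvarrho hrho hk hpk hepsC heps_gt0).
have dich j : exists T1C : R * R, T0 <= T1C.1 /\
    ((forall s t, T1C.1 <= s -> s <= t -> P j t - P j s <= T1C.2) \/
     (forall s t, T1C.1 <= s -> s <= t -> - T1C.2 <= P j t - P j s)).
  (* Mean values of the coefficients give the real combination of the mu_w to which the sign
     condition applies; the oscillations have a bounded primitive. *)
  have [r [sig [rW cs [G dG [CG HCG]] dE]]] := pcls_mean hK tT0 mb md ml (Hd j).1.
  have [g gE] := fsum_of_list (mu eps) rW.
  have g0 : \sum_(w \in mu_indices eps t0 varpi) g w * mu eps w t @[t --> +oo] --> (0 : R).
    rewrite (_ : (fun t => _) = (fun t => \sum_(x <- r) x.2 * mu eps x.1 t)); last exact/funext.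
    elim: r rW {gE dE} => [_|x r IH rW].
      rewrite (_ : (fun t => _) = (fun=> 0)); first exact: cvg_cst.
      by apply/funext => t; rewrite big_nil.
    rewrite (_ : (fun t => _) = (fun t => x.2 * mu eps x.1 t + \sum_(x <- r) x.2 * mu eps x.1 t)); last first.
      by apply/funext => t; rewrite big_cons.
    have h2 := IH (fun y yr => rW y (or_intror yr)).
    have h1 : x.2 * mu eps x.1 t @[t --> +oo] --> x.2 * 0.
      by apply: cvgM; [exact: cvg_cst|apply: mc; apply: rW; left].
    have H := cvgD h1 h2; rewrite mulr0 addr0 in H; exact: H.
  have dP' t : T0 <= t -> is_derive t 1 (P j)
     (complex.Re (lam j) + \sum_(w \in mu_indices eps t0 varpi) g w * mu eps w t + sig t - kap t).
    by move=> Tt; apply: is_derive_eq (dP j t Tt) _; rewrite gE ReD dE addrA.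
  have [T1 [C [T01 H]]] := mean_dichotomy tT0 g0 dP' dG HCG.
  by exists (T1, C); split=> //; case: H => [H|[H _]]; [left|right].
have /choice[T1C HT1C] := dich.
have [Tm HTm] := fin_upper_bound (fun j => (T1C j).1).
have [Cm HCm] := fin_upper_bound (fun j => (T1C j).2).
pose Tf := Num.max T' Tm.
have T'f : T' <= Tf by rewrite le_max lexx.
have Tmf j : (T1C j).1 <= Tf by rewrite (le_trans (HTm j))// le_max lexx orbT.
have T0f : T0 <= Tf by exact: le_trans TT' T'f.
(* The type of component j is decided by the bound itself, with common [Tf] and [Cm]. The two real
   columns of one complex column share it through [und]. *)
pose upb j : bool := `[< forall s t, Tf <= s -> s <= t -> P j t - P j s <= Cm >].
have dich' j s' t : Tf <= s' -> s' <= t -> if upb j then P j t - P j s' <= Cm else - Cm <= P j t - P j s'.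
  move=> Ts st; rewrite /upb; case: asboolP => [h|nh]; first exact: h.
  have [_ [H|H]] := HT1C j.
    case: nh => x y Tx xy; apply: le_trans (H x y (le_trans (Tmf j) Tx) xy) _; exact: HCm.
  by apply: le_trans (H s' t (le_trans (Tmf j) Ts) st); rewrite lerN2 HCm.
pose und (j : 'I_(n + n)) : 'I_n := match fintype.split j with inl i => i | inr i => i end.
have dbl (F : 'I_n -> R -> R) j t : doubled F j t = F (und j) t.
  by rewrite /doubled /und; case: (fintype.split j).
have := @frame_solutions R n m t0 A lam K hK f a eps fl phi0 varrho rho nu k pk qk ha hphi0K hphi0 hvarrho0 hvarrho
  hrho hnu hk hpk hqk hepsC hepsO heps_o1 hflC hflB hflK varpi hvarpi heps_gt0 hrho1 hrho2 phi hphi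
  (n + n)%N Tf (real_frame Q X th) (real_frame_deriv lam Q X dX d th)
  (real_frame_defect A lam B Q X dX d th) (real_coframe Q X th)
  (doubled (fun j t => complex.Re (lam j + d j t))) (fun j => P (und j)) CU CV Cm (fun j => upb (und j)).
case.
- by move=> i j t Tt; apply: (is_derive_real_frame Q dXP dth'); exact: le_trans Tt.
- by move=> t _; exact: (real_frame_eq B Qu QA).
- by move=> t Tt; apply: UV; exact: le_trans Tt.
- by move=> i j; have [c _] := bV i j; exact: ctsW c.
- by move=> i j; apply: L1W (L1_real_frame_defect HE dth' i j).
- by move=> t Tt; apply: HCU; exact: le_trans Tt.
- by move=> t Tt; apply: HCV; exact: le_trans Tt.
- by move=> j t Tt; rewrite dbl; apply: dP; exact: le_trans Tt.
- by move=> j s' t; exact: dich'.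
move=> T1 HT1; apply/nearyP; exists T1 => T T1T; have [v Hv] := HT1 T T1T.
(* One solution suffices, so all free initial values are set to 0. *)
have [||h _ _] := Hv 0; first by move=> i _; rewrite mxE.
  by rewrite normr0 mulr0 invr_ge0.
by exists (fun t => e1 t `^ e *: (real_frame Q X th t *m v 0 t)).
Qed.

End Existence.

Section CoordinateEmbedding.
Context {R : realType} {n : nat}.
Variable A : pred 'I_n.

(** Free parameters are the initial values of the selected components. The others are determined
    from infinity, and the fixed-point theorem requires 0 there. *)
Definition coord_embed (c : 'rV[R]_#|A|) : 'cV[R]_n :=
  \col_i \sum_(k < #|A|) c 0 k *+ (enum_val k == i).

Lemma coord_embed_val c k : coord_embed c (enum_val k) 0 = c 0 k.
Proof.
rewrite mxE (bigD1 k)//= eqxx big1 ?addr0// => k' kk'.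
by rewrite (inj_eq enum_val_inj) (negbTE kk').
Qed.

Lemma coord_embed0 c i : ~~ A i -> coord_embed c i 0 = 0.
Proof.
move=> Ai; rewrite mxE big1// => k _; case: eqP => // E.
by have := enum_valP k; rewrite E => /idP; rewrite unfold_in (negbTE Ai).
Qed.

Lemma coord_embed_le (c : 'rV[R]_#|A|) (x : R) : 0 <= x -> (forall k, `|c 0 k| <= x) -> `|coord_embed c| <= x.
Proof.
move=> x0 cx; apply: mx_norm_le => // i j; rewrite (ord1 j).
have [Ai|Ai] := boolP (A i); last by rewrite coord_embed0// normr0.
have iA : i \in A by [].
by rewrite -(enum_rankK_in iA iA) coord_embed_val.
Qed.

Lemma coord_embedB c c' : coord_embed (c - c') = coord_embed c - coord_embed c'.
Proof.
apply/matrixP => i j; rewrite !mxE -sumrB; apply: eq_bigr => k _.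
by rewrite !mxE mulrnBl.
Qed.

End CoordinateEmbedding.

Section WithinRay.
Context {R : realType}.
Variable T : R.
Implicit Types g h : R -> R.

Lemma within_rayP g : {within ray T, continuous g} <->
  forall t, ray T t -> g x @[x --> within (ray T) (nbhs t)] --> g t.
Proof. exact: subspace_continuousP. Qed.

Lemma within_rayD g h : {within ray T, continuous g} -> {within ray T, continuous h} ->
  {within ray T, continuous (fun t => g t + h t)}.
Proof. by move=> /within_rayP cg /within_rayP ch; apply/within_rayP => t tt; apply: cvgD; [exact: cg|exact: ch]. Qed.

Lemma within_rayM g h : {within ray T, continuous g} -> {within ray T, continuous h} ->
  {within ray T, continuous (fun t => g t * h t)}.
Proof. by move=> /within_rayP cg /within_rayP ch; apply/within_rayP => t tt; apply: cvgM; [exact: cg|exact: ch]. Qed.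

Lemma within_ray_cst c : {within ray T, continuous (fun=> c : R)}.
Proof. by apply/within_rayP => t _; exact: cvg_cst. Qed.

Lemma within_rayV g : (forall t, ray T t -> g t != 0) -> {within ray T, continuous g} ->
  {within ray T, continuous (fun t => (g t)^-1)}.
Proof. by move=> g0 /within_rayP cg; apply/within_rayP => t tt; apply: cvgV; [exact: g0|exact: cg]. Qed.

Lemma within_ray_sum (J : Type) (r : seq J) (F : J -> R -> R) :
  (forall j, {within ray T, continuous (F j)}) -> {within ray T, continuous (fun t => \sum_(j <- r) F j t)}.
Proof.
move=> cF; apply/within_rayP => t tt; apply: cvg_big => [|j _]; first exact: add_continuous.
by have /within_rayP := cF j; apply.
Qed.

End WithinRay.

Lemma within_rayW {R : realType} (T T' : R) (g : R -> R) : T <= T' -> {within ray T, continuous g} ->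
  {within ray T', continuous g}.
Proof.
move=> TT'; apply: continuous_subspaceW => t /rayE T't; apply/rayE; exact: le_trans T't.
Qed.

(** * Families of solutions attached to a given Lyapunov matrix *)

Section SolutionFamilies.
Context {R : realType} {n m : nat}.
Variables (t0 : R) (A : 'M[R]_n) (lam : 'I_n -> R[i]) (K : set (R -> R)).
Hypothesis hK : classK3 t0 (range lam `|` eigen_differences lam) K.
Variables (f : R -> 'cV[R]_n) (a : R)
  (eps : 'I_m.+1 -> R -> R) (fl : 'I_m.+1 -> R -> 'cV[R]_n -> 'cV[R]_n)
  (phi0 : R -> 'cV[R]_n) (varrho : 'I_m.+1 -> R) (rho : nat -> R)
  (nu : nat -> seq (mon m.+1)) (k : nat) (pk : 'I_m.+1 -> nat) (qk : 'I_m.+1 -> int).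
Local Notation D := (tube t0 a phi0).
Hypothesis ha : 0 < a.
Hypothesis hphi0K : vecK K phi0.
Hypothesis hphi0 : solves (ray t0) (fun t v => A *m v + f t) phi0.
Hypothesis hvarrho0 : forall l, 0 < varrho l.
Hypothesis hvarrho : forall l l' : 'I_m.+1, (l <= l')%N -> varrho l <= varrho l'.
Hypothesis hrho : ranks_enum varrho rho.
Hypothesis hnu : mons_enum varrho rho nu.
Hypothesis hk : (1 <= k)%N.
Hypothesis hpk : forall l, (pk l)%:Z = Num.max 0 (Num.floor (rho k - varrho l) + 1).
Hypothesis hqk : forall l, qk l = Num.floor ((rho k - varrho l) / varrho ord0).
Hypothesis hepsC : forall l, Cn_in (ray t0) (pk l) (eps l).
Hypothesis hepsO : forall l r, (r <= pk l)%N ->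
  bigO_pinfty (derive_in_n (ray t0) r (eps l))
    (fun t => eps ord0 t `^ ((varrho l + r%:R) / varrho ord0)).
Hypothesis heps_o1 : eps ord0 t @[t --> +oo] --> (0 : R).
Hypothesis hflC : forall l (q : nat), q%:Z = Num.max 2 (qk l + 1) -> C0n_in D q (fl l).
Hypothesis hflB : forall l (w : {ffun 'I_n -> nat}),
  (mi_deg w)%:Z <= Num.max 2 (qk l + 1) -> [bounded pderive_mi D w (fl l) z.1 z.2 | z in D].
Hypothesis hflK : forall l (w : {ffun 'I_n -> nat}), varrho l <= rho k ->
  (mi_deg w)%:Z <= qk l -> vecK K (fun t => pderive_mi D w (fl l) t (phi0 t)).
Variable varpi : R.
Hypothesis hvarpi0 : 0 < varpi.
Hypothesis hvarpi : Rclass varpi t0 (eps ord0).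
Hypothesis heps_gt0 : forall t, ray t0 t -> 0 < eps ord0 t.
Hypothesis hrho1 : varrho ord0 * varpi < rho k.+1.
Hypothesis hrho2 : varrho ord0 * (2 * varpi - 1) <= rho k.+1.
Variable phi : mon m.+1 -> R -> 'cV[R]_n.
Hypothesis hphi : expansion_coefs t0 D A fl phi0 nu k phi K.
Hypothesis hsign : forall (g1 : R) (g : {ffun 'I_m.+1 -> nat} -> R),
   let F t := g1 * (eps ord0 t)^-1 * derive_in (ray t0) (eps ord0) t
     + \sum_(w \in mu_indices eps t0 varpi) g w * mu eps w t in
   (\forall t \near +oo, 0 <= F t) \/ (\forall t \near +oo, F t <= 0).

Let e1 := eps ord0.
Let s := approx_sol t0 eps phi0 nu k phi.
Let B := Ahat t0 D A eps fl phi0 nu k phi.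
Let e : R := rho k.+1 / varrho ord0 - varpi.
Let kap t := e * ((e1 t)^-1 * derive_in (ray t0) e1 t).


Local Notation W := (mu_indices eps t0 varpi).

(** Degrees are below varpi, so the index set is finite and sums over it are ordinary sums over a
    list. *)
Lemma mu_indices_list : exists Wl : seq {ffun 'I_m.+1 -> nat}, uniq Wl /\ forall w, w \in Wl <-> W w.
Proof.
exists [seq w <- mis (n := m.+1) (Num.bound varpi) | `[< W w >]]; split.
  by rewrite filter_uniq// mis_uniq.
move=> w; rewrite mem_filter mem_mis; split=> [/andP[/asboolP]//|Ww].
apply/andP; split; first exact/asboolP.
have [_ dw _] := Ww; rewrite -(ler_nat R); apply/ltW/(lt_trans dw).
exact: (archi_boundP (ltW hvarpi0)).
Qed.

Lemma fsum_mu_indices (V : nmodType) (F : {ffun 'I_m.+1 -> nat} -> V) (Wl : seq {ffun 'I_m.+1 -> nat}) :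
  uniq Wl -> (forall w, w \in Wl <-> W w) -> \sum_(w \in W) F w = \sum_(w <- Wl) F w.
Proof.
move=> uW WP; rewrite (fsbigE Wl)//.
- rewrite big_seq_cond [RHS]big_seq; apply: eq_bigl => w.
  by case: (boolP (w \in Wl)) => //= /WP Ww; rewrite mem_set.
- by move=> w /= /WP.
- by move=> w /WP ->.
Qed.

Variables (T0 : R) (Q : R -> 'M[R]_n) (gam : 'I_n -> {ffun 'I_m.+1 -> nat} -> R[i])
  (sig : 'I_n -> R -> R[i]).
Hypothesis hD0 : forall t, ray T0 t -> D (t, s t).
Hypothesis red : lyapunov_reduction eps T0 B W lam Q gam sig.

Let dr j t : R := complex.Re (diag_coef eps W lam gam sig j t).
Let p j t : R := dr j t + (varpi - rho k.+1 / varrho ord0) * (eps ord0 t)^-1 * derive_in (ray t0) (eps ord0) t.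

(** Membership in the tube includes the condition on time. *)
Lemma reduction_start : t0 <= T0.
Proof. by have [/= h _] := hD0 ((rayE T0 T0).2 (lexx T0)). Qed.

Lemma p_kap j t : p j t = dr j t - kap t.
Proof. by rewrite /p /kap /e /e1; ring. Qed.

Lemma drE j t : dr j t = complex.Re (lam j) + \sum_(w \in W) complex.Re (gam j w) * mu eps w t + complex.Re (sig j t).
Proof.
have [Wl [uW WP]] := mu_indices_list.
rewrite /dr /diag_coef !ReD; congr (_ + _ + _).
rewrite (fsum_mu_indices _ uW WP) (fsum_mu_indices _ uW WP) Re_sum; apply: eq_bigr => w _.
by rewrite ReM /=; ring.
Qed.

Lemma within_dr j : {within ray T0, continuous (dr j)}.
Proof.
have [Wl [uW WP]] := mu_indices_list.
rewrite (_ : dr j = (fun t => complex.Re (lam j) + \sum_(w <- Wl) complex.Re (gam j w) * mu eps w t + complex.Re (sig j t))).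
  apply: within_rayD; last by have [] := red_sig_cont red j.
  apply: within_rayD; first exact: within_ray_cst.
  apply: within_ray_sum => w; apply: within_rayM; first exact: within_ray_cst.
  exact: (within_rayW reduction_start (mu_within hepsC (w := w))).
by apply/funext => t; rewrite drE (fsum_mu_indices _ uW WP).
Qed.

Lemma within_p j : {within ray T0, continuous (p j)}.
Proof.
apply: within_rayD; first exact: within_dr.
apply: (within_rayW reduction_start).
have c1 : {within ray t0, continuous (eps ord0)} by exact: (eps_within hepsC).
have p1 : (1 <= pk ord0)%N := first_order hvarrho0 hvarrho hrho hk hpk.
have c2 : {within ray t0, continuous (derive_in (ray t0) (eps ord0))} by have [] := hepsC p1.
apply: within_rayM => //; apply: within_rayM; first exact: within_ray_cst.
by apply: within_rayV => // t tt; rewrite gt_eqF// heps_gt0.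
Qed.

(** [transforms] speaks only about solutions. Testing it with the solution x = e^G times the j-th
    basis vector, where G' = dr_j, and dividing by e^G recovers the matrix equation Q' = B Q - Q
    diag(dr). *)
Lemma is_derive_lyapunov i j t : T0 < t ->
  is_derive t 1 (fun t => Q t i j) ((B t *m Q t - Q t *m diag_mx (\row_j dr j t)) i j).
Proof.
move=> T0t; have [G dG] := antiderivative (@within_dr j).
pose x u : 'cV[R]_n := expR (G u) *: delta_mx j 0.
have sx : solves (ray T0) (fun t v => diag_mx (\row_j dr j t) *m v) x.
  move=> u /rayE T0u; apply: is_derive_ray => //; apply/is_derive_entry => i' l.
  rewrite (ord1 l).
  have d1 := @is_derive1_comp R expR G u _ _ (is_derive_expR _) (dG u T0u).
  rewrite (_ : (fun y => x y i' 0) = ((expR \o G) * cst ((i' == j)%:R : R))); last first.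
    by apply/funext => y; rewrite /x !mxE eqxx andbT.
  apply: (is_derive_eq (is_deriveM d1 (is_derive_cst _ _ _))).
  rewrite mul_diag_mx !mxE eqxx andbT /GRing.scale /= mulr0 add0r.
  by case: eqVneq => [->|_]; rewrite /cst ?mulr1 ?mul1r ?mulr0 ?mul0r//= mulrC.
have sQx := (red_transforms red x).1 sx.
have dQx := (is_derive_inP _ _ (nbhs_ray T0t)).1 (sQx t ((rayE T0 t).2 (ltW T0t))).
have mx u i' (M : 'M[R]_n) : (M *m x u) i' 0 = M i' j * expR (G u).
  by rewrite /x -scalemxAr mxE -colE mxE mulrC.
have d1 : is_derive t 1 (fun y => Q y i j * expR (G y)) ((B t *m Q t) i j * expR (G t)).
  have := (is_derive_entry _ _ _).1 dQx i 0; rewrite mulmxA mx.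
  by rewrite (_ : (fun y => (Q y *m x y) i 0) = (fun y => Q y i j * expR (G y)))//; apply/funext => y; rewrite mx.
have dG' := dG t (ltW T0t).
have dN : is_derive t 1 (fun y => - G y) (- dr j t) by exact: is_deriveN.
have d2 := @is_derive1_comp R expR (fun y => - G y) t _ _ (is_derive_expR _) dN.
rewrite (_ : (fun y => Q y i j) = (fun y => Q y i j * expR (G y)) * (expR \o (fun y => - G y))); last first.
  by apply/funext => y; rewrite -[RHS]/(Q y i j * expR (G y) * expR (- G y)) -mulrA -expRD subrr expR0 mulr1.
apply: (is_derive_eq (is_deriveM d1 d2)).
have e1' : expR (G t) * expR (- G t) = 1 by rewrite -expRD subrr expR0.
have -> : (B t *m Q t - Q t *m diag_mx (\row_j dr j t)) i j = (B t *m Q t) i j - Q t i j * dr j t.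
  by rewrite mul_mx_diag !mxE.
rewrite /GRing.scale /=; move: e1' ((B t *m Q t) i j) (Q t i j) (dr j t) => ee b q d.
transitivity ((b - q * d) * (expR (G t) * expR (- G t))); first by ring.
by rewrite ee mulr1.
Qed.

Let Tf := T0 + 1.
Let T0f : T0 < Tf. Proof. by rewrite ltrDl ltr01. Qed.
Let t0f : t0 < Tf. Proof. exact: le_lt_trans reduction_start T0f. Qed.

Lemma bcts_lyapunov i j : bcts Tf (fun t => Q t i j).
Proof.
have [b1 [M [_ HM]] _ _] := red_lyap red; split.
  by apply: (@cts_derive _ Tf _ (fun t => (B t *m Q t - Q t *m diag_mx (\row_j dr j t)) i j)) => t Tt;
    apply: is_derive_lyapunov; exact: lt_le_trans Tt.
exists (M + 1) => t Tt; apply: le_trans (mx_entry_le _ _ _) _.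
by apply: (HM (M + 1)); [rewrite ltrDl ltr01|apply/rayE/ltW/(lt_le_trans T0f)].
Qed.

Lemma bcts_lyapunov_inv : (forall t, Tf <= t -> Q t \in unitmx) /\
  forall i j, bcts Tf (fun t => invmx (Q t) i j).
Proof.
have [_ _ _ [d d0 Hd]] := red_lyap red.
have Hd' t : Tf <= t -> d <= `|\det (Q t)|.
  by move=> Tt; apply: Hd; apply/rayE/ltW/(lt_le_trans T0f).
split; last exact: bcts_invmx bcts_lyapunov d0 Hd'.
by move=> t Tt; rewrite unitmxE unitfE -normr_gt0 (lt_le_trans d0)// Hd'.
Qed.

Lemma sig_bounded_primitive j : exists G : R -> R, exists2 CG : R,
  (forall t, Tf <= t -> is_derive t 1 G (complex.Re (sig j t))) & forall t, Tf <= t -> `|G t| <= CG.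
Proof.
have [cs _] := red_sig_cont red j; have [G dG] := antiderivative cs.
have [ci _] := red_sig_integral red j.
have cG := (cvg_integral_antiderivative cs dG).1 ci.
have dG' t : Tf <= t -> is_derive t 1 G (complex.Re (sig j t)).
  by move=> Tt; apply: dG; apply: ltW; exact: lt_le_trans Tt.
have [_ [C HC]] : bcts Tf G.
  apply: bcts_near; first exact: cts_derive dG'.
  have [T [C HC]] := cvg_bounded_near cG; exists C; apply/nearyP; exists T; exact: HC.
by exists G, C.
Qed.

Lemma integral_p_pinfty j (P : R -> R) : (forall t, T0 <= t -> is_derive t 1 P (p j t)) ->
  integral_pinfty T0 (p j) <-> forall x : R, \forall t \near +oo, x <= P t.
Proof.
move=> dP.
have E t : T0 <= t -> \int[lebesgue_measure]_(x in `[T0, t]) p j x = P t - P T0.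
  by move=> T0t; exact: (integral_antiderivative (@within_p j) dP (lexx T0) T0t).
have HT : \forall t \near +oo, T0 <= t by apply/nearyP; exists T0.
rewrite /integral_pinfty; split=> [/cvgryPge H x|H].
  by apply: filterS2 HT (H (x - P T0)) => t /E ->; rewrite lerD2r.
apply/cvgryPge => x; apply: filterS2 HT (H (x + P T0)) => t /E ->.
by rewrite lerBrDr.
Qed.

(** Divergence of the integral to +oo coincides with the type of dichotomy. Increments bounded above
    prevent P from tending to +oo, while increments bounded below together with unboundedness above
    force it. *)
Lemma growth_classification : exists (P : 'I_n -> R -> R) (T1 C : R),
  [/\ Tf <= T1, forall j t, T0 <= t -> is_derive t 1 (P j) (p j t) &
   forall j s t, T1 <= s -> s <= t ->
     if `[< ~ integral_pinfty T0 (p j) >] then P j t - P j s <= C else - C <= P j t - P j s].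
Proof.
have /choice[P dP] : forall j, exists P : R -> R, forall t, T0 <= t -> is_derive t 1 P (p j t).
  by move=> j; apply: antiderivative; exact: within_p.
have [Wl [uW WP]] := mu_indices_list.
have cls j : exists T1C : R * R, Tf <= T1C.1 /\ forall s t, T1C.1 <= s -> s <= t ->
   if `[< ~ integral_pinfty T0 (p j) >] then P j t - P j s <= T1C.2 else - T1C.2 <= P j t - P j s.
  have [G [CG dG HG]] := sig_bounded_primitive j.
  have g0 : \sum_(w \in W) complex.Re (gam j w) * mu eps w t @[t --> +oo] --> (0 : R).
    rewrite (_ : (fun t => _) = (fun t => \sum_(w <- Wl | `[< W w >]) complex.Re (gam j w) * mu eps w t)); last first.
      apply/funext => t; rewrite (fsum_mu_indices _ uW WP) big_seq [RHS]big_seq_cond.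
      by apply: eq_bigl => w; case: (boolP (w \in Wl)) => //= /WP Ww; apply/esym/asboolP.
    have z0 : \sum_(w <- Wl | `[< W w >]) complex.Re (gam j w) * 0 = 0.
      by rewrite big1// => w _; rewrite mulr0.
    rewrite -[X in _ --> X]z0.
    apply: cvg_big => [|w /asboolP[w1 _ _]]; first exact: add_continuous.
    apply: cvgM; first exact: cvg_cst.
    exact: (mu_cvg0 hvarrho0 hvarrho hepsO heps_o1 heps_gt0 w1).
  have dP' t : Tf <= t -> is_derive t 1 (P j) (complex.Re (lam j) +
      \sum_(w \in W) complex.Re (gam j w) * mu eps w t + complex.Re (sig j t) - kap t).
    move=> Tt; apply: is_derive_eq (dP j t _) _; last by rewrite p_kap drE.
    by apply: ltW; exact: lt_le_trans Tt.
  have [T1 [C [Tf1 [H|[H nB]]]]] := mean_dichotomy hvarrho0 hvarrho hrho hk hpk hepsO heps_o1 heps_gt0 hsign t0f g0 dP' dG HG; exists (T1, C); split=> //.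
    move=> s' t T1s st; rewrite asboolT; first exact: H.
    move=> /(integral_p_pinfty (dP j)).1 /(_ (P j T1 + C + 1)) /nearyP[T2 HT2].
    have := HT2 (Num.max T1 T2); rewrite le_max lexx orbT => /(_ isT).
    have := H T1 (Num.max T1 T2) (lexx _); rewrite le_max lexx => /(_ isT); lra.
  move=> s' t T1s st; rewrite asboolF; first exact: H.
  apply; apply/(integral_p_pinfty (dP j)) => x.
  apply: contrapT => nx; apply: nB; exists (x + C) => t1 T1t1; rewrite leNgt; apply/negP => lt.
  apply: nx; apply/nearyP; exists t1 => t2 t12.
  by have := H t1 t2 T1t1 t12; lra.
have /choice[T1C HT1C] := cls.
have [Tm HTm] := fin_upper_bound (fun j => (T1C j).1).
have [Cm HCm] := fin_upper_bound (fun j => (T1C j).2).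
exists P, (Num.max Tf Tm), Cm; split=> //; first by rewrite le_max lexx.
move=> j s' t Ts st; have [_ H] := HT1C j.
have Tj : (T1C j).1 <= s' by rewrite (le_trans (HTm j))// (le_trans _ Ts)// le_max lexx orbT.
have := H s' t Tj st; have := HCm j.
by case: asboolP => _ h1 h2; lra.
Qed.

Lemma solution_family : \forall T \near +oo,
  independent_family (error_term t0 D A f eps fl phi0 nu k phi (eps ord0) e T) T
    #|[pred j : 'I_n | `[< ~ integral_pinfty T0 (p j) >]]|.
Proof.
have [P [Tc [C [Tfc dP HC]]]] := growth_classification.
have [Qu bV] := bcts_lyapunov_inv.
have [CU HCU] := bcts_mx_bound bcts_lyapunov.
have [CV HCV] := bcts_mx_bound bV.
pose up : pred 'I_n := [pred j : 'I_n | `[< ~ integral_pinfty T0 (p j) >]].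
have T0t t : Tc <= t -> T0 < t by move=> h; apply: lt_le_trans T0f (le_trans Tfc h).
have := @frame_solutions R n m t0 A lam K hK f a eps fl phi0 varrho rho nu k pk qk ha hphi0K hphi0 hvarrho0 hvarrho
  hrho hnu hk hpk hqk hepsC hepsO heps_o1 hflC hflB hflK varpi hvarpi heps_gt0 hrho1 hrho2 phi hphi
  n Tc Q (fun t => B t *m Q t - Q t *m diag_mx (\row_j dr j t)) (fun=> 0) (fun t => invmx (Q t))
  dr P CU CV C up.
case.
- by move=> i j t Tt; apply: is_derive_lyapunov; exact: T0t.
- by move=> t _; rewrite subr0.
- by move=> t Tt; rewrite mulmxV// Qu// (le_trans Tfc).
- by move=> i j; have [c _] := bV i j; exact: ctsW c.
- move=> i j; rewrite (_ : (fun t => _) = (fun=> 0)); first exact: L1_0.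
  by apply/funext => t; rewrite mxE.
- by move=> t Tt; apply: HCU; exact: le_trans Tt.
- by move=> t Tt; apply: HCV; exact: le_trans Tt.
- move=> j t Tt; apply: is_derive_eq (dP j t _) _; last exact: p_kap.
  exact/ltW/T0t.
- exact: HC.
move=> T1 HT1; apply/nearyP; exists (Num.max T1 Tc) => T; rewrite ge_max => /andP[T1T TcT].
have [v Hv] := HT1 T T1T.
(* The side of the parameter cube for which e^C |c| <= 1/4 in the fixed-point theorem. *)
pose x : R := (4 * expR C)^-1.
have E0 := expR_gt0 C.
have x0 : 0 < x by rewrite invr_gt0 mulr_gt0.
pose sg := e1 T `^ e.
have tT : t0 <= T by rewrite (le_trans reduction_start)// ltW// T0t.
have sg0 : 0 < sg by apply: powR_gt0; apply: heps_gt0; exact/rayE.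
have small (c : 'rV[R]_#|up|) : (forall i, `|c 0 i| < x) -> expR C * `|coord_embed c| <= 4^-1.
  move=> cx; rewrite -ler_pdivlMl// -invfM mulrC.
  by apply: coord_embed_le => [|k']; [exact: ltW|exact/ltW/cx].
have zero (c : 'rV[R]_#|up|) i : ~~ up i -> coord_embed c i 0 = 0 by exact: coord_embed0.
exists x, (fun c t => e1 t `^ e *: (Q t *m v (coord_embed c) t)); split=> //.
  by move=> c /small cC; have [] := Hv _ (zero c) cC.
(* [L1'] carries the Lipschitz dependence of v on c over to r = sigma Q v at [T]; [L2] inverts sigma
   Q there. Adding 1 below makes the common constant positive. *)
pose L1' := sg * (n%:R * CU * (2 * expR C)); pose L2 := n%:R * CV * sg^-1.
have CU0 : 0 <= CU := le_trans (normr_ge0 _) (HCU Tf (lexx _)).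
have CV0 : 0 <= CV := le_trans (normr_ge0 _) (HCV Tf (lexx _)).
have L10 : 0 <= L1' by exact: (mulr_ge0 (ltW sg0) (mulr_ge0 (mulr_ge0 (ler0n _ _) CU0) (mulr_ge0 (ler0n _ 2) (ltW E0)))).
have L20 : 0 <= L2 by apply: (mulr_ge0 (mulr_ge0 (ler0n _ _) CV0)); rewrite invr_ge0 ltW.
exists (L1' + L2 + 1); first by rewrite ltr_wpDl// addr_ge0.
move=> c c' /small cC /small cC'.
have [_ vT vL] := Hv _ (zero c) cC.
have [_ vT' _] := Hv _ (zero c') cC'.
have TfT : Tf <= T by exact: le_trans TcT.
have embB : `|coord_embed c - coord_embed c'| <= `|c - c'|.
  rewrite -coord_embedB; apply: coord_embed_le => // k'; exact: mx_entry_le.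
have dE : sg *: (Q T *m v (coord_embed c) T) - sg *: (Q T *m v (coord_embed c') T) =
    sg *: (Q T *m (v (coord_embed c) T - v (coord_embed c') T)).
  by rewrite -scalerBr -mulmxBr.
rewrite dE; split.
  rewrite normrZ gtr0_norm//; apply: (@le_trans _ _ (L1' * `|c - c'|)); last first.
    by rewrite ler_wpM2r// -addrA lerDl addr_ge0.
  rewrite /L1' -mulrA ler_wpM2l ?(ltW sg0)//.
  apply: le_trans (mulmx_norm_le _ _) _; rewrite -!mulrA ler_wpM2l//.
  rewrite ler_pM ?HCU//; apply: le_trans (vL _ (zero c') cC') _.
  by rewrite -mulrA ler_wpM2l// ler_wpM2l// ltW.
set V := v (coord_embed c) T - v (coord_embed c') T.
(* The selected components of v at [T] are the parameters themselves, which gives the lower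
   Lipschitz bound. *)
have cV : `|c - c'| <= `|V|.
  apply: mx_norm_le => // i j; rewrite (ord1 i).
  have uj : up (enum_val j) by have := enum_valP j; rewrite unfold_in.
  have := mx_entry_le V (enum_val j) 0.
  have -> : V (enum_val j) 0 = (c - c') 0 j; last by [].
  have mxB (M1 M2 : 'cV[R]_n) l : (M1 - M2) l 0 = M1 l 0 - M2 l 0 by rewrite !mxE.
  by rewrite /V mxB vT// vT'// !coord_embed_val !mxE.
apply: (@le_trans _ _ (L2 * `|sg *: (Q T *m V)|)); last first.
  by rewrite ler_wpM2r// addrAC lerDr addr_ge0.
apply: le_trans cV _.
have VE : V = sg^-1 *: (invmx (Q T) *m (sg *: (Q T *m V))).
  by rewrite -scalemxAr mulKmx ?Qu// scalerA mulVf ?scale1r// gt_eqF.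
rewrite {1}VE normrZ normfV gtr0_norm// /L2 mulrAC [leRHS]mulrC ler_wpM2l ?invr_ge0 ?(ltW sg0)//.
apply: le_trans (mulmx_norm_le _ _) _; rewrite ler_wpM2r// ler_wpM2l//.
exact: HCV.
Qed.

End SolutionFamilies.

(* The number of small terms is m.+1, and eps_1 is eps ord0. *)
Theorem mainTheorem3 (R : realType) (n m : nat) (hn : (2 <= n)%N) (t0 : R)
    (A : 'M[R]_n) (lam : 'I_n -> R[i]) (hlam : eigenvalues_of A lam)
    (K : set (R -> R))
    (hK : classK3 t0 (range lam `|` eigen_differences lam) K)
    (f : R -> 'cV[R]_n) (hf : vecK K f)
    (phi0 : R -> 'cV[R]_n) (hphi0K : vecK K phi0)
    (hphi0C1 : Cn_in (ray t0) 1 phi0)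
    (hphi0 : solves (ray t0) (fun t v => A *m v + f t) phi0)
    (a : R) (ha : 0 < a) (D : set (R * 'cV[R]_n)) (hD : D = tube t0 a phi0)
    (eps : 'I_m.+1 -> R -> R)
    (fl : 'I_m.+1 -> R -> 'cV[R]_n -> 'cV[R]_n)
    (varrho : 'I_m.+1 -> R) (hvarrho0 : forall l, 0 < varrho l)
    (hvarrho : forall l l' : 'I_m.+1, (l <= l')%N -> varrho l <= varrho l')
    (rho : nat -> R) (hrho : ranks_enum varrho rho)
    (nu : nat -> seq (mon m.+1)) (hnu : mons_enum varrho rho nu)
    (k : nat) (hk : (1 <= k)%N)
    (pk : 'I_m.+1 -> nat)
    (hpk : forall l, (pk l)%:Z = Num.max 0 (Num.floor (rho k - varrho l) + 1))
    (qk : 'I_m.+1 -> int)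
    (hqk : forall l, qk l = Num.floor ((rho k - varrho l) / varrho ord0))
    (hepsC : forall l, Cn_in (ray t0) (pk l) (eps l))
    (hepsO : forall l r, (r <= pk l)%N ->
       bigO_pinfty (derive_in_n (ray t0) r (eps l))
         (fun t => eps ord0 t `^ ((varrho l + r%:R) / varrho ord0)))
    (heps_ge0 : forall t, ray t0 t -> 0 <= eps ord0 t)
    (heps_o1 : eps ord0 t @[t --> +oo] --> (0 : R))
    (hflC : forall l (q : nat), q%:Z = Num.max 2 (qk l + 1) -> C0n_in D q (fl l))
    (hflB : forall l (w : {ffun 'I_n -> nat}),
       (mi_deg w)%:Z <= Num.max 2 (qk l + 1) ->
       [bounded pderive_mi D w (fl l) z.1 z.2 | z in D])
    (hflK : forall l (w : {ffun 'I_n -> nat}), varrho l <= rho k ->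
       (mi_deg w)%:Z <= qk l ->
       vecK K (fun t => pderive_mi D w (fl l) t (phi0 t)))
    (varpi : R) (hvarpi0 : 0 < varpi) (hvarpi : Rclass varpi t0 (eps ord0))
    (hepsR : forall l (r : nat), 1 <= rho k - varrho l -> (1 <= r)%N ->
       r%:Z <= Num.floor (rho k - varrho l) ->
       Rclass 1 t0 (derive_in_n (ray t0) r (eps l)))
    (hfl7 : forall l (sl : nat), varrho l <= varpi * varrho ord0 ->
       sl%:Z = Num.floor (varpi - varrho l / varrho ord0) ->
       [/\ C0n_in D (sl + 2) (fl l),
           forall w : {ffun 'I_n -> nat}, (3 <= mi_deg w <= sl + 2)%N ->
             [bounded pderive_mi D w (fl l) z.1 z.2 | z in D] &
           forall w : {ffun 'I_n -> nat}, (1 <= mi_deg w <= sl + 1)%N ->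
             vecK K (fun t => pderive_mi D w (fl l) t (phi0 t))])
    (hdiff : ~ eigen_differences lam 0)
    (hmono : forall l, ~ Rclass 1 t0 (eps l) ->
       [/\ {in ray t0 &, {homo eps l : x y / x <= y}} \/
           {in ray t0 &, {homo eps l : x y /~ x <= y}},
           eps l t @[t --> +oo] --> (0 : R),
           Cn_in (ray t0) 1 (eps l) &
           Rclass 1 t0 (derive_in (ray t0) (eps l))])
    (heps_gt0 : forall t, ray t0 t -> 0 < eps ord0 t)
    (hsign : forall (g1 : R) (g : {ffun 'I_m.+1 -> nat} -> R),
       let F t := g1 * (eps ord0 t)^-1 * derive_in (ray t0) (eps ord0) t
         + \sum_(w \in mu_indices eps t0 varpi) g w * mu eps w t in
       (\forall t \near +oo, 0 <= F t) \/ (\forall t \near +oo, F t <= 0))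
    (hrho1 : varrho ord0 * varpi < rho k.+1)
    (hrho2 : varrho ord0 * (2 * varpi - 1) <= rho k.+1) :
  (exists phi, expansion_coefs t0 D A fl phi0 nu k phi K) /\
  forall phi : mon m.+1 -> R -> 'cV[R]_n,
    expansion_coefs t0 D A fl phi0 nu k phi K ->
    let s := approx_sol t0 eps phi0 nu k phi in
    (exists2 t, D (t, s t) & residual t0 A f eps fl phi0 nu k phi t != 0) ->
    let error T r := error_term t0 D A f eps fl phi0 nu k phi
      (eps ord0) (rho k.+1 / varrho ord0 - varpi) T r in
    [/\ \forall T \near +oo, exists r, error T r,
        forall (T0 : R) (Q : R -> 'M[R]_n)
          (gam : 'I_n -> {ffun 'I_m.+1 -> nat} -> R[i])
          (sig : 'I_n -> R -> R[i]),
          (forall t, ray T0 t -> D (t, s t)) ->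
          lyapunov_reduction eps T0 (Ahat t0 D A eps fl phi0 nu k phi)
            (mu_indices eps t0 varpi) lam Q gam sig ->
          let p j t :=
            complex.Re (diag_coef eps (mu_indices eps t0 varpi) lam gam sig j t)
            + (varpi - rho k.+1 / varrho ord0) * (eps ord0 t)^-1
              * derive_in (ray t0) (eps ord0) t in
          \forall T \near +oo, independent_family (error T) T
            #|[pred j : 'I_n | `[< ~ integral_pinfty T0 (p j) >]]| &
        forall (T : R) (N : nat), t0 <= T ->
          independent_family (error T) T N -> (N <= n)%N].
Proof.
subst D; split.
  exact: (expansion_exists hlam hK hdiff hvarrho0 hvarrho hrho hnu hpk hqk hflK).
move=> phi hphi s _ error; split.
- exact: (error_exists hlam hK ha hphi0K hphi0 hvarrho0 hvarrho hrho hnu hk hpk hqk hepsC hepsO heps_o1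
    hflC hflB hflK hvarpi0 hvarpi heps_gt0 hrho1 hrho2 hphi hepsR hfl7 hdiff hmono hsign).
- move=> T0 Q gam sig hD0 red p.
  exact: (solution_family hK ha hphi0K hphi0 hvarrho0 hvarrho hrho hnu hk hpk hqk hepsC hepsO heps_o1
    hflC hflB hflK hvarpi0 hvarpi heps_gt0 hrho1 hrho2 hphi hsign hD0 red).
- by move=> T N _; exact: independent_family_dim.
Qed.
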